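(* Let $u, v \ge 1$ be integers with $\gcd(u,v)=1$. (i) There is a constant $C = C(v)>0$ such that for every $\alpha \in \mathbb{R}\setminus\mathbb{Q}$ and $\beta \in \mathbb{R}$ there exist infinitely many primes $\ell \equiv u \bmod v$ with $$\|\alpha \ell - \beta\| \le C\, \ell^{-1/4} (\log \ell)^{8}.$$ (ii) For every real $\epsilon > 0$ there is a constant $C' = C'(v,\epsilon) > 0$ such that the following holds. Let $\alpha \in \mathbb{R}\setminus\mathbb{Q}$, $\beta \in \mathbb{R}$, let $N \ge 1$ be a real number and let $\Delta \in (0,1/2)$. Suppose that $a, q \in \mathbb{Z}$ are coprime with $q > N^{1/4}$ and $|\alpha v - a/q| \le 1/q^2$. Set $\mathcal{L} = \log(Nq/\Delta)$. Then $$\Bigl| \#\{1 \le \ell \le N : \ell \text{ prime},\ \ell \equiv u \bmod v,\ \|\alpha \ell - \beta\| < \Delta\} - 2\Delta\, \pi(N,u,v) \Bigr| \le C'\, \mathcal{L}^7 \left( N q^{-1/2} + N^{3/4} + N^{5/6}\Delta^{1/2} + (\Delta N q)^{1/2} + N^{\epsilon} q \Delta^{1-\epsilon} \right).$$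
   Context: For real $y$, $\|y\|$ denotes the distance from $y$ to the nearest integer. $\pi(N,u,v)$ denotes the number of primes $\ell \le N$ with $\ell \equiv u \bmod v$. *)

(* Defs.v *)
From HB Require Import structures.
From mathcomp Require Import all_boot all_order all_algebra.
From mathcomp Require Import finmap.
From mathcomp Require Import all_classical all_reals all_analysis.

Set Implicit Arguments.
Unset Strict Implicit.
Unset Printing Implicit Defensive.
Import Order.TTheory GRing.Theory Num.Theory.

Local Open Scope classical_set_scope.
Local Open Scope ring_scope.

Definition dist_int (R : realType) (y : R) : R :=
  inf [set `|y - m%:~R| | m in [set: int]].

Definition primes_in_class (u v : nat) : set nat :=
  [set l | prime l /\ l = u %[mod v]].

Definition count_upto (R : realType) (N : R) (A : set nat) : nat :=
  #|` fset_set (A `&` [set l | l%:R <= N]) |%fset.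

(* [fset_set] sends infinite sets to the empty set; the sets counted above are
   always finite. *)
Lemma finite_upto (R : realType) (N : R) (A : set nat) :
  finite_set (A `&` [set l | l%:R <= N]).
Proof.
apply: (@sub_finite_set _ _ `I_(Num.truncn N).+1); last exact: finite_II.
move=> l [_ /= lN]; rewrite ltnS.
by rewrite truncn_ge_nat // (le_trans _ lN).
Qed.

Definition prime_pi (R : realType) (N : R) (u v : nat) : nat :=
  count_upto N (primes_in_class u v).

(* Main.v *)
Require Import Defs.
From HB Require Import structures.
From mathcomp Require Import all_boot all_order all_algebra.
From mathcomp Require Import finmap.
From mathcomp Require Import all_classical all_reals all_analysis.
From mathcomp Require Import ring lra zify.
From mathcomp.real_closed Require Import complex.
From mathcomp Require fingroup cyclic algC cyclotomic classfun character.

(** Both parts count primes [l] of a residue class modulo [v] for which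
    [alpha * l - beta] is close to an integer.

    Part (ii).  The indicator of [dist_int x < Delta] is replaced by a sum of Fejer
    kernels centred at the points of a grid of step about [N ^ (-1 / 4)]
    ([discrepancy_le]).  This bounds the discrepancy by the absolute values of the
    sums of [e(alpha * h * l)] over the primes [l] of the class, for
    [h <= N ^ (1 / 4)], with weights [min (Delta, 1 / h)].  These exponential sums
    are estimated on average over [h] ([prime_exponential_sums]), by Vaughan's
    identity ([vaughan]).  On an arithmetic progression modulo [v] the phase is
    linear with slope [alpha * v], which is why the rational approximation of
    [alpha * v] governs everything; the basic tool is the spacing of its multiples
    modulo one ([min_sum]).
    - In the sums of type I ([type_I]) the inner variable is smooth, so its sum is a
      geometric one.  The outer variable [d] and the frequency [h] only enter through
      [r = h * d], and a divisor bound for [r] is the origin of [N ^ eps].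
    - In the sums of type II ([type_II]) the product [r = h * m] is formed with the
      shorter of the two variables, and Cauchy-Schwarz leads to a large sieve
      inequality ([quadratic_form_le]).  Because the frequency is part of [r], the
      dependence on the number [G] of frequencies is partly of order [sqrt G]; the
      weights [min (Delta, 1 / h)] turn this into the factors [sqrt Delta] of the
      statement ([weight_sqrt_sum]).
    Very large [q] and very small [Delta] are elementary, and [count_discrepancy]
    joins the cases.

    Part (i).  By Dirichlet's approximation theorem there are reduced fractions [a / q]
    close to [alpha * v] with [q] arbitrarily large ([good_approximation]).  Apply part
    (ii) with [N = q ^ 2] and [Delta = c * N ^ (-1 / 4) * (ln N) ^ 8].  The error is of
    order [N ^ (3 / 4) * (ln N) ^ 7], and it is smaller than the main term if [c] is
    large, provided that the class contains at least [kappa * N / ln N] primes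
    ([primes_in_progression]).  More than [q] primes are then counted, so one of them
    exceeds [sqrt N] ([window_count]).

    The lower bound for primes in progressions is a quantitative form of Dirichlet's
    theorem, by an elementary argument of Mertens and Shapiro.  For a character [chi]
    modulo [v] other than the principal one, the sum of [Lambda(n) * chi(n) / n] over
    [n <= x] is bounded if the L-function does not vanish at one
    ([lambda_mean_nonvanishing]), and it is [- ln x] up to a bounded error otherwise
    ([lambda_mean_vanishing]).  As the sum of [Lambda(n) / n] over the class of one is
    non-negative, at most one character can be of the second kind, and it is real
    ([vanishing_opp]); real characters are excluded by comparison with a Lambert series
    ([real_char_nonvanishing]).  Hence every admissible class has the same logarithmic
    mean as the others up to a bounded error ([class_mean_asymptotic]), and a window
    [x / A < n <= x] with [A] a large constant contains enough primes. *)

Set Implicit Arguments.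
Unset Strict Implicit.
Unset Printing Implicit Defensive.
Import Order.TTheory GRing.Theory Num.Theory.

Local Open Scope classical_set_scope.
Local Open Scope ring_scope.

(** * Distance to the nearest integer *)

Section DistInt.
Context {R : realType}.
Implicit Types (x y : R) (m : int).

Lemma dist_int_le y m : dist_int y <= `|y - m%:~R|.
Proof.
apply: ge_inf; last by exists m.
by exists 0 => _ [k _ <-]; exact: normr_ge0.
Qed.

Lemma dist_int_attained y : exists2 m : int, dist_int y = `|y - m%:~R| & dist_int y <= 1 / 2.
Proof.
(* The infimum is attained at the integer obtained by rounding; any other
   integer is at distance at least one from it. *)
pose m : int := Num.floor (y + 1 / 2).
have /andP[m1 m2] : m%:~R <= y + 1 / 2 < (m + 1)%:~R by exact: floor_itv.
have mh : `|y - m%:~R| <= 1 / 2.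
  by rewrite ler_norml; move: m2; rewrite intrD => m2; lra.
have -> : dist_int y = `|y - m%:~R|; last by exists m.
apply/le_anti; rewrite dist_int_le /=.
apply: lb_le_inf; first by exists `|y - m%:~R|; exists m.
move=> _ [k _ <-]; have [->//|km] := eqVneq k m.
have d1 : 1 <= `|m%:~R - k%:~R| :> R.
  by rewrite -intrB -intr_norm ler1z -gtz0_ge1 normr_gt0 subr_eq0 eq_sym.
have := ler_normB (y - k%:~R) (y - m%:~R).
have -> : y - k%:~R - (y - m%:~R) = m%:~R - k%:~R by ring.
lra.
Qed.

Lemma dist_int_ge0 y : 0 <= dist_int y.
Proof. by have [m -> _] := dist_int_attained y. Qed.

Lemma dist_intD x y : dist_int (x + y) <= dist_int x + dist_int y.
Proof.
have [m -> _] := dist_int_attained x; have [k -> _] := dist_int_attained y.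
apply: le_trans (dist_int_le _ (m + k)) _; rewrite intrD.
have -> : x + y - (m%:~R + k%:~R) = (x - m%:~R) + (y - k%:~R) by ring.
exact: ler_normD.
Qed.

Lemma dist_intN y : dist_int (- y) = dist_int y.
Proof.
wlog suff H : y / dist_int (- y) <= dist_int y.
  by apply/le_anti; rewrite H /= -{1}[y]opprK H.
have [m -> _] := dist_int_attained y.
by apply: le_trans (dist_int_le _ (- m)) _; rewrite intrN -opprD normrN.
Qed.

Lemma dist_int_int m : dist_int (m%:~R : R) = 0.
Proof.
by apply/le_anti; rewrite dist_int_ge0 (le_trans (dist_int_le _ m)) // subrr normr0.
Qed.

Lemma dist_intDz y m : dist_int (y + m%:~R) = dist_int y.
Proof.
have H (z : R) (k : int) : dist_int (z + k%:~R) <= dist_int z.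
  by apply: le_trans (dist_intD _ _) _; rewrite dist_int_int addr0.
apply/le_anti; rewrite H /= -{1}[y](addrK m%:~R) -intrN; exact: H.
Qed.

Lemma dist_int_norm y : dist_int y <= `|y|.
Proof. by have := dist_int_le y 0; rewrite subr0. Qed.

Lemma dist_int_small y : `|y| <= 1 / 2 -> dist_int y = `|y|.
Proof.
move=> yh; apply/le_anti; rewrite dist_int_norm /=.
have [m -> _] := dist_int_attained y.
have [->|m0] := eqVneq m 0; first by rewrite subr0.
have d1 : 1 <= `|m%:~R| :> R by rewrite -intr_norm ler1z -gtz0_ge1 normr_gt0.
have := ler_normB y (y - m%:~R).
have -> : y - (y - m%:~R) = m%:~R by ring.
lra.
Qed.

Lemma dist_int_lip x y : `|dist_int x - dist_int y| <= `|x - y|.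
Proof.
rewrite ler_norml; apply/andP; split.
  have := dist_intD (y - x) x; rewrite subrK => h.
  have := dist_int_norm (y - x); rewrite distrC; lra.
have := dist_intD (x - y) y; rewrite subrK => h.
have := dist_int_norm (x - y); lra.
Qed.

End DistInt.

(** * Complex exponentials *)

Section Cexp.
Context {R : realType}.
Local Notation C := R[i].
Implicit Types (x y : R) (z w : C).

(** The modulus as a real number, so that estimates stay in the real field. *)
Definition cabs z : R := Normc.normc z.
Definition cexp x : C := Complex (cos (2 * pi * x)) (sin (2 * pi * x)).

Lemma cabsE (a b : R) : cabs (Complex a b) = Num.sqrt (a ^+ 2 + b ^+ 2).
Proof. by []. Qed.
Lemma cabs_ge0 z : 0 <= cabs z. Proof. by case: z => a b; exact: sqrtr_ge0. Qed.
Lemma cabs0 : cabs 0 = 0. Proof. exact: Normc.normc0. Qed.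
Lemma cabs1 : cabs 1 = 1. Proof. exact: Normc.normc1. Qed.
Lemma cabsM z w : cabs (z * w) = cabs z * cabs w. Proof. exact: Normc.normcM. Qed.
Lemma cabsD z w : cabs (z + w) <= cabs z + cabs w. Proof. exact: le_normcD. Qed.
Lemma cabsN z : cabs (- z) = cabs z. Proof. exact: normcN. Qed.
Lemma cabsB z w : cabs (z - w) <= cabs z + cabs w.
Proof. by rewrite -(cabsN w); exact: cabsD. Qed.
Lemma cabs_real x : cabs (real_complex R x) = `|x|.
Proof. by rewrite cabsE expr0n addr0 sqrtr_sqr. Qed.
Lemma cabs_conj z : cabs (conjc z) = cabs z.
Proof. by case: z => a b; rewrite /cabs /= sqrrN. Qed.
Lemma cabsX z n : cabs (z ^+ n) = cabs z ^+ n.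
Proof. by elim: n => [|n IH]; rewrite ?expr0 ?cabs1 // !exprS cabsM IH. Qed.
Lemma cabs_eq0 z : (cabs z == 0) = (z == 0).
Proof. by apply/eqP/eqP => [|->]; [exact: Normc.eq0_normc | exact: cabs0]. Qed.
Lemma cabs_sqr z : real_complex R (cabs z ^+ 2) = z * conjc z.
Proof.
case: z => a b; rewrite /cabs /= sqr_sqrtr ?addr_ge0 ?sqr_ge0 //.
by apply/eqP; rewrite eq_complex /=; apply/andP; split; apply/eqP; ring.
Qed.
Lemma cabs_sum (I : Type) (r : seq I) (P : pred I) (F : I -> C) :
  cabs (\sum_(i <- r | P i) F i) <= \sum_(i <- r | P i) cabs (F i).
Proof.
elim/big_rec2: _ => [|i y1 y2 _ h]; first by rewrite cabs0.
by apply: le_trans (cabsD _ _) _; rewrite lerD2l.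
Qed.
Lemma Re_le_cabs z : complex.Re z <= cabs z.
Proof.
case: z => a b; rewrite cabsE /=; apply: le_trans (ler_norm _) _.
by rewrite -sqrtr_sqr ler_sqrt ?lerDl ?addr_ge0 ?sqr_ge0.
Qed.

Lemma cexpD x y : cexp (x + y) = cexp x * cexp y.
Proof.
apply/eqP; rewrite eq_complex /= !mulrDr cosD sinD; apply/andP; split; apply/eqP; ring.
Qed.
Lemma cexp0 : cexp 0 = 1.
Proof. by rewrite /cexp mulr0 cos0 sin0. Qed.
Lemma cexpN x : cexp (- x) = conjc (cexp x).
Proof. by rewrite /cexp mulrN cosN sinN. Qed.
Lemma cabs_cexp x : cabs (cexp x) = 1.
Proof. by rewrite cabsE cos2Dsin2 sqrtr1. Qed.
Lemma cexpMn x n : cexp (x * n%:R) = cexp x ^+ n.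
Proof.
elim: n => [|n IH]; first by rewrite mulr0 cexp0.
by rewrite -natr1 mulrDr mulr1 cexpD IH exprSr.
Qed.
Lemma cexp1 : cexp 1 = 1.
Proof. by rewrite /cexp mulr1 mulr_natl cos2pi sin2pi. Qed.
Lemma cexp_nat n : cexp n%:R = 1.
Proof. by rewrite -[n%:R]mul1r cexpMn cexp1 expr1n. Qed.
Lemma cexp_int (m : int) : cexp m%:~R = 1.
Proof.
case: m => n; first exact: cexp_nat.
by rewrite NegzE intrN cexpN -pmulrn cexp_nat conjc1.
Qed.
Lemma cexpDz x (m : int) : cexp (x + m%:~R) = cexp x.
Proof. by rewrite cexpD cexp_int mulr1. Qed.
Lemma cexp_neq0 x : cexp x != 0.
Proof. by rewrite -cabs_eq0 cabs_cexp oner_eq0. Qed.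

(** Up to a half turn, the chord is at least the radius beyond a quarter turn:
    the real part of [cexp y] is then non-positive. *)
Lemma cexp_far y : 1 / 4 <= y <= 1 / 2 -> 1 <= cabs (1 - cexp y).
Proof.
move=> /andP[y1 y2].
have c0 : cos (2 * pi * y) <= 0.
  have := @cos_ge0_pihalf R (pi - 2 * pi * y).
  rewrite cosB cospi sinpi mul0r addr0 mulN1r oppr_ge0; apply.
  by have := pi_gt0 R; nra.
apply: le_trans (Re_le_cabs _) => /=; lra.
Qed.

(** Halving the angle: [1 - e(2y) = (1 - e(y)) (1 + e(y))] and [|1 + e(y)| <= 2],
    so the bound at [2y] gives the bound at [y]; doubling reaches [cexp_far]. *)
Lemma cexp_near y : 0 < y <= 1 / 2 -> 2 * y <= cabs (1 - cexp y).
Proof.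
move=> /andP[y0 yh].
have [n hn] : exists n, 1 / 4 <= 2 ^+ n * y.
  have [n hn] : exists n : nat, 1 / y < n%:R.
    by exists (Num.truncn (1 / y)).+1; exact: truncnS_gt.
  exists n; move: hn; rewrite ltr_pdivrMr // => hn.
  have : n%:R <= 2 ^+ n :> R by rewrite -natrX ler_nat ltnW // ltn_expl.
  by move=> hn2; have := ler_wpM2r (ltW y0) hn2; lra.
elim: n y y0 yh hn => [|n IH] y y0 yh hn.
  have /cexp_far : 1 / 4 <= y <= 1 / 2 by move: hn; rewrite expr0; lra.
  lra.
have [y4|y4] := leP (1 / 4) y.
  have /cexp_far : 1 / 4 <= y <= 1 / 2 by rewrite y4.
  lra.
have := IH (2 * y); rewrite mulrA -exprSr => /(_ _ _ hn) h.
have {h} : 2 * (2 * y) <= cabs (1 - cexp (2 * y)) by apply: h; lra.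
have -> : cexp (2 * y) = cexp y ^+ 2 by rewrite mulrC cexpMn.
have -> : 1 - cexp y ^+ 2 = (1 - cexp y) * (1 + cexp y) by ring.
rewrite cabsM => h.
have := cabsD 1 (cexp y); rewrite cabs1 cabs_cexp => h2.
have := cabs_ge0 (1 - cexp y); nra.
Qed.

Lemma cexp_dist x : 2 * dist_int x <= cabs (1 - cexp x).
Proof.
have [m dE dh] := dist_int_attained x.
have [->|d0] := eqVneq (dist_int x) 0; first by rewrite mulr0 cabs_ge0.
have dp : 0 < dist_int x <= 1 / 2 by rewrite lt_def d0 dist_int_ge0 dh.
have := cexp_near dp; rewrite {2}dE.
have -> : cabs (1 - cexp `|x - m%:~R|) = cabs (1 - cexp (x - m%:~R)).
  case: (lerP 0 (x - m%:~R)) => h; first by rewrite ger0_norm.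
  by rewrite ltr0_norm // cexpN -{1}(conjc1 R) -rmorphB cabs_conj.
by rewrite -intrN cexpDz.
Qed.

(** A geometric sum of ratio [e(x)] is at most [2 / |1 - e(x)|].  The product form
    remains meaningful when [x] is an integer. *)
Lemma geometric_cexp x c n :
  cabs (\sum_(0 <= k < n) cexp (x * k%:R + c)) * dist_int x <= 1.
Proof.
have -> : \sum_(0 <= k < n) cexp (x * k%:R + c) = (\sum_(0 <= k < n) cexp x ^+ k) * cexp c.
  by rewrite mulr_suml; apply: eq_bigr => k _; rewrite cexpD cexpMn.
rewrite cabsM cabs_cexp mulr1.
have e : (1 - cexp x) * (\sum_(0 <= k < n) cexp x ^+ k) = 1 - cexp x ^+ n.
  by rewrite -opprB mulNr big_mkord -subrX1 opprB.
have : cabs (1 - cexp x) * cabs (\sum_(0 <= k < n) cexp x ^+ k) <= 2.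
  rewrite -cabsM e; apply: le_trans (cabsB _ _) _.
  by rewrite cabs1 cabsX cabs_cexp expr1n; lra.
have := cexp_dist x; have := cabs_ge0 (\sum_(0 <= k < n) cexp x ^+ k).
have := dist_int_ge0 x; nra.
Qed.

Lemma cabs_sum_le_card (I : Type) (r : seq I) (P : pred I) (F : I -> C) :
  (forall i, P i -> cabs (F i) <= 1) -> cabs (\sum_(i <- r | P i) F i) <= (size r)%:R.
Proof.
move=> h; apply: le_trans (cabs_sum _ _ _) _.
apply: (@le_trans _ _ (\sum_(i <- r) 1)); last by rewrite big_const_seq count_predT iter_addr addr0.
rewrite big_mkcond; apply: ler_sum => i _; case: ifPn => // /h //.
Qed.

Lemma abel_sum_le (w : nat -> R) (z : nat -> C) n :
  cabs (\sum_(0 <= k < n) real_complex R (w k) * z k) <=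
   `|w n| * cabs (\sum_(0 <= k < n) z k) +
   \sum_(0 <= k < n) `|w k - w k.+1| * cabs (\sum_(0 <= j < k.+1) z j).
Proof.
have -> : \sum_(0 <= k < n) real_complex R (w k) * z k =
   real_complex R (w n) * (\sum_(0 <= k < n) z k) +
   \sum_(0 <= k < n) real_complex R (w k - w k.+1) * \sum_(0 <= j < k.+1) z j.
  elim: n => [|n IH]; first by rewrite !big_geq // mulr0 add0r.
  rewrite big_nat_recr //= IH [in RHS]big_nat_recr //= [\sum_(0 <= i < n.+1) (_ * _)]big_nat_recr //=.
  rewrite [\sum_(0 <= j < n.+1) z j]big_nat_recr //= !rmorphB /=; ring.
apply: le_trans (cabsD _ _) _; apply: lerD; first by rewrite cabsM cabs_real.
apply: le_trans (cabs_sum _ _ _) _.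
by apply: ler_sum => k _; rewrite cabsM cabs_real.
Qed.

(** Summation by parts costs the variation of the weight.  As the same weight
    serves the whole family, bounds on average over the family are enough: this
    keeps the averaging over frequencies intact later on. *)
Lemma abel_sum_family (I : Type) (r : seq I) (w : nat -> R) (z : I -> nat -> C) n (B : R) :
  (forall j, (j <= n)%N -> \sum_(h <- r) cabs (\sum_(0 <= k < j) z h k) <= B) ->
  \sum_(h <- r) cabs (\sum_(0 <= k < n) real_complex R (w k) * z h k) <=
   B * (`|w n| + \sum_(0 <= k < n) `|w k - w k.+1|).
Proof.
move=> hB; apply: le_trans (ler_sum _ (fun h _ => abel_sum_le w (z h) n)) _.
rewrite big_split /= mulrDr -mulr_sumr; apply: lerD.
  by rewrite mulrC; apply: ler_wpM2r => //; exact: hB.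
rewrite exchange_big /= mulr_sumr; apply: ler_sum_nat => k /andP[_ kn].
by rewrite -mulr_sumr mulrC; apply: ler_wpM2r => //; exact: hB.
Qed.

Lemma abel_sum (w : nat -> R) (z : nat -> C) n (B : R) :
  (forall j, (j <= n)%N -> cabs (\sum_(0 <= k < j) z k) <= B) ->
  cabs (\sum_(0 <= k < n) real_complex R (w k) * z k) <=
   B * (`|w n| + \sum_(0 <= k < n) `|w k - w k.+1|).
Proof.
move=> hB; have := @abel_sum_family unit [:: tt] w (fun=> z) n B.
by rewrite big_seq1; apply=> j jn; rewrite big_seq1; exact: hB.
Qed.

End Cexp.

(** * Spacing of a linear sequence modulo one *)

Section MinSum.
Context {R : realType}.
Implicit Types (x y th g X : R).

(** Induction, with [1 / (n + 1) <= ln ((n + 1) / n)]. *)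
Lemma harmonic_le n : (0 < n)%N -> \sum_(1 <= t < n.+1) (t%:R)^-1 <= 1 + ln n%:R :> R.
Proof.
elim: n => // -[_ _|n /(_ isT) IH _]; first by rewrite big_nat1 invr1 ln1 addr0.
rewrite big_nat_recr //=.
have h : (n.+2%:R)^-1 <= ln n.+2%:R - ln n.+1%:R :> R.
  rewrite -ln_div ?posrE ?ltr0n //.
  have e : n.+2%:R / n.+1%:R = (1 + - (n.+2%:R)^-1 : R)^-1.
    rewrite -[n.+2%:R]natr1; field.
    have n0 : 0 <= n%:R :> R := ler0n _ _.
    by apply/andP; split; apply: lt0r_neq0; lra.
  rewrite e lnV ?posrE; last first.
    by rewrite subr_gt0 invf_lt1 ?ltr0n // ltr1n.
  rewrite lerNr; apply: le_ln1Dx.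
  by rewrite ltrN2 invf_lt1 ?ltr0n // ltr1n.
move: h IH; set a := ln n.+2%:R; set b := ln n.+1%:R; set c := (n.+2%:R)^-1; lra.
Qed.

Lemma dist_int_ratio (s : nat) (q : nat) : (0 < q)%N -> (s <= q)%N ->
  dist_int (s%:R / q%:R : R) = (minn s (q - s))%:R / q%:R.
Proof.
move=> q0 sq; have q0' : 0 < q%:R :> R by rewrite ltr0n.
have [h|h] := leqP s (q - s).
  rewrite dist_int_small ?ger0_norm ?divr_ge0 //.
  by rewrite ler_pdivrMr // mulrC mulrA mulr1 ler_pdivlMr // -natrM ler_nat; lia.
rewrite -(dist_intDz _ (-1)).
have -> : s%:R / q%:R + (-1)%:~R = - ((q - s)%:R / q%:R) :> R.
  rewrite natrB // mulrBl divff ?gt_eqF //; rewrite intrN; lra.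
rewrite dist_intN dist_int_small ?ger0_norm ?divr_ge0 //.
by rewrite ler_pdivrMr // mulrC mulrA mulr1 ler_pdivlMr // -natrM ler_nat; lia.
Qed.

Lemma affine_mod_inj (a c : int) (q : nat) (j k : nat) : coprimez a q ->
  (j < q)%N -> (k < q)%N -> ((a * j%:Z + c) %% q%:Z)%Z = ((a * k%:Z + c) %% q%:Z)%Z -> j = k.
Proof.
move=> co jq kq /eqP; rewrite eqz_mod_dvd.
have -> : a * j%:Z + c - (a * k%:Z + c) = a * (j%:Z - k%:Z) by ring.
rewrite Gauss_dvdzr; last by rewrite coprimez_sym.
wlog h : j k jq kq / (k <= j)%N => [H|].
  case/orP: (leq_total k j) => h d; first exact: H.
  by apply/esym; apply: H => //; move: d; rewrite !dvdzE distnC.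
rewrite subzn // => /dvdn_leq /=.
by have [h2|h2] := posnP (j - k); [lia | move=> /(_ isT); lia].
Qed.

(** Over [q] consecutive indices, [th * j + g] differs from [(a * j + c) / q] by at
    most [2 / q], and [a * j + c] runs once through the residues modulo [q].  So
    the distances to the integers are at least [(t - 2) / q], each [t] being taken
    at most twice: residues with [t <= 2] are charged to the trivial bound [X],
    the other ones add up to a harmonic sum. *)
Lemma min_sum_block th g X (a : int) (q : nat) (f : nat -> R) :
  (0 < q)%N -> coprimez a q -> `|th - a%:~R / q%:R| <= 1 / q%:R ^+ 2 ->
  (forall j, (j < q)%N -> 0 <= f j <= X /\ f j * dist_int (th * j%:R + g) <= 1) ->
  \sum_(0 <= j < q) f j <= 5 * X + 6 * q%:R * (1 + ln q%:R).
Proof.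
move=> q0 co tha fP; have q0' : 0 < q%:R :> R by rewrite ltr0n.
have X0 : 0 <= X by have [/andP[f0 fX] _] := fP _ q0; exact: le_trans fX.
(* The grid point closest to [g] from below. *)
pose c := Num.floor (q%:R * g).
have cP : 0 <= g - c%:~R / q%:R <= 1 / q%:R.
  have /andP[c1 c2] : c%:~R <= q%:R * g < (c + 1)%:~R by exact: floor_itv.
  have e : g - c%:~R / q%:R = (q%:R * g - c%:~R) / q%:R by field; rewrite gt_eqF.
  rewrite e; apply/andP; split; first by rewrite divr_ge0 ?subr_ge0 // ltW.
  by rewrite ler_pM2r ?invr_gt0 //; rewrite intrD in c2; lra.
have sP (j : 'I_q) : (`|((a * j%:Z + c) %% q%:Z)%Z| < q)%N.
  rewrite -ltz_nat gez0_abs ?modz_ge0 ?ltz_pmod //; lia.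
pose s j := Ordinal (sP j).
have s_inj : injective s.
  move=> j k /(congr1 val) /= h; apply/val_inj/(@affine_mod_inj a c q) => //.
  all: try exact: ltn_ord.
  have qn0 : q%:Z != 0 by lia.
  by have := congr1 Posz h; rewrite !gez0_abs ?modz_ge0.
pose g1 (t : nat) := if (t <= 2)%N then X else 3 * q%:R / t%:R.
have g1_ge0 t : 0 <= g1 t by rewrite /g1; case: ifP => // _; rewrite !mulr_ge0.
have key (j : 'I_q) : f j <= g1 (s j) + g1 (q - s j)%N.
  suff h : f j <= g1 (minn (s j) (q - s j)).
    by move: h; rewrite /minn; case: ifP => _ h; apply: le_trans h _; rewrite ?lerDl ?lerDr.
  have [/andP[f0 fX] fd] := fP _ (ltn_ord j).
  set t := minn _ _; rewrite /g1; case: ltnP => // t2.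
  have dt : t%:R / q%:R - 2 / q%:R <= dist_int (th * j%:R + g).
    have := dist_int_ratio q0 (ltnW (ltn_ord (s j))); rewrite -/t => <-.
    have e : (a * j%:Z + c)%:~R / q%:R =
             (s j)%:R / q%:R + ((a * j%:Z + c) %/ q%:Z)%Z%:~R :> R.
      rewrite {1}(divz_eq (a * j%:Z + c) q%:Z) intrD intrM /=.
      have -> : ((a * j%:Z + c) %% q%:Z)%Z = (`|((a * j%:Z + c) %% q%:Z)%Z|)%N%:Z.
        by rewrite gez0_abs ?modz_ge0 //; lia.
      by rewrite absz_nat -!pmulrn; field; rewrite gt_eqF.
    rewrite -(dist_intDz _ ((a * j%:Z + c) %/ q%:Z)%Z) -e.
    have := dist_int_lip ((a * j%:Z + c)%:~R / q%:R) (th * j%:R + g).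
    rewrite ler_norml => /andP[_ h].
    suff : `|(a * j%:Z + c)%:~R / q%:R - (th * j%:R + g)| <= 2 / q%:R by move=> h2; lra.
    have -> : (a * j%:Z + c)%:~R / q%:R - (th * j%:R + g) =
              - (j%:R * (th - a%:~R / q%:R)) - (g - c%:~R / q%:R).
      by rewrite intrD intrM -pmulrn; field; rewrite gt_eqF.
    apply: le_trans (ler_normB _ _) _; rewrite normrN normrM normr_nat.
    have -> : 2 / q%:R = 1 / q%:R + 1 / q%:R :> R by field; rewrite gt_eqF.
    case/andP: cP => cP1 cP2; apply: lerD; last by rewrite ger0_norm.
    apply: (@le_trans _ _ (q%:R * (1 / q%:R ^+ 2))).
      by apply: ler_pM => //; rewrite ler_nat ltnW.
    by rewrite expr2 !mul1r invfM mulrA divff ?mul1r ?gt_eqF.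
  have t0 : (0 < t)%N by apply: leq_trans t2.
  rewrite ler_pdivlMr ?ltr0n //.
  have t3 : 3 <= t%:R :> R by rewrite ler_nat.
  have h3 : f j * (t%:R / q%:R - 2 / q%:R) <= 1 by apply: le_trans fd; exact: ler_wpM2l.
  move: h3; rewrite -mulrBl mulrA ler_pdivrMr // mul1r; nra.
have hs1 : \sum_(1 <= t < q.+1) g1 t <= 2 * X + 3 * q%:R * (1 + ln q%:R).
  apply: (@le_trans _ _ (\sum_(1 <= t < q.+1) ((if (t <= 2)%N then X else 0) +
            3 * q%:R / t%:R))).
    apply: ler_sum => t _; rewrite /g1; case: ifP => _; rewrite ?add0r //.
    by rewrite lerDl !mulr_ge0.
  rewrite big_split /=; apply: lerD; last first.
    by rewrite -mulr_sumr ler_wpM2l ?mulr_ge0 // harmonic_le.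
  rewrite -big_mkcond /=.
  apply: (@le_trans _ _ (\sum_(1 <= t < q.+3 | (t <= 2)%N) X)).
    rewrite [leRHS](@big_cat_nat _ _ _ q.+1) //=; last by lia.
    by rewrite lerDl sumr_ge0.
  rewrite big_mkcond big_ltn // big_ltn //= big_nat big1 => [|i /andP[i3 _]]; first by lra.
  by rewrite leqNgt i3.
rewrite big_mkord; apply: (@le_trans _ _ (\sum_(j < q) (g1 (s j) + g1 (q - s j)%N))).
  by apply: ler_sum => j _; exact: key.
have -> : \sum_(j < q) (g1 (s j) + g1 (q - s j)%N) = \sum_(j < q) (g1 j + g1 (q - j)%N).
  by rewrite [RHS](reindex_inj s_inj).
rewrite big_split /=.
have e1 : \sum_(i < q) g1 (q - i)%N = \sum_(1 <= t < q.+1) g1 t.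
  rewrite big_add1 /= big_mkord (reindex_inj rev_ord_inj) /=; apply: eq_bigr => i _.
  by congr g1; have := ltn_ord i; lia.
have e2 : \sum_(i < q) g1 i <= X + \sum_(1 <= t < q.+1) g1 t.
  rewrite -(big_mkord xpredT) big_ltn // lerD ?big_nat_recr //=; last by rewrite lerDl.
rewrite e1; lra.
Qed.

(** Cut the range into blocks of length [q]; a block starting at [n * q] is a
    translate, which only changes [g]. *)
Lemma min_sum th g X (a : int) (q J : nat) (f : nat -> R) :
  (0 < q)%N -> coprimez a q -> `|th - a%:~R / q%:R| <= 1 / q%:R ^+ 2 -> 0 <= X ->
  (forall j, (j < J)%N -> 0 <= f j <= X /\ f j * dist_int (th * j%:R + g) <= 1) ->
  \sum_(0 <= j < J) f j <= (J%:R / q%:R + 1) * (5 * X + 6 * q%:R * (1 + ln q%:R)).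
Proof.
move=> q0 co tha X0; have q0' : 0 < q%:R :> R by rewrite ltr0n.
set Y := 5 * X + _.
have Y0 : 0 <= Y.
  by rewrite addr_ge0 ?mulr_ge0 // addr_ge0 // ln_ge0 // ler1n.
have blocks n : forall g' (f : nat -> R),
  (forall j, (j < n * q)%N -> 0 <= f j <= X /\ f j * dist_int (th * j%:R + g') <= 1) ->
  \sum_(0 <= j < n * q) f j <= n%:R * Y.
  elim: n => [|n IH] g' f' fP; first by rewrite mul0n big_geq // mul0r.
  rewrite (@big_cat_nat _ _ _ (n * q)) //=; last by rewrite leq_pmul2r.
  rewrite -natr1 mulrDl mul1r; apply: lerD.
    by apply: (IH g') => j h; apply: fP; rewrite mulSn ltn_addl.
  rewrite -{1}[(n * q)%N]add0n big_addn mulSn addnK.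
  apply: (@min_sum_block th (th * (n * q)%:R + g') X a) => // j jq.
  have := fP (j + n * q)%N; rewrite mulSn ltn_add2r => /(_ jq); rewrite natrD.
  by have -> : th * (j%:R + (n * q)%:R) + g' = th * j%:R + (th * (n * q)%:R + g') by ring.
move=> fP.
pose f' j := if (j < J)%N then f j else 0.
apply: (@le_trans _ _ (\sum_(0 <= j < (J %/ q).+1 * q) f' j)).
  have hJ : (J <= (J %/ q).+1 * q)%N by rewrite ltnW // ltn_ceil.
  rewrite (big_cat_nat _ hJ) //=.
  rewrite big_nat [X in _ <= X + _]big_nat [X in _ <= X + _](eq_bigr f).
    rewrite lerDl big_nat_cond sumr_ge0 // => i /andP[/andP[h _] _].
    by rewrite /f' ltnNge h.
  by move=> i /andP[_ h]; rewrite /f' h.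
apply: le_trans (blocks _ g _ _) _ => [j _|].
  by rewrite /f'; case: ifP => [/fP //|_]; rewrite mul0r lexx X0 ler01.
apply: ler_wpM2r => //; rewrite -natr1 lerD2r ler_pdivlMr // -natrM ler_nat.
exact: leq_trunc_div.
Qed.
End MinSum.

Local Notation "d %| m" := (dvdn d m) : ring_scope.

(** * Divisor sums and arithmetic functions *)

Section DivisorSums.
Context {V : zmodType}.

Lemma sum_multiples (G : nat -> V) (d x : nat) : (0 < d)%N ->
  \sum_(1 <= n < x.+1 | d %| n) G n = \sum_(1 <= k < (x %/ d).+1) G (d * k)%N.
Proof.
move=> d0; elim: x => [|x IH]; first by rewrite div0n !big_geq.
rewrite big_mkcond big_nat_recr //= -big_mkcond IH divnS //.
case: ifPn => [dx|_] /=; last by rewrite addr0 add0n.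
rewrite add1n [RHS]big_nat_recr //=; congr (_ + G _).
by rewrite mulnC; move: (divnK dx); rewrite divnS // dx add1n.
Qed.

Lemma sum_divisors_swap (F : nat -> nat -> V) (x : nat) :
  \sum_(1 <= n < x.+1) \sum_(1 <= d < n.+1 | d %| n) F d (n %/ d)%N =
  \sum_(1 <= d < x.+1) \sum_(1 <= k < (x %/ d).+1) F d k.
Proof.
have e n : (1 <= n < x.+1)%N -> \sum_(1 <= d < n.+1 | d %| n) F d (n %/ d)%N =
    \sum_(1 <= d < x.+1 | d %| n) F d (n %/ d)%N.
  move=> /andP[n1 nx]; rewrite [RHS](big_cat_nat _ (_ : (n.+1 <= x.+1)%N)) //=.
  rewrite [X in _ = _ + X]big_nat_cond [X in _ = _ + X]big_pred0 ?addr0 //.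
  by move=> i; apply/negbTE/negP => /andP[/andP[h _] /(dvdn_leq n1)]; lia.
rewrite (eq_big_nat _ _ e) (exchange_big_dep_nat xpredT) //=.
apply: eq_big_nat => d /andP[d0 _].
rewrite (sum_multiples (fun n => F d (n %/ d)%N)) //.
by apply: eq_bigr => k _; rewrite mulKn.
Qed.

Lemma hyperbola_swap (F : nat -> nat -> V) (x : nat) :
  \sum_(1 <= d < x.+1) \sum_(1 <= k < (x %/ d).+1) F d k =
  \sum_(1 <= k < x.+1) \sum_(1 <= d < (x %/ k).+1) F d k.
Proof.
have cut (G : nat -> V) d : (0 < d)%N -> \sum_(1 <= k < (x %/ d).+1) G k =
    \sum_(1 <= k < x.+1 | (d * k <= x)%N) G k.
  move=> d0; have h : ((x %/ d).+1 <= x.+1)%N by rewrite ltnS leq_div.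
  rewrite [RHS](big_cat_nat _ h) //= [X in _ = _ + X]big_nat_cond [X in _ = _ + X]big_pred0 ?addr0.
    rewrite big_nat_cond [RHS]big_nat_cond; apply: eq_bigl => k; rewrite !andbT.
    by case: andP => // -[_ kx]; rewrite mulnC -leq_divRL // -ltnS kx.
  move=> k; apply/negbTE/negP => /andP[/andP[h1 _]].
  by rewrite mulnC -leq_divRL // leqNgt h1.
rewrite (eq_big_nat _ _ (fun d h => cut (F d) d (proj1 (andP h)))).
rewrite [RHS](eq_big_nat _ _ (fun k h => cut (F^~ k) k (proj1 (andP h)))).
rewrite (exchange_big_dep_nat xpredT) //=; apply: eq_bigr => k _.
by apply: eq_bigl => d; rewrite mulnC.
Qed.

End DivisorSums.

Section Arithmetic.
Context {R : realType}.
Implicit Types (g f : nat -> R).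

(** The Moebius function. *)
Definition mu (n : nat) : R :=
  if all (fun p => logn p n == 1%N) (primes n) then (-1) ^+ size (primes n) else 0.

Lemma mu_le1 n : `|mu n| <= 1.
Proof.
by rewrite /mu; case: ifP => _; rewrite ?normr0 // normrX normrN1 expr1n.
Qed.

Lemma mu1 : mu 1 = 1. Proof. by []. Qed.

Lemma mu_primeM p d : prime p -> (0 < d)%N ->
  mu (p * d) = if p %| d then 0 else - mu d.
Proof.
move=> pp d0; have p0 := prime_gt0 pp.
have pin : p \in primes (p * d).
  by rewrite mem_primes pp muln_gt0 p0 d0 dvdn_mulr.
case: ifPn => pd.
  rewrite /mu; case: ifP => // /allP /(_ p pin).
  by rewrite lognM // logn_prime // eqxx eqSS -leqn0 leqNgt logn_gt0 mem_primes pp d0 pd.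
have pnd : p \notin primes d by rewrite mem_primes negb_and negb_and pd !orbT.
have perm : perm_eq (primes (p * d)) (p :: primes d).
  apply: uniq_perm; rewrite ?primes_uniq //= ?pnd ?primes_uniq // => q.
  by rewrite primesM // primes_prime // !inE.
rewrite /mu (perm_size perm) (perm_all _ perm) /=.
have l0 : logn p d = 0%N by apply/eqP; rewrite -leqn0 leqNgt logn_gt0.
rewrite lognM // l0 logn_prime // eqxx /=.
rewrite exprS mulN1r (eq_in_all (_ : {in primes d, _ =1 fun q => logn q d == 1%N})).
  by case: ifP => //; rewrite oppr0.
move=> q qd; rewrite lognM // logn_prime //; have [qp|//] := eqVneq q p.
by move: pnd; rewrite -qp qd.
Qed.

(** Split off the least prime factor [p] of [n]: the divisors prime to [p] and
    their multiples by [p] cancel in pairs. *)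
Lemma sum_mu n : (0 < n)%N -> \sum_(1 <= d < n.+1 | d %| n) mu d = (n == 1%N)%:R.
Proof.
move=> n0; have [->|n1] := eqVneq n 1%N; first by rewrite big_mkcond big_nat1 /= mu1.
have n2 : (1 < n)%N by rewrite ltn_neqAle eq_sym n1.
pose p := pdiv n; have pp : prime p by exact: pdiv_prime.
have pn : p %| n by exact: pdiv_dvd.
have [m nE] : exists m, n = (p * m)%N by case/dvdnP: pn => m ->; exists m; rewrite mulnC.
have m0 : (0 < m)%N by move: n0; rewrite nE; case: (m) => //; rewrite muln0.
have p0 := prime_gt0 pp.
rewrite (bigID (fun d => p %| d)) /=.
have -> : \sum_(1 <= d < n.+1 | (d %| n) && (p %| d)) mu d =
          \sum_(1 <= d < n.+1 | p %| d) (if d %| n then mu d else 0).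
  rewrite big_mkcond [RHS]big_mkcond; apply: eq_bigr => d _.
  by case: (d %| n); case: (p %| d).
rewrite sum_multiples // nE mulKn //.
have -> : \sum_(1 <= k < m.+1) (if p * k %| p * m then mu (p * k) else 0) =
          \sum_(1 <= k < m.+1) (if (k %| m) && ~~ (p %| k) then - mu k else 0).
  rewrite big_nat [RHS]big_nat; apply: eq_bigr => k /andP[k0 _].
  rewrite dvdn_pmul2l // mu_primeM //.
  by case: (k %| m) => //=; case: (p %| k).
rewrite -big_mkcond sumrN.
apply/eqP; rewrite addrC subr_eq0; apply/eqP.
have h : (m.+1 <= (p * m).+1)%N by rewrite ltnS leq_pmull.
rewrite (big_cat_nat _ h) //= [X in _ + X]big_nat_cond [X in _ + X]big_pred0 ?addr0.
  apply: eq_bigl => d; case: (boolP (p %| d)) => pd; rewrite ?andbF // !andbT.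
  by rewrite Gauss_dvdr // coprime_sym prime_coprime.
move=> d; apply/negbTE/negP => /andP[/andP[h1 _] /andP[dn pd]].
move: dn; rewrite Gauss_dvdr ?[coprime d p]coprime_sym ?prime_coprime // => /(dvdn_leq m0).
by rewrite leqNgt h1.
Qed.

(** The von Mangoldt function. *)
Definition vonM (n : nat) : R := if primes n is [:: p] then ln p%:R else 0.

Lemma vonM_ge0 n : 0 <= vonM n.
Proof.
rewrite /vonM; case: (primes n) => [|p [|]] //; case: p => [|p]; first by rewrite ln0.
by rewrite ln_ge0 // ler1n.
Qed.

Lemma primes_pow p n : primes n = [:: p] -> [/\ prime p, (0 < logn p n)%N & n = (p ^ logn p n)%N].
Proof.
move=> e; have pin : p \in primes n by rewrite e inE.
move: (pin); rewrite mem_primes => /and3P[pp n0 _].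
split=> //; first by rewrite logn_gt0.
by rewrite -p_part part_pnat_id // /pnat n0 e /= inE eqxx.
Qed.

Lemma vonM_prime_pow p k : prime p -> (0 < k)%N -> vonM (p ^ k) = ln p%:R.
Proof. by move=> pp k0; rewrite /vonM primesX // primes_prime. Qed.

Lemma vonM_prime p : prime p -> vonM p = ln p%:R.
Proof. by move=> pp; rewrite -(vonM_prime_pow pp (ltn0Sn 0)) expn1. Qed.

(** Dividing [n] by a prime factor [p] removes exactly one divisor that is a prime
    power, the largest power of [p] in [n]. *)
Lemma sum_vonM n : (0 < n)%N -> \sum_(1 <= d < n.+1 | d %| n) vonM d = ln n%:R.
Proof.
elim/ltn_ind: n => n IH n0.
have [->|n1] := eqVneq n 1%N; first by rewrite big_mkcond big_nat1 /= /vonM /= ln1.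
have n2 : (1 < n)%N by rewrite ltn_neqAle eq_sym n1.
pose p := pdiv n; have pp : prime p by exact: pdiv_prime.
have pn : p %| n by exact: pdiv_dvd.
have [m nE] : exists m, n = (p * m)%N by case/dvdnP: pn => m ->; exists m; rewrite mulnC.
have m0 : (0 < m)%N by move: n0; rewrite nE; case: (m) => //; rewrite muln0.
have p0 := prime_gt0 pp; have p1 := prime_gt1 pp.
have mn : (m < n)%N by rewrite nE ltn_Pmull.
rewrite (bigID (fun d => d %| m)) /=.
have -> : \sum_(1 <= d < n.+1 | (d %| n) && (d %| m)) vonM d = ln m%:R.
  rewrite -(IH _ mn m0) (big_cat_nat _ (_ : (m.+1 <= n.+1)%N)) //=; last by rewrite ltnS ltnW.
  rewrite [X in _ + X]big_nat_cond [X in _ + X]big_pred0 ?addr0.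
    apply: eq_bigl => d; case: (boolP (d %| m)) => dm; rewrite ?andbF // andbT.
    by rewrite nE dvdn_mull.
  by move=> d; apply/negbTE/negP => /andP[/andP[h1 _] /andP[_ /(dvdn_leq m0)]]; lia.
pose a := logn p n.
have an : (p ^ a <= n)%N by apply: dvdn_leq => //; exact: pfactor_dvdnn.
have aE : a = (logn p m).+1 by rewrite /a nE lognM // logn_prime // eqxx.
rewrite big_mkcond (bigD1_seq (p ^ a)%N) ?mem_index_iota ?iota_uniq //=; last first.
  by rewrite expn_gt0 p0 ltnS an.
rewrite pfactor_dvdnn /= pfactor_dvdn // aE ltnn /=.
rewrite big1 ?addr0; last first.
  move=> d da; case: ifP => // /andP[dn dm]; rewrite /vonM.
  case e : (primes d) => [|q [|]] //; have [qp ql dE] := primes_pow e.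
  have [qE|qp'] := eqVneq q p.
    have := dn; have := dm; rewrite dE qE !pfactor_dvdn // -/a aE.
    rewrite -qE => h1 h2; case/negP: da.
    rewrite dE qE; apply/eqP; congr (_ ^ _)%N; apply/eqP.
    by rewrite -qE eqn_leq h2 ltnNge h1.
  have := dn; rewrite nE Gauss_dvdr ?(negPf dm) // dE coprimeXl // prime_coprime //.
  by rewrite dvdn_prime2.
rewrite vonM_prime_pow // nE natrM lnM ?posrE ?ltr0n //.
by rewrite addrC.
Qed.

Lemma vonM_le_ln n : (0 < n)%N -> vonM n <= ln n%:R.
Proof.
move=> n0; rewrite -sum_vonM // big_mkcond big_nat_recr //= dvdnn lerDr sumr_ge0 // => i _.
by case: ifP => // _; exact: vonM_ge0.
Qed.

Definition dsum g n : R := \sum_(1 <= d < n.+1 | d %| n) g d.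

(** Submultiplicativity, unlike multiplicativity, is asked for all pairs: the
    divisor functions satisfy it, and it lets mean values be bounded without any
    gcd bookkeeping. *)
Definition submult g := (forall n, 0 <= g n) /\
  (forall a b, (0 < a)%N -> (0 < b)%N -> g (a * b)%N <= g a * g b).

Lemma dsum_ge0 g n : (forall n, 0 <= g n) -> 0 <= dsum g n.
Proof. by move=> h; apply: sumr_ge0. Qed.

(** A divisor [d] of [a * b] factors as [gcd(d, a)] times a divisor of [b], so
    the divisors of [a * b] are among the products of a divisor of [a] and a
    divisor of [b]. *)
Lemma submult_dsum g : submult g -> submult (dsum g).
Proof.
move=> [g0 gM]; split=> [n|a b a0 b0]; first exact: dsum_ge0.
have ab0 : (0 < a * b)%N by rewrite muln_gt0 a0.
apply: (@le_trans _ _ (\sum_(1 <= d < (a * b).+1 | d %| a * b)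
    \sum_(1 <= e < a.+1 | e %| a) \sum_(1 <= f < b.+1 | f %| b) (if (e * f == d)%N then g d else 0))).
  rewrite /dsum big_nat_cond [leRHS]big_nat_cond; apply: ler_sum => d /andP[/andP[d0 _] dab].
  pose e := gcdn d a.
  have ea : e %| a by exact: dvdn_gcdr.
  have e0 : (0 < e)%N by rewrite gcdn_gt0 d0.
  have fb : (d %/ e)%N %| b.
    have := dab; rewrite -{1}(divnK (dvdn_gcdl d a)) -/e -{1}(divnK ea) -mulnA [(e * b)%N]mulnC mulnA.
    rewrite dvdn_pmul2r // Gauss_dvdr // /coprime -(eqn_pmul2r e0) mul1n muln_gcdl.
    by rewrite !divnK // dvdn_gcdl.
  have f0 : (0 < d %/ e)%N by rewrite divn_gt0 // dvdn_leq // dvdn_gcdl.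
  rewrite big_mkcond (bigD1_seq e) ?mem_index_iota ?iota_uniq //=; last by rewrite e0 ltnS dvdn_leq.
  rewrite ea big_mkcond (bigD1_seq (d %/ e)%N) ?mem_index_iota ?iota_uniq //=; last by rewrite f0 ltnS dvdn_leq.
  rewrite fb mulnC divnK ?dvdn_gcdl // eqxx -addrA lerDl addr_ge0 //.
    by apply: sumr_ge0 => i _; do 2?case: ifP.
  by apply: sumr_ge0 => i _; case: ifP => // _; apply: sumr_ge0 => j _; case: ifP.
rewrite (exchange_big_dep_nat (fun e => e %| a)) //=.
rewrite /dsum mulr_suml big_nat_cond [leRHS]big_nat_cond; apply: ler_sum => e /andP[/andP[e0 _] ea].
rewrite (exchange_big_dep_nat (fun j => j %| b)) //= mulr_sumr big_nat_cond [leRHS]big_nat_cond.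
apply: ler_sum => f /andP[/andP[f0 _] fb].
apply: le_trans (gM _ _ e0 f0).
have ef : (e * f)%N %| (a * b)%N by exact: dvdn_mul.
have efb : (e * f)%N \in index_iota 1 (a * b).+1.
  by rewrite mem_index_iota muln_gt0 e0 f0 ltnS dvdn_leq.
rewrite big_mkcond (bigD1_seq _ efb) ?iota_uniq //= eqxx ef ea fb /= big1 ?addr0 // => i h.
by rewrite eq_sym (negPf h); case: ifP.
Qed.

Lemma submult1 : submult (fun=> 1).
Proof. by split => [_|_ _ _ _] //; rewrite mulr1. Qed.

Definition tau := dsum (fun=> 1).
Definition tau3 := dsum tau.

Lemma tau_submult : submult tau. Proof. exact: submult_dsum submult1. Qed.
Lemma tau3_submult : submult tau3. Proof. exact: submult_dsum tau_submult. Qed.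

(** Write [n = d * k] with [d] the divisor carrying [g], and split [f] over the
    two factors.  Iterating this gives all mean values of divisor functions below
    as powers of a harmonic sum. *)
Lemma sum_submult_dsum f g x : submult f -> (forall n, 0 <= g n) ->
  \sum_(1 <= n < x.+1) f n * dsum g n <=
  \sum_(1 <= d < x.+1) f d * g d * \sum_(1 <= k < (x %/ d).+1) f k.
Proof.
move=> [f0 fM] g0.
have -> : \sum_(1 <= n < x.+1) f n * dsum g n =
   \sum_(1 <= d < x.+1) \sum_(1 <= k < (x %/ d).+1) f (d * k)%N * g d.
  rewrite -(sum_divisors_swap (fun d k => f (d * k)%N * g d)).
  apply: eq_bigr => n _; rewrite mulr_sumr; apply: eq_bigr => d dn.
  by rewrite mulnC divnK.
rewrite big_nat [leRHS]big_nat; apply: ler_sum => d /andP[d0 _].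
rewrite mulr_sumr big_nat [leRHS]big_nat; apply: ler_sum => k /andP[k0 _].
have := fM _ _ d0 k0; have := g0 d; have := f0 (d * k)%N; nra.
Qed.

Lemma sum_submult_dsum_div f g x : submult f -> (forall n, 0 <= g n) ->
  \sum_(1 <= n < x.+1) f n * dsum g n / n%:R <=
  (\sum_(1 <= d < x.+1) f d * g d / d%:R) * \sum_(1 <= k < x.+1) f k / k%:R.
Proof.
move=> [f0 fM] g0.
apply: (@le_trans _ _ (\sum_(1 <= d < x.+1) f d * g d / d%:R * \sum_(1 <= k < (x %/ d).+1) f k / k%:R)).
  have h : submult (fun n => f n / n%:R).
    split=> [n|a b a0 b0]; first by rewrite divr_ge0.
    have -> : f a / a%:R * (f b / b%:R) = f a * f b / (a * b)%:R.
      by rewrite natrM invfM mulrACA.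
    by rewrite ler_wpM2r ?invr_ge0 // fM.
  have h2 := sum_submult_dsum x h g0.
  apply: le_trans (le_trans _ h2) _; rewrite le_eqVlt; apply/orP; left; apply/eqP;
    by apply: eq_bigr => n _; rewrite [f _ * _ / _]mulrAC.
rewrite mulr_suml big_nat [leRHS]big_nat; apply: ler_sum => d /andP[d0 _].
apply: ler_wpM2l; first by rewrite divr_ge0 // mulr_ge0.
rewrite [leRHS](big_cat_nat _ (_ : ((x %/ d).+1 <= x.+1)%N)) ?ltnS ?leq_div //=.
by rewrite lerDl sumr_ge0 // => i _; rewrite divr_ge0.
Qed.

Definition harmonic_sum x : R := \sum_(1 <= k < x.+1) (k%:R)^-1.
Lemma harmonic_sum_ge0 x : 0 <= harmonic_sum x. Proof. by apply: sumr_ge0 => i _; rewrite invr_ge0. Qed.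
Lemma harmonic_sum_mono x y : (x <= y)%N -> harmonic_sum x <= harmonic_sum y.
Proof.
move=> xy; rewrite /harmonic_sum [leRHS](big_cat_nat _ (_ : (x.+1 <= y.+1)%N)) //=.
by rewrite lerDl sumr_ge0.
Qed.

Lemma sum_tau_div x : \sum_(1 <= n < x.+1) tau n / n%:R <= harmonic_sum x ^+ 2.
Proof.
have := sum_submult_dsum_div x submult1 (fun _ => ler01).
under eq_bigr do rewrite mul1r; under [X in _ <= X * _]eq_bigr do rewrite mulr1 div1r.
by under [X in _ <= _ * X]eq_bigr do rewrite div1r; rewrite expr2.
Qed.

Lemma sum_tau3_div x : \sum_(1 <= n < x.+1) tau3 n / n%:R <= harmonic_sum x ^+ 3.
Proof.
have := sum_submult_dsum_div x submult1 (proj1 tau_submult).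
under eq_bigr do rewrite mul1r; under [X in _ <= X * _]eq_bigr do rewrite mul1r.
under [X in _ <= _ * X]eq_bigr do rewrite div1r; move=> h; apply: le_trans h _.
by rewrite exprSr; apply: ler_wpM2r (sum_tau_div x); exact: harmonic_sum_ge0.
Qed.

Lemma sum_dsum g x : (forall n, 0 <= g n) ->
  \sum_(1 <= n < x.+1) dsum g n <= x%:R * \sum_(1 <= d < x.+1) g d / d%:R.
Proof.
move=> g0; have := sum_submult_dsum x submult1 g0.
under eq_bigr do rewrite mul1r; move=> h; apply: le_trans h _.
rewrite mulr_sumr big_nat [leRHS]big_nat; apply: ler_sum => d /andP[d0 _].
rewrite mul1r sumr_const_nat subn1 /= [leRHS]mulrCA; apply: ler_wpM2l => //.
by rewrite ler_pdivlMr ?ltr0n // -natrM ler_nat leq_trunc_div.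
Qed.

Lemma sum_tau x : \sum_(1 <= n < x.+1) tau n <= x%:R * harmonic_sum x.
Proof. by have := @sum_dsum (fun=> 1) x (fun _ => ler01); under [X in _ <= _ * X]eq_bigr do rewrite div1r. Qed.

Lemma sum_tau3 x : \sum_(1 <= n < x.+1) tau3 n <= x%:R * harmonic_sum x ^+ 2.
Proof.
by apply: le_trans (sum_dsum x (proj1 tau_submult)) _; rewrite ler_wpM2l // sum_tau_div.
Qed.

Lemma sum_tau_sq x : \sum_(1 <= n < x.+1) tau n ^+ 2 <= x%:R * harmonic_sum x ^+ 3.
Proof.
have := sum_submult_dsum x tau_submult (fun _ => ler01).
under eq_bigr do rewrite -expr2; move=> h; apply: le_trans h _.
rewrite exprSr mulrA; apply: (@le_trans _ _ (\sum_(1 <= d < x.+1) tau d / d%:R * (x%:R * harmonic_sum x))); last first.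
  by rewrite -mulr_suml [leRHS]mulrAC [leRHS]mulrC ler_wpM2r ?mulr_ge0 ?harmonic_sum_ge0 // sum_tau_div.
rewrite big_nat [leRHS]big_nat; apply: ler_sum => d /andP[d0 _].
rewrite mulr1 -mulrA ler_wpM2l //; first exact: (proj1 tau_submult).
apply: le_trans (sum_tau _) _; rewrite mulrA ler_pM ?harmonic_sum_ge0 ?harmonic_sum_mono ?leq_div //.
by rewrite mulrC ler_pdivlMr ?ltr0n // -natrM ler_nat leq_trunc_div.
Qed.

Lemma sum_tau3_sq x : \sum_(1 <= n < x.+1) tau3 n ^+ 2 <= x%:R * harmonic_sum x ^+ 8.
Proof.
have t30 := proj1 tau3_submult; have t0 := proj1 tau_submult.
have := sum_submult_dsum x tau3_submult t0.
under eq_bigr do rewrite -expr2; move=> h; apply: le_trans h _.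
apply: (@le_trans _ _ (\sum_(1 <= d < x.+1) tau3 d * tau d / d%:R * (x%:R * harmonic_sum x ^+ 2))).
  rewrite big_nat [leRHS]big_nat; apply: ler_sum => d /andP[d0 _].
  rewrite -[leRHS]mulrA ler_wpM2l ?mulr_ge0 //.
  apply: le_trans (sum_tau3 _) _; rewrite mulrA ler_pM ?exprn_ge0 ?harmonic_sum_ge0 //.
    by rewrite mulrC ler_pdivlMr ?ltr0n // -natrM ler_nat leq_trunc_div.
  by rewrite lerXn2r ?nnegrE ?harmonic_sum_ge0 ?harmonic_sum_mono ?leq_div.
rewrite -mulr_suml mulrC -mulrA ler_wpM2l // (exprD _ 2 6) ler_wpM2l ?exprn_ge0 ?harmonic_sum_ge0 //.
have h := sum_submult_dsum_div x tau3_submult (fun _ => ler01).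
apply: le_trans h _; under [X in X * _]eq_bigr do rewrite mulr1.
rewrite (exprD _ 3 3); have := sum_tau3_div x => h.
by apply: ler_pM => //; apply: sumr_ge0 => i _; rewrite divr_ge0.
Qed.

Lemma tau_prime_pow p a : prime p -> tau (p ^ a) <= a.+1%:R.
Proof.
move=> pp; apply: (@le_trans _ _ (\sum_(1 <= d < (p ^ a).+1 | d %| p ^ a)
    \sum_(0 <= i < a.+1) ((p ^ i)%N == d)%:R)).
  apply: ler_sum => d /(dvdn_pfactor _ _ pp)[i ia ->].
  rewrite (bigD1_seq i) ?mem_index_iota ?iota_uniq //= eqxx lerDl.
  by apply: sumr_ge0.
rewrite (exchange_big_dep_nat xpredT) //=.
apply: (@le_trans _ _ (\sum_(0 <= i < a.+1) 1)); last by rewrite sumr_const_nat subn0.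
rewrite big_nat [leRHS]big_nat; apply: ler_sum => i /andP[_ ia].
have ib : (p ^ i)%N \in index_iota 1 (p ^ a).+1.
  by rewrite mem_index_iota expn_gt0 prime_gt0 //= ltnS leq_exp2l // prime_gt1.
rewrite big_mkcond (bigD1_seq _ ib) ?iota_uniq //= eqxx big1 ?addr0; first by case: ifP.
by move=> j h; rewrite eq_sym (negPf h); case: ifP.
Qed.

(** Submultiplicativity reduces the bound to prime powers.  Primes [p] with
    [p ^ eps >= 2] satisfy [tau p <= p ^ eps] and cost nothing; the finitely many
    smaller ones cost a constant factor each. *)
Lemma tau_le_pow (eps : R) : 0 < eps -> exists2 K : R, 0 < K &
  forall n, (0 < n)%N -> tau n <= K * n%:R `^ eps.
Proof.
move=> e0; have t0 := proj1 tau_submult; have tM := proj2 tau_submult.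
have l2 : 0 < ln 2 :> R by rewrite ln_gt0 // ltr1n.
pose c : R := 1 + (eps * ln 2)^-1.
have c0 : 0 < c by rewrite addr_gt0 // invr_gt0 mulr_gt0.
(* Numbers composed of primes below [B], one prime at a time. *)
have smooth B : exists2 K : R, 0 < K & forall n, (0 < n)%N ->
    (forall p, p \in primes n -> (p < B)%N) -> tau n <= K * n%:R `^ eps.
  elim: B => [|B [K K0 IH]].
    exists 1 => // n n0 h; have -> : n = 1%N.
      apply/eqP; rewrite -[_ == _]negbK; apply/negP => n1.
      have n2 : (1 < n)%N by rewrite ltn_neqAle eq_sym n1.
      by have := h (pdiv n); rewrite mem_primes pdiv_prime // n0 pdiv_dvd => /(_ isT).
    by rewrite /tau /dsum big_mkcond big_nat1 /= powR1 mulr1.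
  have [pB|pB] := boolP (prime B); last first.
    exists K => // n n0 h; apply: IH => // p pn; have := h _ pn.
    rewrite ltnS leq_eqVlt => /orP[/eqP pE|//].
    by move: pn; rewrite mem_primes pE (negPf pB).
  exists (c * K) => [|n n0 h]; first by rewrite mulr_gt0.
  pose a := logn B n; pose m := (n`_(B^'))%N.
  have nE : n = (B ^ a * m)%N by rewrite /m -p_part partnC.
  have m0 : (0 < m)%N by exact: part_gt0.
  have B0 : (0 < B ^ a)%N by rewrite expn_gt0 prime_gt0.
  have hm : tau m <= K * m%:R `^ eps.
    apply: IH => // p; rewrite primes_part mem_filter => /andP[pB' pn].
    have := h _ pn; rewrite ltnS leq_eqVlt => /orP[/eqP pE|//].
    by move: pB'; rewrite pE !inE /= eqxx.
  have ha : tau (B ^ a) <= c * (B ^ a)%N%:R `^ eps.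
    apply: le_trans (tau_prime_pow _ pB) _.
    have : (2 ^ a)%N%:R `^ eps <= (B ^ a)%N%:R `^ eps :> R.
      apply: ge0_ler_powR; [exact: ltW|by rewrite nnegrE|by rewrite nnegrE|].
      have [->//|a0] := posnP a; by rewrite ler_nat leq_exp2r // prime_gt1.
    move=> h2; apply: le_trans (ler_wpM2l (ltW c0) h2).
    rewrite natrX -powR_mulrn // -powRrM /powR gt_eqF //.
    have := expR_ge1Dx (a%:R * eps * ln 2) => h3.
    apply: le_trans (ler_wpM2l (ltW c0) h3).
    have k0 : 0 < eps * ln 2 by rewrite mulr_gt0.
    have ci : (eps * ln 2)^-1 * (a%:R * eps * ln 2) = a%:R.
      by rewrite -mulrA mulrC -mulrA divff ?mulr1 // gt_eqF.
    rewrite -natr1 /c mulrDr mulr1 mulrDl ci mul1r.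
    have := ler0n R a; have : 0 < (eps * ln 2)^-1 by rewrite invr_gt0.
    have : 0 <= a%:R * eps * ln 2 by rewrite !mulr_ge0 // ltW.
    lra.
  rewrite nE natrM powRM //; apply: le_trans (tM _ _ B0 m0) _.
  rewrite [leRHS]mulrACA; exact: ler_pM.
have [B hB] : exists B : nat, forall p, (B <= p)%N -> 2 <= p%:R `^ eps :> R.
  exists (Num.truncn (2 `^ eps^-1 : R)).+1 => p hp.
  have h1 : 2 `^ eps^-1 <= p%:R :> R.
    by apply: ltW; apply: lt_le_trans (truncnS_gt _) _; rewrite ler_nat.
  have := ge0_ler_powR (ltW e0) _ _ h1; rewrite -powRrM mulVf ?gt_eqF // powRr1 //.
  by apply; rewrite nnegrE // powR_ge0.
(* Numbers without prime factor below [B]. *)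
have rough m : (0 < m)%N -> (forall p, p \in primes m -> (B <= p)%N) -> tau m <= m%:R `^ eps.
  elim/ltn_ind: m => m IH m0 h.
  have [->|m1] := eqVneq m 1%N.
    by rewrite /tau /dsum big_mkcond big_nat1 /= powR1.
  have m2 : (1 < m)%N by rewrite ltn_neqAle eq_sym m1.
  pose p := pdiv m; have pp : prime p by exact: pdiv_prime.
  have pn : p %| m by exact: pdiv_dvd.
  have [k mE] : exists k, m = (p * k)%N by case/dvdnP: pn => k ->; exists k; rewrite mulnC.
  have k0 : (0 < k)%N by move: m0; rewrite mE; case: (k) => //; rewrite muln0.
  have km : (k < m)%N by rewrite mE ltn_Pmull // prime_gt1.
  have hk : tau k <= k%:R `^ eps.
    apply: IH => // r rk; apply: h; move: rk; rewrite !mem_primes => /and3P[-> _ rk].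
    by rewrite m0 /= mE dvdn_mull.
  rewrite mE; apply: le_trans (tM _ _ (prime_gt0 pp) k0) _.
  rewrite natrM powRM //; apply: ler_pM => //.
  apply: le_trans (hB p _); first by have := tau_prime_pow 1 pp; rewrite expn1.
  by apply: h; rewrite mem_primes pp m0.
have [K K0 hK] := smooth B.
exists K => // n n0.
pose pi : nat_pred := [pred p | (p < B)%N].
have nE : n = (n`_pi * n`_pi^')%N by rewrite partnC.
rewrite {1}nE; apply: le_trans (tM _ _ (part_gt0 _ _) (part_gt0 _ _)) _.
have nR : n%:R = (n`_pi)%N%:R * (n`_pi^')%N%:R :> R by rewrite -natrM -nE.
rewrite nR.
rewrite powRM // mulrA; apply: ler_pM => //.
  by apply: hK (part_gt0 _ _) _ => p; rewrite primes_part mem_filter => /andP[].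
apply: rough (part_gt0 _ _) _ => p; rewrite primes_part mem_filter => /andP[].
by rewrite !inE /= -leqNgt.
Qed.

End Arithmetic.

Local Notation RtoC := (real_complex _).

(** * Bilinear exponential sums *)

Section Bilinear.
Context {R : realType}.
Local Notation C := R[i].
Implicit Types (th : R) (z b : nat -> C).

Lemma conjcM (z w : C) : conjc (z * w) = conjc z * conjc w.
Proof. exact: rmorphM. Qed.

Lemma cexp_orthogonality (J i j : nat) : (i < J)%N -> (j < J)%N ->
  \sum_(0 <= t < J) cexp (t%:R * (j%:R - i%:R) / J%:R : R) = if i == j then J%:R else 0.
Proof.
move=> iJ jJ; have J0 : (0 < J)%N by apply: leq_trans iJ.
have J0' : J%:R != 0 :> R by rewrite pnatr_eq0 -lt0n.
case: eqP => [->|/eqP ij].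
  under eq_bigr do rewrite subrr mulr0 mul0r cexp0.
  by rewrite sumr_const_nat subn0.
have dpos i' j' : (i' < j')%N -> (j' < J)%N -> 0 < dist_int ((j'%:R - i'%:R) / J%:R : R).
  move=> h jJ'; rewrite -natrB ?(ltnW h) // dist_int_ratio //; last by lia.
  by rewrite divr_gt0 ?ltr0n // leq_min; lia.
set x : R := (j%:R - i%:R) / J%:R.
have xJ : cexp (x * J%:R) = 1.
  rewrite /x mulfVK // -(intrB R j i) //; exact: cexp_int.
have x1 : 1 - cexp x != 0.
  rewrite -cabs_eq0 gt_eqF //; apply: lt_le_trans (cexp_dist x).
  rewrite mulr_gt0 // /x; case: (ltngtP i j) ij => // h _; first exact: dpos.
  by rewrite -dist_intN -mulNr opprB; exact: dpos.
apply: (mulfI x1); rewrite mulr0.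
have -> : \sum_(0 <= t < J) cexp (t%:R * (j%:R - i%:R) / J%:R) = \sum_(t < J) cexp x ^+ t.
  by rewrite big_mkord; apply: eq_bigr => t _; rewrite -cexpMn /x; congr cexp; ring.
by rewrite -opprB mulNr -subrX1 -cexpMn xJ subrr oppr0.
Qed.

(** An upper bound for the Fourier coefficients modulo [J] of an interval starting
    at zero, normalised by [J]. *)
Definition completion_weight (J t : nat) : R :=
  if t == 0%N then 1 else (t%:R)^-1 + ((J - t)%:R)^-1.

Lemma completion_weight_ge0 J t : 0 <= completion_weight J t.
Proof. by rewrite /completion_weight; case: ifP => // _; rewrite addr_ge0. Qed.

Lemma sum_completion_weight J : \sum_(0 <= t < J) completion_weight J t <= 1 + 2 * harmonic_sum J :> R.
Proof.
case: J => [|J]; first by rewrite big_geq // addr_ge0 // mulr_ge0 // harmonic_sum_ge0.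
rewrite big_ltn //= lerD2l; rewrite big_add1 /=.
rewrite (eq_bigr (fun t => (t.+1%:R)^-1 + ((J - t)%:R)^-1)) //.
rewrite big_split /= mulr2n mulrDl mul1r; apply: lerD.
  by rewrite /harmonic_sum big_add1 /= [leRHS]big_nat_recr //= lerDl.
rewrite /harmonic_sum big_add1 /= !big_mkord (reindex_inj rev_ord_inj) /= big_ord_recr /=.
apply: le_trans (_ : \sum_(i < J) (i.+1%:R)^-1 <= _); last by rewrite lerDl.
by apply: ler_sum => i _; have -> : (J - (J - i.+1) = i.+1)%N by have := ltn_ord i; lia.
Qed.

(** The indicator of [j < J'] is expanded in characters modulo [J]; its coefficients
    are geometric sums.  That the weights do not depend on [J'] allows the cut to
    vary with another variable, as in the hyperbola region [m * k <= x]. *)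
Lemma completion z (J J' : nat) : (J' <= J)%N ->
  cabs (\sum_(0 <= j < J') z j) <=
  \sum_(0 <= t < J) completion_weight J t * cabs (\sum_(0 <= j < J) z j * cexp (t%:R * j%:R / J%:R : R)).
Proof.
move=> JJ; have [J0|J0] := posnP J.
  by rewrite J0 !big_geq ?cabs0 //; lia.
have J0' : 0 < J%:R :> R by rewrite ltr0n.
pose D t := \sum_(0 <= i < J') cexp (- (t%:R / J%:R) * i%:R + 0 : R).
pose Z t := \sum_(0 <= j < J) z j * cexp (t%:R * j%:R / J%:R : R).
have e : J%:R * \sum_(0 <= j < J') z j = \sum_(0 <= t < J) D t * Z t.
  transitivity (\sum_(0 <= i < J') \sum_(0 <= j < J) z j * (if i == j then J%:R else 0)).
    rewrite mulr_sumr; apply: eq_big_nat => i /andP[_ iJ].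
    rewrite (bigD1_seq i) ?mem_index_iota ?iota_uniq //=; last by lia.
    rewrite eqxx big1 ?addr0 1?mulrC // => j ji.
    by rewrite eq_sym (negPf ji) mulr0.
  transitivity (\sum_(0 <= i < J') \sum_(0 <= j < J) \sum_(0 <= t < J)
       z j * cexp (t%:R * (j%:R - i%:R) / J%:R : R)).
    apply: eq_big_nat => i /andP[_ iJ]; apply: eq_big_nat => j /andP[_ jJ].
    by rewrite -mulr_sumr cexp_orthogonality //; lia.
  under eq_bigr do rewrite exchange_big /=.
  rewrite exchange_big /=; apply: eq_bigr => t _.
  rewrite /D mulr_suml; apply: eq_bigr => i _; rewrite mulr_sumr; apply: eq_bigr => j _.
  rewrite mulrCA -cexpD; congr (_ * cexp _); field; exact: lt0r_neq0.
have -> : \sum_(0 <= j < J') z j = RtoC (J%:R^-1) * \sum_(0 <= t < J) D t * Z t.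
  rewrite -e mulrA -(rmorph_nat (real_complex R)) -rmorphM mulVf ?gt_eqF //.
  by rewrite rmorph1 mul1r.
rewrite cabsM cabs_real ger0_norm; last by rewrite invr_ge0 ltW.
apply: le_trans (ler_wpM2l _ (cabs_sum _ _ _)) _; first by rewrite invr_ge0 ltW.
rewrite mulr_sumr; apply: ler_sum_nat => t /andP[_ tJ].
rewrite cabsM mulrA; apply: ler_wpM2r; first exact: cabs_ge0.
rewrite /completion_weight; case: eqP => [t0|/eqP t0].
  rewrite mulrC ler_pdivrMr // mul1r.
  have h : cabs (D t) <= (size (index_iota 0 J'))%:R.
    by apply: cabs_sum_le_card => i _; rewrite cabs_cexp.
  by apply: le_trans h _; rewrite size_iota subn0 ler_nat.
have := geometric_cexp (- (t%:R / J%:R) : R) 0 J'; rewrite -/(D t) dist_intN.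
rewrite dist_int_ratio ?(ltnW tJ) // mulrA ler_pdivrMr // mul1r => h.
have tm : (0 < minn t (J - t))%N by rewrite leq_min subn_gt0 tJ lt0n t0.
rewrite mulrC ler_pdivrMr //.
apply: (@le_trans _ _ ((minn t (J - t))%:R^-1 * J%:R)).
  by rewrite mulrC ler_pdivlMr ?ltr0n.
apply: ler_wpM2r; first exact: ltW.
by rewrite /minn; case: ifP => _; rewrite ?lerDl ?lerDr.
Qed.

(** Large sieve inequality for the points [th * j].  Opening the square leaves
    geometric sums over [r] of frequencies [th * (j1 - j2)], whose sum over [j2] is
    controlled by [min_sum]; the cross terms are symmetrised by
    [2 |b1 b2| <= |b1| ^ 2 + |b2| ^ 2]. *)
Lemma quadratic_form_le th (a : int) (q Rn J : nat) b :
  (0 < q)%N -> coprimez a q -> `|th - a%:~R / q%:R| <= 1 / q%:R ^+ 2 ->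
  \sum_(0 <= r < Rn) cabs (\sum_(0 <= j < J) b j * cexp (th * j%:R * r%:R)) ^+ 2 <=
  (\sum_(0 <= j < J) cabs (b j) ^+ 2) *
  ((J%:R / q%:R + 1) * (5 * Rn%:R + 6 * q%:R * (1 + ln q%:R))).
Proof.
move=> q0 co tha; set W := (X in _ <= _ * X).
pose D j1 j2 := \sum_(0 <= r < Rn) cexp (th * (j1%:R - j2%:R) * r%:R + 0).
have DW j1 : \sum_(0 <= j2 < J) cabs (D j1 j2) <= W.
  apply: (@min_sum _ th (- (th * j1%:R)) Rn%:R a) => // j _.
  have h : cabs (D j1 j) <= (size (index_iota 0 Rn))%:R.
    by apply: cabs_sum_le_card => i _; rewrite cabs_cexp.
  move: h; rewrite size_iota subn0 => h; rewrite cabs_ge0 h; split=> //.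
  have := geometric_cexp (th * (j1%:R - j%:R)) 0 Rn; rewrite -/(D j1 j).
  by rewrite -dist_intN (_ : - _ = th * j%:R - th * j1%:R) //; ring.
have Dsym j1 j2 : cabs (D j1 j2) = cabs (D j2 j1).
  rewrite -cabs_conj; congr cabs; rewrite rmorph_sum /=; apply: eq_bigr => r _.
  by rewrite -[LHS]cexpN; congr cexp; ring.
have e : RtoC (\sum_(0 <= r < Rn) cabs (\sum_(0 <= j < J) b j * cexp (th * j%:R * r%:R)) ^+ 2) =
   \sum_(0 <= j1 < J) \sum_(0 <= j2 < J) b j1 * conjc (b j2) * D j1 j2.
  rewrite rmorph_sum /=.
  transitivity (\sum_(0 <= r < Rn) \sum_(0 <= j1 < J) \sum_(0 <= j2 < J)
      b j1 * conjc (b j2) * cexp (th * (j1%:R - j2%:R) * r%:R + 0)).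
    apply: eq_bigr => r _; rewrite cabs_sqr rmorph_sum /= mulr_suml.
    apply: eq_bigr => j1 _; rewrite mulr_sumr; apply: eq_bigr => j2 _.
    rewrite conjcM mulrACA -cexpN -cexpD; congr (_ * cexp _); ring.
  rewrite exchange_big /=; apply: eq_bigr => j1 _.
  rewrite exchange_big /=; apply: eq_bigr => j2 _.
  by rewrite -mulr_sumr.
apply: (@le_trans _ _ (\sum_(0 <= j1 < J) \sum_(0 <= j2 < J) cabs (b j1) * cabs (b j2) * cabs (D j1 j2))).
  apply: le_trans (ler_norm _) _; rewrite -cabs_real e.
  apply: le_trans (cabs_sum _ _ _) _; apply: ler_sum => j1 _.
  apply: le_trans (cabs_sum _ _ _) _; apply: ler_sum => j2 _.
  by rewrite !cabsM cabs_conj.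
apply: (@le_trans _ _ (\sum_(0 <= j1 < J) \sum_(0 <= j2 < J)
   (cabs (b j1) ^+ 2 / 2 * cabs (D j1 j2) + cabs (b j2) ^+ 2 / 2 * cabs (D j2 j1)))).
  apply: ler_sum => j1 _; apply: ler_sum => j2 _.
  rewrite (Dsym j2 j1) -mulrDl; apply: ler_wpM2r; first exact: cabs_ge0.
  by have := sqr_ge0 (cabs (b j1) - cabs (b j2)); rewrite sqrrB; lra.
under eq_bigr do rewrite big_split /=; rewrite big_split /=.
rewrite [X in _ + X]exchange_big /= -big_split mulr_suml.
apply: ler_sum => j1 _; rewrite /= -mulr_sumr -mulrDl -splitr.
by apply: ler_wpM2l (DW j1); exact: sqr_ge0.
Qed.

Lemma cauchy_schwarz_sum (I : Type) (r : seq I) (x y : I -> R) :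
  (forall i, 0 <= x i) -> (forall i, 0 <= y i) ->
  \sum_(i <- r) x i * y i <= Num.sqrt ((\sum_(i <- r) x i ^+ 2) * (\sum_(i <- r) y i ^+ 2)).
Proof.
move=> x0 y0; set S := \sum_(i <- r) _ * _; set X := \sum_(i <- r) _ ^+ 2.
set Y := \sum_(i <- r) y i ^+ 2.
have S0 : 0 <= S by apply: sumr_ge0 => i _; rewrite mulr_ge0.
have X0 : 0 <= X by apply: sumr_ge0 => i _; rewrite sqr_ge0.
have Y0 : 0 <= Y by apply: sumr_ge0 => i _; rewrite sqr_ge0.
rewrite -[S]ger0_norm // -sqrtr_sqr; apply: ler_wsqrtr.
have h (t : R) : 0 <= X * t ^+ 2 - 2 * S * t + Y.
  have -> : X * t ^+ 2 - 2 * S * t + Y = \sum_(i <- r) (x i * t - y i) ^+ 2.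
    rewrite /X /S /Y mulrAC mulr_suml mulr_sumr -sumrB -big_split /=.
    by apply: eq_bigr => i _; ring.
  by apply: sumr_ge0 => i _; exact: sqr_ge0.
have [X00|Xn0] := eqVneq X 0.
  have := h ((Y + 1) / (2 * S)); rewrite X00 !mul0r.
  have [->|Sn0] := eqVneq S 0; first by rewrite expr0n.
  rewrite sub0r mulrA mulrC mulrA mulVf ?mulf_neq0 ?pnatr_eq0 // mul1r; lra.
have := h (S / X); have Xp : 0 < X by rewrite lt_def Xn0.
have -> : X * (S / X) ^+ 2 - 2 * S * (S / X) + Y = (X * Y - S ^+ 2) / X by field.
by rewrite pmulr_lge0 ?invr_gt0 // subr_ge0.
Qed.

(** Collecting the products [h * m = r]: the frequency [h] joins the variable [m],
    which is what makes an average over frequencies better than a single one. *)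
Lemma sum_products_le (G M0 M1 : nat) (P : pred nat) (am Bf : nat -> R) :
  (0 < M0)%N -> (forall m, 0 <= am m) -> (forall r, 0 <= Bf r) ->
  \sum_(1 <= h < G.+1) \sum_(M0 <= m < M1 | P m) am m * Bf (h * m)%N <=
  \sum_(1 <= r < (G * M1).+1) dsum am r * Bf r.
Proof.
move=> M00 am0 Bf0.
rewrite /dsum.
under [leRHS]eq_bigr do rewrite mulr_suml.
apply: (@le_trans _ _ (\sum_(1 <= h < G.+1) \sum_(M0 <= m < M1)
   \sum_(1 <= r < (G * M1).+1) (if (h * m)%N == r then am m * Bf r else 0))).
  rewrite big_nat [leRHS]big_nat; apply: ler_sum => h /andP[h0 hG].
  rewrite big_mkcond big_nat [leRHS]big_nat; apply: ler_sum => m /andP[mM0 mM].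
  have hm : (h * m)%N \in index_iota 1 (G * M1).+1.
    rewrite mem_index_iota muln_gt0 h0 (leq_trans M00) //= ltnS.
    by rewrite leq_mul // ltnW.
  rewrite (bigD1_seq _ hm) ?iota_uniq //= eqxx.
  case: ifP => _; rewrite ?lerDl ?addr_ge0 ?mulr_ge0 ?Bf0 //;
    by apply: sumr_ge0 => i _; case: ifP => // _; rewrite mulr_ge0 ?Bf0.
under [leLHS]eq_bigr do rewrite exchange_big /=.
rewrite [leLHS]exchange_big /=.
rewrite big_nat [leRHS]big_nat; apply: ler_sum => r /andP[r0 _].
rewrite exchange_big /=.
apply: (@le_trans _ _ (\sum_(M0 <= m < M1) if m %| r then am m * Bf r else 0)).
  rewrite big_nat [leRHS]big_nat; apply: ler_sum => m /andP[mM0 _].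
  have m0 : (0 < m)%N by exact: leq_trans mM0.
  case: ifPn => mr; last first.
    rewrite big1 // => h _; case: eqP => // e; case/negP: mr.
    by rewrite -e dvdn_mull.
  have [hG|hG] := leqP (r %/ m) G; last first.
    rewrite big_nat big1 ?mulr_ge0 ?Bf0 // => h /andP[_ hG'].
    case: eqP => // e; move: hG; rewrite -e mulnK //; lia.
  rewrite (bigD1_seq (r %/ m)%N) ?mem_index_iota ?iota_uniq //=; last first.
    by rewrite divn_gt0 // ltnS hG dvdn_leq.
  rewrite divnK // eqxx big1 ?addr0 // => h hr; case: eqP => // e.
  by move: hr; rewrite -e mulnK // eqxx.
rewrite -big_mkcond.
have vanish m : (r < m)%N -> (m %| r) = false.
  by move=> rm; apply/negbTE/negP => /(dvdn_leq r0); lia.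
rewrite [leRHS]big_mkcond.
rewrite big_mkcond.
have F0 m : 0 <= (if m %| r then am m * Bf r else 0).
  by case: ifP => // _; rewrite mulr_ge0 ?Bf0.
apply: (@le_trans _ _ (\sum_(1 <= m < maxn M1 r.+1) if m %| r then am m * Bf r else 0)).
  have [MM|MM] := leqP M1 M0; first by rewrite big_geq // sumr_ge0.
  rewrite [leRHS](big_cat_nat M00 (leq_trans (ltnW MM) (leq_maxl _ _))) /=.
  rewrite [X in _ <= _ + X](big_cat_nat (ltnW MM) (leq_maxl _ _)) /=.
  by rewrite addrCA lerDl addr_ge0 ?sumr_ge0.
rewrite (big_cat_nat (_ : (1 <= r.+1)%N) (leq_maxr _ _)) //= [X in _ + X]big_nat.
rewrite [X in _ + X]big1 ?addr0 // => m /andP[h _].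
by rewrite vanish.
Qed.

(** Completion frees the range of [j] from [m]; then [r = h * m] is collected, and
    Cauchy-Schwarz separates the coefficients of [r], a divisor sum, from the
    quadratic form of [quadratic_form_le]. *)
Lemma bilinear_le th (a : int) (q G M0 M1 J : nat) (P : pred nat) (am : nat -> R) b (cut : nat -> nat) :
  (0 < q)%N -> coprimez a q -> `|th - a%:~R / q%:R| <= 1 / q%:R ^+ 2 ->
  (0 < M0)%N -> (forall m, 0 <= am m) -> (forall m, (M0 <= m < M1)%N -> (cut m <= J)%N) ->
  \sum_(1 <= h < G.+1) \sum_(M0 <= m < M1 | P m)
     am m * cabs (\sum_(0 <= j < cut m) b j * cexp (th * j%:R * (h * m)%:R)) <=
  (1 + 2 * harmonic_sum J) * Num.sqrt ((\sum_(1 <= r < (G * M1).+1) dsum am r ^+ 2) *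
    ((\sum_(0 <= j < J) cabs (b j) ^+ 2) *
     ((J%:R / q%:R + 1) * (5 * (G * M1).+1%:R + 6 * q%:R * (1 + ln q%:R))))).
Proof.
move=> q0 co tha M00 am0 cutJ.
set T := Num.sqrt _.
pose bt t j := b j * cexp (t%:R * j%:R / J%:R : R).
pose B t r := cabs (\sum_(0 <= j < J) bt t j * cexp (th * j%:R * r%:R)).
apply: (@le_trans _ _ (\sum_(0 <= t < J) completion_weight J t * T)); last first.
  by rewrite -mulr_suml ler_wpM2r ?sqrtr_ge0 // sum_completion_weight.
apply: (@le_trans _ _ (\sum_(1 <= h < G.+1) \sum_(M0 <= m < M1 | P m)
     \sum_(0 <= t < J) completion_weight J t * (am m * B t (h * m)%N))).
  apply: ler_sum => h _; rewrite big_nat_cond [leRHS]big_nat_cond.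
  apply: ler_sum => m /andP[mM _].
  under [leRHS]eq_bigr do rewrite mulrCA.
  rewrite -mulr_sumr; apply: ler_wpM2l => //.
  apply: le_trans (completion _ (cutJ _ mM)) _; apply: ler_sum => t _.
  apply: ler_wpM2l; first exact: completion_weight_ge0.
  by rewrite le_eqVlt; apply/orP; left; apply/eqP; congr cabs; apply: eq_bigr => j _; rewrite mulrAC.
under eq_bigr do rewrite exchange_big /=.
rewrite exchange_big /=; apply: ler_sum => t _.
under eq_bigr do rewrite -mulr_sumr.
rewrite -mulr_sumr; apply: ler_wpM2l; first exact: completion_weight_ge0.
have Bt0 r : 0 <= B t r by exact: cabs_ge0.
apply: le_trans (sum_products_le G M1 P M00 am0 Bt0) _.
apply: le_trans (cauchy_schwarz_sum _ _ _) _ => [r|r|].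
- exact: dsum_ge0.
- exact: cabs_ge0.
apply: ler_wsqrtr; apply: ler_wpM2l; first by apply: sumr_ge0 => i _; exact: sqr_ge0.
apply: (@le_trans _ _ (\sum_(0 <= r < (G * M1).+1) B t r ^+ 2)).
  by rewrite [leRHS]big_ltn // lerDr sqr_ge0.
apply: le_trans (quadratic_form_le _ _ _ q0 co tha) _.
rewrite le_eqVlt; apply/orP; left; apply/eqP; congr (_ * _).
by apply: eq_bigr => j _; rewrite /bt cabsM cabs_cexp mulr1.
Qed.

End Bilinear.

Section Progressions.
Context {V : zmodType}.

Lemma sum_residue (F : nat -> V) (v k0 Y : nat) : (k0 < v)%N ->
  \sum_(0 <= k < Y.+1 | (k %% v)%N == k0) F k =
  \sum_(0 <= j < (Y + v - k0) %/ v) F (k0 + v * j)%N.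
Proof.
move=> kv; have v0 : (0 < v)%N by apply: leq_trans kv.
elim: Y => [|Y IH].
  rewrite big_mkcond big_nat1 mod0n add0n; case: eqP => [<-|/eqP k00].
    by rewrite subn0 divnn v0 big_nat1 muln0.
  by rewrite divn_small ?big_geq // ltn_subrL v0 lt0n eq_sym k00.
rewrite big_mkcond big_nat_recr //= -big_mkcond IH.
have -> : (Y.+1 + v - k0 = (Y + v - k0).+1)%N by lia.
rewrite divnS //.
have e : (v %| (Y + v - k0).+1) = ((Y.+1 %% v)%N == k0).
  have -> : ((Y + v - k0).+1 = Y.+1 + v - k0)%N by lia.
  rewrite -eqn_mod_dvd; last by lia.
  by rewrite modnDr (modn_small kv).
rewrite e; case: eqP => [h|_]; last by rewrite addr0 add0n.
rewrite add1n big_nat_recr //=; congr (_ + F _).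
have h2 : v %| (Y + v - k0).+1 by rewrite e; apply/eqP.
have := divnK h2; rewrite divnS // h2 add1n; lia.
Qed.

Lemma sum_split_residue (F : nat -> V) (v Y : nat) : (0 < v)%N ->
  \sum_(0 <= k < Y.+1) F k =
  \sum_(0 <= k0 < v) \sum_(0 <= j < (Y + v - k0) %/ v) F (k0 + v * j)%N.
Proof.
move=> v0; transitivity (\sum_(0 <= k0 < v) \sum_(0 <= k < Y.+1 | (k %% v)%N == k0) F k).
  rewrite (exchange_big_dep_nat xpredT) //=; apply: eq_bigr => k _.
  rewrite big_mkcond (bigD1_seq (k %% v)%N) ?mem_index_iota ?iota_uniq ?ltn_pmod //= eqxx.
  by rewrite big1 ?addr0 // => i h; rewrite eq_sym (negPf h).
by apply: eq_big_nat => k0 /andP[_ h]; rewrite sum_residue.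
Qed.

End Progressions.

Section MinSumRecip.
Context {R : realType}.

Lemma harmonic_sum_le n : (0 < n)%N -> harmonic_sum n <= 1 + ln n%:R :> R.
Proof. exact: harmonic_le. Qed.

(** For [r <= q / 2] the distance from [th * r] to the integers is at least
    [1 / (2 * q)], because [a * r / q] is not an integer; so the size bound [Y / r],
    large for small [r], can be replaced there by [2 * q].  Later blocks of length
    [q], on which [Y / r] is about [Y / (n * q)], give a harmonic sum. *)
Lemma min_sum_recip (th : R) (a : int) (q Q : nat) (Y : R) (phi : nat -> R) :
  (0 < q)%N -> coprimez a q -> `|th - a%:~R / q%:R| <= 1 / q%:R ^+ 2 -> 0 <= Y ->
  (forall r, (0 < r <= Q)%N -> [/\ 0 <= phi r, phi r * r%:R <= Y & phi r * dist_int (th * r%:R) <= 1]) ->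
  \sum_(1 <= r < Q.+1) phi r <=
  10 * (Y / q%:R) * (1 + ln Q.+1%:R) + (6 * Q%:R + 64 * q%:R) * (1 + ln q%:R).
Proof.
move=> q0 co tha Y0 phiP.
have q0' : 0 < q%:R :> R by rewrite ltr0n.
have lq : 0 <= ln q%:R :> R by rewrite ln_ge0 // ler1n.
pose f r := if (0 < r <= Q)%N then phi r else 0.
have f0 r : 0 <= f r by rewrite /f; case: ifP => // /phiP[].
have fY r : f r * r%:R <= Y by rewrite /f; case: ifP => [/phiP[]//|_]; rewrite mul0r.
have fd r : f r * dist_int (th * r%:R) <= 1.
  by rewrite /f; case: ifP => [/phiP[]//|_]; rewrite mul0r.
pose B := (Q %/ q).+1.
have low : \sum_(0 <= r < (q./2).+1) f r <= 48 * q%:R * (1 + ln q%:R).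
  have h : \sum_(0 <= r < (q./2).+1) f r <=
      ((q./2).+1%:R / q%:R + 1) * (5 * (2 * q%:R) + 6 * q%:R * (1 + ln q%:R)).
    apply: (@min_sum _ th 0 _ a) => // j; rewrite addr0 ltnS => jq; split=> //; rewrite f0 /=.
    have [->|j0] := posnP j; first by rewrite /f /= mulr_ge0.
    have jq2 : (j.*2 <= q)%N by lia.
    have q1 : (1 < q)%N by lia.
    have d1 : 1 / q%:R <= dist_int (a%:~R / q%:R * j%:R : R).
      have aj : (`|((a * j%:Z) %% q%:Z)%Z| < q)%N.
        by rewrite -ltz_nat gez0_abs ?modz_ge0 ?ltz_pmod //; lia.
      set s := `|((a * j%:Z) %% q%:Z)%Z|%N in aj.
      have sE : (a * j%:Z)%:~R / q%:R = s%:R / q%:R + ((a * j%:Z) %/ q%:Z)%Z%:~R :> R.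
        rewrite {1}(divz_eq (a * j%:Z) q%:Z) intrD intrM /=.
        have -> : ((a * j%:Z) %% q%:Z)%Z = s%:Z by rewrite /s gez0_abs ?modz_ge0 //; lia.
        by rewrite -!pmulrn; field; rewrite gt_eqF.
      have -> : a%:~R / q%:R * j%:R = (a * j%:Z)%:~R / q%:R :> R.
        by rewrite intrM -pmulrn mulrAC.
      rewrite sE dist_intDz dist_int_ratio ?(ltnW aj) // ler_pM2r ?invr_gt0 // ler1n.
      rewrite leq_min subn_gt0 aj andbT lt0n; apply/eqP => s0.
      have : (q%:Z %| a * j%:Z)%Z.
        by apply/dvdz_mod0P/eqP; rewrite -absz_eq0 -/s s0.
      rewrite Gauss_dvdzr; last by rewrite coprimez_sym.
      by move=> /dvdn_leq /= => /(_ j0); lia.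
    have d2 : `|th * j%:R - a%:~R / q%:R * j%:R| <= 1 / (2 * q%:R).
      rewrite -mulrBl normrM normr_nat.
      have h1 : j%:R <= q%:R / 2 :> R.
        by rewrite ler_pdivlMr // -natrM ler_nat; lia.
      have := ler_pM (normr_ge0 _) (ler0n _ _) tha h1.
      rewrite (_ : 1 / q%:R ^+ 2 * (q%:R / 2) = 1 / (2 * q%:R)) //.
      by field; rewrite gt_eqF.
    have d3 : 1 / (2 * q%:R) <= dist_int (th * j%:R).
      have := dist_int_lip (a%:~R / q%:R * j%:R) (th * j%:R).
      rewrite ler_norml distrC => /andP[_ h].
      have e : 1 / (2 * q%:R) = 1 / q%:R - 1 / (2 * q%:R) :> R by field; rewrite gt_eqF.
      lra.
    have := fd j => h; have h2 : f j * (1 / (2 * q%:R)) <= 1.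
      by apply: le_trans h; apply: ler_wpM2l.
    by move: h2; rewrite mulrA mulr1 ler_pdivrMr ?mulr_gt0 // mul1r.
  apply: le_trans h _.
  have h1 : (q./2).+1%:R / q%:R + 1 <= 3 :> R.
    suff : (q./2).+1%:R / q%:R <= 2 :> R by lra.
    by rewrite ler_pdivrMr // -natrM ler_nat; lia.
  have h2 : 5 * (2 * q%:R) + 6 * q%:R * (1 + ln q%:R) <= 16 * q%:R * (1 + ln q%:R) :> R by nra.
  have h3 : 0 <= 5 * (2 * q%:R) + 6 * q%:R * (1 + ln q%:R) :> R by nra.
  nra.
have high n : \sum_((q./2).+1 <= r < (q./2).+1 + n * q) f r <=
    10 * (Y / q%:R) * harmonic_sum n + n%:R * (6 * q%:R * (1 + ln q%:R)).
  elim: n => [|n IH]; first by rewrite mul0n addn0 big_geq // /harmonic_sum big_geq // mulr0 mul0r addr0.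
  rewrite (@big_cat_nat _ _ _ ((q./2).+1 + n * q)) ?leq_addr ?leq_add2l ?leq_pmul2r //=.
  rewrite (_ : harmonic_sum n.+1 = harmonic_sum n + (n.+1%:R)^-1); last by rewrite /harmonic_sum big_nat_recr.
  rewrite mulrDr [n.+1%:R * (6 * _ * _)](_ : _ = n%:R * (6 * q%:R * (1 + ln q%:R)) +
    6 * q%:R * (1 + ln q%:R)); last by rewrite -natr1; ring.
  rewrite addrACA; apply: lerD => //.
  rewrite -{1}[(_ + n * q)%N]add0n big_addn mulSn addnCA addnK.
  set s := ((q./2).+1 + n * q)%N.
  have s0 : q%:R * n.+1%:R / 2 <= s%:R :> R.
    by rewrite ler_pdivrMr // -!natrM ler_nat /s; lia.
  have s00 : 0 < s%:R :> R by rewrite ltr0n /s.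
  have h : \sum_(0 <= i < q) f (i + s)%N <= 5 * (Y / s%:R) + 6 * q%:R * (1 + ln q%:R).
    apply: (@min_sum_block _ th (th * s%:R) _ a) => // j jq; split.
      rewrite f0 ler_pdivlMr //=; apply: le_trans (fY (j + s)%N).
      by apply: ler_wpM2l => //; rewrite ler_nat leq_addl.
    by have := fd (j + s)%N; rewrite natrD mulrDr.
  apply: le_trans h _; rewrite lerD2r.
  have -> : 10 * (Y / q%:R) * (n.+1%:R)^-1 = 5 * (Y / (q%:R * n.+1%:R / 2)) :> R.
    have : n.+1%:R != 0 :> R by rewrite pnatr_eq0.
    by move: (n.+1%:R : R) => x x0; field; rewrite x0 gt_eqF.
  apply: ler_wpM2l => //; apply: ler_wpM2l => //.
  by rewrite lef_pV2 // posrE divr_gt0 // mulr_gt0 // ltr0n.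
apply: (@le_trans _ _ (\sum_(0 <= r < (q./2).+1 + B * q) f r)).
  have h : (Q.+1 <= (q./2).+1 + B * q)%N.
    by have := ltn_ceil Q q0; rewrite -/B; lia.
  have -> : \sum_(1 <= r < Q.+1) phi r = \sum_(1 <= r < Q.+1) f r.
    by apply: eq_big_nat => r hr; rewrite /f -[(r <= Q)%N]ltnS hr.
  rewrite [leRHS](big_cat_nat (leq0n Q.+1) h) /= [X in _ <= X + _]big_ltn //.
  by rewrite addrAC lerDr addr_ge0 // sumr_ge0.
rewrite (big_cat_nat (_ : (0 <= (q./2).+1)%N) (leq_addr _ _)) //=.
have BQ : B%:R * q%:R <= Q%:R + q%:R :> R.
  by rewrite -natrM -natrD ler_nat /B mulSn addnC leq_add2r leq_trunc_div.
have HB : harmonic_sum B <= 1 + ln Q.+1%:R :> R.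
  apply: le_trans (harmonic_sum_le _) _ => //; rewrite lerD2l ler_ln ?posrE ?ltr0n //.
  by rewrite ler_nat /B ltnS leq_div.
have := high B; have := low.
have YH : 10 * (Y / q%:R) * harmonic_sum B <= 10 * (Y / q%:R) * (1 + ln Q.+1%:R).
  by apply: ler_wpM2l => //; rewrite mulr_ge0 // divr_ge0 // ltW.
have : B%:R * (6 * q%:R * (1 + ln q%:R)) <= (6 * Q%:R + 6 * q%:R) * (1 + ln q%:R) :> R.
  have -> : B%:R * (6 * q%:R * (1 + ln q%:R)) = 6 * (B%:R * q%:R) * (1 + ln q%:R) :> R by ring.
  by apply: ler_wpM2r; [lra|lra].
have : 0 <= q%:R * (1 + ln q%:R) :> R by rewrite mulr_ge0 ?ltW //; lra.
lra.
Qed.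
End MinSumRecip.

(** * The Vaughan identity *)
Section Vaughan.
Context {R : realType}.
Local Notation C := R[i].
Implicit Types (f g : nat -> R) (F : nat -> C).

Definition conv f g n : R := \sum_(1 <= d < n.+1 | d %| n) f d * g (n %/ d)%N.

(** The sum of [(f * g) n * F n] over [n <= x], with [*] the Dirichlet
    convolution, written over the pairs [d * k = n]. *)
Definition bisum f g F x : C :=
  \sum_(1 <= d < x.+1) \sum_(1 <= k < (x %/ d).+1) RtoC (f d * g k) * F (d * k)%N.

Definition trisum f g h F x : C :=
  \sum_(1 <= k < x.+1) \sum_(1 <= d < (x %/ k).+1) \sum_(1 <= j < (x %/ (k * d)).+1)
    RtoC (f k * g d * h j) * F (k * d * j)%N.

(** Both regroupings of a triple convolution give [trisum]; together with
    [trisumC] they express associativity of convolution. *)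
Lemma bisum_conv_r f g h F x : bisum f (conv g h) F x = trisum f g h F x.
Proof.
apply: eq_bigr => k _.
transitivity (\sum_(1 <= n < (x %/ k).+1) \sum_(1 <= d < n.+1 | d %| n)
    RtoC (f k * g d * h (n %/ d)%N) * F (k * d * (n %/ d))%N).
  apply: eq_bigr => n _; rewrite /conv mulr_sumr rmorph_sum /= mulr_suml.
  by apply: eq_bigr => d dn; rewrite mulrA -mulnA [(d * _)%N]mulnC divnK.
rewrite (sum_divisors_swap (fun d j => RtoC (f k * g d * h j) * F (k * d * j)%N)).
by apply: eq_bigr => d _; rewrite divnMA.
Qed.

Lemma bisum_conv_l f g h F x : bisum (conv f g) h F x = trisum f g h F x.
Proof.
pose Psi e : C := \sum_(1 <= j < (x %/ e).+1) RtoC (h j) * F (e * j)%N.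
transitivity (\sum_(1 <= e < x.+1) \sum_(1 <= d < e.+1 | d %| e) RtoC (f d * g (e %/ d)%N) * Psi (d * (e %/ d))%N).
  apply: eq_bigr => e _.
  under [RHS]eq_bigr => d dn do rewrite mulnC divnK //.
  rewrite -mulr_suml -rmorph_sum /= -/(conv f g e) mulr_sumr; apply: eq_bigr => j _.
  by rewrite rmorphM mulrA.
rewrite (sum_divisors_swap (fun d k => RtoC (f d * g k) * Psi (d * k)%N)).
apply: eq_bigr => k _; apply: eq_bigr => d _; rewrite mulr_sumr; apply: eq_bigr => j _.
by rewrite mulrA -rmorphM.
Qed.

Lemma trisumC f g h F x : trisum f g h F x = trisum g f h F x.
Proof.
rewrite /trisum (hyperbola_swap (fun k d => \sum_(1 <= j < (x %/ (k * d)).+1)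
    RtoC (f k * g d * h j) * F (k * d * j)%N)).
apply: eq_bigr => k _; apply: eq_bigr => d _; rewrite mulnC; apply: eq_bigr => j _.
by rewrite [f d * _]mulrC.
Qed.

Lemma bisumC f g F x : bisum f g F x = bisum g f F x.
Proof.
rewrite /bisum (hyperbola_swap (fun d k => RtoC (f d * g k) * F (d * k)%N)).
by apply: eq_bigr => k _; apply: eq_bigr => d _; rewrite [f d * _]mulrC [(d * k)%N]mulnC.
Qed.

Lemma bisumDr f g1 g2 F x : bisum f (fun n => g1 n + g2 n) F x = bisum f g1 F x + bisum f g2 F x.
Proof.
rewrite /bisum -big_split; apply: eq_bigr => d _ /=; rewrite -big_split; apply: eq_bigr => k _ /=.
by rewrite mulrDr rmorphD mulrDl.
Qed.

Lemma eq_bisum f f' g g' F x : (forall n, (0 < n)%N -> f n = f' n) ->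
  (forall n, (0 < n)%N -> g n = g' n) -> bisum f g F x = bisum f' g' F x.
Proof.
move=> ef eg; apply: eq_big_nat => d /andP[d0 _]; apply: eq_big_nat => k /andP[k0 _].
by rewrite ef // eg.
Qed.

Definition below (U : nat) f n : R := if (n <= U)%N then f n else 0.
Definition above (U : nat) f n : R := if (U < n)%N then f n else 0.

Lemma below_above U f n : f n = below U f n + above U f n.
Proof. by rewrite /below /above ltnNge; case: ifP => _; rewrite ?addr0 ?add0r. Qed.

Definition lnN (n : nat) : R := ln n%:R.
Definition one (n : nat) : R := (0 < n)%:R.

(** Split the von Mangoldt function at [V].  The upper part is its convolution with
    the unit [mu * 1]; split [mu] at [U] there.  In the term with small [mu] the
    upper part of von Mangoldt is the whole function minus the lower part, and the
    whole function convolved with [1] is the logarithm. *)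
Theorem vaughan (U V : nat) F x :
  \sum_(1 <= n < x.+1) RtoC (vonM n) * F n =
  \sum_(1 <= n < x.+1) RtoC (below V vonM n) * F n
  + bisum (below U mu) lnN F x
  - bisum (conv (below U mu) (below V vonM)) one F x
  + bisum (above V vonM) (conv (above U mu) one) F x.
Proof.
set L1 := below V vonM; set L2 := above V vonM; set m1 := below U mu; set m2 := above U mu.
have -> : \sum_(1 <= n < x.+1) RtoC (vonM n) * F n =
    \sum_(1 <= n < x.+1) RtoC (L1 n) * F n + \sum_(1 <= n < x.+1) RtoC (L2 n) * F n.
  rewrite -big_split; apply: eq_bigr => n _ /=.
  by rewrite (below_above V vonM n) rmorphD mulrDl.
rewrite -!addrA; congr (_ + _).
pose delta n : R := (n == 1%N)%:R.
have -> : \sum_(1 <= n < x.+1) RtoC (L2 n) * F n = bisum L2 delta F x.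
  apply: eq_big_nat => d /andP[d0 dx].
  rewrite big_ltn ?ltnS ?divn_gt0 // /delta /= mulr1 muln1 big_nat big1 ?addr0 // => k /andP[k1 _].
  by rewrite (_ : (k == 1)%N = false) ?mulr0 ?mul0r //; apply/negbTE; lia.
have -> : bisum L2 delta F x = bisum L2 (fun n => conv m1 one n + conv m2 one n) F x.
  apply: eq_bisum => // n n0; rewrite /delta -sum_mu // /conv -big_split /=.
  rewrite big_nat_cond [RHS]big_nat_cond; apply: eq_bigr => d /andP[/andP[d0 _] dn].
  have nd : (0 < n %/ d)%N by rewrite divn_gt0 // dvdn_leq.
  by rewrite /one nd /= !mulr1 -(below_above U mu d).
rewrite bisumDr addrA; congr (_ + _).
rewrite bisum_conv_r trisumC -bisum_conv_r.
apply/eqP; rewrite eq_sym subr_eq; apply/eqP.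
rewrite bisum_conv_l -bisum_conv_r -bisumDr; apply: eq_bisum => // n n0.
rewrite /lnN -sum_vonM // /conv -big_split /=.
rewrite big_nat_cond [RHS]big_nat_cond; apply: eq_bigr => d /andP[/andP[d0 _] dn].
have nd : (0 < n %/ d)%N by rewrite divn_gt0 // dvdn_leq.
by rewrite /one nd /= !mulr1 addrC -below_above.
Qed.

Lemma abs_conv_mu_le (f : nat -> R) n : (forall k, `|f k| <= 1) ->
  `|conv f one n| <= tau n.
Proof.
move=> h; apply: le_trans (ler_norm_sum _ _ _) _; apply: ler_sum => d _.
rewrite normrM; apply: (@le_trans _ _ (1 * 1)); last by rewrite mulr1.
by apply: ler_pM => //; rewrite /one normr_nat lern1 leq_b1.
Qed.

Lemma below_le (U : nat) f (b : R) : 0 <= b -> (forall n, `|f n| <= b) -> forall n, `|below U f n| <= b.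
Proof. by move=> b0 h n; rewrite /below; case: ifP => _; rewrite ?normr0. Qed.
Lemma above_le (U : nat) f (b : R) : 0 <= b -> (forall n, `|f n| <= b) -> forall n, `|above U f n| <= b.
Proof. by move=> b0 h n; rewrite /above; case: ifP => _; rewrite ?normr0. Qed.

Lemma conv_mu_vonM_le (U V n : nat) : (0 < n)%N ->
  `|conv (below U mu) (below V vonM) n| <= ln n%:R.
Proof.
move=> n0; apply: le_trans (ler_norm_sum _ _ _) _; rewrite -sum_vonM //.
have e : \sum_(1 <= d < n.+1 | d %| n) vonM d = \sum_(1 <= d < n.+1 | d %| n) vonM (n %/ d) :> R.
  have := bisumC vonM one (fun m => (m == n)%:R) n.
  have h f g : bisum f g (fun m => (m == n)%:R : C) n = RtoC (conv f g n).
    rewrite /bisum -(sum_divisors_swap (fun d k => RtoC (f d * g k) * ((d * k)%N == n)%:R)).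
    rewrite big_nat_recr //= big_nat big1 ?add0r => [|m /andP[m0 mn]].
      rewrite /conv rmorph_sum /=; apply: eq_bigr => d dn.
      by rewrite mulnC divnK // eqxx mulr1.
    apply: big1 => d dm; rewrite mulnC divnK //.
    by rewrite (_ : (m == n) = false) ?mulr0 //; apply/negbTE; lia.
  rewrite !h => /complexI; rewrite /conv.
  have n1 d : (0 < d)%N -> d %| n -> one (n %/ d) = 1.
    by move=> d0 dn; rewrite /one divn_gt0 // dvdn_leq.
  rewrite big_nat_cond [RHS]big_nat_cond => h2.
  rewrite big_nat_cond [RHS]big_nat_cond.
  move: h2; under eq_bigr => d /andP[/andP[d0 _] dn] do rewrite n1 // mulr1.
  move=> ->; apply: eq_bigr => d /andP[/andP[d0 _] dn].
  by rewrite /one d0 mul1r.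
rewrite e; apply: ler_sum => d _; rewrite normrM -[leRHS]mul1r.
apply: ler_pM => //; first exact: below_le ler01 mu_le1 _.
by rewrite /below; case: ifP => _; rewrite ?normr0 ?ger0_norm ?vonM_ge0.
Qed.

Lemma conv_below_eq0 (U V n : nat) f g : (U * V < n)%N -> conv (below U f) (below V g) n = 0.
Proof.
move=> h; apply: big1 => d dn; rewrite /below.
case: leqP => dU; last by rewrite mul0r.
case: leqP => nV; last by rewrite mulr0.
by move: h; rewrite -(divnK dn) ltnNge mulnC leq_mul.
Qed.

Lemma conv_above_eq0 (U n : nat) f g : (n <= U)%N -> conv (above U f) g n = 0.
Proof.
move=> nU; have [->|n0] := posnP n; first by rewrite /conv big_geq.
by apply: big1 => d dn; rewrite /above ltnNge (leq_trans (dvdn_leq n0 dn) nU) mul0r.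
Qed.

End Vaughan.

Lemma residue_index_le (v k0 Y j : nat) : (0 < v)%N ->
  (j < (Y + v - k0) %/ v)%N -> (k0 + v * j <= Y)%N.
Proof. by move=> v0; rewrite leq_divRL // mulSn mulnC; lia. Qed.

(** * Sums of type I *)

Section ExpSums.
Context {R : realType} (al : R) (v u : nat) (a : int) (q : nat).
Hypotheses (v0 : (0 < v)%N) (q0 : (0 < q)%N) (co : coprimez a q)
  (tha : `|al * v%:R - a%:~R / q%:R| <= 1 / q%:R ^+ 2).
Local Notation C := R[i].
Let th := al * v%:R.

(** The additive character [n |-> e(al * h * n)] restricted to the residue class of
    [u] modulo [v]. *)
Definition twist (h n : nat) : C := if (n %% v == u %% v)%N then cexp (al * (h * n)%:R) else 0.

Lemma cabs_twist h n : cabs (twist h n) <= 1.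
Proof. by rewrite /twist; case: ifP => _; rewrite ?cabs_cexp ?cabs0. Qed.

(** The congruence on [m * k] only depends on the residue [k0] of [k] modulo [v];
    on each admissible class the phase is linear in [j] with slope
    [al * v * h * m], so the approximation of [al * v] is the relevant one.  The
    classes are not counted: all [v] of them may be admissible when [m] and [v]
    have a common factor. *)
Lemma twist_sum_le (g : nat -> C) (h m Y : nat) : g 0%N = 0 ->
  cabs (\sum_(1 <= k < Y.+1) g k * twist h (m * k)%N) <=
  \sum_(0 <= k0 < v | ((m * k0) %% v == u %% v)%N)
    cabs (\sum_(0 <= j < (Y + v - k0) %/ v) g (k0 + v * j)%N * cexp (th * j%:R * (h * m)%:R)).
Proof.
move=> g0.
have -> : \sum_(1 <= k < Y.+1) g k * twist h (m * k) = \sum_(0 <= k < Y.+1) g k * twist h (m * k).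
  by rewrite [RHS]big_ltn // g0 mul0r add0r.
rewrite (sum_split_residue _ _ v0) [leRHS]big_mkcond /=.
apply: le_trans (cabs_sum _ _ _) _; apply: ler_sum => k0 _.
have e j : ((m * (k0 + v * j)) %% v = (m * k0) %% v)%N.
  by rewrite mulnDr mulnCA addnC [(v * _)%N]mulnC modnMDl.
rewrite /twist; case: ifPn => hk; last first.
  by rewrite big1 ?cabs0 // => j _; rewrite e (negPf hk) mulr0.
rewrite (eq_bigr (fun j => g (k0 + v * j)%N * cexp (th * j%:R * (h * m)%:R) * cexp (al * (h * m * k0)%:R))).
  by rewrite -mulr_suml cabsM cabs_cexp mulr1.
move=> j _; rewrite e hk -mulrA -cexpD /th; congr (_ * cexp _).
rewrite !natrM natrD natrM; ring.
Qed.

Lemma monotone_abel (w : nat -> R) (z : nat -> C) n (B W : R) :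
  0 <= W -> (forall j, 0 <= w j <= W) -> (forall j, w j <= w j.+1) ->
  (forall j, (j <= n)%N -> cabs (\sum_(0 <= k < j) z k) <= B) ->
  cabs (\sum_(0 <= k < n) RtoC (w k) * z k) <= 2 * W * B.
Proof.
move=> W0 wW wm hB; apply: le_trans (abel_sum w hB) _.
have B0 : 0 <= B by apply: le_trans (hB 0%N isT); exact: cabs_ge0.
rewrite [leRHS]mulrC; apply: ler_wpM2l => //.
have -> : \sum_(0 <= k < n) `|w k - w k.+1| = w n - w 0%N.
  rewrite -(telescope_sumr _ (leq0n n)); apply: eq_bigr => k _.
  by rewrite distrC ger0_norm // subr_ge0.
have /andP[w0 _] := wW 0%N; have /andP[wn wn2] := wW n.
by rewrite ger0_norm //; lra.
Qed.

(** The inner sum over [k] has a monotone weight, hence is controlled by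
    [phi (h * d)], a bound for geometric sums.  The products [r = h * d] are
    represented [tau r] times, which is bounded by a small power of [r], and the sum
    of [phi] over [r] is that of [min_sum_recip]. *)
Lemma type_I (w xi : nat -> R) (K eps W X1 : R) (G D x : nat) :
  w 0%N = 0 -> (forall k, w k <= w k.+1) -> (forall k, (k <= x)%N -> w k <= W) ->
  0 <= X1 -> (forall d, (0 < d <= x)%N -> `|xi d| <= X1) ->
  (forall d, (D < d)%N -> xi d = 0) -> 0 < K -> 0 < eps ->
  (forall n, (0 < n)%N -> tau n <= K * n%:R `^ eps) ->
  \sum_(1 <= h < G.+1) cabs (bisum xi w (twist h) x) <=
  2 * v%:R * X1 * W * K * (G * D.+1)%:R `^ eps *
  (20 * (x%:R * G%:R / q%:R) * (1 + ln (G * D.+1).+1%:R)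
   + (6 * (G * D.+1)%:R + 64 * q%:R) * (1 + ln q%:R)).
Proof.
move=> w0 wm wW X10 xiX xiD K0 e0 htau.
have wge0 k : 0 <= w k.
  by elim: k => [|k IH]; rewrite ?w0 // (le_trans IH).
have wmono i j : (i <= j)%N -> w i <= w j.
  by elim: j => [|j IH]; [case: i | rewrite leq_eqVlt => /orP[/eqP->//|]; rewrite ltnS => /IH h; apply: le_trans h _].
have W0 : 0 <= W by have := wW 0%N isT; rewrite w0.
pose d_ r := dist_int (th * r%:R).
(* The minimum of the length bound [2 * x * G / r] and of [1 / ||th * r||], with
   the first choice when [th * r] is an integer. *)
pose phi r : R := if d_ r * (2 * x%:R * G%:R) <= r%:R then 2 * x%:R * G%:R / r%:R else (d_ r)^-1.
have phi0 r : 0 <= phi r.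
  by rewrite /phi; case: ifP => _; rewrite ?divr_ge0 ?mulr_ge0 ?invr_ge0 ?dist_int_ge0.
have inner h d k0 J : (0 < h <= G)%N -> (0 < d <= x)%N -> (J <= (x %/ d + v - k0) %/ v)%N ->
  cabs (\sum_(0 <= j < J) cexp (th * j%:R * (h * d)%:R)) <= phi (h * d)%N.
  move=> /andP[h0 hG] /andP[d0 dx] hJ.
  have b1 : cabs (\sum_(0 <= j < J) cexp (th * j%:R * (h * d)%:R)) * d_ (h * d)%N <= 1.
    rewrite (eq_bigr (fun j => cexp (th * (h * d)%:R * j%:R + 0))); last first.
      by move=> j _; congr cexp; ring.
    exact: geometric_cexp.
  rewrite /phi; case: ifPn => hd.
    have h1 : cabs (\sum_(0 <= j < J) cexp (th * j%:R * (h * d)%:R)) <= (size (index_iota 0 J))%:R.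
      by apply: cabs_sum_le_card => i _; rewrite cabs_cexp.
    apply: le_trans h1 _; rewrite size_iota subn0.
    rewrite ler_pdivlMr ?ltr0n ?muln_gt0 ?h0 //.
    have hJ2 : (J <= x %/ d + 1)%N.
      apply: leq_trans hJ _; apply: leq_trans (leq_div2r _ (leq_subr _ _)) _.
      by rewrite -[X in (_ + X)%N]mul1n divnDMl // addn1 addn1 ltnS leq_div.
    have hJ3 : (J * d <= 2 * x)%N.
      apply: leq_trans (leq_mul hJ2 (leqnn d)) _; rewrite mulnDl mul1n mulnC mul2n -addnn.
      by apply: leq_add; rewrite // mulnC leq_trunc_div.
    by rewrite -!natrM ler_nat [(h * d)%N]mulnC mulnA leq_mul.
  move: hd; rewrite -ltNge => hd.
  have dp : 0 < d_ (h * d)%N.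
    rewrite lt_def dist_int_ge0 andbT; apply: contraTneq hd => ->.
    by rewrite mul0r -leNgt.
  by rewrite -[leRHS]mul1r ler_pdivlMr.
have step h : (0 < h <= G)%N ->
  cabs (bisum xi w (twist h) x) <= 2 * v%:R * X1 * W * \sum_(1 <= d < D.+1) phi (h * d)%N.
  move=> hh; apply: le_trans (cabs_sum _ _ _) _.
  apply: (@le_trans _ _ (\sum_(1 <= d < x.+1) if (d <= D)%N then 2 * v%:R * X1 * W * phi (h * d)%N else 0)).
    apply: ler_sum_nat => d /andP[d0 dx]; rewrite ltnS in dx.
    have dd : (0 < d <= x)%N by rewrite d0.
    case: leqP => dD; last first.
      rewrite big1 ?cabs0 // => k _; by rewrite xiD // mul0r rmorph0 mul0r.
    rewrite (eq_bigr (fun k => RtoC (xi d) * (RtoC (w k) * twist h (d * k)%N))); last first.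
      by move=> k _; rewrite rmorphM mulrA.
    rewrite -mulr_sumr cabsM cabs_real.
    have -> : 2 * v%:R * X1 * W * phi (h * d)%N = X1 * (v%:R * (2 * W * phi (h * d)%N)) by ring.
    apply: ler_pM => //; [exact: cabs_ge0|exact: xiX|].
    apply: le_trans (@twist_sum_le (fun k => RtoC (w k)) h d (x %/ d) _) _; first by rewrite w0 rmorph0.
    apply: (@le_trans _ _ (\sum_(0 <= k0 < v) 2 * W * phi (h * d)%N)); last first.
      by rewrite sumr_const_nat subn0 -[_ *+ v]mulr_natl.
    rewrite big_mkcond; apply: ler_sum => k0 _.
    case: ifP => _; last by rewrite !mulr_ge0.
    (* Clipping the argument makes the weight bounded and monotone beyond the
       range of summation. *)
    pose wt j := w (minn (k0 + v * j) (x %/ d)).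
    rewrite (eq_big_nat _ _ (F2 := fun j => RtoC (wt j) * cexp (th * j%:R * (h * d)%:R))); last first.
      move=> j /andP[_ jJ]; congr (RtoC (w _) * _).
      by apply/esym/minn_idPl; exact: residue_index_le jJ.
    apply: monotone_abel => // [j|j|j hj].
    - by rewrite wge0 wW // (leq_trans (geq_minr _ _)) // leq_div.
    - apply: wmono; rewrite leq_min geq_minr andbT (leq_trans (geq_minl _ _)) //.
      by rewrite leq_add2l leq_mul2l leqnSn orbT.
    - exact: inner hj.
  rewrite -big_mkcond mulr_sumr.
  have F0 d : 0 <= 2 * v%:R * X1 * W * phi (h * d)%N by rewrite !mulr_ge0.
  rewrite big_mkcond [leRHS]big_mkcond /=.
  apply: (@le_trans _ _ (\sum_(1 <= d < (maxn x D).+1) if (d <= D)%N then 2 * v%:R * X1 * W * phi (h * d)%N else 0)).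
    rewrite [leRHS](big_cat_nat (_ : (1 <= x.+1)%N) (_ : (x.+1 <= (maxn x D).+1)%N)) ?ltnS ?leq_maxl //=.
    by rewrite lerDl sumr_ge0 // => i _; case: ifP.
  rewrite (big_cat_nat (_ : (1 <= D.+1)%N) (_ : (D.+1 <= (maxn x D).+1)%N)) ?ltnS ?leq_maxr //=.
  rewrite [X in _ + X]big_nat [X in _ + X]big1 ?addr0; last by move=> i /andP[h1 _]; rewrite leqNgt h1.
  by apply: ler_sum_nat => i /andP[_ iD]; rewrite -ltnS iD.
apply: (@le_trans _ _ (\sum_(1 <= h < G.+1) 2 * v%:R * X1 * W * \sum_(1 <= d < D.+1) phi (h * d)%N)).
  by apply: ler_sum_nat => h hh; apply: step; rewrite -ltnS.
rewrite -mulr_sumr -!(mulrA (2 * v%:R * X1 * W)); apply: ler_wpM2l; first by rewrite !mulr_ge0.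
have h1 := @sum_products_le R G 1 D.+1 xpredT (fun=> 1) phi isT (fun _ => ler01) phi0.
have {h1}h1 : \sum_(1 <= h < G.+1) \sum_(1 <= d < D.+1) phi (h * d)%N <=
    \sum_(1 <= r < (G * D.+1).+1) tau r * phi r.
  by apply: le_trans h1; apply: ler_sum => h _; apply: ler_sum => d _; rewrite mul1r.
apply: le_trans h1 _.
apply: (@le_trans _ _ (\sum_(1 <= r < (G * D.+1).+1) (K * (G * D.+1)%:R `^ eps) * phi r)).
  apply: ler_sum_nat => r /andP[r0 rQ]; apply: ler_wpM2r => //.
  apply: le_trans (htau _ r0) _; apply: ler_wpM2l; first exact: ltW.
  by apply: ge0_ler_powR; [exact: ltW|rewrite nnegrE|rewrite nnegrE|rewrite ler_nat -ltnS].
rewrite -mulr_sumr !mulrA; apply: ler_wpM2l; first by rewrite mulr_ge0 ?powR_ge0 // ltW.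
have Y0 : 0 <= 2 * x%:R * G%:R :> R by rewrite !mulr_ge0.
apply: le_trans (@min_sum_recip R th a q (G * D.+1) _ phi q0 co tha Y0 _) _.
  move=> r /andP[r0 rQ]; have r0' : 0 < r%:R :> R by rewrite ltr0n.
  split=> //; rewrite /phi; case: ifPn => hd.
  - by rewrite divfK ?gt_eqF.
  - move: hd; rewrite -ltNge => hd.
    have dp : 0 < d_ r.
      rewrite lt_def dist_int_ge0 andbT; apply: contraTneq hd => ->.
      by rewrite mul0r -leNgt.
    by rewrite mulrC ler_pdivrMr // mulrC ltW.
  - by rewrite mulrAC ler_pdivrMr // mul1r mulrC.
  - by rewrite -/(d_ r) mulVf //; apply: contraNneq hd => ->; rewrite mul0r.
rewrite le_eqVlt; apply/orP; left; apply/eqP; ring.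
Qed.

End ExpSums.

(** A common bound for the integers whose logarithms occur, for parameters at most
    [X]. *)
Definition log_range (X : nat) : nat := (16 * X ^ 2)%N.

(** * Sums of type II *)

Section TypeII.
Context {R : realType} (al : R) (v u : nat) (a : int) (q : nat).
Hypotheses (v0 : (0 < v)%N) (q0 : (0 < q)%N) (co : coprimez a q)
  (tha : `|al * v%:R - a%:~R / q%:R| <= 1 / q%:R ^+ 2).
Local Notation C := R[i].
Let th := al * v%:R.
Local Notation twist := (twist al v u).

(** [bilinear_le] on each residue class of the inner variable modulo [v].  The outer
    variable lives in [M0, M1), where the inner one has at most [J] values per
    class; the sum over the classes costs the factor [v]. *)
Lemma type_II_general (f g am : nat -> R) (G M0 M1 J x : nat) (B2 : R) :
  (0 < M0)%N -> (forall m, ~~ (M0 <= m < M1)%N -> f m = 0) ->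
  (forall m, `|f m| <= am m) -> g 0%N = 0 -> 0 <= B2 ->
  (forall k0, (k0 < v)%N -> \sum_(0 <= j < J) g (k0 + v * j)%N ^+ 2 <= B2) ->
  (forall m k0 j, (M0 <= m < M1)%N -> (J <= j < (x %/ m + v - k0) %/ v)%N -> g (k0 + v * j)%N = 0) ->
  \sum_(1 <= h < G.+1) cabs (bisum f g (twist h) x) <=
  v%:R * ((1 + 2 * harmonic_sum J) * Num.sqrt ((\sum_(1 <= r < (G * M1).+1) dsum am r ^+ 2) *
    (B2 * ((J%:R / q%:R + 1) * (5 * (G * M1).+1%:R + 6 * q%:R * (1 + ln q%:R)))))).
Proof.
move=> M00 fsupp fam g0 B20 hB2 gJ.
have am0 m : 0 <= am m by exact: le_trans (fam m).
pose cut k0 m := minn J ((x %/ m + v - k0) %/ v).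
pose S k0 h m := cabs (\sum_(0 <= j < cut k0 m) RtoC (g (k0 + v * j)%N) * cexp (th * j%:R * (h * m)%:R)).
pose P k0 m := (m <= x)%N && ((m * k0) %% v == u %% v)%N.
apply: (@le_trans _ _ (\sum_(1 <= h < G.+1) \sum_(0 <= k0 < v) \sum_(M0 <= m < M1 | P k0 m) am m * S k0 h m)).
  apply: ler_sum => h _; apply: le_trans (cabs_sum _ _ _) _.
  apply: (@le_trans _ _ (\sum_(1 <= m < x.+1) if (M0 <= m < M1)%N then
     \sum_(0 <= k0 < v | ((m * k0) %% v == u %% v)%N) am m * S k0 h m else 0)).
    apply: ler_sum_nat => m /andP[m0 mx]; case: ifPn => hm; last first.
      by rewrite big1 ?cabs0 // => k _; rewrite fsupp // mul0r rmorph0 mul0r.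
    rewrite (eq_bigr (fun k => RtoC (f m) * (RtoC (g k) * twist h (m * k)%N))); last first.
      by move=> k _; rewrite rmorphM mulrA.
    rewrite -[leRHS]mulr_sumr -[X in cabs X]mulr_sumr cabsM cabs_real.
    apply: ler_pM => //; first exact: cabs_ge0.
    apply: le_trans (twist_sum_le _ _ v0 _ _ _ (_ : RtoC (g 0%N) = 0)) _; first by rewrite g0 rmorph0.
    rewrite le_eqVlt; apply/orP; left; apply/eqP; rewrite big_nat_cond [RHS]big_nat_cond.
    apply: eq_bigr => k0 _; congr cabs.
    rewrite [LHS](big_cat_nat (leq0n (cut k0 m)) (geq_minr _ _)) /=.
    rewrite [X in _ + X]big_nat [X in _ + X]big1 ?addr0 // => j /andP[j1 j2].
    rewrite (gJ m) ?rmorph0 ?mul0r // j2 andbT.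
    by move: j1; rewrite /cut geq_min leqNgt [(_ <= j)%N in X in _ || X]leqNgt j2 orbF -leqNgt.
  rewrite [leRHS](exchange_big_dep xpredT) //=.
  have F0 m : 0 <= \sum_(0 <= k0 < v | P k0 m) am m * S k0 h m.
    by apply: sumr_ge0 => k0 _; rewrite mulr_ge0 ?cabs_ge0.
  apply: (@le_trans _ _ (\sum_(1 <= m < x.+1 | (M0 <= m < M1)%N) \sum_(0 <= k0 < v | P k0 m) am m * S k0 h m)).
    rewrite -big_mkcond /= big_nat_cond [leRHS]big_nat_cond; apply: ler_sum => m /andP[/andP[_ mx] _].
    by rewrite le_eqVlt; apply/orP; left; apply/eqP; apply: eq_bigl => k0; rewrite /P -ltnS mx.
  have [MM|MM] := leqP M1 M0.
    rewrite [leLHS]big_pred0; first by rewrite big_geq.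
    by move=> m; apply/negbTE; lia.
  apply: (@le_trans _ _ (\sum_(1 <= m < maxn x.+1 M1 | (M0 <= m < M1)%N) \sum_(0 <= k0 < v | P k0 m) am m * S k0 h m)).
    rewrite [leRHS](big_cat_nat (_ : (1 <= x.+1)%N) (leq_maxl _ _)) //=.
    by rewrite lerDl sumr_ge0.
  rewrite (big_cat_nat (_ : (1 <= M1)%N) (leq_maxr _ _)) //=; last by lia.
  rewrite [X in _ + X]big_nat_cond [X in _ + X]big_pred0 ?addr0; last by move=> m; apply/negbTE; lia.
  rewrite (big_cat_nat M00 (ltnW MM)) //= big_nat_cond big_pred0 ?add0r; last by move=> m; apply/negbTE; lia.
  by rewrite big_mkcond; apply: ler_sum => m _; case: ifP.
rewrite exchange_big /=; set T := (X in v%:R * X).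
apply: (@le_trans _ _ (\sum_(0 <= k0 < v) T)); last by rewrite sumr_const_nat subn0 -[T *+ v]mulr_natl.
apply: ler_sum_nat => k0 /andP[_ k0v].
apply: le_trans (@bilinear_le R th a q G M0 M1 J (P k0) am _ (cut k0) q0 co tha M00 am0 _) _.
  by move=> m _; exact: geq_minl.
have HJ0 : 0 <= 1 + 2 * harmonic_sum J :> R by rewrite addr_ge0 // mulr_ge0 // harmonic_sum_ge0.
apply: ler_wpM2l => //; apply: ler_wsqrtr; apply: ler_wpM2l.
  by apply: sumr_ge0 => r _; exact: sqr_ge0.
apply: ler_wpM2r.
  by rewrite mulr_ge0 ?addr_ge0 ?divr_ge0 ?mulr_ge0 // addr_ge0 // ln_ge0 // ler1n.
apply: le_trans (hB2 _ k0v); apply: ler_sum => j _.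
by rewrite cabs_real real_normK ?num_real.
Qed.

Context (X U G : nat) (l : R).
Hypotheses (G0 : (0 < G)%N) (GX : (G <= X)%N) (l1 : 1 <= l)
  (lX : 1 + ln (log_range X)%:R <= l) (lq : 1 + ln q%:R <= l).

Let X0 : (0 < X)%N := leq_trans G0 GX.

Lemma harmonic_sum_le_l n : (n <= 16 * X ^ 2)%N -> harmonic_sum n <= l.
Proof.
move=> h; apply: le_trans (harmonic_sum_mono h) _; apply: le_trans (harmonic_sum_le _) lX.
by rewrite muln_gt0 expn_gt0 X0.
Qed.

Lemma ln_le_l n : (n <= 16 * X ^ 2)%N -> ln n%:R <= l.
Proof.
case: n => [|n] h; first by rewrite ln0 // (le_trans ler01).
apply: le_trans lX; rewrite addrC -[leLHS]addr0 lerD //.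
by rewrite ler_ln ?posrE ?ltr0n ?ler_nat // muln_gt0 expn_gt0 X0.
Qed.

(** The square of the type II bound, up to logarithms.  Both ranges of the dyadic
    blocks below are dominated by it. *)
Definition type_II_size : R :=
  G%:R * X%:R * (G%:R * X%:R / q%:R + X%:R / U.+1%:R * l + G%:R * Num.sqrt X%:R + q%:R * l).

(** The von Mangoldt function on the range [U < n <= X]; values beyond [X] never
    occur and are removed to have a uniform bound. *)
Definition lambda_part : nat -> R := below X (above U vonM).

Lemma lambda_part_le n : `|lambda_part n| <= l.
Proof.
have l0 : 0 <= l by exact: le_trans l1.
rewrite /lambda_part /below; case: ifP => nX; rewrite ?normr0 // /above.
case: ifP => Un; rewrite ?normr0 // ger0_norm ?vonM_ge0 //.
have n0 : (0 < n)%N by lia.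
apply: le_trans (vonM_le_ln n0) (ln_le_l _); nia.
Qed.

Lemma lambda_part_vonM n : `|lambda_part n| <= vonM n.
Proof.
rewrite /lambda_part /below /above; do 2?case: ifP => _; rewrite ?normr0 ?vonM_ge0 //.
by rewrite ger0_norm ?vonM_ge0.
Qed.

Lemma lambda_part0 : lambda_part 0 = 0.
Proof. by rewrite /lambda_part /below /above. Qed.

Let q0' : 0 < q%:R :> R. Proof. by rewrite ltr0n. Qed.
Let l0 : 0 < l. Proof. by exact: lt_le_trans l1. Qed.

Lemma sqrt_bound (c : R) (Z : R) : 0 <= c -> Z <= c ^+ 2 * (l ^+ 10 * type_II_size) ->
  Num.sqrt Z <= c * l ^+ 5 * Num.sqrt type_II_size.
Proof.
move=> c0 h; apply: le_trans (ler_wsqrtr h) _.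
have l10 : l ^+ 10 = (l ^+ 5) ^+ 2 by rewrite -exprM.
rewrite l10 mulrA -exprMn sqrtrM ?sqr_ge0 // sqrtr_sqr ger0_norm //.
by rewrite mulr_ge0 // exprn_ge0 // ltW.
Qed.

Lemma completion_factor_le n : (n <= 16 * X ^ 2)%N -> 1 + 2 * harmonic_sum n <= 3 * l.
Proof. by move=> /harmonic_sum_le_l h; have := l1; lra. Qed.

(** For blocks with [M ^ 2 <= X] the divisor-bounded variable is taken as the outer
    one, of size [M <= sqrt X], and joins the frequency.  The collected
    coefficients are then those of [tau3], whose mean square costs [l ^ 8]. *)
Lemma type_II_block_low (f : nat -> R) (M x : nat) :
  (U < M)%N -> (M ^ 2 <= X)%N -> (x <= X)%N ->
  (forall m, ~~ (M <= m < M.*2)%N -> f m = 0) -> (forall m, `|f m| <= tau m) ->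
  \sum_(1 <= h < G.+1) cabs (bisum f lambda_part (twist h) x) <=
  39 * v%:R * l ^+ 6 * Num.sqrt type_II_size.
Proof.
move=> UM MX xX fs ft; have M0 : (0 < M)%N by lia.
have MleX : (M <= X)%N by apply: leq_trans MX; rewrite -{1}(expn1 M) leq_pexp2l.
pose J := (X %/ M).+1.
have JX : J%:R * M%:R <= 2 * X%:R :> R.
  by rewrite -!natrM ler_nat /J mulSn mul2n -addnn leq_add // leq_trunc_div.
have lp2 (n : nat) : lambda_part n ^+ 2 <= l ^+ 2.
  rewrite -[lambda_part n ^+ 2]real_normK ?num_real //.
  by rewrite lerXn2r ?nnegrE ?lambda_part_le // ltW.
apply: le_trans (@type_II_general f lambda_part tau G M M.*2 J x (J%:R * l ^+ 2) M0 fs ft lambda_part0 _ _ _) _.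
- by rewrite mulr_ge0 // exprn_ge0 // ltW.
- move=> k0 _; apply: (@le_trans _ _ (\sum_(0 <= j < J) l ^+ 2)); first by apply: ler_sum.
  by rewrite sumr_const_nat subn0 -[_ *+ J]mulr_natl.
- move=> m k0 j /andP[mM _] /andP[j1 j2]; exfalso.
  have : ((x %/ m + v - k0) %/ v <= (x %/ m).+1)%N.
    apply: leq_trans (leq_div2r _ (leq_subr _ _)) _.
    by rewrite -[X in (_ + X)%N]mul1n divnDMl // addn1 ltnS leq_div.
  have : (x %/ m <= X %/ M)%N by apply: leq_trans (leq_div2r _ xX) (leq_div2l _ M0 mM).
  by move: j1 j2; rewrite /J; lia.
have GM : (G * M.*2 <= 16 * X ^ 2)%N by nia.
have hA : \sum_(1 <= r < (G * M.*2).+1) dsum tau r ^+ 2 <= (G * M.*2)%:R * l ^+ 8 :> R.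
  apply: le_trans (sum_tau3_sq _) _; apply: ler_wpM2l => //.
  by rewrite lerXn2r ?nnegrE ?harmonic_sum_ge0 ?harmonic_sum_le_l // ltW.
have H3 : 1 + 2 * harmonic_sum J <= 3 * l by apply: completion_factor_le; rewrite /J; have := leq_div X M; nia.
have key : Num.sqrt ((\sum_(1 <= r < (G * M.*2).+1) dsum tau r ^+ 2) *
   (J%:R * l ^+ 2 * ((J%:R / q%:R + 1) * (5 * (G * M.*2).+1%:R + 6 * q%:R * (1 + ln q%:R)))))
   <= 13 * l ^+ 5 * Num.sqrt type_II_size.
  apply: sqrt_bound => //.
  set T := 5 * _ + _.
  have T0 : 0 <= T by rewrite addr_ge0 ?mulr_ge0 // addr_ge0 // ln_ge0 // ler1n.
  have TT : T <= 15 * (G%:R * M%:R) + 6 * q%:R * l.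
    apply: lerD; last by apply: ler_wpM2l => //; rewrite mulr_ge0.
    have : (1:R) <= G%:R * M%:R by rewrite -natrM ler1n muln_gt0 G0.
    have -> : (G * M.*2).+1%:R = 2 * (G%:R * M%:R) + 1 :> R.
      by rewrite -muln2 -addn1 natrD !natrM; ring.
    lra.
  have J1 : 0 <= J%:R / q%:R + 1 :> R by rewrite addr_ge0 // divr_ge0.
  apply: (@le_trans _ _ ((G * M.*2)%:R * l ^+ 8 * (J%:R * l ^+ 2 * ((J%:R / q%:R + 1) *
     (15 * (G%:R * M%:R) + 6 * q%:R * l))))).
    apply: ler_pM => //; first by apply: sumr_ge0 => i _; exact: sqr_ge0.
      by rewrite !mulr_ge0 ?exprn_ge0 ?(ltW l0).
    by apply: ler_wpM2l; [rewrite mulr_ge0 // exprn_ge0 // ltW|apply: ler_wpM2l].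
  have -> : (G * M.*2)%:R * l ^+ 8 * (J%:R * l ^+ 2 * ((J%:R / q%:R + 1) *
     (15 * (G%:R * M%:R) + 6 * q%:R * l))) =
     l ^+ 10 * (2 * G%:R * (J%:R * M%:R) * (15 * G%:R * (J%:R * M%:R) / q%:R + 6 * J%:R * l
       + 15 * (G%:R * M%:R) + 6 * (q%:R * l))).
    by rewrite natrM -muln2 natrM; field; rewrite gt_eqF.
  rewrite [leRHS]mulrCA; apply: ler_wpM2l; first by rewrite exprn_ge0 // ltW.
  have JMp : J%:R <= 2 * (X%:R / U.+1%:R) :> R.
    rewrite mulrA ler_pdivlMr ?ltr0n //; apply: le_trans JX.
    by apply: ler_wpM2l => //; rewrite ler_nat.
  have Msq : M%:R <= Num.sqrt X%:R :> R.
    rewrite -[M%:R]ger0_norm // -sqrtr_sqr ler_wsqrtr //.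
    by rewrite -natrX ler_nat.
  apply: (@le_trans _ _ (2 * G%:R * (2 * X%:R) * (15 * G%:R * (2 * X%:R) / q%:R + 6 * (2 * (X%:R / U.+1%:R)) * l
       + 15 * (G%:R * Num.sqrt X%:R) + 6 * (q%:R * l)))).
    have G0' : 0 <= G%:R :> R by [].
    have XU0 : 0 <= X%:R / U.+1%:R :> R by rewrite divr_ge0.
    apply: ler_pM.
    - by rewrite !mulr_ge0.
    - by rewrite !addr_ge0 ?mulr_ge0 // ?invr_ge0 // ltW.
    - by apply: ler_wpM2l => //; rewrite mulr_ge0.
    - rewrite lerD2r; apply: lerD; last by apply: ler_wpM2l => //; apply: ler_wpM2l.
      apply: lerD; last by apply: ler_wpM2r; [exact: ltW|apply: ler_wpM2l].
      by apply: ler_wpM2r; rewrite ?invr_ge0 //; apply: ler_wpM2l; rewrite // mulr_ge0.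
  rewrite /type_II_size.
  set t1 := G%:R * X%:R / q%:R; set t2 := X%:R / U.+1%:R * l; set t3 := G%:R * Num.sqrt X%:R.
  have p1 : 0 <= t1 by rewrite divr_ge0 ?mulr_ge0.
  have p2 : 0 <= t2 by rewrite mulr_ge0 ?divr_ge0 // ltW.
  have p3 : 0 <= t3 by rewrite mulr_ge0 ?sqrtr_ge0.
  have p4 : 0 <= q%:R * l by rewrite mulr_ge0 // ltW.
  have -> : 15 * G%:R * (2 * X%:R) / q%:R = 30 * t1 by rewrite /t1; ring.
  have -> : 6 * (2 * (X%:R / U.+1%:R)) * l = 12 * t2 by rewrite /t2; ring.
  have -> : 13 ^+ 2 * (G%:R * X%:R * (t1 + t2 + t3 + q%:R * l)) =
     (G%:R * X%:R) * (169 * (t1 + t2 + t3 + q%:R * l)) by ring.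
  have -> : 2 * G%:R * (2 * X%:R) * (30 * t1 + 12 * t2 + 15 * t3 + 6 * (q%:R * l)) =
     (G%:R * X%:R) * (4 * (30 * t1 + 12 * t2 + 15 * t3 + 6 * (q%:R * l))) by ring.
  apply: ler_wpM2l; first by rewrite mulr_ge0.
  lra.
have -> : 39 * v%:R * l ^+ 6 * Num.sqrt type_II_size =
   v%:R * ((3 * l) * (13 * l ^+ 5 * Num.sqrt type_II_size)) by ring.
apply: ler_wpM2l => //; apply: ler_pM; rewrite ?sqrtr_ge0 //.
by rewrite addr_ge0 // mulr_ge0 // harmonic_sum_ge0.
Qed.

(** For blocks with [X < M ^ 2] the roles are exchanged: the outer variable is the
    von Mangoldt one, of size [X / M <= sqrt X].  Its collected coefficients are
    divisor sums of von Mangoldt, that is at most logarithms. *)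
Lemma type_II_block_high (f : nat -> R) (M x : nat) :
  (M * U.+1 <= X)%N -> (X < M ^ 2)%N -> (x <= X)%N ->
  (forall m, ~~ (M <= m < M.*2)%N -> f m = 0) -> (forall m, `|f m| <= tau m) ->
  \sum_(1 <= h < G.+1) cabs (bisum lambda_part f (twist h) x) <=
  39 * v%:R * l ^+ 6 * Num.sqrt type_II_size.
Proof.
move=> MU XM xX fs ft; have M0 : (0 < M)%N by case: (M) XM.
have MleX : (M <= X)%N by apply: leq_trans MU; rewrite leq_pmulr.
(* As the other variable is at least [M], the von Mangoldt variable may be cut at
   [X / M]. *)
pose M1 := (X %/ M).+1; pose J := M.*2.
have M1X : M1%:R * M%:R <= 2 * X%:R :> R.
  by rewrite -!natrM ler_nat /M1 mulSn mul2n -addnn leq_add // leq_trunc_div.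
pose f1 := below (X %/ M) lambda_part.
have e h : bisum lambda_part f (twist h) x = bisum f1 f (twist h) x.
  apply: eq_big_nat => k /andP[k0 kx]; rewrite /f1 [below (X %/ M) _ _]/below; case: leqP => // kM.
  rewrite big_nat [RHS]big1 ?big1 // => [m /andP[m0 mx]|m _]; last by rewrite mul0r rmorph0 mul0r.
  suff -> : f m = 0 by rewrite mulr0 rmorph0 mul0r.
  apply: fs; rewrite negb_and -ltnNge; apply/orP; left.
  rewrite ltnS in mx; apply: leq_ltn_trans mx _; rewrite ltn_divLR //.
  by rewrite mulnC -ltn_divLR //; apply: leq_ltn_trans kM; exact: leq_div2r.
under eq_bigr do rewrite e.
have s1 m : ~~ (1 <= m < M1)%N -> f1 m = 0.
  rewrite /f1 /below /M1 ltnS; case: ifP => // hm; rewrite andbT -eqn0Ngt => /eqP ->.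
  exact: lambda_part0.
have s2 m : `|f1 m| <= vonM m.
  by rewrite /f1 /below; case: ifP => _; rewrite ?normr0 ?vonM_ge0 ?lambda_part_vonM.
have f00 : f 0%N = 0 by apply: fs; rewrite leqn0; case: (M) M0.
have J4 : (J <= 16 * X ^ 2)%N by rewrite /J; nia.
apply: le_trans (@type_II_general f1 f vonM G 1 M1 J x (J%:R * l ^+ 3) isT s1 s2 f00 _ _ _) _.
- by rewrite mulr_ge0 // exprn_ge0 // ltW.
- move=> k0 k0v.
  have h1 : \sum_(0 <= j < J) f (k0 + v * j)%N ^+ 2 <= \sum_(0 <= m < (k0 + v * J).+1) f m ^+ 2.
    apply: (@le_trans _ _ (\sum_(0 <= m < (k0 + v * J).+1 | (m %% v)%N == k0) f m ^+ 2)).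
      rewrite (sum_residue (fun n => f n ^+ 2)) //.
      have -> : ((k0 + v * J + v - k0) %/ v = J.+1)%N.
        have -> : (k0 + v * J + v - k0 = J.+1 * v)%N by rewrite mulSn mulnC; lia.
        by rewrite mulnK.
      by rewrite [leRHS]big_nat_recr //= lerDl sqr_ge0.
    rewrite big_mkcond; apply: ler_sum => m _; case: ifP => // _; exact: sqr_ge0.
  apply: le_trans h1 _.
  apply: (@le_trans _ _ (\sum_(1 <= m < (maxn (k0 + v * J) J).+1) if (m <= J)%N then tau m ^+ 2 else 0)).
    rewrite big_ltn // f00 expr0n add0r.
    apply: (@le_trans _ _ (\sum_(1 <= m < (k0 + v * J).+1) if (m <= J)%N then tau m ^+ 2 else 0)).
      apply: ler_sum => m _; case: leqP => hm; last by rewrite fs ?expr0n //; rewrite -/J; lia.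
      rewrite -[f m ^+ 2]real_normK ?num_real //.
      by rewrite lerXn2r ?nnegrE //; exact: (le_trans (normr_ge0 _) (ft m)).
    rewrite [leRHS](big_cat_nat (_ : (1 <= (k0 + v * J).+1)%N) (_ : (_ <= (maxn (k0 + v * J) J).+1)%N)) ?ltnS ?leq_maxl //=.
    by rewrite lerDl sumr_ge0 // => i _; case: ifP => // _; exact: sqr_ge0.
  rewrite (big_cat_nat (_ : (1 <= J.+1)%N) (_ : (_ <= (maxn (k0 + v * J) J).+1)%N)) ?ltnS ?leq_maxr //=.
  rewrite [X in _ + X]big_nat [X in _ + X]big1 ?addr0; last by move=> i /andP[h _]; rewrite leqNgt h.
  rewrite (eq_big_nat _ _ (F2 := fun m => tau m ^+ 2)); last by move=> m /andP[_ h]; rewrite -ltnS h.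
  apply: le_trans (sum_tau_sq _) _; apply: ler_wpM2l => //.
  by rewrite lerXn2r ?nnegrE ?harmonic_sum_ge0 ?harmonic_sum_le_l // ltW.
- move=> m k0 j _ /andP[j1 _]; apply: fs; rewrite negb_and -[(_ < M.*2)%N]negbK -leqNgt -/J; apply/orP; right.
  by rewrite negbK (leq_trans j1) // (leq_trans (leq_pmull _ v0)) // leq_addl.
have M1le : (M1 <= X.+1)%N by rewrite /M1 ltnS leq_div.
have GM : (G * M1 <= 16 * X ^ 2)%N by nia.
have hA : \sum_(1 <= r < (G * M1).+1) dsum vonM r ^+ 2 <= (G * M1)%:R * l ^+ 2 :> R.
  apply: (@le_trans _ _ (\sum_(1 <= r < (G * M1).+1) l ^+ 2)); last first.
    by rewrite sumr_const_nat subn1 /= -[_ *+ (G * M1)]mulr_natl.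
  apply: ler_sum_nat => r /andP[r0 rQ]; rewrite /dsum sum_vonM //.
  rewrite lerXn2r ?nnegrE ?ln_ge0 ?ler1n ?(ltW l0) //.
  by apply: ln_le_l; lia.
have H3 : 1 + 2 * harmonic_sum J <= 3 * l by apply: completion_factor_le.
have key : Num.sqrt ((\sum_(1 <= r < (G * M1).+1) dsum vonM r ^+ 2) *
   (J%:R * l ^+ 3 * ((J%:R / q%:R + 1) * (5 * (G * M1).+1%:R + 6 * q%:R * (1 + ln q%:R)))))
   <= 13 * l ^+ 5 * Num.sqrt type_II_size.
  apply: sqrt_bound => //.
  set T := 5 * _ + _.
  have T0 : 0 <= T by rewrite addr_ge0 ?mulr_ge0 // addr_ge0 // ln_ge0 // ler1n.
  have TT : T <= 10 * (G%:R * M1%:R) + 6 * q%:R * l.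
    apply: lerD; last by apply: ler_wpM2l => //; rewrite mulr_ge0.
    have : (1:R) <= G%:R * M1%:R by rewrite -natrM ler1n muln_gt0 G0.
    have -> : (G * M1).+1%:R = G%:R * M1%:R + 1 :> R by rewrite -addn1 natrD natrM.
    lra.
  have J1 : 0 <= J%:R / q%:R + 1 :> R by rewrite addr_ge0 // divr_ge0.
  apply: (@le_trans _ _ ((G * M1)%:R * l ^+ 2 * (J%:R * l ^+ 3 * ((J%:R / q%:R + 1) *
     (10 * (G%:R * M1%:R) + 6 * q%:R * l))))).
    apply: ler_pM => //; first by apply: sumr_ge0 => i _; exact: sqr_ge0.
      by rewrite !mulr_ge0 ?exprn_ge0 ?(ltW l0).
    by apply: ler_wpM2l; [rewrite mulr_ge0 // exprn_ge0 // ltW|apply: ler_wpM2l].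
  have -> : (G * M1)%:R * l ^+ 2 * (J%:R * l ^+ 3 * ((J%:R / q%:R + 1) *
     (10 * (G%:R * M1%:R) + 6 * q%:R * l))) =
     l ^+ 5 * (2 * G%:R * (M1%:R * M%:R) * (20 * G%:R * (M1%:R * M%:R) / q%:R + 12 * (M%:R * l)
       + 10 * (G%:R * M1%:R) + 6 * (q%:R * l))).
    by rewrite /J natrM -muln2 natrM; field; rewrite gt_eqF.
  have XM' : X%:R <= M%:R * Num.sqrt X%:R :> R.
    rewrite -{1}[X%:R]sqr_sqrtr // expr2; apply: ler_wpM2r; rewrite ?sqrtr_ge0 //.
    rewrite -[M%:R]ger0_norm // -sqrtr_sqr ler_wsqrtr //.
    by rewrite -natrX ler_nat ltnW.
  have M1p : M1%:R <= 2 * Num.sqrt X%:R :> R.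
    have Mp : 0 < M%:R :> R by rewrite ltr0n.
    by rewrite -(ler_pM2r Mp); apply: le_trans M1X _; rewrite -mulrA ler_wpM2l // mulrC.
  have Mp : M%:R <= X%:R / U.+1%:R :> R.
    by rewrite ler_pdivlMr ?ltr0n // -natrM ler_nat.
  apply: (@le_trans _ _ (l ^+ 5 * (2 * G%:R * (2 * X%:R) * (20 * G%:R * (2 * X%:R) / q%:R + 12 * (X%:R / U.+1%:R * l)
       + 10 * (G%:R * (2 * Num.sqrt X%:R)) + 6 * (q%:R * l))))).
    have G0' : 0 <= G%:R :> R by [].
    apply: ler_wpM2l; first by rewrite exprn_ge0 // ltW.
    apply: ler_pM.
    - by rewrite !mulr_ge0.
    - by rewrite !addr_ge0 ?mulr_ge0 // ?invr_ge0 // ltW.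
    - by apply: ler_wpM2l => //; rewrite mulr_ge0.
    - rewrite lerD2r; apply: lerD; last by apply: ler_wpM2l => //; apply: ler_wpM2l.
      apply: lerD; last by apply: ler_wpM2l => //; apply: ler_wpM2r => //; exact: ltW.
      by apply: ler_wpM2r; rewrite ?invr_ge0 //; apply: ler_wpM2l; rewrite // mulr_ge0.
  rewrite [leRHS]mulrCA; apply: ler_pM.
  - by rewrite exprn_ge0 // ltW.
  - by rewrite !mulr_ge0 // !addr_ge0 ?mulr_ge0 ?divr_ge0 ?invr_ge0 ?sqrtr_ge0 // ltW.
  - by apply: ler_weXn2l.
  rewrite /type_II_size.
  set t1 := G%:R * X%:R / q%:R; set t2 := X%:R / U.+1%:R * l; set t3 := G%:R * Num.sqrt X%:R.
  have p1 : 0 <= t1 by rewrite divr_ge0 ?mulr_ge0.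
  have p2 : 0 <= t2 by rewrite mulr_ge0 ?divr_ge0 // ltW.
  have p3 : 0 <= t3 by rewrite mulr_ge0 ?sqrtr_ge0.
  have p4 : 0 <= q%:R * l by rewrite mulr_ge0 // ltW.
  have -> : 20 * G%:R * (2 * X%:R) / q%:R = 40 * t1 by rewrite /t1; ring.
  have -> : 10 * (G%:R * (2 * Num.sqrt X%:R)) = 20 * t3 by rewrite /t3; ring.
  have -> : 13 ^+ 2 * (G%:R * X%:R * (t1 + t2 + t3 + q%:R * l)) =
     (G%:R * X%:R) * (169 * (t1 + t2 + t3 + q%:R * l)) by ring.
  have -> : 2 * G%:R * (2 * X%:R) * (40 * t1 + 12 * t2 + 20 * t3 + 6 * (q%:R * l)) =
     (G%:R * X%:R) * (4 * (40 * t1 + 12 * t2 + 20 * t3 + 6 * (q%:R * l))) by ring.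
  apply: ler_wpM2l; first by rewrite mulr_ge0.
  lra.
have -> : 39 * v%:R * l ^+ 6 * Num.sqrt type_II_size =
   v%:R * ((3 * l) * (13 * l ^+ 5 * Num.sqrt type_II_size)) by ring.
apply: ler_wpM2l => //; apply: ler_pM; rewrite ?sqrtr_ge0 //.
by rewrite addr_ge0 // mulr_ge0 // harmonic_sum_ge0.
Qed.

Lemma ln2_ge_half : 1 / 2 <= ln 2 :> R.
Proof.
have e : 2 = (1 + - (1 / 2))^-1 :> R by field.
rewrite [X in ln X]e lnV ?posrE; last by lra.
by rewrite lerNr; apply: le_ln1Dx; lra.
Qed.

(** Dyadic decomposition of the divisor-bounded variable, starting at [U + 1], into
    at most [2 * l] blocks.  Blocks with [M * (U + 1) > X] are empty, as both
    variables exceed [U]. *)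
Lemma type_II x : (x <= X)%N ->
  \sum_(1 <= h < G.+1) cabs (bisum (above U vonM) (conv (above U mu) one) (twist h) x) <=
  78 * v%:R * l ^+ 7 * Num.sqrt type_II_size.
Proof.
move=> xX; set am := conv (above U mu) one.
pose M i := (2 ^ i * U.+1)%N.
pose f i m := if (M i <= m < M i.+1)%N then am m else 0.
pose I := (trunc_log 2 X).+1.
have XI : (X < 2 ^ I)%N by exact: trunc_log_ltn.
have Mmono i : (M i <= M i.+1)%N by rewrite /M leq_mul2r expnS leq_pmull.
have cover n m : \sum_(0 <= i < n) f i m = if (U.+1 <= m < M n)%N then am m else 0.
  elim: n => [|n IH].
    by rewrite big_geq // /M expn0 mul1n; case: ifP => // h; exfalso; move: h; lia.
  rewrite big_nat_recr //= IH /f.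
  have h0 : (U.+1 <= M n)%N by rewrite /M leq_pmull // expn_gt0.
  have h1 := Mmono n.
  case: (ltnP m (M n)) => h2; rewrite ?andbF ?andbT.
    by rewrite (leq_trans h2 h1) !andbT addr0.
  by rewrite (leq_trans h0 h2) /= add0r.
have e h : bisum (above U vonM) am (twist h) x = \sum_(0 <= i < I) bisum lambda_part (f i) (twist h) x.
  rewrite /bisum exchange_big /=; apply: eq_big_nat => d /andP[d0 dx].
  rewrite exchange_big /=; apply: eq_big_nat => k /andP[k0 kx].
  rewrite -mulr_suml -rmorph_sum /= -mulr_sumr cover.
  have kX : (k <= X)%N by rewrite (leq_trans _ xX) // (leq_trans _ (leq_div x d)) // -ltnS.
  have dX : (d <= X)%N by rewrite (leq_trans _ xX) // -ltnS.
  rewrite /lambda_part [below X _ d]/below dX; congr (RtoC (_ * _) * _).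
  case: ifPn => // hk; apply: conv_above_eq0.
  have : (k < M I)%N by apply: leq_ltn_trans kX (leq_trans XI _); rewrite /M leq_pmulr.
  lia.
apply: (@le_trans _ _ (\sum_(0 <= i < I) 39 * v%:R * l ^+ 6 * Num.sqrt type_II_size)).
  apply: (@le_trans _ _ (\sum_(0 <= i < I) \sum_(1 <= h < G.+1) cabs (bisum lambda_part (f i) (twist h) x))).
    rewrite exchange_big /=; apply: ler_sum => h _; rewrite e; exact: cabs_sum.
  apply: ler_sum => i _.
  have fs m : ~~ (M i <= m < (M i).*2)%N -> f i m = 0.
    by move=> hm; rewrite /f; case: ifP => // h; case/negP: hm; move: h; rewrite /M expnS -mulnA mul2n.
  have ft m : `|f i m| <= tau m.
    rewrite /f; case: ifP => _; last by rewrite normr0; exact: (proj1 tau_submult).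
    apply: abs_conv_mu_le; apply: above_le => //; exact: mu_le1.
  have Ui : (U < M i)%N by rewrite /M leq_pmull // expn_gt0.
  have [h1|h1] := leqP (M i ^ 2) X.
    under eq_bigr do rewrite bisumC.
    exact: (type_II_block_low Ui h1 xX fs ft).
  have [h2|h2] := leqP (M i * U.+1) X; first exact: (type_II_block_high h2 h1 xX fs ft).
  apply: (@le_trans _ _ 0); last first.
    by rewrite !mulr_ge0 ?sqrtr_ge0 ?exprn_ge0 ?(ltW l0).
  rewrite big1 // => h _; apply/eqP; rewrite cabs_eq0; apply/eqP.
  rewrite /bisum big_nat big1 // => d /andP[d0 dx]; rewrite big_nat big1 // => k /andP[k0 kx].
  have [Ud|Ud] := leqP d U.
    by rewrite /lambda_part /below /above ltnNge Ud /= if_same mul0r rmorph0 mul0r.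
  suff -> : f i k = 0 by rewrite mulr0 rmorph0 mul0r.
  apply: fs; rewrite negb_and -ltnNge; apply/orP; left.
  have : (k * d <= x)%N by rewrite -leq_divRL.
  nia.
rewrite sumr_const_nat subn0 -[_ *+ I]mulr_natl.
have Il : I%:R <= 2 * l.
  have h : ln (2 ^ (trunc_log 2 X))%:R <= ln X%:R :> R.
    by rewrite ler_ln ?posrE ?ltr0n ?expn_gt0 // ler_nat trunc_logP.
  have h2 : ln X%:R <= ln (log_range X)%:R :> R.
    rewrite /log_range ler_ln ?posrE ?ltr0n ?muln_gt0 ?expn_gt0 ?X0 // ler_nat; nia.
  move: h; rewrite natrX lnXn // -[ln 2 *+ _]mulr_natl => h.
  have h3 : (trunc_log 2 X)%:R * (1 / 2) <= (trunc_log 2 X)%:R * ln 2 :> R.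
    by apply: ler_wpM2l; rewrite ?ln2_ge_half.
  have -> : I%:R = (trunc_log 2 X)%:R + 1 :> R by rewrite /I -addn1 natrD.
  have := lX; move: h h2 h3; lra.
have -> : 78 * v%:R * l ^+ 7 * Num.sqrt type_II_size = (2 * l) * (39 * v%:R * l ^+ 6 * Num.sqrt type_II_size) by ring.
by apply: ler_wpM2r => //; rewrite !mulr_ge0 ?sqrtr_ge0 ?exprn_ge0 ?(ltW l0).
Qed.

End TypeII.

(** * Exponential sums over primes *)

(** Linear arithmetic over the natural numbers that forgets the other hypotheses,
    whose real-valued contents slow the decision procedure down. *)
Ltac nlia := repeat (match goal with H : ?T |- _ => lazymatch T with
  | is_true (leq _ _) => fail | nat => fail | @eq nat _ _ => fail
  | is_true (andb _ _) => fail | is_true (negb _) => fail | _ => clear H end end); lia.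

Lemma le_log_range k X : (k <= X)%N -> (k <= 16 * X ^ 2)%N.
Proof. by move=> h; nia. Qed.

Lemma leq_square n : (n <= n * n)%N.
Proof. by case: n => // n; rewrite leq_pmulr. Qed.

(** [16] exceeds the base of natural logarithms. *)
Lemma ln_ge1 (R : realType) (X : nat) : (16 <= X)%N -> 1 <= ln X%:R :> R.
Proof.
move=> X16; have e16 : expR 1 <= 16 :> R.
  have -> : 1 = (1 / 2) + (1 / 2) :> R by field.
  have h : expR (1 / 2) <= 2 :> R.
    rewrite -[leRHS](@lnK R) ?posrE // ler_expR; exact: ln2_ge_half.
  by rewrite expRD; have := expR_gt0 (1 / 2 : R); nra.
have : ln (expR 1) <= ln X%:R :> R.
  rewrite ler_ln ?posrE ?expR_gt0 ?ltr0n ?(leq_trans _ X16) //.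
  by apply: le_trans e16 _; rewrite ler_nat.
by rewrite expRK.
Qed.

Lemma sqrt_exists (X : nat) : exists Y, (Y ^ 2 <= X < Y.+1 ^ 2)%N.
Proof.
have h : exists Y, (Y ^ 2 <= X)%N by exists 0%N.
have hb Y : (Y ^ 2 <= X)%N -> (Y <= X)%N by exact: leq_trans (leq_square Y).
case: (ex_maxnP h hb) => Y hY hmax; exists Y; rewrite hY ltnNge /=.
by apply/negP => /hmax; rewrite ltnn.
Qed.

Section PrimePowers.
Context {R : realType}.

Definition prime_log (n : nat) : R := if prime n then ln n%:R else 0.

Lemma prime_log_le n : prime_log n <= vonM n.
Proof. by rewrite /prime_log; case: ifP => [/vonM_prime->//|_]; exact: vonM_ge0. Qed.

Context (X Y : nat) (l : R).
Hypotheses (X1 : (1 < X)%N) (l1 : 1 <= l) (lX : 1 + ln X%:R <= l)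
  (YX : (Y ^ 2 <= X < Y.+1 ^ 2)%N).

Let l0 : 0 < l. Proof. by exact: lt_le_trans l1. Qed.
Let X0 : (0 < X)%N := ltnW X1.

Lemma trunc_log_le_l : (trunc_log 2 X).+1%:R <= 2 * l.
Proof.
have h : ln (2 ^ (trunc_log 2 X))%:R <= ln X%:R :> R.
  by rewrite ler_ln ?posrE ?ltr0n ?expn_gt0 // ler_nat trunc_logP.
move: h; rewrite natrX lnXn // -[ln 2 *+ _]mulr_natl => h.
have h3 : (trunc_log 2 X)%:R * (1 / 2) <= (trunc_log 2 X)%:R * ln 2 :> R.
  by apply: ler_wpM2l; rewrite ?ln2_ge_half.
have -> : (trunc_log 2 X).+1%:R = (trunc_log 2 X)%:R + 1 :> R by rewrite -addn1 natrD.
have := lX; move: h h3; lra.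
Qed.

(** A proper prime power [p ^ k <= X] has [p <= Y], the integer part of [sqrt X],
    and [k] at most [log_2 X]. *)
Lemma prime_powers_le x : (x <= X)%N ->
  \sum_(1 <= n < x.+1) (vonM n - prime_log n) <= 2 * Y%:R * l ^+ 2.
Proof.
move=> xX; pose I := (trunc_log 2 X).+1.
have XI : (X < 2 ^ I)%N by exact: trunc_log_ltn.
apply: (@le_trans _ _ (\sum_(1 <= n < x.+1) \sum_(1 <= p < Y.+1) \sum_(0 <= k < I) if (p ^ k == n)%N then l else 0)).
  apply: ler_sum_nat => n /andP[n0 nx]; have nX : (n <= X)%N by nlia.
  have rhs0 : 0 <= \sum_(1 <= p < Y.+1) \sum_(0 <= k < I) if (p ^ k == n)%N then l else 0.
    by apply: sumr_ge0 => p _; apply: sumr_ge0 => k _; case: ifP => // _; exact: ltW.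
  rewrite /prime_log; case: ifPn => np; first by rewrite vonM_prime // subrr.
  rewrite subr0 {1}/vonM; case e : (primes n) => [|p [|]] //.
  have [pp kp nE] := primes_pow e; set k := logn p n in kp nE.
  have k2 : (1 < k)%N.
    rewrite ltn_neqAle kp andbT; apply/eqP => k1; case/negP: np.
    by rewrite nE -k1 expn1.
  have pY : (p <= Y)%N.
    rewrite leqNgt; apply/negP => Yp; have /andP[_ hX] := YX.
    suff : (Y.+1 ^ 2 <= X)%N by rewrite leqNgt hX.
    apply: leq_trans nX; rewrite nE; apply: leq_trans (_ : (p ^ 2 <= p ^ k)%N).
      by rewrite leq_exp2r.
    by rewrite leq_exp2l // prime_gt1.
  have kI : (k < I)%N.
    rewrite -(@ltn_exp2l 2) //; apply: leq_ltn_trans XI; apply: leq_trans nX; rewrite [leqRHS]nE.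
    by rewrite leq_exp2r ?prime_gt1 // ltnW.
  have p0 := prime_gt0 pp.
  rewrite (bigD1_seq p) ?mem_index_iota ?iota_uniq ?p0 //=.
  rewrite (bigD1_seq k) ?mem_index_iota ?iota_uniq //= -nE eqxx -addrA.
  apply: (@le_trans _ _ (l + 0)).
    rewrite addr0; apply: (@le_trans _ _ (ln X%:R)); last by move: lX; lra.
    rewrite ler_ln ?posrE ?ltr0n // ler_nat; apply: leq_trans pY _; have /andP[h _] := YX.
    by apply: leq_trans h; exact: leq_square.
  rewrite lerD2l addr_ge0 //; first by apply: sumr_ge0 => i _; case: ifP => // _; exact: ltW.
  by apply: sumr_ge0 => i _; apply: sumr_ge0 => j _; case: ifP => // _; exact: ltW.
rewrite exchange_big /=; apply: (@le_trans _ _ (\sum_(1 <= p < Y.+1) 2 * l ^+ 2)); last first.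
  by rewrite sumr_const_nat subn1 /= -[_ *+ Y]mulr_natl mulrA [Y%:R * 2]mulrC.
apply: ler_sum => p _; rewrite exchange_big /=.
apply: (@le_trans _ _ (\sum_(0 <= k < I) l)); last first.
  rewrite sumr_const_nat subn0 -[_ *+ I]mulr_natl expr2 mulrA.
  by apply: ler_wpM2r; [exact: ltW|exact: trunc_log_le_l].
apply: ler_sum => k _.
have [pk|pk] := boolP ((p ^ k)%N \in index_iota 1 x.+1).
  rewrite (bigD1_seq _ pk) ?iota_uniq //= eqxx big1 ?addr0 // => i hi.
  by rewrite eq_sym (negPf hi).
rewrite big_seq big1 ?(ltW l0) // => i hi; case: eqP => // e.
by case/negP: pk; rewrite e.
Qed.

End PrimePowers.

Section PrimeSums.
Context {R : realType} (al : R) (v u : nat) (a : int) (q : nat).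
Hypotheses (v0 : (0 < v)%N) (q0 : (0 < q)%N) (co : coprimez a q)
  (tha : `|al * v%:R - a%:~R / q%:R| <= 1 / q%:R ^+ 2).
Local Notation C := R[i].
Local Notation twist := (twist al v u).

Section Fixed.
Context (X U Y : nat) (l K eps : R).
Hypotheses (X1 : (1 < X)%N) (l1 : 1 <= l) (UX : (U * U <= X)%N)
  (lX : 1 + ln (log_range X)%:R <= l) (lq : 1 + ln q%:R <= l)
  (YX : (Y ^ 2 <= X < Y.+1 ^ 2)%N) (K0 : 0 < K) (e0 : 0 < eps)
  (htau : forall n, (0 < n)%N -> tau n <= K * n%:R `^ eps).

Let l0 : 0 < l. Proof. by exact: lt_le_trans l1. Qed.
Let X0 : (0 < X)%N := ltnW X1.

Let lX' : 1 + ln X%:R <= l.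
Proof.
apply: le_trans lX; rewrite lerD2l /log_range ler_ln ?posrE ?ltr0n ?muln_gt0 ?expn_gt0 ?X0 // ler_nat.
by rewrite -[X in (X <= _)%N]mul1n; apply: leq_mul => //; rewrite -{1}(expn1 X) leq_exp2l.
Qed.

(** The contributions of the initial segment, of the two type I sums and of the
    type II sum in the Vaughan identity with both cuts at [U]. *)
Definition vaughan_bound (G : nat) : R :=
  G%:R * (U%:R * l) +
  4 * v%:R * l * K * (G * (U * U).+1)%:R `^ eps *
    (20 * (X%:R * G%:R / q%:R) * l + (6 * (G * (U * U).+1)%:R + 64 * q%:R) * l) +
  78 * v%:R * l ^+ 7 * Num.sqrt (type_II_size q X U G l).

Lemma sum_vonM_twist (G x : nat) : (0 < G)%N -> (G <= X)%N -> (x <= X)%N ->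
  \sum_(1 <= h < G.+1) cabs (\sum_(1 <= n < x.+1) RtoC (vonM n) * twist h n) <= vaughan_bound G.
Proof.
move=> G0 GX xX.
have GD : ((G * (U * U).+1).+1 <= log_range X)%N by rewrite /log_range; nia.
have hlog : 1 + ln (G * (U * U).+1).+1%:R <= l.
  apply: le_trans lX; rewrite lerD2l ler_ln ?posrE ?ltr0n //.
  - by rewrite ler_nat.
  - by apply: leq_trans GD.
have GD0 : 0 <= (G * (U * U).+1)%:R `^ eps by exact: powR_ge0.
have tI (w xi : nat -> R) (W Z : R) : w 0%N = 0 -> (forall k, w k <= w k.+1) ->
    (forall k, (k <= x)%N -> w k <= W) -> 0 <= Z -> (forall d, (0 < d <= x)%N -> `|xi d| <= Z) ->
    (forall d, (U * U < d)%N -> xi d = 0) -> Z * W = l ->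
    \sum_(1 <= h < G.+1) cabs (bisum xi w (twist h) x) <=
    2 * v%:R * l * K * (G * (U * U).+1)%:R `^ eps *
    (20 * (X%:R * G%:R / q%:R) * l + (6 * (G * (U * U).+1)%:R + 64 * q%:R) * l).
  move=> w0 wm wW Z0 xiZ xiD ZW.
  apply: le_trans (@type_I R al v u a q v0 q0 co tha w xi K eps W Z G (U * U) x w0 wm wW Z0 xiZ xiD K0 e0 htau) _.
  rewrite -(mulrA (2 * v%:R)) ZW; apply: ler_wpM2l.
    by rewrite !mulr_ge0 ?(ltW l0) ?(ltW K0).
  apply: lerD.
    apply: ler_pM => //; first by rewrite addr_ge0 // ln_ge0 // ler1n.
    apply: ler_wpM2l => //; apply: ler_wpM2r; rewrite ?invr_ge0 //.
    by apply: ler_wpM2r => //; rewrite ler_nat.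
  by apply: ler_wpM2l => //; rewrite addr_ge0 ?mulr_ge0.
have hmu n : `|below U mu n| <= 1 :> R by apply: below_le => //; exact: mu_le1.
have I1 := tI lnN (below U mu) l 1.
have I2 := tI one (conv (below U mu) (below U vonM)) 1 l.
have II := @type_II R al v u a q v0 q0 co tha X U G l G0 GX l1 lX lq x xX.
have xl k : (k <= x)%N -> lnN k <= l.
  by move=> kx; apply: (@ln_le_l R X G l G0 GX l1 lX); apply: le_log_range; exact: leq_trans xX.
have {}I1 : \sum_(1 <= h < G.+1) cabs (bisum (below U mu) lnN (twist h) x) <=
    2 * v%:R * l * K * (G * (U * U).+1)%:R `^ eps *
    (20 * (X%:R * G%:R / q%:R) * l + (6 * (G * (U * U).+1)%:R + 64 * q%:R) * l).
  apply: I1 => //.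
  - by rewrite /lnN ln0.
  - case=> [|k]; first by rewrite /lnN ln0 // ln1.
    by rewrite /lnN ler_ln ?posrE ?ltr0n // ler_nat.
  - by move=> d hd; rewrite /below leqNgt (leq_ltn_trans (leq_square U) hd).
  - by rewrite mul1r.
have {}I2 : \sum_(1 <= h < G.+1) cabs (bisum (conv (below U mu) (below U vonM)) one (twist h) x) <=
    2 * v%:R * l * K * (G * (U * U).+1)%:R `^ eps *
    (20 * (X%:R * G%:R / q%:R) * l + (6 * (G * (U * U).+1)%:R + 64 * q%:R) * l).
  apply: I2 => //.
  - by move=> k; rewrite /one ler_nat; case: k.
  - by move=> k _; rewrite /one lern1 leq_b1.
  - exact: ltW.
  - by move=> d /andP[d0 dx]; apply: le_trans (conv_mu_vonM_le _ _ d0) (xl _ dx).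
  - by move=> d hd; apply: conv_below_eq0.
  - by rewrite mulr1.
have I0 : \sum_(1 <= h < G.+1) cabs (\sum_(1 <= n < x.+1) RtoC (below U vonM n) * twist h n) <= G%:R * (U%:R * l).
  apply: (@le_trans _ _ (\sum_(1 <= h < G.+1) U%:R * l)); last first.
    by rewrite sumr_const_nat subn1 /= -[_ *+ G]mulr_natl.
  apply: ler_sum => h _; apply: le_trans (cabs_sum _ _ _) _.
  apply: (@le_trans _ _ (\sum_(1 <= n < x.+1) if (n <= U)%N then l else 0)).
    apply: ler_sum_nat => n /andP[n0 nx]; rewrite cabsM cabs_real /below.
    case: ifP => _; last by rewrite normr0 mul0r.
    rewrite -[leRHS]mulr1; apply: ler_pM; rewrite ?cabs_ge0 ?cabs_twist //.
    by rewrite ger0_norm ?vonM_ge0 // (le_trans (vonM_le_ln n0)) // xl.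
  apply: (@le_trans _ _ (\sum_(1 <= n < (maxn x U).+1) if (n <= U)%N then l else 0)).
    rewrite [leRHS](big_cat_nat (_ : (1 <= x.+1)%N) (_ : (_ <= (maxn x U).+1)%N)) ?ltnS ?leq_maxl //=.
    by rewrite lerDl sumr_ge0 // => i _; case: ifP => // _; exact: ltW.
  rewrite (big_cat_nat (_ : (1 <= U.+1)%N) (_ : (_ <= (maxn x U).+1)%N)) ?ltnS ?leq_maxr //=.
  rewrite [X in _ + X]big_nat [X in _ + X]big1 ?addr0; last by move=> i /andP[h1 _]; rewrite leqNgt h1.
  rewrite (eq_big_nat _ _ (F2 := fun=> l)); last by move=> i /andP[_ h1]; rewrite -ltnS h1.
  by rewrite sumr_const_nat subn1 /= -[_ *+ U]mulr_natl.
apply: (@le_trans _ _ (\sum_(1 <= h < G.+1) (cabs (\sum_(1 <= n < x.+1) RtoC (below U vonM n) * twist h n) +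
   cabs (bisum (below U mu) lnN (twist h) x) +
   cabs (bisum (conv (below U mu) (below U vonM)) one (twist h) x) +
   cabs (bisum (above U vonM) (conv (above U mu) one) (twist h) x)))).
  apply: ler_sum => h _; rewrite (vaughan U U).
  apply: le_trans (cabsD _ _) _; rewrite lerD2r.
  apply: le_trans (cabsB _ _) _; rewrite lerD2r; exact: cabsD.
rewrite !big_split /= /vaughan_bound.
move: I0 I1 I2 II; set s0 := \sum_(_ <= _ < _) _; set s1 := \sum_(_ <= _ < _) _.
set s2 := \sum_(_ <= _ < _) _; set s3 := \sum_(_ <= _ < _) _.
set b0 := G%:R * _; set b2 := (_ + _ * l); set b3 := 78 * _ * _ * _; set b4 := _ `^ _ => h0 h1 h2 h3.
have -> : 4 * v%:R * l * K * b4 * b2 = 2 * v%:R * l * K * b4 * b2 + 2 * v%:R * l * K * b4 * b2 by ring.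
by rewrite addrA; apply: lerD => //; apply: lerD => //; apply: lerD.
Qed.

Lemma sum_prime_log_twist (G x : nat) : (0 < G)%N -> (G <= X)%N -> (x <= X)%N ->
  \sum_(1 <= h < G.+1) cabs (\sum_(1 <= n < x.+1) RtoC (prime_log n) * twist h n) <=
  vaughan_bound G + G%:R * (2 * Y%:R * l ^+ 2).
Proof.
move=> G0 GX xX.
apply: (@le_trans _ _ (\sum_(1 <= h < G.+1) (cabs (\sum_(1 <= n < x.+1) RtoC (vonM n) * twist h n) +
   2 * Y%:R * l ^+ 2))); last first.
  rewrite big_split /=; apply: lerD; first exact: sum_vonM_twist.
  by rewrite sumr_const_nat subn1 /= -[_ *+ G]mulr_natl.
apply: ler_sum => h _.
have -> : \sum_(1 <= n < x.+1) RtoC (prime_log n) * twist h n =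
  \sum_(1 <= n < x.+1) RtoC (vonM n) * twist h n -
  \sum_(1 <= n < x.+1) RtoC (vonM n - prime_log n) * twist h n.
  by rewrite -sumrB; apply: eq_bigr => n _; rewrite -mulrBl -rmorphB; congr (RtoC _ * _); ring.
apply: le_trans (cabsB _ _) _; rewrite lerD2l.
apply: le_trans (cabs_sum _ _ _) _; apply: le_trans (prime_powers_le X1 l1 lX' YX xX).
apply: ler_sum => n _; rewrite cabsM cabs_real ger0_norm ?subr_ge0 ?prime_log_le //.
rewrite -[leRHS]mulr1; apply: ler_wpM2l; last exact: cabs_twist.
by rewrite subr_ge0 prime_log_le.
Qed.

(** Partial summation removes the weight [ln].  Primes up to [sqrt X] are counted
    trivially; beyond, the weight [1 / ln n] is decreasing from at most
    [2 / ln X], so one logarithm is saved. *)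
Lemma prime_twist_sum (G : nat) : (0 < G)%N -> (G <= X)%N ->
  \sum_(1 <= h < G.+1) cabs (\sum_(1 <= n < X.+1 | prime n) twist h n) <=
  G%:R * Y%:R + 4 * (vaughan_bound G + G%:R * (2 * Y%:R * l ^+ 2)) / ln X%:R.
Proof.
move=> G0 GX; set Psi := vaughan_bound G + _.
have /andP[YX1 YX2] := YX.
have Y0 : (0 < Y)%N by case: (Y) YX2 => //; rewrite exp1n; nlia.
have YleX : (Y <= X)%N by exact: leq_trans (leq_square Y) YX1.
have lnY : 0 < ln Y.+1%:R :> R by rewrite ln_gt0 // ltr1n.
have lnX0 : 0 < ln X%:R :> R by rewrite ln_gt0 // ltr1n.
pose w k : R := (ln (k + Y.+1)%:R)^-1.
pose z h k := RtoC (prime_log (k + Y.+1)%N) * twist h (k + Y.+1)%N.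
have wpos k : 0 < ln (k + Y.+1)%:R :> R by rewrite ln_gt0 // ltr1n; nlia.
have w0 k : 0 <= w k by rewrite invr_ge0 ltW.
have wdec k : w k.+1 <= w k.
  rewrite lef_pV2 ?posrE // ler_ln ?posrE ?ltr0n ?addnS // ler_nat; nlia.
have part h j : \sum_(0 <= k < j) z h k = \sum_(Y.+1 <= n < (Y + j).+1) RtoC (prime_log n) * twist h n.
  rewrite -{1}[Y.+1]add0n big_addn (_ : (Y + j).+1 - Y.+1 = j)%N //; nlia.
have split h : \sum_(1 <= n < X.+1 | prime n) twist h n =
  \sum_(1 <= n < Y.+1 | prime n) twist h n + \sum_(0 <= k < X - Y) RtoC (w k) * z h k.
  rewrite (big_cat_nat (_ : (1 <= Y.+1)%N) (_ : (Y.+1 <= X.+1)%N)) //=; congr (_ + _).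
  rewrite -{1}[Y.+1]add0n big_addn subSS big_mkcond; apply: eq_bigr => k _.
  rewrite /z mulrA -rmorphM /w /prime_log; case: ifP => _; last by rewrite mulr0 rmorph0 mul0r.
  by rewrite mulVf ?rmorph1 ?mul1r // gt_eqF.
have hB j : (j <= X - Y)%N -> \sum_(1 <= h < G.+1) cabs (\sum_(0 <= k < j) z h k) <= 2 * Psi.
  move=> jX; rewrite mulr_natl mulr2n.
  apply: le_trans (lerD (sum_prime_log_twist G0 GX (_ : (Y + j <= X)%N)) (sum_prime_log_twist G0 GX YleX)); last by nlia.
  rewrite -big_split; apply: ler_sum => h _; rewrite part.
  have -> : \sum_(Y.+1 <= n < (Y + j).+1) RtoC (prime_log n) * twist h n =
    \sum_(1 <= n < (Y + j).+1) RtoC (prime_log n) * twist h n -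
    \sum_(1 <= n < Y.+1) RtoC (prime_log n) * twist h n.
    rewrite [X in _ = X - _](big_cat_nat (_ : (1 <= Y.+1)%N) (_ : (Y.+1 <= (Y + j).+1)%N)) ?ltnS ?leq_addr //=.
    by rewrite addrAC subrr add0r.
  exact: cabsB.
apply: (@le_trans _ _ (\sum_(1 <= h < G.+1) (Y%:R + cabs (\sum_(0 <= k < X - Y) RtoC (w k) * z h k)))).
  apply: ler_sum => h _; rewrite split; apply: le_trans (cabsD _ _) _; rewrite lerD2r.
  rewrite big_mkcond; apply: le_trans (@cabs_sum_le_card R nat _ xpredT _ _) _.
    by move=> i _; case: ifP => _; rewrite ?cabs0 ?cabs_twist.
  by rewrite size_iota subn1.
rewrite big_split /= sumr_const_nat subn1 /= -[_ *+ G]mulr_natl; apply: lerD => //.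
apply: le_trans (@abel_sum_family R nat _ w z _ _ hB) _.
have -> : `|w (X - Y)%N| + \sum_(0 <= k < X - Y) `|w k - w k.+1| = w 0%N.
  rewrite (eq_bigr (fun k => - (w k.+1 - w k))); last first.
    by move=> k _; rewrite ger0_norm ?subr_ge0 // opprB.
  by rewrite sumrN telescope_sumr // ger0_norm //; ring.
have Psi0 : 0 <= 2 * Psi by apply: le_trans (hB 0%N isT); apply: sumr_ge0 => i _; exact: cabs_ge0.
have hw : w 0%N <= 2 / ln X%:R.
  rewrite /w add0n ler_pdivlMr // mulrC ler_pdivrMr //.
  rewrite mulr_natl -lnXn ?ltr0n // ler_ln ?posrE ?exprn_gt0 ?ltr0n //.
  by rewrite -natrX ler_nat ltnW.
apply: le_trans (ler_wpM2l Psi0 hw) _.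
by rewrite le_eqVlt; apply/orP; left; apply/eqP; rewrite !mulrA; congr (_ / _); ring.
Qed.

End Fixed.

Lemma sqrt_add4 (x y z t : R) : 0 <= x -> 0 <= y -> 0 <= z -> 0 <= t ->
  Num.sqrt (x ^+ 2 + y ^+ 2 + z ^+ 2 + t ^+ 2) <= x + y + z + t.
Proof.
move=> x0 y0 z0 t0; have s0 : 0 <= x + y + z + t by rewrite !addr_ge0.
rewrite -[leRHS]ger0_norm // -sqrtr_sqr ler_sqrt ?sqr_ge0 //.
have h1 := mulr_ge0 x0 y0; have h2 := mulr_ge0 x0 z0; have h3 := mulr_ge0 x0 t0.
have h4 := mulr_ge0 y0 z0; have h5 := mulr_ge0 y0 t0; have h6 := mulr_ge0 z0 t0.
rewrite !expr2; nra.
Qed.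

(** The final bookkeeping, isolated because linear arithmetic is slow in the context
    where it is needed.  The capital letters stand for the contributions that are
    dominated; the prefix [k] marks those carrying the divisor constant. *)
Lemma collect_terms (V W lV A w w3 z kw kw3 kz : R) :
  V <= W -> lV <= W -> W <= w -> A <= 2560 * kw + 8192 * kz ->
  0 <= w -> 0 <= w3 -> 0 <= z -> 0 <= kw -> 0 <= kw3 -> 0 <= kz ->
  V + (16 * V + A + (1248 * w + 1248 * w3) + 32 * lV) <=
  10000 * kw + 10000 * kw3 + 10000 * kz + 10000 * w + 10000 * w3 + 10000 * z.
Proof. by move=> *; lra. Qed.

(** Vaughan bound with both cuts at [X ^ (1 / 3)], which balances the type I term
    [U ^ 2] against the type II term [X / U].  Powers of [X] are written as powers
    of [T = X ^ (1 / 12)].  The bound keeps the terms of order [G] and [sqrt G] apart,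
    because they behave differently when the frequencies are weighted. *)
Theorem prime_exponential_sums (K eps T l : R) (X G : nat) :
  (16 <= X)%N -> 0 < T -> T ^+ 12 = X%:R -> T ^+ 3 <= q%:R -> (q <= X ^ 2)%N ->
  0 < K -> 0 < eps -> eps <= 1 -> X%:R `^ (2 * eps) <= T ->
  (forall n, (0 < n)%N -> tau n <= K * n%:R `^ eps) ->
  (0 < G)%N -> (G <= X)%N ->
  l = 4 * ln X%:R ->
  \sum_(1 <= h < G.+1) cabs (\sum_(1 <= n < X.+1 | prime n) twist h n) <=
  10000 * v%:R * (K + 1) *
  (l ^+ 6 * (X%:R / Num.sqrt q%:R + T ^+ 9) * G%:R +
   l ^+ 6 * Num.sqrt l * (T ^+ 10 + T ^+ 6 * Num.sqrt q%:R) * Num.sqrt G%:R +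
   X%:R `^ (2 * eps) * l * q%:R).
Proof.
move=> X16 T0 TX Tq qX K0 e0 e1 ET htau G0 GX lE.
have X1 : (1 < X)%N by nlia.
have T1 : 1 <= T.
  rewrite leNgt; apply/negP => h; have : T ^+ 12 < 1 by rewrite exprn_ilt1 ?ltW.
  by rewrite TX ltNge ler1n; nlia.
have lnX1 := ln_ge1 R X16.
have l1 : 1 <= l by rewrite lE; lra.
have l0 : 0 < l by exact: lt_le_trans l1.
have X0' : 0 < X%:R :> R by rewrite ltr0n; nlia.
have ln16 : ln 16 <= ln X%:R :> R by rewrite ler_ln ?posrE // ler_nat.
have lX : 1 + ln (log_range X)%:R <= l.
  rewrite /log_range natrM natrX lnM ?posrE ?exprn_gt0 // lnXn // -[_ *+ 2]mulr_natl lE; lra.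
have lq : 1 + ln q%:R <= l.
  have X20 : (0 < X ^ 2)%N by rewrite expn_gt0 (ltnW X1).
  have : ln q%:R <= ln (X ^ 2)%:R :> R.
    by rewrite ler_ln ?posrE ?ltr0n // ler_nat.
  rewrite natrX lnXn // -[_ *+ 2]mulr_natl lE; lra.
have [Y YX] := sqrt_exists X.
(* The cut [X ^ (1 / 3)]. *)
pose U := Num.truncn (T ^+ 4).
have T40 : 0 <= T ^+ 4 by rewrite exprn_ge0 // ltW.
have UT : U%:R <= T ^+ 4 by rewrite -truncn_ge_nat // /U lexx.
have UT1 : T ^+ 4 < U.+1%:R by exact: truncnS_gt.
have UX : (U * U <= X)%N.
  rewrite -(ler_nat R) natrM -TX; apply: (@le_trans _ _ (T ^+ 4 * T ^+ 4)).
    by apply: ler_pM.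
  by rewrite -exprD; apply: ler_weXn2l.
apply: le_trans (@prime_twist_sum X U Y l K eps X1 l1 UX lX lq YX K0 e0 htau G G0 GX) _.
have /andP[YX1 _] := YX.
have YT : Y%:R <= T ^+ 6.
  rewrite -(@ler_pXn2r _ 2) ?nnegrE ?exprn_ge0 ?(ltW T0) //.
  by rewrite -exprM TX -natrX ler_nat.
have qp : 0 < q%:R :> R by rewrite ltr0n.
set sq := Num.sqrt q%:R; set sG := Num.sqrt G%:R; set sl := Num.sqrt l.
have sq2 : sq ^+ 2 = q%:R by rewrite sqr_sqrtr // ltW.
have sG2 : sG ^+ 2 = G%:R by rewrite sqr_sqrtr.
have sl2 : sl ^+ 2 = l by rewrite sqr_sqrtr // ltW.
have sq0 : 0 < sq by rewrite sqrtr_gt0.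
have sG0 : 0 <= sG by exact: sqrtr_ge0.
have sl0 : 0 <= sl by exact: sqrtr_ge0.
have XT : Num.sqrt X%:R = T ^+ 6.
  by rewrite -TX (exprM T 6 2) sqrtr_sqr ger0_norm // exprn_ge0 // ltW.
have XU : X%:R / U.+1%:R <= T ^+ 8.
  rewrite ler_pdivrMr ?ltr0n // -TX (exprD T 8 4); apply: ler_wpM2l; last exact: ltW.
  by rewrite exprn_ge0 // ltW.
have Gp : 0 <= G%:R :> R by [].
have hsize : Num.sqrt (type_II_size q X U G l) <=
   G%:R * X%:R / sq + sG * T ^+ 10 * sl + G%:R * T ^+ 9 + sG * T ^+ 6 * sq * sl.
  have Tn n : 0 <= T ^+ n by rewrite exprn_ge0 // ltW.
  have t1 := divr_ge0 (mulr_ge0 Gp (ler0n R X)) (ltW sq0).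
  have t2 := mulr_ge0 (mulr_ge0 sG0 (Tn 10%N)) sl0; have t3 := mulr_ge0 Gp (Tn 9%N).
  have t4 := mulr_ge0 (mulr_ge0 (mulr_ge0 sG0 (Tn 6%N)) (ltW sq0)) sl0.
  apply: le_trans (sqrt_add4 t1 t2 t3 t4).
  apply: ler_wsqrtr; rewrite /type_II_size XT.
  have -> : (G%:R * X%:R / sq) ^+ 2 + (sG * T ^+ 10 * sl) ^+ 2 + (G%:R * T ^+ 9) ^+ 2 +
      (sG * T ^+ 6 * sq * sl) ^+ 2 =
      G%:R * X%:R * (G%:R * X%:R / q%:R + T ^+ 8 * l + G%:R * T ^+ 6 + q%:R * l).
    rewrite -TX -sq2 -sG2 -sl2; field; exact: lt0r_neq0.
  apply: ler_wpM2l; first by rewrite mulr_ge0.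
  by rewrite !lerD2r lerD2l; apply: ler_wpM2r => //; exact: ltW.
set E := X%:R `^ (2 * eps).
have E0 : 0 <= E by exact: powR_ge0.
have U1T : (G * (U * U).+1)%:R <= 2 * (G%:R * T ^+ 8) :> R.
  have -> : (G * (U * U).+1)%:R = G%:R * (U%:R * U%:R + 1) :> R by rewrite natrM -addn1 natrD natrM.
  rewrite mulrCA; apply: ler_wpM2l => //.
  have : U%:R * U%:R <= T ^+ 8 :> R by rewrite (exprD T 4 4); exact: ler_pM.
  have : 1 <= T ^+ 8 by rewrite exprn_ege1.
  lra.
have hE : (G * (U * U).+1)%:R `^ eps <= 2 * E.
  have h : (G * (U * U).+1)%:R <= 2 * X%:R ^+ 2 :> R.
    apply: le_trans U1T _; apply: ler_wpM2l => //; rewrite expr2; apply: ler_pM => //; rewrite ?ler_nat ?exprn_ge0 ?(ltW T0) //.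
    by rewrite -TX; apply: ler_weXn2l.
  apply: le_trans (ge0_ler_powR (ltW e0) _ _ h) _; rewrite ?nnegrE ?mulr_ge0 ?sqr_ge0 //.
  rewrite powRM ?sqr_ge0 //; apply: ler_pM; rewrite ?powR_ge0 //.
    by apply: le_trans (ler_powR _ e1) _; rewrite ?ler1n // powRr1.
  by rewrite /E powRrM powR_mulrn.
rewrite /vaughan_bound.
set Pe := (G * (U * U).+1)%:R `^ eps in hE *.
have Pe0 : 0 <= Pe by exact: powR_ge0.
have vp : 1 <= v%:R :> R by rewrite ler1n.
(* The factor [E = X ^ (2 * eps)] is harmless in the first two terms: it is at most
   [T], hence absorbed by [sqrt q] in the first one and by the gap between [T ^ 8]
   and [T ^ 9] in the second one. *)
have h1 : 4 * v%:R * l * K * Pe * (20 * (X%:R * G%:R / q%:R) * l + (6 * (G * (U * U).+1)%:R + 64 * q%:R) * l)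
  <= 8 * v%:R * K * l ^+ 2 * (20 * (X%:R / sq * G%:R) + 12 * (T ^+ 9 * G%:R) + 64 * (E * q%:R)).
  apply: (@le_trans _ _ (4 * v%:R * l * K * (2 * E) * (20 * (X%:R * G%:R / q%:R) * l + (12 * (G%:R * T ^+ 8) + 64 * q%:R) * l))).
    apply: ler_pM.
    - by rewrite !mulr_ge0 ?(ltW l0) ?(ltW K0).
    - by rewrite addr_ge0 // !mulr_ge0 ?addr_ge0 ?mulr_ge0 ?invr_ge0 ?(ltW l0).
    - by apply: ler_wpM2l hE; rewrite !mulr_ge0 ?(ltW l0) ?(ltW K0).
    - rewrite lerD2l; apply: ler_wpM2r; first exact: ltW.
      by rewrite lerD2r; move: U1T; lra.
  have -> : 4 * v%:R * l * K * (2 * E) * (20 * (X%:R * G%:R / q%:R) * l + (12 * (G%:R * T ^+ 8) + 64 * q%:R) * l)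
    = 8 * v%:R * K * l ^+ 2 * (20 * (X%:R * G%:R * (E / q%:R)) + 12 * (G%:R * (T ^+ 8 * E)) + 64 * (E * q%:R)) by ring.
  apply: ler_wpM2l; first by rewrite !mulr_ge0 ?(ltW l0) ?(ltW K0).
  rewrite lerD2r; apply: lerD; apply: ler_wpM2l => //.
    have -> : X%:R / sq * G%:R = X%:R * G%:R * sq^-1 by ring.
    apply: ler_wpM2l; first by rewrite mulr_ge0.
    rewrite -sq2 expr2 invfM mulrA ler_piMl ?invr_ge0 ?(ltW sq0) //.
    rewrite ler_pdivrMr // mul1r; apply: le_trans ET _.
    rewrite -(@ler_pXn2r _ 3) ?nnegrE ?(ltW T0) ?(ltW sq0) //; apply: le_trans Tq _.
    rewrite -sq2; apply: ler_weXn2l => //.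
    rewrite -(@ler_pXn2r _ 2) ?nnegrE ?(ltW sq0) // expr1n sq2 ler1n //.
  rewrite [leRHS]mulrC; apply: ler_wpM2l => //; rewrite (exprSr T 8); apply: ler_wpM2l => //.
  by rewrite exprn_ge0 // ltW.
have lln : (4 : R) / ln X%:R = 16 / l by rewrite lE; field; rewrite gt_eqF //; lra.
set S := Num.sqrt _ in hsize *.
rewrite mulrAC lln.
have ln6 : 1 <= l ^+ 6 by rewrite exprn_ege1.
have l6 : l <= l ^+ 6 by rewrite -{1}(expr1 l); apply: ler_weXn2l.
set V1 := X%:R / sq * G%:R in h1 *.
have V10 : 0 <= V1 by rewrite !mulr_ge0 ?invr_ge0 ?(ltW sq0).
set V2 := T ^+ 9 * G%:R in h1 *.
have V20 : 0 <= V2 by rewrite !mulr_ge0 ?exprn_ge0 ?(ltW T0).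
have c1 : G%:R * Y%:R <= V2.
  rewrite mulrC; apply: ler_wpM2r => //; apply: le_trans YT _; exact: ler_weXn2l.
have c2 : G%:R * (U%:R * l) <= l * V2.
  have -> : l * V2 = G%:R * (T ^+ 9 * l) by rewrite /V2; ring.
  apply: ler_wpM2l => //; apply: ler_wpM2r; first exact: ltW.
  by apply: le_trans UT _; exact: ler_weXn2l.
have c3 : G%:R * (2 * Y%:R * l ^+ 2) <= 2 * l ^+ 2 * V2.
  have -> : 2 * l ^+ 2 * V2 = G%:R * (2 * T ^+ 9 * l ^+ 2) by rewrite /V2; ring.
  apply: ler_wpM2l => //; apply: ler_wpM2r; first exact: sqr_ge0.
  apply: ler_wpM2l => //; apply: le_trans YT _; exact: ler_weXn2l.
set V3 := (T ^+ 10 + T ^+ 6 * sq) * sG.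
have V30 : 0 <= V3 by rewrite !mulr_ge0 ?addr_ge0 ?mulr_ge0 ?exprn_ge0 ?(ltW T0) ?(ltW sq0).
have hS : S <= V1 + V2 + sl * V3.
  apply: le_trans hsize _; rewrite le_eqVlt; apply/orP; left; apply/eqP.
  by rewrite /V1 /V2 /V3; ring.
have S0 : 0 <= S by exact: sqrtr_ge0.
set Z := E * l * q%:R.
have Z0 : 0 <= Z by rewrite !mulr_ge0 ?(ltW l0).
apply: (@le_trans _ _ (V2 + 16 / l * (l * V2 + 8 * v%:R * K * l ^+ 2 * (20 * V1 + 12 * V2 + 64 * (E * q%:R))
   + 78 * v%:R * l ^+ 7 * (V1 + V2 + sl * V3) + 2 * l ^+ 2 * V2))).
  apply: lerD => //; apply: ler_wpM2l; first by rewrite divr_ge0 // ltW.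
  apply: lerD => //; apply: lerD; first exact: lerD.
  by apply: ler_wpM2l hS; rewrite !mulr_ge0 ?exprn_ge0 ?(ltW l0).
have -> : 16 / l * (l * V2 + 8 * v%:R * K * l ^+ 2 * (20 * V1 + 12 * V2 + 64 * (E * q%:R))
   + 78 * v%:R * l ^+ 7 * (V1 + V2 + sl * V3) + 2 * l ^+ 2 * V2) =
   16 * V2 + 128 * (v%:R * K) * (l * (20 * V1 + 12 * V2) + 64 * Z) + 1248 * v%:R * (l ^+ 6 * (V1 + V2) + l ^+ 6 * sl * V3) + 32 * l * V2.
  by rewrite /Z; field; rewrite gt_eqF.
have -> : l ^+ 6 * (X%:R / sq + T ^+ 9) * G%:R = l ^+ 6 * (V1 + V2) by rewrite /V1 /V2; ring.
rewrite -(mulrA (l ^+ 6 * sl)) -/V3.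
have vK : 0 <= v%:R * K by rewrite mulr_ge0 // ltW.
set W := l ^+ 6 * (V1 + V2); set W3 := l ^+ 6 * sl * V3.
have W30 : 0 <= W3 by apply: mulr_ge0 V30; apply: mulr_ge0 sl0; rewrite exprn_ge0 // ltW.
have w1 : V2 <= W.
  apply: (@le_trans _ _ (1 * (V1 + V2))); first by rewrite mul1r lerDr.
  by apply: ler_wpM2r => //; rewrite addr_ge0.
have w2 : l * (20 * V1 + 12 * V2) <= 20 * W.
  have -> : 20 * W = l ^+ 6 * (20 * V1 + 20 * V2) by rewrite /W; ring.
  apply: ler_pM => //; [exact: ltW|apply: addr_ge0; exact: mulr_ge0|lra].
have w3 : l * V2 <= W.
  by apply: ler_pM => //; [exact: ltW|rewrite lerDr].
have W0 : 0 <= W by exact: le_trans w1.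
have vW : W <= v%:R * W by rewrite ler_peMl.
have k1 : 128 * (v%:R * K) * (l * (20 * V1 + 12 * V2) + 64 * Z) <= 128 * (v%:R * K) * (20 * W + 64 * Z).
  by apply: ler_wpM2l; [rewrite mulr_ge0|rewrite lerD2r].
have vKW := mulr_ge0 vK W0; have vKZ := mulr_ge0 vK Z0; have vKW3 := mulr_ge0 vK W30.
have vZ : 0 <= v%:R * Z by rewrite mulr_ge0.
have vW3 : 0 <= v%:R * W3 by rewrite mulr_ge0.
have -> : 10000 * v%:R * (K + 1) * (W + W3 + Z) = 10000 * (v%:R * K * W) + 10000 * (v%:R * K * W3)
  + 10000 * (v%:R * K * Z) + 10000 * (v%:R * W) + 10000 * (v%:R * W3) + 10000 * (v%:R * Z) by ring.
have -> : 1248 * v%:R * (W + W3) = 1248 * (v%:R * W) + 1248 * (v%:R * W3) by ring.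
have e2 : 128 * (v%:R * K) * (20 * W + 64 * Z) = 2560 * (v%:R * K * W) + 8192 * (v%:R * K * Z) by ring.
move: k1; rewrite e2 -(mulrA 32) => k1.
exact: (collect_terms w1 w3 vW k1 (le_trans W0 vW) vW3 vZ vKW vKW3 vKZ).
Qed.

End PrimeSums.

(** * Counting points near the integers with Fejer kernels *)
Section Fejer.
Context {R : realType}.
Local Notation C := R[i].
Implicit Types (x y : R).

Lemma conjc_sum (I : Type) (r : seq I) (P : pred I) (F : I -> C) :
  conjc (\sum_(i <- r | P i) F i) = \sum_(i <- r | P i) conjc (F i).
Proof. exact: rmorph_sum. Qed.

(** Telescoping, with [1 / e ^ 2 <= 2 * (1 / e - 1 / (e + 1))] for [e >= 1]. *)
Lemma inverse_square_tail (d B : R) (n : nat) : 1 <= d -> 0 <= B ->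
  \sum_(0 <= t < n) B / (d + t%:R) ^+ 2 <= 2 * B / d.
Proof.
move=> d1 B0; have d0 : 0 < d by lra.
suff : \sum_(0 <= t < n) B / (d + t%:R) ^+ 2 <= 2 * B * (1 / d - 1 / (d + n%:R)).
  have : 0 <= B * (1 / (d + n%:R)) by rewrite mulr_ge0 // divr_ge0 // addr_ge0 // ltW.
  lra.
elim: n => [|n IH]; first by rewrite big_nil addr0 subrr mulr0.
rewrite big_nat_recr //=; apply: le_trans (lerD IH (lexx _)) _.
have -> : d + n.+1%:R = d + n%:R + 1 by rewrite -addrA natr1.
have : 1 <= d + n%:R by apply: le_trans d1 _; rewrite lerDl.
move: (d + n%:R) => e e1.
have e0 : 0 < e by lra.
rewrite -subr_ge0.
have -> : 2 * B * (1 / d - 1 / (e + 1)) - (2 * B * (1 / d - 1 / e) + B / e ^+ 2) =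
  B * ((e - 1) / (e ^+ 2 * (e + 1))).
  by field; rewrite ?gt_eqF //; lra.
by rewrite mulr_ge0 // divr_ge0 ?mulr_ge0 ?sqr_ge0 //; lra.
Qed.

(** A kernel sampled at the points of a progression has two tails: the samples
    decay like an inverse square from both ends of the progression. *)
Lemma two_sided_tail (c : nat -> R) (d B : R) (n : nat) : 1 <= d -> 0 <= B ->
  (forall t, (t < n)%N -> c t * (d + (minn t (n - t.+1))%:R) ^+ 2 <= B) ->
  \sum_(0 <= t < n) c t <= 4 * B / d.
Proof.
move=> d1 B0 hc; have d0 : 0 < d by lra.
pose g t := B / (d + t%:R) ^+ 2.
have g0 t : 0 <= g t by rewrite divr_ge0 ?sqr_ge0.
apply: (@le_trans _ _ (\sum_(0 <= t < n) (g t + g (n - t.+1)%N))).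
  rewrite big_nat [leRHS]big_nat; apply: ler_sum => t /andP[_ tn].
  have := hc _ tn; rewrite -ler_pdivlMr ?exprn_gt0 ?ltr_wpDr //.
  rewrite -/(g _) => h; apply: le_trans h _.
  by rewrite /minn; case: ifP => _; rewrite ?lerDl ?lerDr.
rewrite big_split /=.
have -> : \sum_(0 <= t < n) g (n - t.+1)%N = \sum_(0 <= t < n) g t.
  by rewrite [RHS]big_nat_rev; apply: eq_bigr => t _; rewrite add0n.
have := @inverse_square_tail d B n d1 B0; rewrite -/(\sum_(0 <= t < n) g t); lra.
Qed.

(** The Fejer kernel, without its usual normalisation by [H]. *)
Definition fejer (H : nat) x : R := cabs (\sum_(0 <= h < H) cexp (x * h%:R)) ^+ 2.

Lemma fejer_ge0 H x : 0 <= fejer H x. Proof. exact: sqr_ge0. Qed.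

Lemma fejer_dist H x : fejer H x * dist_int x ^+ 2 <= 1.
Proof.
have := @geometric_cexp R x 0 H; under eq_bigr do rewrite addr0.
rewrite /fejer -exprMn => h; apply: exprn_ile1 => //.
by rewrite mulr_ge0 ?cabs_ge0 ?dist_int_ge0.
Qed.

Lemma fejer_expand H x :
  RtoC (fejer H x) = \sum_(0 <= h < H) \sum_(0 <= k < H) cexp (x * (h%:R - k%:R)).
Proof.
rewrite /fejer cabs_sqr conjc_sum mulr_suml; apply: eq_bigr => h _.
rewrite mulr_sumr; apply: eq_bigr => k _.
by rewrite -cexpN -cexpD; congr cexp; ring.
Qed.

(** The frequencies of the kernel are less than [H] in absolute value, so sampling
    at [2 * H] equidistant points integrates it exactly. *)
Lemma fejer_full_grid H x : (0 < H)%N ->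
  \sum_(0 <= i < (2 * H)%N) fejer H (x - i%:R / (2 * H%:R)) = 2 * H%:R ^+ 2.
Proof.
move=> H0; have Hp : H%:R != 0 :> R by rewrite pnatr_eq0 -lt0n.
apply: (@complexI R); rewrite rmorph_sum /=.
under eq_bigr do rewrite fejer_expand.
rewrite exchange_big /=.
under eq_bigr => h _.
  rewrite exchange_big /=.
  under eq_bigr => k _.
    under eq_bigr => i _.
      have -> : (x - i%:R / (2 * H%:R)) * (h%:R - k%:R) =
        x * (h%:R - k%:R) + i%:R * (k%:R - h%:R) / (2 * H)%:R by rewrite natrM; field.
      rewrite cexpD; over.
    rewrite -mulr_sumr; over.
  over.
transitivity (\sum_(0 <= h < H) (2 * H)%:R : C); last first.
  rewrite sumr_const_nat subn0 -[_ *+ H]mulr_natr rmorphM rmorphXn /= !rmorph_nat natrM expr2.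
  by rewrite mulrA.
apply: eq_big_nat => h /andP[_ hH].
rewrite (bigD1_seq h) ?mem_index_iota ?iota_uniq //= cexp_orthogonality ?eqxx; try lia.
rewrite subrr mulr0 cexp0 mul1r big1_seq ?addr0 // => k /andP[kh].
rewrite mem_index_iota => /andP[_ kH].
by rewrite cexp_orthogonality; try lia; rewrite eq_sym (negPf kh) mulr0.
Qed.

Lemma dist_int_frac (j M : nat) : (0 < M)%N -> (j <= M)%N ->
  (minn j (M - j))%:R <= M%:R * dist_int (j%:R / M%:R : R).
Proof.
move=> M0 jM; have Mp : 0 < M%:R :> R by rewrite ltr0n.
have half k : (2 * k <= M)%N -> dist_int (k%:R / M%:R : R) = k%:R / M%:R.
  move=> kM; have k0 : 0 <= k%:R / M%:R :> R by rewrite divr_ge0.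
  rewrite dist_int_small ger0_norm // ler_pdivrMr //.
  by have : (2 * k)%:R <= M%:R :> R; [rewrite ler_nat|rewrite natrM; lra].
case: (leqP (2 * j) M) => h.
  by rewrite half // mulrC divfK ?gt_eqF // ler_nat geq_minl.
have -> : j%:R / M%:R = - ((M - j)%:R / M%:R) + 1%:~R :> R.
  by rewrite natrB //; field; rewrite gt_eqF.
rewrite dist_intDz dist_intN half; last lia.
by rewrite mulrC divfK ?gt_eqF // ler_nat geq_minr.
Qed.

(** The smoothed indicator of the arc of radius [Delta]: the Fejer kernels
    centred at the [m.*2.+1] points of the grid of step [1 / (2 * H)] that lie
    in the arc. *)
Definition arc (H m : nat) x : R :=
  2 / (2 * H%:R) ^+ 2 * \sum_(0 <= i < m.*2.+1) fejer H (x - (i%:R - m%:R) / (2 * H%:R)).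

(** The kernels at the remaining points of the grid.  By [fejer_full_grid] the two
    functions add up to one, so a bound for [coarc] inside the arc shows that [arc]
    is close to one there. *)
Definition coarc (H m : nat) x : R :=
  2 / (2 * H%:R) ^+ 2 *
  \sum_(0 <= t < 2 * H - m.*2.+1) fejer H (x - (m.+1 + t)%:R / (2 * H%:R)).

Section Arc.
Context (H m : nat) (Delta : R).
Hypotheses (H0 : (0 < H)%N) (m1 : m%:R <= 2 * H%:R * Delta) (m2 : 2 * H%:R * Delta < m.+1%:R)
  (D0 : 0 < Delta) (D2 : Delta < 1 / 2).

Let Hp : 0 < H%:R :> R. Proof. by rewrite ltr0n. Qed.
Local Notation M := (2 * H%:R).

Lemma arc_size : (m.*2.+1 <= 2 * H)%N.
Proof.
rewrite -[X in (X < _)%N]muln2 mulnC -(ltr_nat R) !natrM.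
have : M * Delta < M * (1 / 2) by rewrite ltr_pM2l // mulr_gt0.
move: m1; lra.
Qed.

Lemma arc_coarc x : arc H m x + coarc H m x = 1.
Proof.
have hs := arc_size.
rewrite /arc /coarc -mulrDr.
have -> : \sum_(0 <= i < m.*2.+1) fejer H (x - (i%:R - m%:R) / M) +
   \sum_(0 <= t < 2 * H - m.*2.+1) fejer H (x - (m.+1 + t)%:R / M) =
   \sum_(0 <= i < (2 * H)%N) fejer H (x + m%:R / M - i%:R / M).
  rewrite [RHS](@big_cat_nat _ _ _ m.*2.+1) //=; congr (_ + _).
    by apply: eq_bigr => i _; congr fejer; ring.
  rewrite -{2}(add0n m.*2.+1) big_addn; apply: eq_bigr => t _; congr fejer.
  have -> : (t + m.*2.+1)%:R = (m.+1 + t)%:R + m%:R :> R by rewrite -natrD; congr (_%:R); lia.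
  ring.
rewrite fejer_full_grid //; field; exact: lt0r_neq0.
Qed.

Lemma arc_ge0 x : 0 <= arc H m x.
Proof. by rewrite mulr_ge0 ?divr_ge0 ?sqr_ge0 // sumr_ge0 // => i _; exact: fejer_ge0. Qed.

Lemma coarc_ge0 x : 0 <= coarc H m x.
Proof. by rewrite mulr_ge0 ?divr_ge0 ?sqr_ge0 // sumr_ge0 // => i _; exact: fejer_ge0. Qed.

Lemma fejer_sample (y e : R) : 0 <= e -> e <= M * dist_int y ->
  2 / M ^+ 2 * fejer H y * e ^+ 2 <= 2.
Proof.
move=> e0 he; apply: (@le_trans _ _ (2 / M ^+ 2 * fejer H y * (M * dist_int y) ^+ 2)).
  apply: ler_wpM2l; first exact: mulr_ge0 (divr_ge0 _ (sqr_ge0 _)) (fejer_ge0 _ _).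
  by rewrite ler_pXn2r ?nnegrE // (le_trans e0).
have -> : 2 / M ^+ 2 * fejer H y * (M * dist_int y) ^+ 2 = 2 * (fejer H y * dist_int y ^+ 2).
  by field; exact: lt0r_neq0.
by have := fejer_dist H y; lra.
Qed.

Lemma arc_outside x : 1 <= M * (dist_int x - Delta) ->
  arc H m x <= 8 / (M * (dist_int x - Delta)).
Proof.
move=> hd; rewrite /arc mulr_sumr.
have -> : 8 = 4 * 2 :> R by ring.
apply: two_sided_tail => // t tm; apply: fejer_sample.
  by rewrite addr_ge0 //; move: hd; lra.
have h : dist_int x <= dist_int (x - (t%:R - m%:R) / M) + `|(t%:R - m%:R) / M|.
  by rewrite -{1}(subrK ((t%:R - m%:R) / M) x); apply: le_trans (dist_intD _ _) _;
    rewrite lerD2l dist_int_norm.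
have e : M * `|(t%:R - m%:R) / M| + (minn t (m.*2.+1 - t.+1))%:R = m%:R :> R.
  have Mp : 0 < M :> R by rewrite mulr_gt0.
  rewrite normrM (@ger0_norm _ M^-1) ?invr_ge0 ?(ltW Mp) // mulrC divfK ?gt_eqF //.
  case: (leqP t m) => tmm.
    rewrite (minn_idPl _); last lia.
    by rewrite distrC ger0_norm ?subr_ge0 ?ler_nat // subrK.
  rewrite (minn_idPr _); last lia.
  rewrite ger0_norm ?subr_ge0 ?ler_nat 1?ltnW // subSS natrB; last lia.
  by rewrite -mul2n natrM; ring.
have : M * dist_int x <= M * (dist_int (x - (t%:R - m%:R) / M) + `|(t%:R - m%:R) / M|).
  by apply: ler_wpM2l h; rewrite mulr_ge0.
rewrite mulrDr; move: m1 e; lra.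
Qed.

Lemma coarc_inside x : 1 <= M * (Delta - dist_int x) ->
  coarc H m x <= 8 / (M * (Delta - dist_int x)).
Proof.
move=> hd; rewrite /coarc mulr_sumr; have hs := arc_size.
have -> : 8 = 4 * 2 :> R by ring.
apply: two_sided_tail => // t tm; apply: fejer_sample.
  by rewrite addr_ge0 //; move: hd; lra.
set j := (m.+1 + t)%N.
have := @dist_int_frac j (2 * H) _ _; rewrite natrM => hj.
have {}hj : (minn j (2 * H - j))%:R <= M * dist_int (j%:R / M) :> R by apply: hj; rewrite /j; lia.
have h : dist_int (j%:R / M) <= dist_int (x - j%:R / M) + dist_int x.
  rewrite -(dist_intN (x - _)); have := dist_intD (- (x - j%:R / M)) x.
  by rewrite opprB subrK.
have e : (minn j (2 * H - j) = m.+1 + minn t (2 * H - m.*2.+1 - t.+1))%N by rewrite /j; lia.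
rewrite e natrD in hj.
have : M * dist_int (j%:R / M) <= M * (dist_int (x - j%:R / M) + dist_int x).
  by apply: ler_wpM2l h; rewrite mulr_ge0.
rewrite mulrDr; move: m2 hj; lra.
Qed.

(** Outside the arc [arc] is small, inside [coarc] is small; close to the end points
    both are only known to lie between zero and one. *)
Lemma arc_error x : `|(dist_int x < Delta)%R%:R - arc H m x| <=
  8 / Num.max 8 (M * `|dist_int x - Delta|).
Proof.
have a0 := arc_ge0 x; have b0 := coarc_ge0 x; have ab := arc_coarc x.
case: (leP (M * `|dist_int x - Delta|) 8) => h.
  rewrite divff // ler_norml; case: ltP => _ /=; apply/andP; split; lra.
case: (ltP (dist_int x) Delta) => hd.
  have e : `|dist_int x - Delta| = Delta - dist_int x by rewrite distrC ger0_norm // subr_ge0 ltW.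
  rewrite e in h *.
  have -> : true%:R - arc H m x = coarc H m x by rewrite /= -ab; ring.
  by rewrite ger0_norm // coarc_inside //; lra.
have e : `|dist_int x - Delta| = dist_int x - Delta by rewrite ger0_norm // subr_ge0.
rewrite e in h *.
by rewrite sub0r normrN ger0_norm // arc_outside //; lra.
Qed.

End Arc.

(** Each distance [k] is attained at most twice from a given [h]. *)
Lemma off_diagonal_sum (H : nat) (b : nat -> R) : (forall k, 0 <= b k) ->
  \sum_(0 <= h < H) \sum_(0 <= k < H | k != h) b (h - k + (k - h))%N <=
  2 * H%:R * \sum_(1 <= k < H) b k.
Proof.
move=> b0; have -> : 2 * H%:R * \sum_(1 <= k < H) b k = \sum_(0 <= h < H) 2 * \sum_(1 <= k < H) b k.
  by rewrite sumr_const_nat subn0 -[_ *+ H]mulr_natl; ring.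
rewrite big_nat [leRHS]big_nat; apply: ler_sum => h /andP[_ hH].
have sub n : (n <= H)%N -> \sum_(1 <= k < n) b k <= \sum_(1 <= k < H) b k.
  move=> nH; case: n nH => [|n] nH; first by rewrite big_geq // sumr_ge0.
  rewrite [leRHS](@big_cat_nat _ _ _ n.+1) //= lerDl sumr_ge0 //.
rewrite (@big_cat_nat _ _ _ h) //=; last exact: ltnW.
rewrite [X in _ + X]big_mkcond big_ltn //= eqxx add0r -big_mkcond /=.
have -> : 2 * \sum_(1 <= k < H) b k = \sum_(1 <= k < H) b k + \sum_(1 <= k < H) b k by ring.
apply: lerD.
  apply: le_trans (sub h.+1 hH); rewrite [leRHS]big_add1 /= [leRHS]big_nat_rev /= big_mkcond /=.
  rewrite big_nat [leRHS]big_nat; apply: ler_sum => k /andP[_ kh].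
  rewrite add0n subnSK // neq_ltn kh /= (eqnP (ltnW kh)) addn0 //.
apply: le_trans (sub (H - h)%N (leq_subr _ _)).
rewrite -{1}(add1n h) big_addn big_mkcond /=; apply: ler_sum => k _.
by case: ifP => _ //; rewrite addnK (_ : h - (k + h) = 0)%N ?add0n //; lia.
Qed.

Section Equidistribution.
Context (I : Type) (r : seq I) (P : pred I) (x : I -> R).

Let S (k : R) : C := \sum_(i <- r | P i) cexp (x i * k).

Lemma cabs_cexp_sumN (F : I -> R) :
  cabs (\sum_(i <- r | P i) cexp (- F i)) = cabs (\sum_(i <- r | P i) cexp (F i)).
Proof.
rewrite -cabs_conj conjc_sum; congr cabs; apply: eq_bigr => i _.
by rewrite -cexpN opprK.
Qed.

(** Writing the smoothed indicator as a trigonometric polynomial bounds the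
    discrepancy by exponential sums.  Its mean value is [(2m + 1) / (2H)], within
    [1 / (2H)] of [2 * Delta]; the [k]-th coefficient is at most this mean value
    and, being a geometric sum, at most [1 / k]. *)
Lemma discrepancy_le (H : nat) (Delta : R) : (0 < H)%N -> 0 < Delta -> Delta < 1 / 2 ->
  `|\sum_(i <- r | P i) (dist_int (x i) < Delta)%R%:R - 2 * Delta * \sum_(i <- r | P i) 1| <=
  (\sum_(i <- r | P i) 1) / (2 * H%:R) +
  \sum_(i <- r | P i) 8 / Num.max 8 (2 * H%:R * `|dist_int (x i) - Delta|) +
  2 * \sum_(1 <= k < H) Num.min (2 * Delta + 1 / (2 * H%:R)) (1 / k%:R) *
        cabs (\sum_(i <- r | P i) cexp (x i * k%:R)).
Proof.
move=> H0 D0 D2; have Hp : 0 < H%:R :> R by rewrite ltr0n.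
set M := 2 * H%:R; have Mp : 0 < M by rewrite mulr_gt0.
pose m := Num.truncn (M * Delta).
have MD0 : 0 <= M * Delta by rewrite mulr_ge0 // ltW.
have /andP[m1 m2] := truncn_itv MD0; rewrite -/m in m1 m2.
set c := \sum_(i <- r | P i) 1.
have c0 : 0 <= c by rewrite sumr_ge0.
(* The contribution of the grid points to the coefficient of frequency [k]. *)
pose D (k : R) : C := \sum_(0 <= t < m.*2.+1) cexp (- ((t%:R - m%:R) / M) * k).
have Dm k : cabs (D k) <= m.*2.+1%:R.
  have := @cabs_sum_le_card R _ (index_iota 0 m.*2.+1) predT (fun t => cexp (- ((t%:R - m%:R) / M) * k)).
  by rewrite size_iota subn0; apply => t _; rewrite cabs_cexp.
have Dk k : (0 < k < H)%N -> cabs (D k%:R) <= M / k%:R.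
  move=> /andP[k0 kH]; have kp : 0 < k%:R :> R by rewrite ltr0n.
  have := @geometric_cexp R (- (k%:R / M)) (m%:R * k%:R / M) m.*2.+1.
  rewrite dist_intN dist_int_small; last first.
    rewrite ger0_norm ?divr_ge0 ?(ltW Mp) // ler_pdivrMr // /M.
    by have : k%:R <= H%:R :> R; [rewrite ler_nat ltnW|lra].
  rewrite ger0_norm ?divr_ge0 ?(ltW Mp) // -ler_pdivlMr ?divr_gt0 // div1r invf_div.
  congr (_ <= _); congr cabs; apply: eq_bigr => t _; congr cexp; ring.
have arcE : RtoC (\sum_(i <- r | P i) arc H m (x i)) =
   RtoC (2 / M ^+ 2) * \sum_(0 <= h < H) \sum_(0 <= k < H) D (h%:R - k%:R) * S (h%:R - k%:R).
  rewrite /arc -mulr_sumr rmorphM /= -/M; congr (_ * _); rewrite rmorph_sum /=.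
  under eq_bigr => i _.
    rewrite rmorph_sum /=; under eq_bigr do rewrite fejer_expand.
    rewrite exchange_big /=; under eq_bigr do rewrite exchange_big /=; over.
  rewrite exchange_big /=; apply: eq_bigr => h _; rewrite exchange_big /=; apply: eq_bigr => k _.
  rewrite /D /S mulr_sumr; apply: eq_bigr => i _; rewrite mulr_suml; apply: eq_bigr => t _.
  by rewrite -cexpD; congr cexp; ring.
have D00 : D 0 = RtoC m.*2.+1%:R.
  rewrite /D; under eq_bigr do rewrite mulr0 cexp0.
  by rewrite sumr_const_nat subn0 rmorph_nat.
have S00 : S 0 = RtoC c.
  by rewrite /S /c rmorph_sum; apply: eq_bigr => i _ /=; rewrite mulr0 cexp0 rmorph1.
pose b k := cabs (D k%:R) * cabs (S k%:R).
have b0 k : 0 <= b k by rewrite mulr_ge0 ?cabs_ge0.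
have bE (h k : nat) : cabs (D (h%:R - k%:R) * S (h%:R - k%:R)) = b (h - k + (k - h))%N.
  rewrite cabsM /b; case: (leqP k h) => hk.
    by rewrite (eqnP hk) addn0 natrB.
  rewrite (eqnP (ltnW hk)) add0n natrB 1?ltnW //; congr (_ * _).
    rewrite /D -cabs_conj conjc_sum; congr cabs; apply: eq_bigr => t _.
    by rewrite -cexpN; congr cexp; ring.
  rewrite /S -cabs_cexp_sumN; congr cabs; apply: eq_bigr => i _.
  by congr cexp; ring.
have mean : `|\sum_(i <- r | P i) arc H m (x i) - m.*2.+1%:R / M * c| <=
    2 * \sum_(1 <= k < H) Num.min (2 * Delta + 1 / M) (1 / k%:R) * cabs (S k%:R).
  have -> : forall y z : R, `|y - z| = cabs (RtoC y - RtoC z).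
    by move=> y z; rewrite -cabs_real; congr cabs; exact: rmorphB.
  rewrite arcE.
  have -> : \sum_(0 <= h < H) \sum_(0 <= k < H) D (h%:R - k%:R) * S (h%:R - k%:R) =
     RtoC (H%:R * (m.*2.+1%:R * c)) +
     \sum_(0 <= h < H) \sum_(0 <= k < H | k != h) D (h%:R - k%:R) * S (h%:R - k%:R).
    have -> : RtoC (H%:R * (m.*2.+1%:R * c)) = \sum_(0 <= h < H) D 0 * S 0.
      have RM (y z : R) : RtoC (y * z) = RtoC y * RtoC z by exact: rmorphM.
      have RN n : RtoC n%:R = n%:R :> C by exact: rmorph_nat.
      by rewrite D00 S00 sumr_const_nat subn0 -[RHS]mulr_natl !RM !RN.
    rewrite -big_split /=; apply: eq_big_nat => h /andP[_ hH].
    by rewrite (bigD1_seq h) ?mem_index_iota ?iota_uniq //= subrr.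
  have -> : RtoC (m.*2.+1%:R / M * c) = RtoC (2 / M ^+ 2) * RtoC (H%:R * (m.*2.+1%:R * c)).
    by rewrite -rmorphM; congr RtoC; rewrite /M; field; exact: lt0r_neq0.
  rewrite mulrDr [_ + _ - _]addrC addKr cabsM cabs_real ger0_norm ?divr_ge0 ?sqr_ge0 //.
  apply: (@le_trans _ _ (2 / M ^+ 2 * (2 * H%:R * \sum_(1 <= k < H) b k))).
    apply: ler_wpM2l; first by rewrite divr_ge0 ?sqr_ge0.
    apply: le_trans (off_diagonal_sum H b0).
    apply: le_trans (cabs_sum _ _ _) _; apply: ler_sum => h _.
    by apply: le_trans (cabs_sum _ _ _) _; apply: ler_sum => k _; rewrite bE.
  have -> : 2 / M ^+ 2 * (2 * H%:R * \sum_(1 <= k < H) b k) = 2 * \sum_(1 <= k < H) b k / M.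
    by rewrite -mulr_suml /M; field; exact: lt0r_neq0.
  apply: ler_wpM2l => //; rewrite big_nat [leRHS]big_nat; apply: ler_sum => k kH.
  rewrite /b mulrAC; apply: ler_wpM2r; first exact: cabs_ge0.
  have kp : 0 < k%:R :> R by rewrite ltr0n; case/andP: kH.
  rewrite le_min; apply/andP; split; rewrite ler_pdivrMr //.
    apply: le_trans (Dm _) _; rewrite mulrDl divfK ?gt_eqF // -addn1 natrD -mul2n natrM lerD2r.
    by move: m1; lra.
  by rewrite div1r mulrC; exact: Dk.
have e1 : `|\sum_(i <- r | P i) (dist_int (x i) < Delta)%R%:R - \sum_(i <- r | P i) arc H m (x i)| <=
  \sum_(i <- r | P i) 8 / Num.max 8 (M * `|dist_int (x i) - Delta|).
  rewrite -sumrB; apply: le_trans (ler_norm_sum _ _ _) _; apply: ler_sum => i _.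
  exact: arc_error.
have e2 : `|m.*2.+1%:R / M * c - 2 * Delta * c| <= c / M.
  rewrite -mulrBl normrM (ger0_norm c0) mulrC; apply: ler_wpM2l => //.
  have -> : m.*2.+1%:R / M - 2 * Delta = (2 * m%:R + 1 - 2 * (M * Delta)) / M.
    by rewrite -addn1 natrD -mul2n natrM; field; exact: lt0r_neq0.
  rewrite normrM (@ger0_norm _ M^-1) ?invr_ge0 ?(ltW Mp) // ler_piMl ?invr_ge0 ?(ltW Mp) //.
  by move: m2; rewrite -addn1 natrD ler_norml => m2; apply/andP; split; lra.
move: mean e1 e2; rewrite /S; set A := \sum_(i <- r | P i) _%:R; set B := \sum_(i <- r | P i) arc _ _ _.
set E1 := \sum_(i <- r | P i) _; set E2 := 2 * \sum_(1 <= k < H) _.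
move=> h1 h2 h3.
have -> : A - 2 * Delta * c = (A - B) + (B - m.*2.+1%:R / M * c) + (m.*2.+1%:R / M * c - 2 * Delta * c) by ring.
have -> : c / M + E1 + E2 = E1 + E2 + c / M by ring.
apply: le_trans (ler_normD _ _) (lerD _ h3).
by apply: le_trans (ler_normD _ _) (lerD h2 h1).
Qed.

End Equidistribution.
End Fejer.

(** * From exponential sums to the discrepancy *)
Section Weights.
Context {R : realType}.

(** Summation by parts: for a non-increasing weight, comparing all initial sums
    compares the weighted sums. *)
Lemma weighted_sum_le (s a w : nat -> R) (G : nat) :
  (forall g, (g <= G)%N -> \sum_(1 <= k < g.+1) s k <= \sum_(1 <= k < g.+1) a k) ->
  (forall k, 0 <= w k) -> (forall k, w k.+2 <= w k.+1) ->
  \sum_(1 <= k < G.+1) w k * s k <= \sum_(1 <= k < G.+1) w k * a k.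
Proof.
move=> hs w0 wd; rewrite -subr_ge0 -sumrB.
suff : forall g, (g <= G)%N -> w g * \sum_(1 <= k < g.+1) (a k - s k) <=
   \sum_(1 <= k < g.+1) (w k * a k - w k * s k).
  move=> /(_ G (leqnn G)); apply: le_trans; apply: mulr_ge0 => //.
  by rewrite sumrB subr_ge0 hs.
elim=> [|g IH] gG; first by rewrite !big_geq // mulr0.
rewrite big_nat_recr //= [leRHS]big_nat_recr //= mulrDr -mulrBr lerD2r.
apply: le_trans (IH (ltnW gG)).
case: g {IH} gG => [|g] gG; first by rewrite big_geq // !mulr0.
by apply: ler_wpM2r (wd g); rewrite sumrB subr_ge0 hs // ltnW.
Qed.

Lemma sqrt_step (n : nat) :
  exists s t : R, [/\ 0 <= s, 0 < t, t ^+ 2 = s ^+ 2 + 1, s = Num.sqrt n%:R & t = Num.sqrt n.+1%:R].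
Proof.
exists (Num.sqrt n%:R), (Num.sqrt n.+1%:R); split => //.
by rewrite !sqr_sqrtr // natr1.
Qed.

Lemma sqrt_le_sum (G : nat) : Num.sqrt G%:R <= \sum_(1 <= k < G.+1) (Num.sqrt k%:R)^-1 :> R.
Proof.
elim: G => [|G IH]; first by rewrite big_geq // sqrtr0.
rewrite big_nat_recr //=; apply: le_trans (lerD IH (lexx _)).
have [s [t [s0 t0 e <- <-]]] := sqrt_step G.
rewrite -lerBlDl -[leRHS]div1r ler_pdivlMr //; nra.
Qed.

Lemma sum_inv_sqrt_le (G : nat) :
  \sum_(1 <= k < G.+1) (Num.sqrt k%:R)^-1 <= 2 * Num.sqrt G%:R :> R.
Proof.
elim: G => [|G IH]; first by rewrite big_geq // sqrtr0 mulr0.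
rewrite big_nat_recr //=; apply: le_trans (lerD IH (lexx _)) _.
have [s [t [s0 t0 e <- <-]]] := sqrt_step G.
rewrite -lerBrDl -[leLHS]div1r ler_pdivrMr //; nra.
Qed.

Lemma sum_three_halves (K n : nat) :
  \sum_(K.+1 <= k < K.+1 + n) (k%:R * Num.sqrt k%:R)^-1 <= 3 / Num.sqrt K.+1%:R :> R.
Proof.
have [_ [t [_ t0 _ _ tE]]] := sqrt_step K.
case: n => [|n]; first by rewrite addn0 big_geq // -tE divr_ge0 // ltW.
suff : \sum_(K.+1 <= k < K.+1 + n.+1) (k%:R * Num.sqrt k%:R)^-1 <=
   3 / Num.sqrt K.+1%:R - 2 / Num.sqrt (K.+1 + n)%:R :> R.
  move=> h; apply: le_trans h _; rewrite lerBlDr lerDl divr_ge0 // sqrtr_ge0.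
elim: n => [|n IH].
  rewrite addn0 addn1 big_nat1 -tE.
  have <- : t ^+ 2 = K.+1%:R by rewrite tE sqr_sqrtr.
  have t1 : 1 <= t by rewrite tE -[leLHS]sqrtr1 ler_sqrt // ler1n.
  rewrite -mulrBl invfM -[_ - _]/(3 - 2); have -> : 3 - 2 = 1 :> R by ring.
  by apply: ler_wpM2r; rewrite ?invr_ge0 ?(ltW t0) // invf_le1 ?exprn_gt0 // exprn_ege1.
rewrite addnS big_nat_recr ?leq_addr //=; apply: le_trans (lerD IH (lexx _)) _.
rewrite (addnS K.+1 n).
have [s [r [s0 r0 e sE <-]]] := sqrt_step (K.+1 + n).
have <- : r ^+ 2 = (K.+1 + n).+1%:R by rewrite e sE sqr_sqrtr // natr1.
rewrite -sE.
have sp : 0 < s by rewrite sE sqrtr_gt0 ltr0n.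
rewrite -addrA lerD2l -subr_ge0.
have -> : - (2 / r) - (- (2 / s) + (r ^+ 2 * r)^-1) = (2 * r ^+ 2 * (r - s) - s) / (s * r ^+ 3).
  by field; rewrite !gt_eqF.
apply: divr_ge0; last by rewrite mulr_ge0 ?exprn_ge0 // ltW.
have h : (r - s) * (r + s) = 1 by rewrite -subr_sqr e; ring.
have -> : 2 * r ^+ 2 * (r - s) - s = (r - s) * (2 * r ^+ 2 - s * (r + s)) + s * ((r - s) * (r + s) - 1).
  by ring.
have sr : 0 <= r - s by move: s0 r0 h; nra.
by rewrite h subrr mulr0 addr0 mulr_ge0 //; move: s0 r0 sr; nra.
Qed.

(** The weight [min D (1 / k)] decays like [1 / k] only beyond [1 / D]; against
    [1 / sqrt k] both ranges contribute [sqrt D]. *)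
Lemma weight_sqrt_sum (D : R) (G : nat) : 0 < D ->
  \sum_(1 <= k < G.+1) Num.min D (1 / k%:R) * (Num.sqrt k%:R)^-1 <= 5 * Num.sqrt D.
Proof.
move=> D0; pose K := Num.truncn D^-1.
have /andP[K1 K2] : K%:R <= D^-1 < K.+1%:R by apply: truncn_itv; rewrite invr_ge0 ltW.
set d := Num.sqrt D; have d0 : 0 < d by rewrite sqrtr_gt0.
have dE : d ^+ 2 = D by rewrite sqr_sqrtr // ltW.
have sK : Num.sqrt K%:R <= d^-1 by rewrite /d -sqrtrV ?(ltW D0) //; apply: ler_wsqrtr.
have sK1 : (Num.sqrt K.+1%:R)^-1 <= d.
  rewrite -[leRHS]invrK lef_pV2 ?posrE ?invr_gt0 ?sqrtr_gt0 ?ltr0n //.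
  by rewrite /d -sqrtrV ?(ltW D0) //; apply: ler_wsqrtr; exact: ltW.
have w0 k : 0 <= (Num.sqrt k%:R)^-1 :> R by rewrite invr_ge0 sqrtr_ge0.
have hA n : \sum_(1 <= k < n.+1) Num.min D (1 / k%:R) * (Num.sqrt k%:R)^-1 <= D * (2 * Num.sqrt n%:R).
  apply: (@le_trans _ _ (\sum_(1 <= k < n.+1) D * (Num.sqrt k%:R)^-1)).
    by apply: ler_sum => k _; apply: ler_wpM2r; rewrite // ge_min lexx.
  by rewrite -mulr_sumr; apply: ler_wpM2l (sum_inv_sqrt_le n); exact: ltW.
have hAK : D * (2 * Num.sqrt K%:R) <= 2 * d.
  have -> : 2 * d = D * (2 * d^-1) by rewrite -dE; field; exact: lt0r_neq0.
  by apply: ler_wpM2l; [exact: ltW|apply: ler_wpM2l].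
case: (leqP G K) => GK.
  apply: le_trans (hA G) _; apply: (@le_trans _ _ (D * (2 * Num.sqrt K%:R))); last by lra.
  by apply: ler_wpM2l; [exact: ltW|apply: ler_wpM2l => //; rewrite ler_sqrt // ler_nat].
rewrite (@big_cat_nat _ _ _ K.+1) //=; last exact: ltnW.
have -> : 5 * d = 2 * d + 3 * d by ring.
apply: lerD; first exact: le_trans (hA K) hAK.
apply: (@le_trans _ _ (3 / Num.sqrt K.+1%:R)); last by apply: ler_wpM2l.
have -> : G.+1 = (K.+1 + (G.+1 - K.+1))%N by lia.
apply: le_trans (sum_three_halves K _); apply: ler_sum => k _.
by rewrite invfM; apply: ler_wpM2r => //; rewrite ge_min div1r lexx orbT.
Qed.

End Weights.

Section ClassSums.
Context {R : realType} (al : R) (v u : nat) (a : int) (q : nat).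
Hypotheses (v0 : (0 < v)%N) (q0 : (0 < q)%N) (co : coprimez a q)
  (tha : `|al * v%:R - a%:~R / q%:R| <= 1 / q%:R ^+ 2).
Local Notation C := R[i].
Local Notation in_class n := (prime n && (n %% v == u %% v)%N).

(** Dropping primality: the integers of a residue class modulo [v] form a linear
    sequence of slope [al * v], to which [min_sum] applies. *)
Lemma class_min_sum (X : nat) (be W : R) (f : R -> R) : 0 <= W ->
  (forall y, 0 <= f y <= W) -> (forall y, f y * dist_int y <= 1) ->
  \sum_(1 <= n < X.+1 | in_class n) f (al * n%:R - be) <=
  (X.+1%:R / q%:R + 1) * (5 * W + 6 * q%:R * (1 + ln q%:R)).
Proof.
move=> W0 hf hd; have f0 y : 0 <= f y by case/andP: (hf y).
set k0 := (u %% v)%N; have k0v : (k0 < v)%N by rewrite ltn_mod.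
apply: (@le_trans _ _ (\sum_(0 <= n < X.+1 | (n %% v)%N == k0) f (al * n%:R - be))).
  rewrite [leRHS]big_ltn_cond // -/k0.
  have h : \sum_(1 <= n < X.+1 | in_class n) f (al * n%:R - be) <=
           \sum_(1 <= n < X.+1 | (n %% v)%N == k0) f (al * n%:R - be).
    rewrite big_mkcond [leRHS]big_mkcond; apply: ler_sum => n _ /=.
    by case: (prime n); case: eqP.
  by case: ifP => _ //; apply: le_trans h _; rewrite lerDr.
rewrite (sum_residue (fun n => f (al * n%:R - be)) X k0v).
set J := ((X + v - k0) %/ v)%N.
have JX : (J <= X.+1)%N.
  apply: leq_trans (leq_div2r v (leq_subr k0 (X + v))) _.
  by rewrite divnDr ?dvdnn // divnn v0 addn1 ltnS leq_div.
apply: (@le_trans _ _ ((J%:R / q%:R + 1) * (5 * W + 6 * q%:R * (1 + ln q%:R)))).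
  apply: (@min_sum R (al * v%:R) (al * k0%:R - be) W a q J
    (fun j => f (al * (k0 + v * j)%N%:R - be)) q0 co tha W0) => j _; split => //.
  by have -> : al * v%:R * j%:R + (al * k0%:R - be) = al * (k0 + v * j)%N%:R - be
    by rewrite natrD natrM; ring.
apply: ler_wpM2r.
  by rewrite addr_ge0 ?mulr_ge0 // addr_ge0 // ln_ge0 // ler1n.
by rewrite lerD2r; apply: ler_wpM2r; rewrite ?invr_ge0 // ler_nat.
Qed.

(** The indicator divided by [Delta] is at most the inverse of the distance to the
    integers. *)
Lemma class_small_arc (X : nat) (be Delta : R) : 0 < Delta ->
  \sum_(1 <= n < X.+1 | in_class n) (dist_int (al * n%:R - be) < Delta)%R%:R <=
  (X.+1%:R / q%:R + 1) * (5 + 6 * (Delta * q%:R) * (1 + ln q%:R)).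
Proof.
move=> D0; pose f (y : R) := (dist_int y < Delta)%R%:R / Delta.
have := @class_min_sum X be (1 / Delta) f.
rewrite /f -mulr_suml => h.
have {}h : (\sum_(1 <= n < X.+1 | in_class n) (dist_int (al * n%:R - be) < Delta)%R%:R) / Delta
   <= (X.+1%:R / q%:R + 1) * (5 * (1 / Delta) + 6 * q%:R * (1 + ln q%:R)).
  apply: h; first by rewrite divr_ge0 // ltW.
    move=> y; rewrite divr_ge0 ?(ltW D0) //=; apply: ler_wpM2r; rewrite ?invr_ge0 ?(ltW D0) //.
    by case: (_ < _).
  move=> y; case: ltP => h /=; last by rewrite !mul0r.
  by rewrite mul1r mulrC ler_pdivrMr // mul1r ltW.
move: h; rewrite ler_pdivrMr // => h; apply: le_trans h _.
rewrite le_eqVlt; apply/orP; left; apply/eqP; field.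
by rewrite (gt_eqF D0) pnatr_eq0 -lt0n q0.
Qed.

(** Being close to the boundary of the arc means that the point shifted by [Delta] or
    [- Delta] is close to an integer; which of the two depends on the side of the
    nearest integer. *)
Lemma class_boundary (X : nat) (be Delta M : R) : 0 < M ->
  \sum_(1 <= n < X.+1 | in_class n) 8 / Num.max 8 (M * `|dist_int (al * n%:R - be) - Delta|) <=
  2 * ((X.+1%:R / q%:R + 1) * (5 + 48 * q%:R * (1 + ln q%:R) / M)).
Proof.
move=> M0; pose f (y : R) := M / Num.max 8 (M * dist_int y).
have mx0 (z : R) : 0 < Num.max 8 z by rewrite lt_max ltr0n.
have key b : 8 / M * \sum_(1 <= n < X.+1 | in_class n) f (al * n%:R - b) <=
   (X.+1%:R / q%:R + 1) * (5 + 48 * q%:R * (1 + ln q%:R) / M).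
  have h : \sum_(1 <= n < X.+1 | in_class n) f (al * n%:R - b) <=
     (X.+1%:R / q%:R + 1) * (5 * (M / 8) + 6 * q%:R * (1 + ln q%:R)).
    apply: class_min_sum; first by rewrite divr_ge0 // ltW.
      move=> y; rewrite /f divr_ge0 ?(ltW M0) ?(ltW (mx0 _)) //=.
      by apply: ler_wpM2l; [exact: ltW|rewrite lef_pV2 ?posrE // le_max lexx].
    move=> y; rewrite /f mulrAC ler_pdivrMr // mul1r le_max lexx orbT //.
  apply: le_trans (ler_wpM2l _ h) _; first by rewrite divr_ge0 // ltW.
  rewrite le_eqVlt; apply/orP; left; apply/eqP; field.
  by rewrite (gt_eqF M0) pnatr_eq0 -lt0n q0.
have -> : 2 * ((X.+1%:R / q%:R + 1) * (5 + 48 * q%:R * (1 + ln q%:R) / M)) =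
  (X.+1%:R / q%:R + 1) * (5 + 48 * q%:R * (1 + ln q%:R) / M) +
  (X.+1%:R / q%:R + 1) * (5 + 48 * q%:R * (1 + ln q%:R) / M) by ring.
apply: le_trans (lerD (key (be + Delta)) (key (be - Delta))).
rewrite -mulrDr -big_split mulr_sumr /=; apply: ler_sum => n _.
have -> : al * n%:R - (be + Delta) = al * n%:R - be - Delta by ring.
have -> : al * n%:R - (be - Delta) = al * n%:R - be + Delta by ring.
move: (al * n%:R - be) => x.
have aux (d e : R) : d <= e -> 8 / Num.max 8 (M * e) <= 8 / M * (M / Num.max 8 (M * d)).
  move=> de; rewrite mulrA divfK ?gt_eqF //; apply: ler_wpM2l => //.
  rewrite lef_pV2 ?posrE // ge_max !le_max lexx /=; apply/orP; right.
  by apply: ler_wpM2l => //; exact: ltW.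
have f0 y : 0 <= 8 / M * f y by rewrite mulr_ge0 // divr_ge0 // ?(ltW M0) ?(ltW (mx0 _)).
rewrite mulrDr; have [m hm _] := dist_int_attained x.
case: (lerP 0 (x - m%:~R)) => s.
  apply: le_trans (aux (dist_int (x - Delta)) _ _) _; last by rewrite lerDl.
  rewrite hm (ger0_norm s); apply: le_trans (dist_int_le _ m) _.
  by rewrite addrAC.
apply: le_trans (aux (dist_int (x + Delta)) _ _) _; last by rewrite lerDr.
rewrite hm (ltr0_norm s); apply: le_trans (dist_int_le _ m) _.
rewrite -normrN le_eqVlt; apply/orP; left; apply/eqP; congr `|_|; ring.
Qed.

(** The shift [be] only contributes a phase common to all terms. *)
Lemma class_expsum (X : nat) (be : R) (k : nat) :
  cabs (\sum_(1 <= n < X.+1 | in_class n) cexp ((al * n%:R - be) * k%:R)) =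
  cabs (\sum_(1 <= n < X.+1 | prime n) twist al v u k n).
Proof.
have -> : \sum_(1 <= n < X.+1 | in_class n) cexp ((al * n%:R - be) * k%:R) =
  cexp (- be * k%:R) * \sum_(1 <= n < X.+1 | prime n) twist al v u k n.
  rewrite big_mkcondr mulr_sumr /=; apply: eq_bigr => n _; rewrite /twist.
  case: ifP => _; last by rewrite mulr0.
  by rewrite -cexpD; congr cexp; rewrite natrM; ring.
by rewrite cabsM cabs_cexp mul1r.
Qed.

Lemma discrepancy_trivial (X : nat) (be Delta : R) : 0 < Delta -> Delta < 1 / 2 ->
  `|\sum_(1 <= n < X.+1 | in_class n) (dist_int (al * n%:R - be) < Delta)%R%:R -
    2 * Delta * \sum_(1 <= n < X.+1 | in_class n) 1| <= X%:R.
Proof.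
move=> D0 D2; have h : \sum_(1 <= n < X.+1 | in_class n) 1 <= X%:R :> R.
  apply: (@le_trans _ _ (\sum_(1 <= n < X.+1) 1)).
    by rewrite big_mkcond; apply: ler_sum => n _; case: ifP.
  by rewrite sumr_const_nat subn1.
have h0 : 0 <= \sum_(1 <= n < X.+1 | in_class n) 1 :> R by rewrite sumr_ge0.
have h1 : \sum_(1 <= n < X.+1 | in_class n) (dist_int (al * n%:R - be) < Delta)%R%:R <=
  \sum_(1 <= n < X.+1 | in_class n) 1 :> R by apply: ler_sum => n _; case: (_ < _).
have h2 : 0 <= \sum_(1 <= n < X.+1 | in_class n) (dist_int (al * n%:R - be) < Delta)%R%:R :> R.
  by rewrite sumr_ge0.
move: h h0 h1 h2; set A := \sum_(1 <= n < _ | _) _; set B := \sum_(1 <= n < _ | _) _.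
move=> h h0 h1 h2; rewrite ler_norml; apply/andP; split; nra.
Qed.

(** The Fejer kernels have degree about [X ^ (1 / 4)].  In the weighted sum of the
    exponential sums, the average bound of order [G] costs one more logarithm, and
    the one of order [sqrt G] gains a factor [sqrt Delta] by [weight_sqrt_sum]. *)
Lemma discrepancy_of_expsums (c0 E T l be Delta : R) (X : nat) :
  (1 < X)%N -> 0 < T -> T ^+ 12 = X%:R -> (q <= X ^ 2)%N -> 175 <= c0 -> 1 <= E -> 1 <= l ->
  (forall n, (0 < n)%N -> (n <= X ^ 2)%N -> 1 + ln n%:R <= l) ->
  (forall g, (0 < g)%N -> (g <= X)%N ->
    \sum_(1 <= h < g.+1) cabs (\sum_(1 <= n < X.+1 | prime n) twist al v u h n) <=
    c0 * (l ^+ 6 * (X%:R / Num.sqrt q%:R + T ^+ 9) * g%:R +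
      l ^+ 6 * Num.sqrt l * (T ^+ 10 + T ^+ 6 * Num.sqrt q%:R) * Num.sqrt g%:R + E * l * q%:R)) ->
  0 < Delta -> Delta < 1 / 2 -> 1 <= Delta * T ^+ 3 ->
  `|\sum_(1 <= n < X.+1 | in_class n) (dist_int (al * n%:R - be) < Delta)%R%:R -
    2 * Delta * \sum_(1 <= n < X.+1 | in_class n) 1| <=
  20 * c0 * (l ^+ 7 *
  (X%:R / Num.sqrt q%:R + T ^+ 9 + T ^+ 10 * Num.sqrt Delta +
   T ^+ 6 * Num.sqrt q%:R * Num.sqrt Delta + E * q%:R * Delta)).
Proof.
move=> X1 T0 TX qX c175 E1 l1 hln hexp D0 D2 DT.
have l0 : 0 <= l by exact: le_trans l1.
have T1 : 1 <= T.
  rewrite leNgt; apply/negP => h; have : T ^+ 12 < 1 by rewrite exprn_ilt1 ?ltW.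
  by rewrite TX ltNge ler1n (ltnW X1).
have Tn n : 0 <= T ^+ n by rewrite exprn_ge0 // ltW.
pose G := Num.truncn (T ^+ 3).
have /andP[GT GT1] : G%:R <= T ^+ 3 < G.+1%:R by exact: truncn_itv.
have G0 : (0 < G)%N by rewrite truncn_gt0 exprn_ege1.
have GX : (G <= X)%N.
  by rewrite -(ler_nat R) -TX; apply: le_trans GT _; exact: ler_weXn2l.
have X0' : 0 < X%:R :> R by rewrite ltr0n ltnW.
have qp : 0 < q%:R :> R by rewrite ltr0n.
pose M : R := 2 * G.+1%:R.
have M0 : 0 < M by rewrite mulr_gt0.
have T3 : 0 < T ^+ 3 by rewrite exprn_gt0.
have MT : T ^+ 3 <= M / 2 by rewrite /M mulrC mulKf // ltW.
set sq := Num.sqrt q%:R; set sD := Num.sqrt Delta; set Q := X%:R / sq.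
have sq1 : 1 <= sq by rewrite -[leLHS]sqrtr1 ler_sqrt // ler1n.
have sD0 : 0 <= sD by exact: sqrtr_ge0.
have Q0 : 0 <= Q by rewrite divr_ge0 // sqrtr_ge0.
apply: le_trans (@discrepancy_le R nat _ _ _ G.+1 Delta isT D0 D2) _.
rewrite -/M.
(* There are at most [X = T ^ 12] points and [M] exceeds [T ^ 3]. *)
have h1 : (\sum_(1 <= n < X.+1 | in_class n) 1) / M <= T ^+ 9.
  rewrite ler_pdivrMr //; apply: (@le_trans _ _ X%:R).
    apply: (@le_trans _ _ (\sum_(1 <= n < X.+1) 1)).
      by rewrite big_mkcond; apply: ler_sum => n _; case: ifP.
    by rewrite sumr_const_nat subn1.
  by rewrite -TX (exprD T 9 3); apply: ler_wpM2l => //; lra.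
(* Here [M] exceeds [2 * T ^ 3], and [1 / T ^ 3 <= Delta] by hypothesis. *)
have h2 : \sum_(1 <= n < X.+1 | in_class n) 8 / Num.max 8 (M * `|dist_int (al * n%:R - be) - Delta|)
   <= 20 * Q + 10 + 96 * (l * T ^+ 9) + 48 * (l * (q%:R * Delta)).
  apply: le_trans (class_boundary _ _ _ M0) _.
  pose t := (T ^+ 3)^-1.
  have t0 : 0 <= t by rewrite invr_ge0.
  have tD : t <= Delta by rewrite -[t]div1r ler_pdivrMr.
  have XT : X%:R * t = T ^+ 9 by rewrite -TX (exprD T 9 3) /t mulfK // gt_eqF.
  have a1 : 48 * q%:R * (1 + ln q%:R) / M <= 24 * (q%:R * l * t).
    have -> : 24 * (q%:R * l * t) = 48 * q%:R * l * (t / 2) by field.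
    rewrite -(mulrA _ _ M^-1) -(mulrA _ l); apply: ler_wpM2l; first by rewrite mulr_ge0.
    apply: ler_pM; rewrite ?invr_ge0 ?(ltW M0) //; [|exact: hln|].
      by rewrite addr_ge0 // ln_ge0 // ler1n.
    rewrite /t -invfM lef_pV2 ?posrE ?mulr_gt0 //; move: MT; lra.
  pose Y : R := X%:R / q%:R.
  have YQ : Y <= Q.
    apply: ler_wpM2l => //; rewrite lef_pV2 ?posrE ?(lt_le_trans ltr01 sq1) //.
    by rewrite -[leRHS](@sqr_sqrtr R) ?(ltW qp) // -/sq expr2 ler_peMl // (le_trans ler01 sq1).
  have Y0 : 0 <= Y by rewrite divr_ge0.
  have Yq : Y * q%:R = X%:R by rewrite divfK // gt_eqF.
  have a2 : X.+1%:R / q%:R <= 2 * Y.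
    rewrite /Y mulrA; apply: ler_wpM2r; first by rewrite invr_ge0.
    by rewrite -natrM ler_nat mul2n -addnn -addn1 leq_add2l ltnW.
  have a3 : 0 <= 48 * q%:R * (1 + ln q%:R) / M.
    rewrite divr_ge0 ?(ltW M0) // mulr_ge0 // ?mulr_ge0 // addr_ge0 // ln_ge0 // ler1n //.
  apply: (@le_trans _ _ (2 * ((2 * Y + 1) * (5 + 24 * (q%:R * l * t))))).
    apply: ler_wpM2l => //.
    by apply: ler_pM; [rewrite addr_ge0 // divr_ge0|rewrite addr_ge0|rewrite lerD2r|rewrite lerD2l].
  have -> : 2 * ((2 * Y + 1) * (5 + 24 * (q%:R * l * t))) =
    20 * Y + 10 + 96 * (l * ((Y * q%:R) * t)) + 48 * (l * (q%:R * t)) by ring.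
  rewrite Yq XT.
  have : l * (q%:R * t) <= l * (q%:R * Delta) by apply: ler_wpM2l => //; apply: ler_wpM2l.
  by move: YQ; lra.
(* The bound for frequencies up to [g] is compared with the sum over [k <= g] of
   [A + B / sqrt k], plus the term [Z], which does not grow with [g] and is charged
   to [k = 1]. *)
have h3 : \sum_(1 <= k < G.+1) Num.min (2 * Delta + 1 / M) (1 / k%:R) *
    cabs (\sum_(1 <= n < X.+1 | in_class n) cexp ((al * n%:R - be) * k%:R)) <=
  c0 * (l ^+ 6 * (Q + T ^+ 9) * l + l ^+ 6 * Num.sqrt l * (T ^+ 10 + T ^+ 6 * sq) * (9 * sD) +
    E * l * q%:R * (3 * Delta)).
  set D := 2 * Delta + 1 / M.
  have D0' : 0 < D by rewrite /D addr_gt0 ?divr_gt0 // mulr_gt0.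
  have D3 : D <= 3 * Delta.
    have : 1 / M <= Delta; last by rewrite /D; lra.
    rewrite ler_pdivrMr //; apply: le_trans DT _; apply: ler_wpM2l; first exact: ltW.
    by move: MT M0; lra.
  set A := l ^+ 6 * (Q + T ^+ 9); set B := l ^+ 6 * Num.sqrt l * (T ^+ 10 + T ^+ 6 * sq).
  have l60 : 0 <= l ^+ 6 by rewrite exprn_ge0.
  have A0 : 0 <= A by rewrite mulr_ge0 // addr_ge0.
  have B0 : 0 <= B by rewrite mulr_ge0 ?mulr_ge0 ?sqrtr_ge0 // addr_ge0 // mulr_ge0 // sqrtr_ge0.
  set Z := E * l * q%:R.
  have Z0 : 0 <= Z by rewrite mulr_ge0 // mulr_ge0 // (le_trans ler01).
  have c00 : 0 <= c0 by apply: le_trans c175.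
  pose w (k : nat) : R := Num.min D (1 / k%:R).
  have w0 k : 0 <= w k by rewrite le_min (ltW D0') divr_ge0.
  have hZ (F : nat -> R) n : (1 < n)%N -> \sum_(1 <= k < n) (if k == 1%N then F k else 0) = F 1%N.
    move=> n1; rewrite big_ltn //= big_nat_cond big1 ?addr0 // => i /andP[/andP[i2 _] _].
    by rewrite gtn_eqF.
  apply: (@le_trans _ _ (\sum_(1 <= k < G.+1) w k * (c0 * (A + B * (Num.sqrt k%:R)^-1 + (if k == 1%N then Z else 0))))).
    apply: weighted_sum_le => // [g gG|k].
      case: g gG => [|g] gG; first by rewrite !big_geq.
      under eq_bigr do rewrite class_expsum.
      apply: le_trans (hexp g.+1 isT (leq_trans gG GX)) _.
      rewrite -mulr_sumr; apply: ler_wpM2l => //.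
      rewrite -/sq -/Q -/A -/B -/Z.
      rewrite !big_split /= sumr_const_nat subn1 /= -[A *+ _]mulr_natr -mulr_sumr.
      rewrite (hZ (fun=> Z)) // lerD2r lerD2l; apply: ler_wpM2l => //.
      exact: sqrt_le_sum.
    by rewrite /w le_min !ge_min lexx /= !div1r lef_pV2 ?posrE ?ltr0n // ler_nat leqnSn orbT.
  under eq_bigr do rewrite mulrCA.
  rewrite -mulr_sumr; apply: ler_wpM2l => //.
  under eq_bigr do rewrite !mulrDr.
  rewrite !big_split /=; apply: lerD; [apply: lerD|].
  - rewrite -mulr_suml mulrC; apply: ler_wpM2l => //.
    apply: le_trans (hln G G0 _); last by apply: leq_trans GX _; rewrite -{1}(expn1 X) leq_exp2l.
    apply: le_trans (@harmonic_le R G G0); apply: ler_sum => k _.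
    by rewrite /w ge_min div1r lexx orbT.
  - under eq_bigr do rewrite mulrCA.
    rewrite -mulr_sumr; apply: ler_wpM2l => //.
    apply: le_trans (weight_sqrt_sum _ D0') _.
    rewrite -(@ler_pXn2r _ 2) ?nnegrE ?mulr_ge0 ?sqrtr_ge0 // !exprMn !sqr_sqrtr ?(ltW D0) ?(ltW D0') //.
    by move: D3; lra.
  have -> : \sum_(1 <= k < G.+1) w k * (if k == 1%N then Z else 0) = w 1%N * Z.
    rewrite -(hZ (fun k => w k * Z) G.+1) //; apply: eq_bigr => k _.
    by case: ifP => _; rewrite ?mulr0.
  rewrite mulrC; apply: ler_wpM2l => //; apply: le_trans D3.
  by rewrite /w ge_min lexx.
set s := Q + T ^+ 9 + _ + _ + _.
set l7 := l ^+ 7.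
have l71 : l <= l7 by rewrite -[leLHS]expr1; apply: ler_weXn2l.
have hs1 : 0 <= T ^+ 10 * sD by rewrite mulr_ge0.
have hs2 : 0 <= T ^+ 6 * sq * sD by rewrite mulr_ge0 // mulr_ge0 // (le_trans ler01 sq1).
have qD0 : 0 <= q%:R * Delta by rewrite mulr_ge0 // ltW.
have hz : q%:R * Delta <= E * q%:R * Delta by rewrite -mulrA ler_peMl.
have T91 : 1 <= T ^+ 9 by rewrite exprn_ege1.
have sE : s = (Q + T ^+ 9) + (T ^+ 10 * sD + T ^+ 6 * sq * sD) + E * q%:R * Delta by rewrite /s; ring.
have s0 : 0 <= s by rewrite sE; lra.
have ls : s <= l7 * s by rewrite ler_peMl //; lra.
have lt (x : R) : 0 <= x -> x <= s -> l * x <= l7 * s by move=> *; exact: ler_pM.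
have k1 := lt (T ^+ 9) (Tn 9%N); have k2 := lt (q%:R * Delta) qD0.
have {}k1 : l * T ^+ 9 <= l7 * s by apply: k1; rewrite sE; lra.
have {}k2 : l * (q%:R * Delta) <= l7 * s by apply: k2; rewrite sE; lra.
have sl : Num.sqrt l <= l.
  rewrite -[leRHS](@sqr_sqrtr R) // expr2 ler_peMl ?sqrtr_ge0 // -[leLHS]sqrtr1.
  exact: ler_wsqrtr.
have h4 : l ^+ 6 * (Q + T ^+ 9) * l + l ^+ 6 * Num.sqrt l * (T ^+ 10 + T ^+ 6 * sq) * (9 * sD) +
    E * l * q%:R * (3 * Delta) <= 9 * (l7 * s).
  apply: (@le_trans _ _ (l7 * (Q + T ^+ 9) + 9 * (l7 * (T ^+ 10 * sD + T ^+ 6 * sq * sD)) +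
     3 * (l7 * (E * q%:R * Delta)))).
    apply: lerD; [apply: lerD|].
    - by rewrite le_eqVlt /l7 exprSr; apply/orP; left; apply/eqP; ring.
    - have -> : l ^+ 6 * Num.sqrt l * (T ^+ 10 + T ^+ 6 * sq) * (9 * sD) =
        9 * (l ^+ 6 * Num.sqrt l * (T ^+ 10 * sD + T ^+ 6 * sq * sD)) by ring.
      apply: ler_wpM2l => //; apply: ler_wpM2r; first exact: addr_ge0.
      by rewrite /l7 (exprSr l 6); apply: ler_wpM2l => //; rewrite exprn_ge0.
    - have -> : E * l * q%:R * (3 * Delta) = 3 * (l * (E * q%:R * Delta)) by ring.
      by apply: ler_wpM2l => //; apply: ler_wpM2r => //; lra.
  rewrite sE !mulrDr -!addrA.
  have l70 : 0 <= l7 by exact: le_trans l71.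
  have p1 : 0 <= l7 * (Q + T ^+ 9) by rewrite mulr_ge0 ?addr_ge0.
  have p2 : 0 <= l7 * (E * q%:R * Delta) by rewrite mulr_ge0 // (le_trans qD0).
  by move: p1 p2; rewrite !mulrDr; lra.
move: h1 h2 h3; set S1 := _ / M; set S2 := \sum_(1 <= n < X.+1 | _) _; set S3 := \sum_(1 <= k < G.+1) _.
move=> h1 h2 h3.
have {}h3 : S3 <= c0 * (9 * (l7 * s)).
  by apply: le_trans h3 _; apply: ler_wpM2l h4; apply: le_trans c175.
have hc : 175 * (l7 * s) <= c0 * (l7 * s) by apply: ler_wpM2r => //; exact: le_trans ls.
have q1 : Q <= s by rewrite sE; lra.
have q2 : T ^+ 9 <= s by rewrite sE; lra.
have -> : 20 * c0 * (l7 * s) = 20 * (c0 * (l7 * s)) by ring.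
move: h3; have -> : c0 * (9 * (l7 * s)) = 9 * (c0 * (l7 * s)) by ring.
move: hc ls k1 k2 T91 q1 q2 h1 h2; lra.
Qed.

Theorem discrepancy_bound (K eps T l be Delta : R) (X : nat) :
  (16 <= X)%N -> 0 < T -> T ^+ 12 = X%:R -> T ^+ 3 <= q%:R -> (q <= X ^ 2)%N ->
  0 < K -> 0 < eps -> eps <= 1 -> X%:R `^ (2 * eps) <= T ->
  (forall n, (0 < n)%N -> tau n <= K * n%:R `^ eps) ->
  l = 4 * ln X%:R -> 0 < Delta -> Delta < 1 / 2 -> 1 <= Delta * T ^+ 3 ->
  `|\sum_(1 <= n < X.+1 | in_class n) (dist_int (al * n%:R - be) < Delta)%R%:R -
    2 * Delta * \sum_(1 <= n < X.+1 | in_class n) 1| <=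
  20 * (10000 * v%:R * (K + 1)) * (l ^+ 7 *
  (X%:R / Num.sqrt q%:R + T ^+ 9 + T ^+ 10 * Num.sqrt Delta +
   T ^+ 6 * Num.sqrt q%:R * Num.sqrt Delta + X%:R `^ (2 * eps) * q%:R * Delta)).
Proof.
move=> X16 T0 TX Tq qX K0 e0 e1 ET htau lE D0 D2 DT.
have X1 : (1 < X)%N by apply: leq_trans X16.
have lnX1 := ln_ge1 R X16.
apply: discrepancy_of_expsums => //.
- rewrite -[175]mulr1 -[175 * 1]mulr1; apply: ler_pM => //; last by rewrite lerDr ltW.
  by apply: ler_pM; rewrite ?ler1n ?ler_nat.
- by rewrite -[leLHS](powRr0 X%:R) ler_powR ?ler1n ?(ltnW X1) // mulr_ge0 // ltW.
- by rewrite lE; lra.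
- move=> n n0 nX; have : ln n%:R <= ln (X ^ 2)%:R :> R.
    by rewrite ler_ln ?posrE ?ltr0n ?ler_nat // expn_gt0 (ltnW X1).
  rewrite natrX lnXn ?ltr0n ?(ltnW X1) // -[_ *+ 2]mulr_natl lE.
  by move: lnX1; lra.
- move=> g g0 gX.
  exact: (@prime_exponential_sums R al v u a q v0 q0 co tha K eps T l X g X16 T0 TX Tq qX K0 e0 e1 ET htau g0 gX lE).
Qed.

End ClassSums.

(** * The counting estimate *)

Section Counting.
Context {R : realType}.

Lemma count_uptoE (N : R) (A : set nat) (P : pred nat) :
  (forall n, A n <-> P n) -> ~~ P 0%N ->
  (count_upto N A)%:R = \sum_(1 <= n < (Num.truncn N).+1 | P n) 1 :> R.
Proof.
move=> AP P0; rewrite big_const_seq iter_addr addr0 -size_filter; congr (_%:R).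
apply: perm_size; apply: uniq_perm; rewrite ?fset_uniq ?filter_uniq ?iota_uniq // => n.
have -> : (n \in enum_fset (fset_set (A `&` [set l | l%:R <= N]))) = (n \in A `&` [set l | l%:R <= N]).
  exact: (in_fset_set (finite_upto N A) n).
rewrite mem_filter mem_index_iota; apply/idP/idP.
  rewrite inE => -[/AP Pn /= nN]; rewrite Pn ltnS truncn_ge_nat ?nN ?andbT; last first.
    by apply: le_trans nN.
  by rewrite lt0n; apply: contraNneq P0 => <-.
move=> /andP[Pn /andP[n0]]; rewrite ltnS => nN; rewrite inE; split; first exact/AP.
apply: le_trans (_ : (Num.truncn N)%:R <= N); first by rewrite ler_nat.
have N1 : 1 <= N by rewrite -truncn_gt0 (leq_trans n0).
by case/andP: (truncn_itv (le_trans ler01 N1)).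
Qed.
End Counting.

Section PartTwo.
Context {R : realType} (v : nat).
Hypothesis v0 : (0 < v)%N.

Lemma powR_ge1 (x r : R) : 1 <= x -> 0 <= r -> 1 <= x `^ r.
Proof. by move=> x1 r0; rewrite -[leLHS](powRr0 x); exact: ler_powR. Qed.

Lemma powR_twelfth (x : R) (k : nat) : (x `^ (1 / 12)) ^+ k = x `^ (k%:R / 12).
Proof. by rewrite -powR_mulrn ?powR_ge0 // -powRrM; congr (_ `^ _); field. Qed.

Lemma sqrt_powR (x : R) : 0 <= x -> x `^ (1 / 2) = Num.sqrt x.
Proof. by move=> x0; rewrite div1r powR12_sqrt. Qed.

Definition error_terms (N q Delta eps : R) : R :=
  N * q `^ (- (1 / 2)) + N `^ (3 / 4) + N `^ (5 / 6) * Delta `^ (1 / 2)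
  + (Delta * N * q) `^ (1 / 2) + N `^ eps * q * Delta `^ (1 - eps).

Section Fixed.
Context (u : nat) (al be N Delta eps K : R) (a : int) (q : nat).
Local Notation in_class n := (prime n && (n %% v == u %% v)%N).
Local Notation X := (Num.truncn N).
Local Notation L := (ln (N * q%:R / Delta)).
Local Notation T := ((X%:R : R) `^ (1 / 12)).
Hypotheses (N1 : 1 <= N) (D0 : 0 < Delta) (D2 : Delta < 1 / 2) (co : coprimez a q)
  (qN : N `^ (1 / 4) < q%:R) (tha : `|al * v%:R - a%:~R / q%:R| <= 1 / q%:R ^+ 2)
  (K0 : 0 < K) (e0 : 0 < eps).

Lemma q_gt1 : (1 < q)%N.
Proof.
rewrite -(ltr_nat R); apply: le_lt_trans qN.
exact: powR_ge1.
Qed.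

Let qp : 0 < q%:R :> R. Proof. by rewrite ltr0n ltnW // q_gt1. Qed.
Let N0 : 0 < N. Proof. by exact: lt_le_trans ltr01 N1. Qed.

Lemma X_bounds : X%:R <= N < X.+1%:R.
Proof. by apply: truncn_itv; exact: ltW. Qed.

Lemma X_gt0 : (0 < X)%N.
Proof. by rewrite truncn_gt0. Qed.

Lemma log_ratio_ge (x : R) : 0 < x -> x <= N * q%:R -> ln x <= L.
Proof.
move=> x0 xN; rewrite ler_ln ?posrE ?divr_gt0 ?mulr_gt0 //; apply: le_trans xN _.
rewrite ler_pdivlMr // ler_piMr ?mulr_ge0 ?(ltW N0) //; move: D2; lra.
Qed.

(** Since [q >= 2] and [Delta < 1 / 2], the argument of the logarithm is at least
    [4]; so a logarithmic factor never shrinks an estimate. *)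
Lemma L_ge1 : 1 <= L.
Proof.
apply: (@le_trans _ _ (ln 4)).
  have -> : 4 = 2 * 2 :> R by ring.
  by rewrite lnM ?posrE //; have := @ln2_ge_half R; lra.
rewrite ler_ln ?posrE ?divr_gt0 ?mulr_gt0 //.
have h : 2 <= N * q%:R.
  rewrite -[2]mul1r; apply: ler_pM => //; rewrite (ler_nat R 2); exact: q_gt1.
by rewrite ler_pdivlMr //; move: D0 D2 h; nra.
Qed.

(** The terms of the error in the shape in which they are compared with the bounds of
    the previous part: square roots instead of powers, and [Delta] instead of the
    larger [Delta ^ (1 - eps)]. *)
Lemma error_terms_split :
  exists b1 b2 b3 b4 b5 : R,
  [/\ [/\ N / Num.sqrt q%:R <= b1, N `^ (3 / 4) = b2, N `^ (5 / 6) * Num.sqrt Delta = b3,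
       Num.sqrt (Delta * N * q%:R) = b4 & N `^ eps * q%:R * Delta <= b5],
     [/\ 0 <= b1, 0 <= b2, 0 <= b3, 0 <= b4 & 0 <= b5] &
     error_terms N q%:R Delta eps = b1 + b2 + b3 + b4 + b5].
Proof.
exists (N * q%:R `^ (- (1 / 2))), (N `^ (3 / 4)), (N `^ (5 / 6) * Delta `^ (1 / 2)),
  ((Delta * N * q%:R) `^ (1 / 2)), (N `^ eps * q%:R * Delta `^ (1 - eps)).
split; last by [].
  split => //.
  - by rewrite powRN sqrt_powR.
  - by rewrite sqrt_powR // ltW.
  - by rewrite sqrt_powR // !mulr_ge0 // ltW.
  apply: ler_wpM2l; first by rewrite mulr_ge0 ?powR_ge0.
  rewrite -[leLHS](powRr1 (ltW D0)); apply: ger_powR; last by move: e0; lra.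
  by rewrite D0 /=; move: D2; lra.
by split; rewrite ?mulr_ge0 ?powR_ge0 // ltW.
Qed.

Local Notation disc := (`|\sum_(1 <= n < X.+1 | in_class n) (dist_int (al * n%:R - be) < Delta)%R%:R -
    2 * Delta * \sum_(1 <= n < X.+1 | in_class n) 1|).

Lemma discrepancy_below_16 : (X < 16)%N -> disc <= 64 * L ^+ 7 * error_terms N q%:R Delta eps.
Proof.
move=> X16; apply: le_trans (discrepancy_trivial al v u X be D0 D2) _.
have [b1 [b2 [b3 [b4 [b5 [[_ h2 _ _ _] [b10 _ b30 b40 b50] ->]]]]]] := error_terms_split.
have b21 : 1 <= b2.
  by rewrite -h2; exact: powR_ge1.
have L7 : 1 <= L ^+ 7 by rewrite exprn_ege1 // L_ge1.
apply: (@le_trans _ _ 64); first by rewrite (ler_nat R _ 64) ltnW // (leq_trans X16).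
rewrite -[leLHS]mulr1 -[64 * 1]mulr1; apply: ler_pM => //; last by lra.
by apply: ler_pM.
Qed.

(** Here the fourth error term alone exceeds [N]. *)
Lemma discrepancy_large_q : N <= Delta * q%:R -> disc <= 64 * L ^+ 7 * error_terms N q%:R Delta eps.
Proof.
move=> Nq; apply: le_trans (discrepancy_trivial al v u X be D0 D2) _.
have [b1 [b2 [b3 [b4 [b5 [[_ _ _ h4 _] [b10 b20 b30 _ b50] ->]]]]]] := error_terms_split.
have /andP[XN _] := X_bounds; apply: le_trans XN _.
have b4N : N <= b4.
  rewrite -h4 -{1}(ger0_norm (ltW N0)) -sqrtr_sqr; apply: ler_wsqrtr.
  have -> : Delta * N * q%:R = N * (Delta * q%:R) by ring.
  by rewrite expr2; apply: ler_wpM2l => //; exact: ltW.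
have L7 : 1 <= L ^+ 7 by rewrite exprn_ege1 // L_ge1.
have L64 : 1 <= 64 * L ^+ 7 by lra.
apply: (@le_trans _ _ (b1 + b2 + b3 + b4 + b5)); first by lra.
by rewrite ler_peMl // !addr_ge0 //; move: b4N (ltW N0); lra.
Qed.

Lemma L_pow7 : [/\ 1 <= L ^+ 7 & L <= L ^+ 7].
Proof.
have L1 := L_ge1; split; first by rewrite exprn_ege1.
by rewrite -{1}(expr1 L); apply: ler_weXn2l.
Qed.

Lemma T_le (k : nat) : T ^+ k <= N `^ (k%:R / 12).
Proof.
rewrite powR_twelfth; have /andP[XN _] := X_bounds.
by apply: ge0_ler_powR; rewrite ?nnegrE ?divr_ge0 // ltW.
Qed.

Lemma X_div_sqrt : X%:R / Num.sqrt q%:R <= N / Num.sqrt q%:R.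
Proof. by have /andP[XN _] := X_bounds; apply: ler_wpM2r; rewrite // invr_ge0 sqrtr_ge0. Qed.

Lemma T_ge1 : 1 <= T.
Proof.
by apply: powR_ge1; rewrite // ler1n X_gt0.
Qed.

Lemma T12 : T ^+ 12 = X%:R.
Proof. by rewrite powR_twelfth divff // powRr1. Qed.

(** For [Delta] below [X ^ (-1 / 4)] the expected number is at most [N ^ (3 / 4)], and
    [class_small_arc] bounds the actual one. *)
Lemma discrepancy_small_arc : Delta * T ^+ 3 < 1 -> disc <= 64 * L ^+ 7 * error_terms N q%:R Delta eps.
Proof.
move=> DT.
have [b1 [b2 [b3 [b4 [b5 [[h1 h2 _ _ h5] [b10 b20 b30 b40 b50] ->]]]]]] := error_terms_split.
have q0 : (0 < q)%N by rewrite ltnW // q_gt1.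
set S := \sum_(1 <= n < _ | _) _; set S1 := \sum_(1 <= n < _ | _) 1.
have T91 : 1 <= T ^+ 9 by rewrite exprn_ege1 // T_ge1.
have T9 : T ^+ 9 <= b2.
  by rewrite -h2; apply: le_trans (T_le 9) _; rewrite le_eqVlt; apply/orP; left; apply/eqP; congr (_ `^ _); field.
have S10 : 0 <= S1 by rewrite /S1 sumr_ge0.
have S1X : S1 <= X%:R.
  apply: (@le_trans _ _ (\sum_(1 <= n < X.+1) 1)).
    by rewrite /S1 big_mkcond; apply: ler_sum => n _; case: ifP.
  by rewrite sumr_const_nat subn1.
have DX : Delta * X%:R <= T ^+ 9.
  by rewrite -[Z in _ * Z <= _]T12 (exprD T 3 9) mulrA ler_piMl ?exprn_ge0 ?powR_ge0 // ltW.
have S0 : 0 <= S by rewrite /S sumr_ge0.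
have L1 := L_ge1.
have hq : 1 + ln q%:R <= 2 * L.
  have : ln q%:R <= L by apply: log_ratio_ge => //; rewrite ler_peMl.
  by move: L1; lra.
pose Y : R := X%:R / q%:R.
have Yq : Y * q%:R = X%:R by rewrite divfK // gt_eqF.
have Y1 : Y <= b1.
  apply: le_trans h1; apply: le_trans X_div_sqrt.
  have s1 : 1 <= Num.sqrt q%:R :> R by rewrite -[leLHS]sqrtr1 ler_wsqrtr // ler1n.
  apply: ler_wpM2l => //; rewrite lef_pV2 ?posrE ?(lt_le_trans ltr01 s1) //.
  by rewrite -[leRHS](@sqr_sqrtr R) ?(ltW qp) // expr2 ler_peMl // (le_trans ler01 s1).
have hS : S <= (2 * Y + 1) * (5 + 12 * (Delta * q%:R) * L).
  apply: le_trans (class_small_arc u v0 q0 co tha X be D0) _.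
  have X0 := X_gt0.
  apply: ler_pM; rewrite ?addr_ge0 ?divr_ge0 ?mulr_ge0 ?(ltW D0) //.
  - by rewrite addr_ge0 // ln_ge0 // ler1n.
  - rewrite lerD2r mulrA; apply: ler_wpM2r; first by rewrite invr_ge0.
    by rewrite -natrM ler_nat mul2n -addnn -addn1 leq_add2l.
  rewrite lerD2l; have -> : 12 * (Delta * q%:R) * L = 6 * (Delta * q%:R) * (2 * L) by ring.
  by apply: ler_wpM2l => //; rewrite !mulr_ge0 // ltW.
have {}hS : S <= 10 * Y + 5 + 24 * (Delta * X%:R * L) + 12 * (Delta * q%:R * L).
  by apply: le_trans hS _; rewrite le_eqVlt; apply/orP; left; apply/eqP; rewrite -Yq; ring.
have XL : Delta * X%:R * L <= T ^+ 9 * L by apply: ler_wpM2r => //; lra.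
have h5' : Delta * q%:R <= b5.
  apply: le_trans h5; rewrite mulrC; apply: ler_wpM2r; first exact: ltW.
  rewrite ler_peMl //; rewrite -[leLHS](powRr0 N); apply: ler_powR => //; exact: ltW.
have [l1 l7] := L_pow7; set l := L ^+ 7 in l1 l7 *.
have h5L : Delta * q%:R * L <= b5 * l.
  by apply: ler_pM => //; [rewrite mulr_ge0 // ltW|lra].
have h2L : T ^+ 9 * L <= b2 * l by apply: ler_pM => //; lra.
have DS1 : Delta * S1 <= b2.
  by apply: le_trans T9; apply: le_trans DX; apply: ler_wpM2l => //; exact: ltW.
have main : S + 2 * Delta * S1 <= l * (64 * (b1 + b2 + b5)).
  have i1 : b1 <= b1 * l by rewrite ler_peMr.
  have i2 : b2 <= b2 * l by rewrite ler_peMr.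
  have i5 : 0 <= b5 * l by rewrite mulr_ge0 //; lra.
  have b21 : 1 <= b2 by exact: le_trans T9.
  have -> : l * (64 * (b1 + b2 + b5)) = 64 * (b1 * l) + 64 * (b2 * l) + 64 * (b5 * l) by ring.
  rewrite -mulrA; move: hS XL Y1 h5L h2L DS1 i1 i2 i5 b21 b10.
  lra.
have sb : b1 + b2 + b5 <= b1 + b2 + b3 + b4 + b5 by lra.
apply: (@le_trans _ _ (S + 2 * Delta * S1)).
  have : 0 <= 2 * Delta * S1 by rewrite !mulr_ge0 // ltW.
  by rewrite ler_norml; move: S0; move: (2 * Delta * S1) => z *; apply/andP; split; lra.
apply: le_trans main _; rewrite mulrA (mulrC l); apply: ler_wpM2l => //; lra.
Qed.

(** The small exponent of the divisor bound is taken at most [eps / 2], since it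
    enters doubled, and at most [1 / 24], so that [X ^ (2 * e) <= T]. *)
Lemma discrepancy_main : 
  (16 <= X)%N -> Delta * q%:R < N -> 1 <= Delta * T ^+ 3 -> 
  (forall n, (0 < n)%N -> tau n <= K * n%:R `^ (Num.min (eps / 2) (1 / 24))) ->
  disc <= 20 * (10000 * v%:R * (K + 1)) * (4 * L) ^+ 7 * error_terms N q%:R Delta eps.
Proof.
move=> X16 qD DT htau.
have q0 : (0 < q)%N by rewrite ltnW // q_gt1.
have X0 := X_gt0; have Xp : 0 < X%:R :> R by rewrite ltr0n.
have /andP[XN NX] := X_bounds.
have T1 := T_ge1.
set e := Num.min (eps / 2) (1 / 24) in htau *.
have e0' : 0 < e by rewrite lt_min !divr_gt0.
have [eA eB] : 2 * e <= eps /\ e <= 1 / 24.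
  have : e <= eps / 2 by rewrite ge_min lexx.
  have : e <= 1 / 24 by rewrite ge_min lexx orbT.
  by split; lra.
have Tq : T ^+ 3 <= q%:R.
  apply: le_trans (T_le 3) _; apply: ltW; apply: le_lt_trans qN.
  by rewrite le_eqVlt; apply/orP; left; apply/eqP; congr (_ `^ _); field.
have qX : (q <= X ^ 2)%N.
  rewrite -(ler_nat R) natrX.
  have h1 : q%:R <= N * T ^+ 3.
    apply: (@le_trans _ _ (Delta * q%:R * T ^+ 3)); last first.
      by apply: ler_wpM2r; [rewrite exprn_ge0 // (le_trans ler01)|exact: ltW].
    by rewrite mulrAC ler_peMl.
  apply: le_trans h1 _; rewrite expr2.
  have h2 : N <= 2 * X%:R.
    apply: ltW; apply: lt_le_trans NX _.
    by rewrite -natrM ler_nat mul2n -addnn -addn1 leq_add2l.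
  have h3 : 2 * T ^+ 3 <= X%:R.
    have t3 : 2 <= T ^+ 3.
      rewrite leNgt; apply/negP => t3.
      have : (T ^+ 3) ^+ 4 < 2 ^+ 4 by rewrite ltr_pXn2r ?nnegrE ?exprn_ge0 // (le_trans ler01).
      rewrite -exprM T12 ltNge => /negP; apply.
      by rewrite -natrX ler_nat.
    rewrite -[leRHS]T12 (exprD T 3 9) mulrC; apply: ler_wpM2l; first by lra.
    by apply: le_trans t3 _; apply: ler_weXn2l.
  apply: (@le_trans _ _ (2 * X%:R * T ^+ 3)).
    by apply: ler_wpM2r => //; rewrite exprn_ge0 // (le_trans ler01).
  have -> : 2 * X%:R * T ^+ 3 = X%:R * (2 * T ^+ 3) by ring.
  exact: ler_wpM2l.
have ET : X%:R `^ (2 * e) <= T by apply: ler_powR; [rewrite ler1n|lra].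
apply: le_trans (@discrepancy_bound R al v u a q v0 q0 co tha K e T (4 * ln X%:R) be Delta X X16
  (lt_le_trans ltr01 T1) T12 Tq qX K0 e0' _ ET htau erefl D0 D2 DT) _; first by lra.
have K1 : 0 <= K + 1 by rewrite addr_ge0 // ltW.
rewrite -[leRHS]mulrA; apply: ler_wpM2l.
  exact: (mulr_ge0 (ler0n _ _) (mulr_ge0 (mulr_ge0 (ler0n _ _) (ler0n _ _)) K1)).
have lnX0 : 0 <= ln X%:R :> R by rewrite ln_ge0 // ler1n.
have [b1 [b2 [b3 [b4 [b5 [[h1 h2 h3 h4 h5] [b10 b20 b30 b40 b50] ->]]]]]] := error_terms_split.
have sD0 : 0 <= Num.sqrt Delta by exact: sqrtr_ge0.
have Tn n : 0 <= T ^+ n by rewrite exprn_ge0 // (le_trans ler01).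
apply: ler_pM.
- by rewrite exprn_ge0 // mulr_ge0.
- by rewrite !addr_ge0 ?mulr_ge0 ?powR_ge0 ?invr_ge0 ?sqrtr_ge0 // ltW.
- rewrite ler_pXn2r ?nnegrE ?mulr_ge0 //; last by apply: le_trans L_ge1.
  by apply: ler_wpM2l => //; apply: log_ratio_ge => //; apply: le_trans XN _; rewrite ler_peMr ?ler1n // ltW.
apply: lerD; [apply: lerD; [apply: lerD; [apply: lerD|]|]|].
- exact: le_trans X_div_sqrt h1.
- rewrite -h2; apply: le_trans (T_le 9) _.
  by rewrite le_eqVlt; apply/orP; left; apply/eqP; congr (_ `^ _); field.
- rewrite -h3; apply: ler_wpM2r => //; apply: le_trans (T_le 10) _.
  by rewrite le_eqVlt; apply/orP; left; apply/eqP; congr (_ `^ _); field.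
- have -> : T ^+ 6 = Num.sqrt X%:R.
    by rewrite -[in RHS]T12 (exprM T 6 2) sqrtr_sqr ger0_norm.
  rewrite -h4 -sqrtrM // -sqrtrM; last by rewrite mulr_ge0.
  apply: ler_wsqrtr; rewrite mulrC mulrA; apply: ler_wpM2r; first exact: ltW.
  by apply: ler_wpM2l => //; exact: ltW.
apply: le_trans h5; apply: ler_wpM2r; first exact: ltW.
apply: ler_wpM2r; first exact: ltW.
apply: (@le_trans _ _ (X%:R `^ eps)); first by apply: ler_powR; rewrite ?ler1n.
by apply: ge0_ler_powR; rewrite ?nnegrE // ltW.
Qed.

End Fixed.

(** Only the case where both [q] and the reciprocal of [Delta] are not too large
    needs exponential sums.  The other cases follow from trivial estimates and
    from the spacing of the multiples of [alpha * v] modulo one. *)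
Theorem count_discrepancy (eps : R) : 0 < eps -> exists2 C' : R, 0 < C' &
  forall (u : nat) (alpha beta N Delta : R) (a q : int),
  1 <= N -> 0 < Delta -> Delta < 1 / 2 -> coprimez a q -> N `^ (1 / 4) < q%:~R ->
  `|alpha * v%:R - a%:~R / q%:~R| <= 1 / q%:~R ^+ 2 ->
  `|(count_upto N (primes_in_class u v `&`
          [set l | dist_int (alpha * l%:R - beta) < Delta]))%:R
      - 2 * Delta * (prime_pi N u v)%:R|
  <= C' * ln (N * q%:~R / Delta) ^+ 7 * error_terms N q%:~R Delta eps.
Proof.
move=> e0; have m0 : 0 < Num.min (eps / 2) (1 / 24) by rewrite lt_min !divr_gt0.
have [K K0 htau] := tau_le_pow m0.
set c := 20 * (10000 * v%:R * (K + 1)).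
have c0 : 0 <= c.
  have K1 : 0 <= K + 1 by rewrite addr_ge0 // ltW.
  exact: (mulr_ge0 (ler0n _ _) (mulr_ge0 (mulr_ge0 (ler0n _ _) (ler0n _ _)) K1)).
have c4 : 0 <= c * 4 ^+ 7 by rewrite mulr_ge0 // exprn_ge0.
exists (c * 4 ^+ 7 + 64) => [|u al be N Delta a q N1 D0 D2 co qN tha].
  by apply: ltr_wpDl.
have q0 : 0 < q%:~R :> R by apply: le_lt_trans qN; exact: powR_ge0.
case: q q0 co qN tha => q; last by rewrite ltr0z.
move=> q0 co qN tha; rewrite -!pmulrn in q0 qN tha *.
pose P n := prime n && (n %% v == u %% v)%N.
have classP n : primes_in_class u v n <-> P n.
  rewrite /primes_in_class /P /=; split=> [[-> /eqP ->]|/andP[-> /eqP ->]] //.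
rewrite /prime_pi (@count_uptoE _ N _ P) // (@count_uptoE _ N _
   (fun n => P n && (dist_int (al * n%:R - be) < Delta))) //; last first.
  move=> n; split=> [[/classP -> ->]//|/andP[/classP ? ?]]; split => //.
have -> : \sum_(1 <= n < (Num.truncn N).+1 | P n && (dist_int (al * n%:R - be) < Delta)) 1 =
   \sum_(1 <= n < (Num.truncn N).+1 | P n) (dist_int (al * n%:R - be) < Delta)%R%:R :> R.
  rewrite big_mkcondr /=; apply: eq_bigr => n _; by case: (_ < _).
have [b1 [b2 [b3 [b4 [b5 [_ [b10 b20 b30 b40 b50] bE]]]]]] := error_terms_split q N1 D0 D2 e0.
have B0 : 0 <= error_terms N q%:R Delta eps by rewrite bE !addr_ge0.
have [L1 _] := L_pow7 N1 D0 D2 qN.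
set L := ln _ in L1 *; set B := error_terms _ _ _ _ in B0 *.
have LB : 0 <= L ^+ 7 * B by rewrite mulr_ge0 // (le_trans ler01).
have small x : x <= 64 * L ^+ 7 * B -> x <= (c * 4 ^+ 7 + 64) * L ^+ 7 * B.
  move=> h; apply: le_trans h _; rewrite -(mulrA 64) -(mulrA (_ + 64)).
  by apply: ler_wpM2r => //; rewrite lerDr.
have [X16|X16] := ltnP (Num.truncn N) 16; first exact/small/discrepancy_below_16.
have [qD|qD] := lerP N (Delta * q%:R); first exact/small/discrepancy_large_q.
have [DT|DT] := lerP 1 (Delta * (((Num.truncn N)%:R : R) `^ (1 / 12)) ^+ 3); last first.
  by apply/small; exact: (discrepancy_small_arc u be N1 D0 D2 co qN tha e0 DT).
apply: le_trans (discrepancy_main u be N1 D0 D2 co qN tha K0 e0 X16 qD DT htau) _.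
have assoc (d x y z : R) : d * (x * y) * z = d * x * (y * z) by ring.
rewrite -/c -/L -/B exprMn assoc -(mulrA (_ + 64)); apply: ler_wpM2r => //.
by rewrite lerDl.
Qed.

End PartTwo.

(** * Chebyshev and Mertens *)
Section Chebyshev.
Context {R : realType}.
Local Notation vonM := (@vonM R).
Local Notation mu := (@mu R).

(** The Chebyshev function. *)
Definition psi (x : nat) : R := \sum_(1 <= n < x.+1) vonM n.
Definition log_fact (x : nat) : R := \sum_(1 <= n < x.+1) ln n%:R.

Lemma log_fact_vonM x : log_fact x = \sum_(1 <= d < x.+1) vonM d * (x %/ d)%:R.
Proof.
transitivity (\sum_(1 <= n < x.+1) \sum_(1 <= d < n.+1 | d %| n) vonM d).
  by apply: eq_big_nat => n /andP[n0 _]; rewrite sum_vonM.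
rewrite (sum_divisors_swap (fun d _ => vonM d)); apply: eq_bigr => d _.
by rewrite sumr_const_nat subn1 mulr_natr.
Qed.

Lemma log_fact_factorial x : log_fact x = ln (x`!)%:R.
Proof.
elim: x => [|x IH]; first by rewrite /log_fact big_geq // fact0 ln1.
rewrite /log_fact big_nat_recr //= -/(log_fact x) IH factS natrM lnM ?posrE ?ltr0n ?fact_gt0 //.
by rewrite addrC.
Qed.

(** The central binomial coefficient is at most [4 ^ n].  In its logarithm, the
    prime powers in [n < d <= 2n] occur with coefficient at least one and the other
    ones with non-negative coefficients. *)
Lemma psi_double n : psi (2 * n) - psi n <= 2 * n%:R.
Proof.
case: n => [|n]; first by rewrite muln0 subrr mulr0.
set m := n.+1; have mm : (m.+1 <= (2 * m).+1)%N by rewrite ltnS leq_pmull.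
have key : psi (2 * m) - psi m <= log_fact (2 * m) - 2 * log_fact m.
  have -> : psi (2 * m) - psi m = \sum_(m.+1 <= d < (2 * m).+1) vonM d.
    by rewrite /psi (big_cat_nat _ mm) //= addrAC subrr add0r.
  rewrite !log_fact_vonM.
  have -> : \sum_(1 <= d < (2 * m).+1) vonM d * ((2 * m) %/ d)%:R =
    \sum_(1 <= d < m.+1) vonM d * ((2 * m) %/ d)%:R +
    \sum_(m.+1 <= d < (2 * m).+1) vonM d * ((2 * m) %/ d)%:R by rewrite (big_cat_nat _ mm).
  rewrite mulr_sumr addrAC -sumrB -[leLHS]add0r; apply: lerD.
    apply: sumr_ge0 => d _; rewrite mulrCA -mulrBr mulr_ge0 ?vonM_ge0 //.
    rewrite subr_ge0 -natrM ler_nat; case: d => [|d]; first by rewrite divn0 muln0.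
    by rewrite leq_divRL // -mulnA leq_mul2l leq_divM orbT.
  rewrite big_nat [leRHS]big_nat; apply: ler_sum => d /andP[d1 d2].
  rewrite ler_peMr ?vonM_ge0 // ler1n divn_gt0 //; by apply: leq_trans d1.
apply: le_trans key _; rewrite !log_fact_factorial.
have -> : 2 * ln (m`!)%:R = ln ((m`! * m`!)%:R) :> R.
  by rewrite natrM lnM ?posrE ?ltr0n ?fact_gt0 //; ring.
have e : ((2 * m)`! = 'C(2 * m, m) * (m`! * m`!))%N.
  by have := @bin_fact (2 * m) m; rewrite leq_pmull // => /(_ isT) <-; rewrite mul2n -addnn addnK.
have b0 : (0 < 'C(2 * m, m))%N by rewrite bin_gt0 leq_pmull.
rewrite e [in X in X - _]natrM lnM ?posrE ?ltr0n ?muln_gt0 ?fact_gt0 //= addrK.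
have b2 : ('C(2 * m, m) <= 2 ^ (2 * m))%N.
  rewrite -[2%N]/(1 + 1)%N expnDn (bigD1 (inord m : 'I_(2 * m).+1)) //=.
  by rewrite inordK ?ltnS ?leq_pmull // !exp1n !muln1 leq_addr.
apply: (@le_trans _ _ (ln (2 ^ (2 * m))%:R)).
  by rewrite ler_ln ?posrE ?ltr0n ?expn_gt0 // ler_nat.
rewrite natrX lnXn // -[_ *+ _]mulr_natl natrM ler_piMr //.
rewrite -[leRHS](@expRK R) ler_ln ?posrE ?expR_gt0 //.
by have := @expR_ge1Dx R 1; lra.
Qed.

Lemma psi_mono x y : (x <= y)%N -> psi x <= psi y.
Proof.
move=> xy; rewrite /psi [leRHS](@big_cat_nat _ _ _ x.+1) //= lerDl sumr_ge0 // => i _.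
exact: vonM_ge0.
Qed.

(** Iterate [psi_double] over the halves, rounded up. *)
Lemma psi_le x : psi x <= 4 * x%:R.
Proof.
elim/ltn_ind: x => x IH.
case: x IH => [|[|[|x]]] IH.
- by rewrite /psi big_geq // mulr0.
- by rewrite /psi big_nat1 /vonM /= mulr1.
- have := psi_double 1; have := IH 1%N isT; rewrite /psi big_nat1 /vonM /= muln1; lra.
set y := x.+3; set n := (uphalf y).
have ny : (n < y)%N by rewrite /n /y; lia.
have y2 : (y <= 2 * n)%N by rewrite /n /y; lia.
have n2 : (6 * n <= 4 * y)%N by rewrite /n /y; lia.
apply: le_trans (psi_mono y2) _.
have h1 := psi_double n; have h2 := IH n ny.
have h3 : (6 * n)%:R <= (4 * y)%:R :> R by rewrite ler_nat.
move: h1 h2 h3; rewrite !natrM; lra.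
Qed.

Lemma log_fact_ge x : (0 < x)%N -> x%:R * ln x%:R - x%:R <= log_fact x.
Proof.
elim: x => // x IH _; case: x IH => [|x] IH.
  by rewrite ln1 /log_fact big_nat1 ln1; lra.
rewrite /log_fact big_nat_recr //=; apply: le_trans (lerD (IH isT) (lexx _)).
set y : R := x.+1%:R; have y0 : 0 < y by rewrite ltr0n.
have yE : x.+2%:R = y + 1 :> R by rewrite natr1.
have step : y * (ln x.+2%:R - ln y) <= 1.
  rewrite -ler_pdivlMl // mulr1.
  have -> : ln x.+2%:R = ln y + ln (1 + y^-1).
    rewrite -lnM ?posrE ?addr_gt0 ?invr_gt0 //; congr ln; rewrite yE; field; exact: lt0r_neq0.
  rewrite addrC addKr; apply: le_ln1Dx; apply: lt_trans (_ : 0 < y^-1); last by rewrite invr_gt0.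
  by rewrite ltrN10.
move: (ln x.+2%:R) step => l2 step; rewrite yE; lra.
Qed.

Lemma log_fact_le x : log_fact x <= x%:R * ln x%:R.
Proof.
case: x => [|x]; first by rewrite /log_fact big_geq // mul0r.
apply: (@le_trans _ _ (\sum_(1 <= n < x.+2) ln x.+1%:R)).
  rewrite /log_fact big_nat [leRHS]big_nat; apply: ler_sum => n /andP[n0 nx].
  by rewrite ler_ln ?posrE ?ltr0n // ler_nat.
by rewrite sumr_const_nat subn1 mulr_natl.
Qed.

(** The logarithm of [x!] is the sum of [vonM d * floor (x / d)]; dropping the integer
    part costs at most [psi x]. *)
Lemma mertens x : (0 < x)%N ->
  ln x%:R - 1 <= \sum_(1 <= d < x.+1) vonM d / d%:R <= ln x%:R + 4.
Proof.
move=> x0; have xp : 0 < x%:R :> R by rewrite ltr0n.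
have E : x%:R * \sum_(1 <= d < x.+1) vonM d / d%:R = \sum_(1 <= d < x.+1) vonM d * (x%:R / d%:R).
  by rewrite mulr_sumr; apply: eq_bigr => d _; ring.
have fl d : (0 < d)%N -> (x %/ d)%:R <= (x%:R / d%:R : R) < (x %/ d)%:R + 1.
  move=> d0; rewrite ler_pdivlMr ?ltr0n // ltr_pdivrMr ?ltr0n // natr1 -!natrM ler_nat ltr_nat.
  by rewrite leq_divM ltn_ceil.
apply/andP; split; rewrite -(ler_pM2l xp) E.
  apply: (@le_trans _ _ (log_fact x)); first by have := log_fact_ge x0; lra.
  rewrite log_fact_vonM big_nat [leRHS]big_nat; apply: ler_sum => d /andP[d0 _].
  by apply: ler_wpM2l; [exact: vonM_ge0|case/andP: (fl d d0)].
apply: (@le_trans _ _ (log_fact x + psi x)).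
  rewrite log_fact_vonM /psi -big_split /= big_nat [leRHS]big_nat; apply: ler_sum => d /andP[d0 _].
  rewrite -[X in _ <= _ + X]mulr1 -mulrDr; apply: ler_wpM2l; first exact: vonM_ge0.
  by case/andP: (fl d d0) => _ /ltW.
have := log_fact_le x; have := psi_le x; lra.
Qed.

Lemma sum_log_ratio x : (0 < x)%N -> \sum_(1 <= d < x.+1) (ln x%:R - ln d%:R) <= x%:R :> R.
Proof.
move=> x0; rewrite sumrB sumr_const_nat subn1 /= -/(log_fact x) -[_ *+ x]mulr_natl.
have := log_fact_ge x0; lra.
Qed.

End Chebyshev.

(** * Logarithmic means of a bounded character *)
Section DirichletSeries.
Context {R : realType}.
Local Notation C := R[i].
Context (chi : nat -> C) (c : R).
Hypotheses (chi1 : chi 1%N = 1) (chiM : forall m n, chi (m * n)%N = chi m * chi n)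
  (chi_le1 : forall n, cabs (chi n) <= 1)
  (chi_sum : forall a b, cabs (\sum_(a <= n < b) chi n) <= c).
Local Notation vonM := (@vonM R).
Local Notation mu := (@mu R).

Let c0 : 0 <= c. Proof. by apply: le_trans (cabs_ge0 _) (chi_sum 0 0). Qed.

(** Summation by parts against the bounded sums of [chi]. *)
Lemma weighted_char_sum (w : nat -> R) (a b : nat) :
  (forall n, (a <= n)%N -> w n.+1 <= w n) -> (forall n, 0 <= w n) ->
  cabs (\sum_(a <= n < b) RtoC (w n) * chi n) <= c * w a.
Proof.
move=> wd w0; case: (leqP b a) => ab; first by rewrite big_geq // cabs0 mulr_ge0.
rewrite -{1}(add0n a) big_addn.
apply: le_trans (@abel_sum R (fun k => w (k + a)%N) (fun k => chi (k + a)%N) (b - a) c _) _.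
  move=> j _; have := chi_sum a (j + a); rewrite -{1}(add0n a) big_addn addnK //.
apply: ler_wpM2l => //.
rewrite (eq_bigr (fun k => w (k + a)%N - w (k.+1 + a)%N)); last first.
  by move=> k _; rewrite ger0_norm // subr_ge0 addSn wd // leq_addl.
rewrite ger0_norm // -[X in _ + X]opprK -sumrN.
under eq_bigr do rewrite opprB.
by rewrite telescope_sumr // add0n opprB addrC subrK.
Qed.

Definition chi_over (n : nat) : C := RtoC (n%:R^-1) * chi n.

Lemma chi_overM m n : chi_over (m * n) = chi_over m * chi_over n.
Proof. by rewrite /chi_over natrM invfM rmorphM chiM mulrACA. Qed.

Lemma cabs_chi_over n : cabs (chi_over n) <= n%:R^-1.
Proof.
rewrite /chi_over cabsM cabs_real ger0_norm ?invr_ge0 //.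
by rewrite ler_piMr ?invr_ge0.
Qed.

(** Partial sums of the L-function of [chi] at one. *)
Definition ell (x : nat) : C := \sum_(1 <= n < x.+1) chi_over n.

Lemma ell_tail (x y : nat) : (x <= y)%N -> cabs (ell y - ell x) <= c / x.+1%:R.
Proof.
move=> xy; rewrite /ell (@big_cat_nat _ _ _ x.+1) //= addrAC subrr add0r.
rewrite (eq_big_nat _ _ (F2 := fun n => RtoC ((maxn 1 n)%:R^-1) * chi n)); last first.
  by move=> n /andP[xn _]; rewrite /chi_over; case: n xn => // n _; rewrite (maxn_idPr _).
apply: le_trans (@weighted_char_sum (fun n => (maxn 1 n)%:R^-1) x.+1 y.+1 _ _) _ => //.
  move=> n xn; rewrite lef_pV2 ?posrE ?ltr0n ?leq_max //.
  by rewrite ler_nat geq_max !leq_max leqnSn /= orbT.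
by rewrite (maxn_idPr _).
Qed.

Definition lambda_mean (x : nat) : C := \sum_(1 <= d < x.+1) RtoC (vonM d) * chi_over d.

Lemma cabs_lambda_mean x : (0 < x)%N -> cabs (lambda_mean x) <= ln x%:R + 4.
Proof.
move=> x0; have /andP[_ h] := @mertens R x x0; apply: le_trans h.
apply: le_trans (cabs_sum _ _ _) _; apply: ler_sum => d _.
rewrite cabsM cabs_real ger0_norm ?vonM_ge0 //.
by apply: ler_wpM2l; [exact: vonM_ge0|exact: cabs_chi_over].
Qed.

(** The weight [ln n / n] decreases once [ln n >= 1], hence beyond [16]. *)
Lemma log_mean_bounded x : cabs (\sum_(1 <= n < x.+1) RtoC (ln n%:R) * chi_over n) <= 16 + c.
Proof.
pose w (n : nat) : R := ln n%:R / n%:R.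
have w01 n : 0 <= w n <= 1.
  case: n => [|n]; first by rewrite /w invr0 mulr0 lexx ler01.
  rewrite /w divr_ge0 ?ln_ge0 ?ler1n //= ler_pdivrMr ?ltr0n // mul1r.
  have := @ln_sublinear R n.+1%:R; rewrite ltr0n => /(_ isT) /ltW //.
have short n : (n <= 16)%N -> cabs (\sum_(1 <= n < n.+1) RtoC (w n) * chi n) <= 16.
  move=> n16; apply: le_trans (@cabs_sum_le_card R _ _ _ _ _) _.
    move=> i _; rewrite cabsM cabs_real; case/andP: (w01 i) => a b.
    by rewrite ger0_norm // mulr_ile1 ?cabs_ge0.
  by rewrite size_iota subn1 (ler_nat R _ 16).
have -> : \sum_(1 <= n < x.+1) RtoC (ln n%:R) * chi_over n = \sum_(1 <= n < x.+1) RtoC (w n) * chi n.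
  by apply: eq_bigr => n _; rewrite /chi_over mulrA -rmorphM.
case: (leqP x 16) => hx; first by apply: le_trans (short _ hx) _; rewrite lerDl.
rewrite (@big_cat_nat _ _ _ 17) //=; last by rewrite ltnW.
apply: le_trans (cabsD _ _) (lerD (short 16%N isT) _).
apply: le_trans (@weighted_char_sum w 17 x.+1 _ _) _; last 1 first.
- by rewrite ler_piMr //; case/andP: (w01 17%N).
- move=> n n17; have n0 : (0 < n)%N by apply: leq_trans n17.
  have np : 0 < n%:R :> R by rewrite ltr0n.
  have l1 : 1 <= ln n%:R :> R by apply: ln_ge1; exact: ltnW.
  rewrite /w -natr1 ler_pdivrMr ?ltr_wpDr // mulrAC ler_pdivlMr // natr1.
  have -> : ln n.+1%:R = ln n%:R + ln (1 + n%:R^-1) :> R.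
    rewrite -lnM ?posrE ?addr_gt0 ?invr_gt0 //; congr ln; rewrite mulrDr mulr1 divff ?natr1 //.
    exact: lt0r_neq0.
  have : ln (1 + n%:R^-1) <= n%:R^-1 :> R.
    by apply: le_ln1Dx; apply: lt_trans (_ : 0 < n%:R^-1); rewrite ?invr_gt0 ?ltrN10.
  rewrite -natr1; move: (ln (1 + n%:R^-1)) => z hz.
  have : z * n%:R <= 1 by rewrite -ler_pdivlMr // div1r.
  by move: l1; lra.
by move=> n; case/andP: (w01 n).
Qed.

Lemma floor_recip_le (x d : nat) : (0 < x)%N -> (0 < d)%N -> d%:R^-1 * (x %/ d).+1%:R^-1 <= x%:R^-1 :> R.
Proof.
move=> x0 d0; rewrite -invfM -natrM lef_pV2 ?posrE ?ltr0n ?muln_gt0 ?d0 //.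
by rewrite ler_nat mulnC ltnW // ltn_ceil.
Qed.

(** The logarithm is the divisor sum of von Mangoldt, so the bounded sum of
    [log_mean_bounded] is the sum of [vonM d * chi d / d * ell (x / d)].  Replacing
    [ell (x / d)] by [ell x] costs a bounded amount, by the Chebyshev bound. *)
Lemma ell_lambda_mean x : (0 < x)%N -> cabs (ell x) * cabs (lambda_mean x) <= 16 + 5 * c.
Proof.
move=> x0; have xp : 0 < x%:R :> R by rewrite ltr0n.
have E : \sum_(1 <= n < x.+1) RtoC (ln n%:R) * chi_over n =
   \sum_(1 <= d < x.+1) RtoC (vonM d) * chi_over d * ell (x %/ d).
  transitivity (\sum_(1 <= n < x.+1) \sum_(1 <= d < n.+1 | d %| n) RtoC (vonM d) * chi_over (d * (n %/ d))).
    apply: eq_big_nat => n /andP[n0 _]; rewrite -sum_vonM // rmorph_sum mulr_suml.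
    by apply: eq_bigr => d dn; rewrite mulnC divnK.
  rewrite (sum_divisors_swap (fun d k => RtoC (vonM d) * chi_over (d * k))).
  apply: eq_bigr => d _; rewrite /ell mulr_sumr; apply: eq_bigr => k _.
  by rewrite chi_overM mulrA.
have E2 : ell x * lambda_mean x = \sum_(1 <= n < x.+1) RtoC (ln n%:R) * chi_over n +
   \sum_(1 <= d < x.+1) RtoC (vonM d) * chi_over d * (ell x - ell (x %/ d)).
  rewrite E -big_split /= mulr_sumr; apply: eq_bigr => d _; rewrite -mulrDr addrC subrK mulrC.
  by [].
rewrite -cabsM E2; apply: le_trans (cabsD _ _) _.
have -> : 16 + 5 * c = (16 + c) + 4 * c by ring.
apply: lerD; first exact: log_mean_bounded.
apply: (@le_trans _ _ (\sum_(1 <= d < x.+1) vonM d * (c / x%:R))).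
  apply: le_trans (cabs_sum _ _ _) _; rewrite big_nat [leRHS]big_nat; apply: ler_sum => d /andP[d0 dx].
  rewrite (cabsM (_ * _)) (cabsM (RtoC _)) cabs_real ger0_norm ?vonM_ge0 // -mulrA.
  apply: ler_wpM2l; first exact: vonM_ge0.
  apply: (@le_trans _ _ (d%:R^-1 * (c / (x %/ d).+1%:R))).
    by apply: ler_pM; rewrite ?cabs_ge0 ?cabs_chi_over // ell_tail // leq_div.
  by rewrite mulrCA; apply: ler_wpM2l => //; exact: floor_recip_le.
rewrite -mulr_suml -/(psi x) mulrCA [leRHS]mulrC; apply: ler_wpM2l => //.
by rewrite ler_pdivrMr // psi_le.
Qed.

(** The sums [ell x] converge, with error [c / (x + 1)]: this says that their
    limit, the value of the L-function at one, is zero. *)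
Definition ell_vanishing := forall x, cabs (ell x) <= 2 * c / x.+1%:R.

(** If the limit of [ell] is not zero then [ell x] stays away from zero for large
    [x], and [ell_lambda_mean] applies. *)
Lemma lambda_mean_nonvanishing : ~ ell_vanishing ->
  exists B : R, forall x, (0 < x)%N -> cabs (lambda_mean x) <= B.
Proof.
move=> /existsNP[y /negP]; rewrite -ltNge => hy.
set e := c / y.+1%:R.
have e0 : 0 < cabs (ell y) - e.
  by rewrite subr_gt0; apply: le_lt_trans hy; rewrite /e -mulrA ler_peMl // ?divr_ge0 // ler1n.
pose B1 := (16 + 5 * c) / (cabs (ell y) - e).
have B10 : 0 <= B1 by rewrite divr_ge0 ?(ltW e0) // addr_ge0 // mulr_ge0.
have L0 : 0 <= ln y.+1%:R + 4 :> R by rewrite addr_ge0 // ln_ge0 // ler1n.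
exists (B1 + (ln y.+1%:R + 4)) => x x0.
case: (leqP y x) => xy.
  apply: (@le_trans _ _ B1); last by rewrite lerDl.
  rewrite ler_pdivlMr // mulrC; apply: le_trans (ell_lambda_mean x0).
  apply: ler_wpM2r; first exact: cabs_ge0.
  rewrite lerBlDr; have := cabsD (ell x) (- (ell x - ell y)).
  rewrite cabsN opprB addrC subrK => h; apply: le_trans h _; rewrite lerD2l; exact: ell_tail.
apply: (@le_trans _ _ (ln y.+1%:R + 4)); last by rewrite lerDr.
apply: le_trans (cabs_lambda_mean x0) _; rewrite lerD2r ler_ln ?posrE ?ltr0n // ler_nat.
by rewrite ltnW // ltnW.
Qed.

Lemma one_gt0 n : (0 < n)%N -> one n = 1 :> R.
Proof. by rewrite /one => ->. Qed.

Lemma one_div n d : (0 < n)%N -> d %| n -> one (n %/ d) = 1 :> R.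
Proof. move=> n0 dn; apply: one_gt0; rewrite divn_gt0; last exact: dvdn_gt0 n0 dn.
exact: dvdn_leq. Qed.

Lemma bisum_mu_one (F : nat -> C) x : (0 < x)%N -> bisum mu one F x = F 1%N.
Proof.
move=> x0; rewrite /bisum.
rewrite -(sum_divisors_swap (fun d k => RtoC (mu d * one k) * F (d * k)%N)).
rewrite (eq_big_nat _ _ (F2 := fun n => if n == 1%N then F 1%N else 0)); last first.
  move=> n /andP[n0 _].
  transitivity (\sum_(1 <= d < n.+1 | d %| n) RtoC (mu d) * F n).
    by apply: eq_bigr => d dn; rewrite one_div // mulr1 [(d * _)%N]mulnC divnK.
  rewrite -mulr_suml -rmorph_sum /= sum_mu //.
  by case: eqP => [->|_]; rewrite ?rmorph1 ?rmorph0 ?mul1r ?mul0r.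
by rewrite big_ltn //= big_nat_cond big1 ?addr0 // => n /andP[/andP[n2 _] _]; rewrite gtn_eqF.
Qed.

(** Summing [mu d * ln (x / d)] over the divisors [d] of [n] gives [vonM n], plus
    [ln x] when [n = 1]. *)
Lemma lambda_mean_mu x : (0 < x)%N ->
  lambda_mean x + RtoC (ln x%:R) =
  \sum_(1 <= d < x.+1) RtoC (mu d * (ln x%:R - ln d%:R)) * chi_over d * ell (x %/ d).
Proof.
move=> x0.
have h1 : RtoC (ln x%:R) = RtoC (ln x%:R) * bisum mu one chi_over x.
  by rewrite bisum_mu_one // /chi_over chi1 invr1 rmorph1 !mulr1.
have h2 : bisum (fun d => mu d * ln d%:R) one chi_over x + bisum mu lnN chi_over x = 0.
  transitivity (bisum mu one (fun n => RtoC (ln n%:R) * chi_over n) x); last first.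
    by rewrite bisum_mu_one // ln1 rmorph0 mul0r.
  rewrite /bisum -big_split /=; apply: eq_big_nat => d /andP[d0 _].
  rewrite -big_split /=; apply: eq_big_nat => k /andP[k0 _].
  rewrite -mulrDl mulrA -!rmorphM -rmorphD /=; congr (RtoC _ * _).
  by rewrite one_gt0 // /lnN natrM lnM ?posrE ?ltr0n //; ring.
have h3 : bisum mu lnN chi_over x = lambda_mean x.
  have -> : bisum mu lnN chi_over x = bisum mu (conv vonM one) chi_over x.
    apply: eq_bisum => // n n0; rewrite /lnN -sum_vonM // /conv.
    by apply: eq_bigr => d dn; rewrite one_div // mulr1.
  rewrite bisum_conv_r trisumC -bisum_conv_r; apply: eq_big_nat => d /andP[d0 dx].
  have x1 : (0 < x %/ d)%N by rewrite divn_gt0.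
  rewrite big_ltn //= big_nat_cond big1 ?addr0.
    rewrite muln1; congr (RtoC _ * _); rewrite /conv.
    by rewrite big_mkcond big_nat1 /= mu1 one_gt0 // !mulr1.
  move=> n /andP[/andP[n2 _] _]; have n0 : (0 < n)%N by apply: leq_trans n2.
  have -> : conv mu one n = 0; last by rewrite mulr0 rmorph0 mul0r.
  transitivity (\sum_(1 <= d < n.+1 | d %| n) mu d); last by rewrite sum_mu // gtn_eqF.
  by apply: eq_bigr => e en; rewrite one_div // mulr1.
have h4 (f : nat -> R) : bisum f one chi_over x =
    \sum_(1 <= d < x.+1) RtoC (f d) * chi_over d * ell (x %/ d).
  apply: eq_bigr => d _; rewrite /ell mulr_sumr; apply: eq_big_nat => k /andP[k0 _].
  by rewrite one_gt0 // mulr1 chi_overM mulrA.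
have -> : lambda_mean x = - bisum (fun d => mu d * ln d%:R) one chi_over x.
  by apply/eqP; rewrite -addr_eq0 addrC -h3 h2.
rewrite h1 !h4 addrC mulr_sumr -sumrB; apply: eq_bigr => d _.
rewrite mulrBr [mu d * ln x%:R]mulrC rmorphB !rmorphM /=; ring.
Qed.

(** Each [ell (x / d)] is then at most [2 * c * d / x], and the sum of [ln (x / d)]
    over [d <= x] is at most [x]. *)
Lemma lambda_mean_vanishing x : ell_vanishing -> (0 < x)%N ->
  cabs (lambda_mean x + RtoC (ln x%:R)) <= 2 * c.
Proof.
move=> hv x0; have xp : 0 < x%:R :> R by rewrite ltr0n.
rewrite lambda_mean_mu //.
apply: (@le_trans _ _ (\sum_(1 <= d < x.+1) (ln x%:R - ln d%:R) * (2 * c / x%:R))).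
  apply: le_trans (cabs_sum _ _ _) _; rewrite big_nat [leRHS]big_nat; apply: ler_sum => d /andP[d0 dx].
  have l0 : 0 <= ln x%:R - ln d%:R :> R by rewrite subr_ge0 ler_ln ?posrE ?ltr0n // ler_nat.
  rewrite (cabsM (_ * _)) (cabsM (RtoC _)) cabs_real normrM (ger0_norm l0) -mulrA.
  apply: ler_pM; rewrite ?mulr_ge0 ?cabs_ge0 //; first by rewrite ler_piMl ?mu_le1.
  apply: (@le_trans _ _ (d%:R^-1 * (2 * c / (x %/ d).+1%:R))).
    by apply: ler_pM; rewrite ?cabs_ge0 ?cabs_chi_over.
  rewrite mulrCA; apply: ler_wpM2l; first by rewrite mulr_ge0.
  exact: floor_recip_le.
rewrite -mulr_suml.
have := @sum_log_ratio R x x0; set S := \sum_(1 <= d < _) _ => hS.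
rewrite mulrA ler_pdivrMr // mulrC; apply: ler_wpM2l => //; rewrite mulr_ge0 //.
Qed.

End DirichletSeries.

(** * Real characters do not vanish at one *)
Section RealCharacter.
Context {R : realType} (rho : nat -> R) (c : R).
Hypotheses (rho1 : rho 1%N = 1) (rhoM : forall m n, rho (m * n)%N = rho m * rho n)
  (rho_val : forall n, [|| rho n == -1, rho n == 0 | rho n == 1])
  (rho_sum : forall a b, `|\sum_(a <= n < b) rho n| <= c).

Lemma dsum_multiples (p m : nat) : (0 < p)%N -> (0 < m)%N ->
  \sum_(1 <= d < (p * m).+1 | (d %| p * m) && (p %| d)) rho d = rho p * dsum rho m.
Proof.
move=> p0 m0.
have -> : \sum_(1 <= d < (p * m).+1 | (d %| p * m) && (p %| d)) rho d =
          \sum_(1 <= d < (p * m).+1 | p %| d) (if d %| p * m then rho d else 0).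
  rewrite big_mkcond [RHS]big_mkcond; apply: eq_bigr => d _.
  by case: (d %| p * m); case: (p %| d).
rewrite sum_multiples // mulKn // /dsum mulr_sumr [RHS]big_mkcond /=.
by apply: eq_bigr => k _; rewrite dvdn_pmul2l // rhoM.
Qed.

(** The divisors of [p * m] are those of [m] together with their multiples by [p];
    the multiples of [p] dividing [m] are counted twice. *)
Lemma dsum_primeM (p m : nat) : prime p -> (0 < m)%N ->
  dsum rho (p * m) = (1 + rho p) * dsum rho m - (if p %| m then rho p * dsum rho (m %/ p) else 0).
Proof.
move=> pp m0; have p0 := prime_gt0 pp.
rewrite {1}/dsum (bigID (fun d => p %| d)) /= dsum_multiples // mulrDl mul1r -addrA addrCA; congr (_ + _).
have h : (m.+1 <= (p * m).+1)%N by rewrite ltnS leq_pmull.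
have -> : \sum_(1 <= d < (p * m).+1 | (d %| p * m) && ~~ (p %| d)) rho d =
          \sum_(1 <= d < m.+1 | (d %| m) && ~~ (p %| d)) rho d.
  rewrite (big_cat_nat _ h) //= [X in _ + X]big_nat_cond [X in _ + X]big_pred0 ?addr0.
    apply: eq_bigl => d; case: (boolP (p %| d)) => pd; rewrite ?andbF // !andbT.
    by rewrite Gauss_dvdr // coprime_sym prime_coprime.
  move=> d; apply/negbTE/negP => /andP[/andP[h1 _] /andP[dn pd]].
  move: dn; rewrite Gauss_dvdr ?[coprime d p]coprime_sym ?prime_coprime // => /(dvdn_leq m0).
  by rewrite leqNgt h1.
rewrite /dsum [\sum_(1 <= d < m.+1 | d %| m) _](bigID (fun d => p %| d)) /= addrAC.
suff -> : \sum_(1 <= d < m.+1 | (d %| m) && (p %| d)) rho d =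
   (if p %| m then rho p * dsum rho (m %/ p) else 0) by rewrite subrr add0r.
case: ifP => pm.
  have [j mE] : exists j, m = (p * j)%N by case/dvdnP: pm => j ->; exists j; rewrite mulnC.
  have j0 : (0 < j)%N by move: m0; rewrite mE; case: (j) => //; rewrite muln0.
  by rewrite mE mulKn // dsum_multiples.
rewrite big1 // => d /andP[dm pd]; by rewrite (dvdn_trans pd dm) in pm.
Qed.

Lemma dsum_rho1 : dsum rho 1 = 1.
Proof. by rewrite /dsum big_mkcond big_nat1 /= rho1. Qed.

(** The two claims are proved together by removing primes: at primes with [rho p = 1]
    positivity needs monotonicity, which itself uses positivity for smaller
    arguments. *)
Lemma dsum_rho_ge0_mono (n : nat) : (0 < n)%N -> 0 <= dsum rho n /\
  forall p, prime p -> p %| n -> rho p = 1 -> dsum rho (n %/ p) <= dsum rho n.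
Proof.
elim/ltn_ind: n => n IH n0.
have mono p : prime p -> p %| n -> rho p = 1 -> dsum rho (n %/ p) <= dsum rho n.
  move=> pp pn rp; have p0 := prime_gt0 pp.
  have [m nE] : exists m, n = (p * m)%N by case/dvdnP: pn => m ->; exists m; rewrite mulnC.
  have m0 : (0 < m)%N by move: n0; rewrite nE; case: (m) => //; rewrite muln0.
  have mn : (m < n)%N by rewrite nE ltn_Pmull ?prime_gt1.
  have [G0 Gm] := IH m mn m0.
  rewrite nE mulKn // dsum_primeM // rp mul1r.
  case: ifP => pm; last by rewrite subr0; lra.
  have := Gm p pp pm rp; lra.
split=> //; have [->|n1] := eqVneq n 1%N; first by rewrite dsum_rho1.
have n2 : (1 < n)%N by rewrite ltn_neqAle eq_sym n1.
pose p := pdiv n; have pp : prime p by exact: pdiv_prime.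
have pn : p %| n by exact: pdiv_dvd.
have p0 := prime_gt0 pp.
have [m nE] : exists m, n = (p * m)%N by case/dvdnP: pn => m ->; exists m; rewrite mulnC.
have m0 : (0 < m)%N by move: n0; rewrite nE; case: (m) => //; rewrite muln0.
have mn : (m < n)%N by rewrite nE ltn_Pmull ?prime_gt1.
have [G0 Gm] := IH m mn m0.
case/or3P: (rho_val p) => /eqP rp.
- rewrite nE dsum_primeM // rp subrr mul0r add0r; case: ifP => pm; last by rewrite oppr0.
  rewrite mulN1r opprK.
  have mp0 : (0 < m %/ p)%N by rewrite divn_gt0 // dvdn_leq.
  by case: (IH (m %/ p)%N _ mp0) => //; apply: leq_ltn_trans mn; exact: leq_div.
- rewrite nE dsum_primeM // rp addr0 mul1r mul0r; by case: ifP => _; rewrite subr0.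
- by apply: le_trans (mono p pp pn rp); rewrite nE mulKn.
Qed.

Lemma dsum_rho_square (k : nat) : (0 < k)%N -> 1 <= dsum rho (k * k).
Proof.
elim/ltn_ind: k => k IH k0.
have [->|k1] := eqVneq k 1%N; first by rewrite muln1 dsum_rho1.
have k2 : (1 < k)%N by rewrite ltn_neqAle eq_sym k1.
pose p := pdiv k; have pp : prime p by exact: pdiv_prime.
have pk : p %| k by exact: pdiv_dvd.
have p0 := prime_gt0 pp.
have [j kE] : exists j, k = (p * j)%N by case/dvdnP: pk => m ->; exists m; rewrite mulnC.
have j0 : (0 < j)%N by move: k0; rewrite kE; case: (j) => //; rewrite muln0.
have jk : (j < k)%N by rewrite kE ltn_Pmull ?prime_gt1.
have jj0 : (0 < j * j)%N by rewrite muln_gt0 j0.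
have pjj0 : (0 < p * (j * j))%N by rewrite muln_gt0 p0.
apply: le_trans (IH j jk j0) _.
have -> : (k * k = p * (p * (j * j)))%N by rewrite kE; lia.
case/or3P: (rho_val p) => /eqP rp.
- by rewrite (dsum_primeM pp pjj0) rp subrr mul0r add0r dvdn_mulr // mulKn // mulN1r opprK.
- rewrite (dsum_primeM pp pjj0) rp addr0 mul1r mul0r if_same subr0.
  by rewrite (dsum_primeM pp jj0) rp addr0 mul1r mul0r if_same subr0.
- have h (m : nat) : (0 < m)%N -> dsum rho m <= dsum rho (p * m).
    move=> m0; have pm0 : (0 < p * m)%N by rewrite muln_gt0 p0.
    have [_ /(_ p pp (dvdn_mulr _ (dvdnn p)) rp)] := dsum_rho_ge0_mono pm0.
    by rewrite mulKn.
  exact: le_trans (h _ jj0) (h _ pjj0).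
Qed.

Lemma sum_squares_le (g : nat -> R) (M : nat) : (forall n, (0 < n)%N -> 0 <= g n) ->
  \sum_(1 <= m < M.+1) g (m * m)%N <= \sum_(1 <= n < (M * M).+1) g n.
Proof.
move=> g0; elim: M => [|M IH]; first by rewrite !big_geq.
rewrite big_nat_recr //=; have h : ((M * M).+1 <= M.+1 * M.+1)%N by lia.
rewrite [leRHS](@big_cat_nat _ _ _ (M * M).+1) //=; last by rewrite ltnW.
apply: lerD => //; rewrite big_nat_recr //= lerDr big_nat; apply: sumr_ge0 => n /andP[n1 _].
by apply: g0; apply: leq_trans n1.
Qed.

Section Lambert.
Context (s : R).
Hypotheses (s0 : 0 < s) (s1 : s < 1).
Let t := s ^+ 2.
Let t0 : 0 < t. Proof. by rewrite exprn_gt0. Qed.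
Let t1 : t < 1. Proof. by rewrite exprn_ilt1 // ltW. Qed.

Definition geom (n : nat) : R := \sum_(0 <= i < n) t ^+ i.

Lemma geom_recr n : geom n.+1 = geom n + t ^+ n. Proof. by rewrite /geom big_nat_recr. Qed.

Lemma geom_recl n : geom n.+1 = 1 + t * geom n.
Proof.
rewrite /geom big_ltn // expr0 big_add1 /= mulr_sumr; congr (_ + _).
by apply: eq_bigr => i _; rewrite exprS.
Qed.

Lemma geomE n : (1 - t) * geom n = 1 - t ^+ n.
Proof. by have := geom_recr n; rewrite geom_recl => e; rewrite mulrBl mul1r; move: e; lra. Qed.

(** Pairing [t ^ i] with [t ^ (n - 1 - i)] bounds the geometric sum by its middle term. *)
Lemma geom_ge n : n%:R * s ^+ n.-1 <= geom n.
Proof.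
case: n => [|n]; first by rewrite mul0r /geom big_geq.
rewrite /=; suff : 2 * (n.+1%:R * s ^+ n) <= geom n.+1 + geom n.+1 by lra.
rewrite {2}/geom big_nat_rev /= add0n -big_split /=.
have -> : 2 * (n.+1%:R * s ^+ n) = \sum_(0 <= i < n.+1) 2 * s ^+ n.
  by rewrite sumr_const_nat subn0 -[_ *+ n.+1]mulr_natl; ring.
apply: ler_sum_nat => i /andP[_ ni].
rewrite subSS /t -!exprM ![(2 * _)%N]mulnC !exprM.
have -> : s ^+ n = s ^+ i * s ^+ (n - i) by rewrite -exprD subnKC.
move: (s ^+ i) (s ^+ (n - i)) => x y; have := sqr_ge0 (x - y); rewrite sqrrB; lra.
Qed.

Lemma geom_gt0 n : (0 < n)%N -> 0 < geom n.
Proof.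
case: n => // n _; rewrite geom_recl ltr_wpDr //; apply: mulr_ge0; first exact: ltW.
by apply: sumr_ge0 => i _; rewrite exprn_ge0 // ltW.
Qed.

(** The difference of the weights of the L-sum and of the Lambert series, the latter
    multiplied by [1 - t]. *)
Definition lambert_weight (n : nat) : R := n%:R^-1 - t ^+ n / geom n.

(** The difference of two consecutive weights has the sign of
    [geom n * geom (n + 1) - n * (n + 1) * t ^ n], which is non-negative by
    [geom_ge]. *)
Lemma lambert_weight_decr n : (0 < n)%N -> lambert_weight n.+1 <= lambert_weight n.
Proof.
move=> n0; have g0 := geom_gt0 n0; have np : 0 < n%:R :> R by rewrite ltr0n.
have key : n%:R * (n%:R + 1) * t ^+ n <= geom n * geom n.+1.
  apply: (@le_trans _ _ ((n%:R * s ^+ n.-1) * (n.+1%:R * s ^+ n))); last first.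
    by apply: ler_pM; rewrite ?mulr_ge0 ?exprn_ge0 ?(ltW s0) ?geom_ge // (geom_ge n.+1).
  have -> : n%:R * s ^+ n.-1 * (n.+1%:R * s ^+ n) = n%:R * (n%:R + 1) * (s ^+ (n.-1 + n)).
    by rewrite natr1 exprD; ring.
  apply: ler_wpM2l; first by rewrite mulr_ge0 // addr_ge0.
  by rewrite -exprM; apply: ler_wiXn2l; [exact: ltW|exact: ltW|lia].
rewrite /lambert_weight -subr_ge0.
have gE := geom_recr n; have gE' := geom_recl n.
have g1 : 0 < geom n.+1 by exact: geom_gt0.
have -> : n%:R^-1 - t ^+ n / geom n - (n.+1%:R^-1 - t ^+ n.+1 / geom n.+1) =
  (geom n * geom n.+1 - n%:R * (n%:R + 1) * (t ^+ n * (geom n.+1 - t * geom n))) /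
  (n%:R * (n%:R + 1) * (geom n * geom n.+1)).
  have n1 : n%:R + 1 != 0 :> R by rewrite gt_eqF // ltr_wpDr.
  rewrite -(natr1 n) exprS; field; rewrite n1 !gt_eqF //.
have -> : geom n.+1 - t * geom n = 1 by rewrite gE'; ring.
by rewrite mulr1 divr_ge0 ?subr_ge0 // !mulr_ge0 ?addr_ge0 ?(ltW g0) ?(ltW g1).
Qed.

Lemma lambert_weight_ge0 n : 0 <= lambert_weight n.
Proof.
case: n => [|n]; first by rewrite /lambert_weight /geom big_geq // !invr0 mulr0 subr0.
rewrite /lambert_weight subr_ge0 ler_pdivrMr ?geom_gt0 // mulrC ler_pdivlMr ?ltr0n // mulrC.
apply: le_trans (geom_ge n.+1); apply: ler_wpM2l => //=.
by rewrite -exprM; apply: ler_wiXn2l; [exact: ltW|exact: ltW|lia].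
Qed.

Lemma lambert_weight1 : lambert_weight 1 = 1 - t.
Proof. by rewrite /lambert_weight /geom big_nat1 expr0 invr1 mulr1 expr1. Qed.

(** The decreasing [lambert_weight] turns the bound for the sums of [rho] into one of
    size [1 - t], its first value. *)
Lemma lambert_sum_le (X : nat) :
  (forall x, `|\sum_(1 <= n < x.+1) rho n / n%:R| <= 2 * c / x.+1%:R) ->
  `|\sum_(1 <= n < X.+1) rho n * (t ^+ n / geom n)| <= 2 * c / X.+1%:R + c * (1 - t).
Proof.
move=> hv.
have w : `|\sum_(1 <= n < X.+1) rho n * lambert_weight n| <= c * (1 - t).
  have := @weighted_char_sum R (fun n => RtoC (rho n)) c _ lambert_weight 1 X.+1 _ lambert_weight_ge0.
  rewrite lambert_weight1 => h.
  have -> : `|\sum_(1 <= n < X.+1) rho n * lambert_weight n| =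
     cabs (\sum_(1 <= n < X.+1) RtoC (lambert_weight n) * RtoC (rho n)).
    rewrite -cabs_real rmorph_sum; congr cabs; apply: eq_bigr => n _.
    by rewrite mulrC rmorphM.
  apply: h => [a b|n n0]; last exact: lambert_weight_decr.
  have -> : \sum_(a <= n < b) RtoC (rho n) = RtoC (\sum_(a <= n < b) rho n) by rewrite rmorph_sum.
  by rewrite cabs_real.
have -> : \sum_(1 <= n < X.+1) rho n * (t ^+ n / geom n) =
   \sum_(1 <= n < X.+1) rho n / n%:R - \sum_(1 <= n < X.+1) rho n * lambert_weight n.
  by rewrite -sumrB; apply: eq_bigr => n _; rewrite /lambert_weight; ring.
apply: le_trans (ler_normB _ _) _; exact: lerD.
Qed.

Lemma lambert_truncation (n X : nat) : (0 < n)%N -> (n <= X)%N ->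
  `|t ^+ n / (1 - t ^+ n) - \sum_(1 <= k < (X %/ n).+1) t ^+ (n * k)| <= t ^+ X / (1 - t).
Proof.
move=> n0 nX; have tn1 : t ^+ n < 1 by rewrite exprn_ilt1 // ?ltW // -lt0n.
have tnt : t ^+ n <= t by rewrite -[leRHS]expr1; apply: ler_wiXn2l; rewrite ?ltW.
have geo K : \sum_(1 <= k < K.+1) t ^+ (n * k) = (t ^+ n - t ^+ (n * K.+1)) / (1 - t ^+ n).
  elim: K => [|K IH]; first by rewrite big_geq // muln1 subrr mul0r.
  rewrite big_nat_recr //= IH (mulnSr n K.+1) exprD; field.
  by rewrite subr_eq0 eq_sym lt_eqF.
rewrite geo -mulrBl opprB addrC subrK.
have d1 : 0 < 1 - t ^+ n by rewrite subr_gt0.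
have tk k : 0 <= t ^+ k by apply: exprn_ge0; exact: ltW.
rewrite ger0_norm; last by rewrite divr_ge0 // ltW.
apply: ler_pM; [exact: tk|by rewrite invr_ge0 ltW| |].
  by apply: ler_wiXn2l; [exact: ltW|exact: ltW|rewrite mulnC; apply: ltnW; exact: ltn_ceil].
by rewrite lef_pV2 ?posrE ?subr_gt0 // lerD2l lerN2.
Qed.

End Lambert.

(** If the sums of [rho n / n] tended to zero at rate [1 / x], the Lambert series
    of [rho] would stay bounded near one; but it is the power series with
    coefficients [dsum rho], which are non-negative and at least one on squares. *)
Theorem real_char_nonvanishing :
  ~ (forall x, `|\sum_(1 <= n < x.+1) rho n / n%:R| <= 2 * c / x.+1%:R).
Proof.
move=> hv; have c0 : 0 <= c by apply: le_trans (normr_ge0 _) (rho_sum 0 0).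
suff key (M : nat) : (1 < M)%N -> M%:R * expR (- 2) <= 3 * c + 4.
  pose z := (3 * c + 4) / expR (-2).
  have z0 : 0 <= z by rewrite divr_ge0 ?expR_ge0 // addr_ge0 // mulr_ge0.
  have h := key (Num.truncn z).+2 isT.
  have : z < (Num.truncn z).+2%:R.
    by apply: lt_trans (truncnS_gt z) _; rewrite ltr_nat.
  by rewrite ltr_pdivrMr ?expR_gt0 // ltNge h.
(* With [t = exp (-2 / Y)], the coefficients at the squares up to [Y = M ^ 2]
   contribute at least [M * exp (-2)], and truncating at [X = Y ^ 2] is harmless. *)
move=> M1; pose Y := (M * M)%N; pose X := (Y * Y)%N.
have Y2 : (2 <= Y)%N by rewrite /Y; lia.
have Yp : 0 < Y%:R :> R by rewrite ltr0n; lia.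
pose s : R := expR (- Y%:R^-1).
have s0 : 0 < s by exact: expR_gt0.
have s1 : s < 1 by rewrite expR_lt1 oppr_lt0 invr_gt0.
set t := s ^+ 2.
have tE k : t ^+ k = expR (- (2 * k%:R / Y%:R)).
  rewrite -exprM /s -expRM_natl; congr expR; rewrite natrM; field; exact: lt0r_neq0.
have t0 : 0 < t by rewrite exprn_gt0.
have t1 : t < 1 by rewrite exprn_ilt1 // ltW.
have tY : t ^+ Y = expR (-2) by rewrite tE; congr expR; field; exact: lt0r_neq0.
have u1 : Y%:R^-1 <= 1 - t.
  have -> : t = expR (- (2 / Y%:R)) by rewrite -[t]expr1 tE mulr1.
  set z : R := 2 / Y%:R.
  have z1 : z <= 1 by rewrite ler_pdivrMr // mul1r (ler_nat R 2).
  have z0 : 0 <= z by rewrite divr_ge0 // ltW.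
  have -> : Y%:R^-1 = z / 2 by rewrite /z; field; exact: lt0r_neq0.
  rewrite expRN; have e := @expR_ge1Dx R z; have ep := expR_gt0 z.
  rewrite lerBrDr -lerBrDl -[leLHS]div1r ler_pdivrMr //; nra.
have tX : Y%:R ^+ 3 * t ^+ X <= 4.
  have -> : t ^+ X = expR (- (2 * Y%:R / 3)) ^+ 3.
    rewrite -expRM_natl tE; congr expR; rewrite /X natrM; field; exact: lt0r_neq0.
  rewrite -exprMn expRN; have e := @expR_ge1Dx R (2 * Y%:R / 3).
  have ep : 0 < expR (2 * Y%:R / 3) :> R by exact: expR_gt0.
  set E := expR _ in e ep *.
  have h : Y%:R / E <= 3 / 2 by rewrite ler_pdivrMr //; lra.
  have h0 : 0 <= Y%:R / E by rewrite divr_ge0 // ltW.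
  apply: (@le_trans _ _ ((3 / 2) ^+ 3)); first by apply: lerXn2r; rewrite ?nnegrE // divr_ge0.
  by rewrite !exprS expr0; lra.
have lower : M%:R * expR (-2) <= \sum_(1 <= n < X.+1) dsum rho n * t ^+ n.
  have YX : (Y.+1 <= X.+1)%N by rewrite ltnS /X leq_pmulr //; lia.
  have nn n : (0 < n)%N -> 0 <= dsum rho n * t ^+ n.
    by move=> n0; case: (dsum_rho_ge0_mono n0) => h _; rewrite mulr_ge0 // exprn_ge0 // ltW.
  rewrite [leRHS](@big_cat_nat _ _ _ Y.+1) //=; apply: le_trans (_ : _ <= \sum_(1 <= n < Y.+1) dsum rho n * t ^+ n) _; last first.
    by rewrite lerDl big_nat sumr_ge0 // => n /andP[n1 _]; apply: nn; apply: leq_trans n1.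
  apply: le_trans (sum_squares_le M nn).
  have -> : M%:R * expR (-2) = \sum_(1 <= m < M.+1) expR (-2) :> R.
    by rewrite sumr_const_nat subn1 mulr_natl.
  rewrite big_nat [leRHS]big_nat; apply: ler_sum => m /andP[m0 mM].
  rewrite -[leLHS]mul1r -tY; apply: ler_pM => //; [by apply: exprn_ge0; exact: ltW|exact: dsum_rho_square|].
  by apply: ler_wiXn2l; [exact: ltW|exact: ltW|rewrite /Y leq_mul].
apply: le_trans lower _.
have -> : \sum_(1 <= n < X.+1) dsum rho n * t ^+ n =
   \sum_(1 <= n < X.+1) rho n * \sum_(1 <= k < (X %/ n).+1) t ^+ (n * k).
  transitivity (\sum_(1 <= n < X.+1) \sum_(1 <= d < n.+1 | d %| n) rho d * t ^+ (d * (n %/ d))).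
    apply: eq_bigr => n _; rewrite /dsum mulr_suml; apply: eq_bigr => d dn.
    by rewrite [(d * _)%N]mulnC divnK.
  rewrite (sum_divisors_swap (fun d k => rho d * t ^+ (d * k))).
  by apply: eq_bigr => n _; rewrite mulr_sumr.
have main : \sum_(1 <= n < X.+1) rho n * (t ^+ n / (1 - t ^+ n)) <= 3 * c.
  have := lambert_sum_le s0 s1 X hv; rewrite -/t.
  have -> : \sum_(1 <= n < X.+1) rho n * (t ^+ n / geom s n) =
    (1 - t) * \sum_(1 <= n < X.+1) rho n * (t ^+ n / (1 - t ^+ n)).
    rewrite mulr_sumr; apply: eq_big_nat => n /andP[n0 _].
    have := geomE s n; rewrite -/t => <-; have := geom_gt0 s0 n0 => g0; field.
    by rewrite (gt_eqF g0) subr_eq0 gt_eqF.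
  have d0 : 0 < 1 - t by rewrite subr_gt0.
  move=> /(le_trans (ler_norm _)); rewrite -ler_pdivlMl // => h; apply: le_trans h _.
  rewrite ler_pdivrMl //; have -> : (1 - t) * (3 * c) = 2 * (c * (1 - t)) + c * (1 - t) by ring.
  rewrite lerD2r -mulrA; apply: ler_wpM2l => //; apply: ler_wpM2l => //.
  have Y0 : (0 < Y)%N by apply: leq_trans Y2.
  apply: le_trans u1; rewrite lef_pV2 ?posrE ?ltr0n // ler_nat /X.
  by apply: leqW; exact: leq_pmulr.
have err : `|\sum_(1 <= n < X.+1) rho n * (t ^+ n / (1 - t ^+ n)) -
   \sum_(1 <= n < X.+1) rho n * \sum_(1 <= k < (X %/ n).+1) t ^+ (n * k)| <= 4.
  rewrite -sumrB; apply: le_trans (ler_norm_sum _ _ _) _; apply: le_trans tX.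
  apply: (@le_trans _ _ (\sum_(1 <= n < X.+1) t ^+ X / (1 - t))).
    rewrite big_nat [leRHS]big_nat; apply: ler_sum => n /andP[n0 nX].
    rewrite -mulrBr normrM -[leRHS]mul1r; apply: ler_pM => //.
      by case/or3P: (rho_val n) => /eqP ->; rewrite ?normrN ?normr1 ?normr0.
    exact: (lambert_truncation s0 s1).
  rewrite sumr_const_nat subn1 /= -[_ *+ X]mulr_natl mulrCA [leRHS]mulrC; apply: ler_wpM2l.
    by apply: exprn_ge0; exact: ltW.
  rewrite {1}/X natrM exprS expr2 -mulrA; apply: ler_wpM2l => //; apply: ler_wpM2l => //.
  by rewrite -[leRHS]invrK lef_pV2 ?posrE ?subr_gt0 ?invr_gt0.
move: err main; rewrite ler_norml => /andP[h1 h2]; lra.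
Qed.

End RealCharacter.

From mathcomp Require fingroup cyclic algC cyclotomic classfun character.

(** * Characters modulo v *)
Section UnitSeparation.
Import fingroup zmodp cyclic algC cyclotomic classfun character.
Local Open Scope ring_scope.

(** The linear characters of the abelian group of units have trivial common kernel.
    As their values are roots of unity of order dividing the exponent, a character is
    recorded by its additive exponents [f], so that it can be evaluated in any field
    of complex numbers. *)
Lemma unit_separation (w k : nat) (a : 'Z_w.+2) :
  (forall x : {unit 'Z_w.+2}, (x ^+ k.+2)%g = 1%g) -> a \is a GRing.unit -> a != 1 ->
  exists f : 'Z_w.+2 -> 'Z_k.+2,
    [/\ (forall x y, x \is a GRing.unit -> y \is a GRing.unit -> f (x * y) = f x + f y),
        (forall x, x \isn't a GRing.unit -> f x = 0) & f a != 0].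
Proof.
move=> hk ua a1; pose G := [set: {unit 'Z_w.+2}]%G.
have cG : abelian G by exact: units_Zp_abelian.
pose b : {unit 'Z_w.+2} := FinRing.unit 'Z_w.+2 ua.
have b1 : b != 1%g by apply: contraNneq a1 => e; rewrite -[a]/(val b) e FinRing.val_unit1.
have [i hi] : exists i : Iirr G, 'chi_i b != 'chi_i 1%g.
  have : b \notin (\bigcap_i cfker 'chi[G]_i)%SET by rewrite TI_cfker_irr inE.
  move=> /bigcapP h; apply/existsP; apply: contra_notT h; rewrite negb_exists => /forallP h i _.
  by rewrite cfkerEirr inE; have := h i; rewrite negbK.
have lin : 'chi_i \is a linear_char by move/char_abelianP: cG; apply.
have [z pz] := C_prim_root_exists (ltn0Sn k.+1).
have root (x : {unit 'Z_w.+2}) : exists j : 'I_k.+2, 'chi_i x == z ^+ j.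
  have e : 'chi_i x ^+ k.+2 = 1 by rewrite -lin_charX ?inE // hk lin_char1.
  by have [j ->] := prim_rootP pz e; exists j.
pose g x : 'Z_k.+2 := xchoose (root x).
have gE x : 'chi_i x = z ^+ (g x) by apply/eqP; exact: (xchooseP (root x)).
have gM x y : g (x * y)%g = g x + g y.
  apply/val_inj => /=; have : 'chi_i (x * y)%g = 'chi_i x * 'chi_i y by rewrite lin_charM ?inE.
  rewrite !gE -exprD => /eqP; rewrite (eq_prim_root_expr pz) => /eqP <-.
  by rewrite modn_small.
exists (fun x => if insub x is Some y then g y else 0); split.
- move=> x y ux uy; have uxy : x * y \is a GRing.unit by rewrite unitrM ux.
  rewrite (insubT (fun x : 'Z_w.+2 => x \is a GRing.unit) ux).
  rewrite (insubT (fun x : 'Z_w.+2 => x \is a GRing.unit) uy).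
  rewrite (insubT (fun x : 'Z_w.+2 => x \is a GRing.unit) uxy) -gM; congr g.
  exact: val_inj.
- by move=> x nx; rewrite insubF //; exact: negbTE.
- rewrite (insubT (fun x : 'Z_w.+2 => x \is a GRing.unit) ua) /=.
  apply: contraNneq hi => e; rewrite -[b]/(Sub a ua) (gE (Sub a ua)) e expr0.
  by rewrite lin_char1.
Qed.

(** Twice the order of the group: at least two, as the indexing of the residues
    requires. *)
Lemma unit_exponent (w : nat) : exists k, forall x : {unit 'Z_w.+2}, (x ^+ k.+2)%g = 1%g.
Proof.
pose n := (#|[set: {unit 'Z_w.+2}]%G|)%N.
have n0 : (0 < n)%N by exact: cardG_gt0.
have [k kE] : exists k, (2 * n = k.+2)%N by case: n n0 => // m _; exists (2 * m)%N; rewrite mulnS.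
exists k => x; rewrite -kE mulnC expgM; have -> : (x ^+ n = 1)%g by apply: expg_cardG; rewrite inE.
exact: expg1n.
Qed.

End UnitSeparation.

Section PeriodicSums.
Context {R : realType}.
Local Notation C := R[i].

(** Full periods contribute nothing, so only two incomplete periods remain. *)
Lemma periodic_sum_bound (chi : nat -> C) (v : nat) : (0 < v)%N ->
  (forall n, chi (n + v)%N = chi n) -> (forall n, cabs (chi n) <= 1) ->
  \sum_(0 <= n < v) chi n = 0 ->
  forall a b, cabs (\sum_(a <= n < b) chi n) <= 2 * v%:R.
Proof.
move=> v0 per le1 s0.
have h N : cabs (\sum_(0 <= n < N) chi n) <= v%:R.
  elim/ltn_ind: N => N IH; case: (ltnP N v) => Nv.
    apply: le_trans (@cabs_sum_le_card R _ _ _ _ _) _ => //.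
    by rewrite size_iota subn0 ler_nat ltnW.
  rewrite (@big_cat_nat _ _ _ v) //= s0 add0r -{1}(add0n v) big_addn.
  under eq_bigr do rewrite per.
  by apply: IH; rewrite ltn_subrL v0 (leq_trans v0).
move=> a b; case: (leqP b a) => ab; first by rewrite big_geq // cabs0 mulr_ge0.
have -> : \sum_(a <= n < b) chi n = \sum_(0 <= n < b) chi n - \sum_(0 <= n < a) chi n.
  by rewrite (@big_cat_nat _ _ _ a 0 b) //= 1?ltnW // addrAC subrr add0r.
apply: le_trans (cabsB _ _) _; have := h a; have := h b; lra.
Qed.

End PeriodicSums.

Section Characters.
Context {R : realType} (w k : nat).
Local Notation C := R[i].
Local Notation v := w.+2.
Local Notation n := k.+2.

Definition root_of_unity (a : 'Z_n) : C := cexp ((a : nat)%:R / n%:R).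

Lemma cabs_root a : cabs (root_of_unity a) = 1. Proof. exact: cabs_cexp. Qed.

Lemma root0 : root_of_unity 0 = 1.
Proof. by rewrite /root_of_unity /= mul0r cexp0. Qed.

Lemma rootD a b : root_of_unity (a + b) = root_of_unity a * root_of_unity b.
Proof.
rewrite /root_of_unity -cexpD -mulrDl -natrD /= {2}(divn_eq (a + b) n) natrD natrM mulrDl.
by rewrite mulfK ?pnatr_eq0 // addrC -[X in _ + X]/(((a + b) %/ n)%:Z%:~R) cexpDz.
Qed.

Lemma rootN a : root_of_unity (- a) = conjc (root_of_unity a).
Proof.
have h : root_of_unity (- a) * root_of_unity a = conjc (root_of_unity a) * root_of_unity a.
  by rewrite -rootD addNr root0 {1}/root_of_unity -cexpN /root_of_unity -cexpD addNr cexp0.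
exact: (mulIf (cexp_neq0 _) h).
Qed.

Lemma root_eq1 a : root_of_unity a = 1 -> a = 0.
Proof.
move=> e; have := @cexp_dist R ((a : nat)%:R / n%:R); rewrite -/(root_of_unity a) e subrr cabs0 => h.
have an : (a < n)%N by exact: ltn_ord.
have := @dist_int_frac R a n isT (ltnW an).
have -> : dist_int ((a : nat)%:R / n%:R) = 0 :> R.
  by apply/le_anti; rewrite dist_int_ge0 andbT; move: h; lra.
rewrite mulr0 (ler_nat R _ 0) leqn0 => /eqP m0; apply/val_inj => /=.
move: m0; rewrite /minn; case: ifP => // _ /eqP; rewrite subn_eq0 leqNgt an //.
Qed.

(** Characters modulo [v] through their exponents: additive on units, and zero
    elsewhere so that equality of functions is equality of characters. *)
Definition is_character (f : {ffun 'Z_v -> 'Z_n}) : bool :=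
  [forall x, forall y, (x \is a GRing.unit) && (y \is a GRing.unit) ==> (f (x * y) == f x + f y)] &&
  [forall x, (x \isn't a GRing.unit) ==> (f x == 0)].

Lemma is_characterP (f : {ffun 'Z_v -> 'Z_n}) : reflect
  ((forall x y, x \is a GRing.unit -> y \is a GRing.unit -> f (x * y) = f x + f y) /\
   (forall x, x \isn't a GRing.unit -> f x = 0)) (is_character f).
Proof.
apply: (iffP andP) => -[h1 h2]; split.
- by move=> x y ux uy; apply/eqP; have /forallP/(_ x)/forallP/(_ y) := h1; rewrite ux uy.
- by move=> x nx; apply/eqP; have /forallP/(_ x) := h2; rewrite nx.
- by apply/forallP => x; apply/forallP => y; apply/implyP => /andP[ux uy]; rewrite h1.
- by apply/forallP => x; apply/implyP => nx; rewrite h2.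
Qed.

Lemma character0 : is_character 0.
Proof. by apply/is_characterP; split => *; rewrite !ffunE ?addr0. Qed.

Lemma characterD f g : is_character f -> is_character g -> is_character (f + g).
Proof.
move=> /is_characterP[f1 f2] /is_characterP[g1 g2]; apply/is_characterP; split=> [x y ux uy|x nx].
  by rewrite !ffunE f1 // g1 // addrACA.
by rewrite !ffunE f2 // g2 // addr0.
Qed.

Lemma characterN f : is_character f -> is_character (- f).
Proof.
move=> /is_characterP[f1 f2]; apply/is_characterP; split=> [x y ux uy|x nx].
  by rewrite !ffunE f1 // opprD.
by rewrite !ffunE f2 // oppr0.
Qed.

Lemma characterDr f g : is_character g -> is_character (f + g) = is_character f.
Proof.
move=> cg; apply/idP/idP => [h|cf]; last exact: characterD.
by rewrite -[f](addrK g); apply: characterD => //; exact: characterN.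
Qed.

Definition character (f : {ffun 'Z_v -> 'Z_n}) (m : nat) : C :=
  if coprime v m then root_of_unity (f m%:R) else 0.

Lemma natr_unit m : (m%:R : 'Z_v) \is a GRing.unit = coprime v m.
Proof. exact: unitZpE. Qed.

Section One.
Context (f : {ffun 'Z_v -> 'Z_n}).
Hypothesis cf : is_character f.

Lemma characterM a b : character f (a * b) = character f a * character f b.
Proof.
have /is_characterP[f1 f2] := cf.
rewrite /character coprimeMr; case ca : (coprime v a); case cb : (coprime v b); rewrite ?mulr0 ?mul0r //=.
by rewrite -rootD natrM f1 // natr_unit.
Qed.

Lemma character1 : character f 1 = 1.
Proof.
have /is_characterP[f1 f2] := cf.
have h : f 1 = 0.
  by have := f1 1 1 (unitr1 _) (unitr1 _); rewrite mulr1 => /eqP; rewrite -subr_eq subrr eq_sym => /eqP.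
by rewrite /character coprimen1 mulr1n h root0.
Qed.

Lemma cabs_character m : cabs (character f m) <= 1.
Proof. by rewrite /character; case: ifP => _; rewrite ?cabs_root ?cabs0. Qed.

Lemma character_mod m l : m = l %[mod v] -> character f m = character f l.
Proof.
move=> e; rewrite /character -coprime_modr e coprime_modr.
by rewrite -(Zp_nat_mod (isT : (1 < v)%N) m) e Zp_nat_mod.
Qed.

Lemma character_period m : character f (m + v) = character f m.
Proof. by apply: character_mod; rewrite modnDr. Qed.

(** Multiplying the argument by a unit [b] multiplies the sum by the value at [b],
    which differs from one for a suitable [b]. *)
Lemma character_full_sum : f != 0 -> \sum_(0 <= m < v) character f m = 0.
Proof.
move=> f0; have /is_characterP[f1 f2] := cf.
have [b fb] : exists b, f b != 0.
  by apply/existsP; apply: contra_neqT f0; rewrite negb_exists => /forallP h;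
    apply/ffunP => b; rewrite ffunE; apply/eqP; have := h b; rewrite negbK.
have ub : b \is a GRing.unit by apply: contraNT fb => /f2 ->.
pose g (x : 'Z_v) : C := if x \is a GRing.unit then root_of_unity (f x) else 0.
have -> : \sum_(0 <= m < v) character f m = \sum_(x : 'Z_v) g x.
  rewrite big_mkord; apply: eq_bigr => x _.
  by rewrite /character /g -natr_unit natr_Zp.
set S := \sum_x g x.
have e : S = root_of_unity (f b) * S.
  rewrite {1}/S (reindex_inj (mulrI ub)) mulr_sumr; apply: eq_bigr => x _.
  rewrite /g unitrM ub /=; case: ifP => ux; last by rewrite mulr0.
  by rewrite f1 // rootD.
apply/eqP; have /eqP : (1 - root_of_unity (f b)) * S = 0 by rewrite mulrBl mul1r -e subrr.
rewrite mulf_eq0 => /orP[|//]; rewrite subr_eq0 eq_sym => /eqP/root_eq1 z.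
by rewrite z eqxx in fb.
Qed.

Lemma character_sum_bound : f != 0 ->
  forall a b, cabs (\sum_(a <= m < b) character f m) <= 2 * v%:R.
Proof.
move=> f0; apply: periodic_sum_bound => //; [exact: character_period|exact: cabs_character|].
exact: character_full_sum.
Qed.

Lemma characterNE m : character (- f) m = conjc (character f m).
Proof. by rewrite /character; case: ifP => _; rewrite ?conjc0 // ffunE rootN. Qed.

End One.

(** The sum is unchanged when the summation variable [f] is translated by a character
    that separates the two residues, and is multiplied by a value different from
    one. *)
Lemma character_orthogonality (u m : nat) : (forall x : {unit 'Z_v}, (x ^+ n)%g = 1%g) ->
  coprime v u ->
  \sum_(f | is_character f) conjc (character f u) * character f m =
  if (m == u %[mod v])%N then #|[pred f | is_character f]|%:R else 0.
Proof.
move=> hk cu.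
case: ifP => [/eqP mu|mu].
  rewrite -sum1_card natr_sum; apply: eq_bigr => f cf.
  rewrite (character_mod f mu) -characterNE.
  by rewrite /character cu -rootD ffunE addNr root0.
case cm : (coprime v m); last first.
  by rewrite big1 // => f _; rewrite {2}/character cm mulr0.
pose x : 'Z_v := u%:R; pose y : 'Z_v := m%:R.
have ux : x \is a GRing.unit by rewrite natr_unit.
have uy : y \is a GRing.unit by rewrite natr_unit.
have ua : y / x \is a GRing.unit by rewrite unitrM uy unitrV.
have a1 : y / x != 1.
  apply: contraFneq mu => e; have : y = x by rewrite -[y](divrK ux) e mul1r.
  move=> /(congr1 val) /=; rewrite !val_Zp_nat // => /eqP; by rewrite eq_sym => /eqP ->.
have [g [g1 g2 ga]] := unit_separation hk ua a1.
pose f0 : {ffun 'Z_v -> 'Z_n} := [ffun z => g z].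
have cf0 : is_character f0.
  by apply/is_characterP; split=> [z t uz ut|z nz]; rewrite !ffunE; [exact: g1|exact: g2].
set S := \sum_(f | _) _.
have SE : S = \sum_(f | is_character f) root_of_unity (f (y / x)).
  apply: eq_bigr => f cf; have /is_characterP[f1 _] := cf.
  rewrite -characterNE /character cu cm ffunE -/x -/y -rootD.
  by rewrite -{1}[y](divrK ux) f1 // addrCA addNr addr0.
have e : S = root_of_unity (g (y / x)) * S.
  rewrite {1}SE (reindex_inj (addIr f0)) SE mulr_sumr; apply: eq_big => f.
    by rewrite characterDr.
  by move=> _; rewrite !ffunE rootD mulrC.
apply/eqP; have /eqP : (1 - root_of_unity (g (y / x))) * S = 0 by rewrite mulrBl mul1r -e subrr.
rewrite mulf_eq0 => /orP[|//]; rewrite subr_eq0 eq_sym => /eqP/root_eq1 z.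
by rewrite z eqxx in ga.
Qed.

End Characters.

(** * Primes in progressions *)
Section NonCoprime.
Context {R : realType}.
Local Notation vonM := (@vonM R).

Lemma vonM_primeM_le (p k : nat) : prime p -> (0 < k)%N ->
  vonM (p * k) <= (if k == 1%N then ln p%:R else 0) + (if p %| k then vonM k else 0).
Proof.
move=> pp k0; have p0 := prime_gt0 pp.
have rhs : 0 <= (if k == 1%N then ln p%:R else 0) + (if p %| k then vonM k else 0).
  by rewrite addr_ge0 //; case: ifP => // _; [rewrite ln_ge0 // ler1n|exact: vonM_ge0].
rewrite {1}/vonM; case e : (primes (p * k)) => [|r [|]] //.
have [rp l0 kE] := primes_pow e.
have pr : p = r.
  have : p \in primes (p * k) by rewrite mem_primes pp muln_gt0 p0 k0 dvdn_mulr.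
  by rewrite e inE => /eqP.
rewrite -pr in kE l0 *; move: (logn p (p * k)) l0 kE => [//|j] _.
rewrite expnS => /eqP; rewrite eqn_pmul2l // => /eqP kE.
case: j kE => [|j] kE; first by rewrite kE /= lerDl; case: ifP => // _; exact: vonM_ge0.
have -> : (p %| k) by rewrite kE expnS dvdn_mulr.
by rewrite kE vonM_prime_pow // lerDr; case: ifP => // _; rewrite ln_ge0 // ler1n.
Qed.

(** Writing the multiples of [p] as [p * k] bounds the sum by [ln p / p] plus [1 / p]
    times the same kind of sum for a smaller bound. *)
Lemma prime_multiples_mean (p x : nat) : prime p ->
  \sum_(1 <= n < x.+1 | p %| n) vonM n / n%:R <= 2 * ln p%:R.
Proof.
move=> pp; have p0 := prime_gt0 pp; have pR : 0 < p%:R :> R by rewrite ltr0n.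
have p2 : 2 <= p%:R :> R by rewrite (ler_nat R 2); exact: prime_gt1.
have lp : 0 <= ln p%:R :> R by rewrite ln_ge0 // ler1n.
elim/ltn_ind: x => x IH; case: x IH => [|x] IH.
  by rewrite big_geq // mulr_ge0.
rewrite (sum_multiples (fun n => vonM n / n%:R)) //.
set y := (x.+1 %/ p)%N.
have yx : (y < x.+1)%N by rewrite ltn_Pdiv // prime_gt1.
apply: (@le_trans _ _ (\sum_(1 <= k < y.+1) ((if k == 1%N then ln p%:R / p%:R else 0) +
    p%:R^-1 * (if p %| k then vonM k / k%:R else 0)))).
  apply: ler_sum_nat => k /andP[k0 _]; have kp : 0 < k%:R :> R by rewrite ltr0n.
  rewrite natrM invfM mulrA ler_pdivrMr // -ler_pdivlMr ?invr_gt0 // invrK.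
  apply: le_trans (vonM_primeM_le pp k0) _; rewrite le_eqVlt; apply/orP; left; apply/eqP.
  case: eqP => [->|_]; case: ifP => _; field; rewrite ?pnatr_eq0 -?lt0n ?p0 ?k0 ?andbT ?gt_eqF //.
rewrite big_split /= -mulr_sumr -[X in _ + _ * X]big_mkcond /=.
have h1 : \sum_(1 <= k < y.+1) (if k == 1%N then ln p%:R / p%:R else 0) <= ln p%:R / p%:R :> R.
  case: y {yx} => [|y]; first by rewrite big_geq // divr_ge0.
  rewrite big_ltn //= big_nat_cond big1 ?addr0 // => i /andP[/andP[i2 _] _].
  by rewrite gtn_eqF.
apply: le_trans (lerD h1 (ler_wpM2l _ (IH _ yx))) _; first by rewrite invr_ge0.
have -> : ln p%:R / p%:R + p%:R^-1 * (2 * ln p%:R) = 3 * ln p%:R / p%:R :> R by ring.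
by rewrite ler_pdivrMr //; nra.
Qed.

Lemma non_coprime_mean (v x : nat) : (0 < v)%N ->
  \sum_(1 <= n < x.+1 | ~~ coprime v n) vonM n / n%:R <= \sum_(p <- primes v) 2 * ln p%:R.
Proof.
move=> v0; apply: (@le_trans _ _ (\sum_(p <- primes v) \sum_(1 <= n < x.+1 | p %| n) vonM n / n%:R)).
  have -> : \sum_(p <- primes v) \sum_(1 <= n < x.+1 | p %| n) vonM n / n%:R =
    \sum_(1 <= n < x.+1) \sum_(p <- primes v) (if p %| n then vonM n / n%:R else 0).
    by rewrite exchange_big /=; apply: eq_bigr => p _; rewrite big_mkcond.
  rewrite big_mkcond; apply: ler_sum_nat => n /andP[n0 _].
  have t0 p : 0 <= (if p %| n then vonM n / n%:R else 0).
    by case: ifP => // _; rewrite divr_ge0 ?vonM_ge0.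
  case: ifPn => cn; last by apply: sumr_ge0.
  have g1 : (1 < gcdn v n)%N.
    by rewrite ltn_neqAle eq_sym cn gcdn_gt0 v0.
  pose p := pdiv (gcdn v n); have pp : prime p by exact: pdiv_prime.
  have pg : p %| gcdn v n by exact: pdiv_dvd.
  have pn : p %| n by apply: dvdn_trans pg (dvdn_gcdr _ _).
  have pv : p \in primes v by rewrite mem_primes pp v0 (dvdn_trans pg (dvdn_gcdl _ _)).
  by rewrite (bigD1_seq p) ?primes_uniq //= pn lerDl sumr_ge0.
rewrite big_seq [leRHS]big_seq; apply: ler_sum => p; rewrite mem_primes => /and3P[pp _ _].
exact: prime_multiples_mean.
Qed.

End NonCoprime.

Lemma cabs_realB (R : realType) (y z : R) : cabs (RtoC y - RtoC z) = `|y - z|.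
Proof. by rewrite -cabs_real; congr cabs; apply/esym; exact: rmorphB. Qed.

Section Modulus.
Context {R : realType} (w k : nat).
Hypothesis hk : forall x : {unit 'Z_w.+2}, (x ^+ k.+2)%g = 1%g.
Local Notation C := R[i].
Local Notation v := w.+2.
Local Notation vonM := (@vonM R).
Local Notation chars := {ffun 'Z_v -> 'Z_k.+2}.
Implicit Types f : chars.
Local Notation chi f := (@character R w k f).
Let c : R := 2 * v%:R.

Let c0 : 0 <= c. Proof. by rewrite mulr_ge0. Qed.

(** The bound [2 * v] for the sums of a character enters the definition of
    [ell_vanishing], which is why it is fixed here. *)
Definition vanishing f := ell_vanishing (chi f) c.

Lemma mean_bound f : is_character f -> f != 0 -> exists B : R, 0 <= B /\
  forall x, (0 < x)%N ->
   (vanishing f -> cabs (lambda_mean (chi f) x + RtoC (ln x%:R)) <= B) /\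
   (~ vanishing f -> cabs (lambda_mean (chi f) x) <= B).
Proof.
move=> cf f0; have [hv|hv] := pselect (vanishing f).
  exists (2 * c); split=> [|x x0]; first by rewrite mulr_ge0.
  split=> // _; apply: lambda_mean_vanishing => //.
  - exact: character1.
  - exact: characterM.
  - exact: cabs_character.
  - exact: character_sum_bound.
have [B hB] := @lambda_mean_nonvanishing R (chi f) c (characterM cf) (cabs_character f)
  (character_sum_bound cf f0) hv.
exists `|B|; split=> // x x0; split=> // _.
by apply: le_trans (hB x x0) _; exact: ler_norm.
Qed.

Lemma mean_bound_uniform : exists B : R, 0 <= B /\ forall f, is_character f -> f != 0 ->
  forall x, (0 < x)%N ->
   (vanishing f -> cabs (lambda_mean (chi f) x + RtoC (ln x%:R)) <= B) /\
   (~ vanishing f -> cabs (lambda_mean (chi f) x) <= B).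
Proof.
have h f : exists B : R, 0 <= B /\ (is_character f -> f != 0 -> forall x, (0 < x)%N ->
   (vanishing f -> cabs (lambda_mean (chi f) x + RtoC (ln x%:R)) <= B) /\
   (~ vanishing f -> cabs (lambda_mean (chi f) x) <= B)).
  have [cf|ncf] := boolP (is_character f); last by exists 0.
  have [->|f0] := eqVneq f 0; first by exists 0; split => // _ /eqP.
  by have [B [B0 hB]] := mean_bound cf f0; exists B.
have [B hB] := choice h.
exists (\sum_f B f); split; first by apply: sumr_ge0 => f _; case: (hB f).
move=> f cf f0 x x0.
have le : B f <= \sum_f B f.
  by rewrite (bigD1 f) //= lerDl sumr_ge0 // => g _; case: (hB g).
have [_ /(_ cf f0 x x0)[h1 h2]] := hB f.
by split=> hv; apply: le_trans le; [exact: h1|exact: h2].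
Qed.

(** The principal character differs from one at integers not prime to [v], which
    contribute a bounded amount; the rest is [mertens]. *)
Lemma lambda_mean_principal x : (0 < x)%N ->
  cabs (lambda_mean (chi 0) x - RtoC (ln x%:R)) <= 5 + \sum_(p <- primes v) 2 * ln p%:R.
Proof.
move=> x0.
have -> : lambda_mean (chi 0) x = RtoC (\sum_(1 <= n < x.+1 | coprime v n) vonM n / n%:R).
  rewrite rmorph_sum big_mkcond; apply: eq_bigr => n _ /=.
  rewrite /chi_over /character ffunE root0.
  by case: ifP => _; rewrite ?mulr0 // mulr1 -rmorphM.
rewrite cabs_realB.
have := @non_coprime_mean R v x isT; set E := \sum_(p <- _) _.
have /andP[h1 h2] := @mertens R x x0.
move: h1 h2; rewrite (bigID (fun n => coprime v n)) /=.
set S1 := \sum_(1 <= n < x.+1 | coprime v n) _; set S2 := \sum_(1 <= n < x.+1 | ~~ _) _.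
have S20 : 0 <= S2 by apply: sumr_ge0 => n _; rewrite divr_ge0 ?vonM_ge0.
by move=> h1 h2 h3; rewrite ler_norml; apply/andP; split; lra.
Qed.

Definition class_mean (u x : nat) : R :=
  \sum_(1 <= n < x.+1 | (n == u %[mod v])%N) vonM n / n%:R.

Definition n_chars : nat := #|[pred f : chars | is_character f]|.

Lemma n_chars_gt0 : (0 < n_chars)%N.
Proof. by apply/card_gt0P; exists 0; rewrite inE; exact: character0. Qed.

Lemma class_meanE u x : coprime v u ->
  RtoC (n_chars%:R * class_mean u x) =
  \sum_(f | is_character f) conjc (chi f u) * lambda_mean (chi f) x.
Proof.
move=> cu; rewrite /lambda_mean.
under [RHS]eq_bigr do rewrite mulr_sumr.
rewrite exchange_big /= rmorphM /class_mean rmorph_sum mulr_sumr big_mkcond.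
apply: eq_bigr => n _ /=.
have -> : \sum_(f | is_character f) conjc (chi f u) * (RtoC (vonM n) * chi_over (chi f) n) =
   RtoC (vonM n / n%:R) * \sum_(f | is_character f) conjc (chi f u) * chi f n.
  rewrite mulr_sumr; apply: eq_bigr => f _; rewrite /chi_over rmorphM; ring.
rewrite character_orthogonality //; case: ifP => _; last by rewrite mulr0.
by rewrite rmorph_nat mulrC.
Qed.

Lemma Re_lambda_mean_le (B : R) f x : (0 < x)%N ->
  ((vanishing f -> cabs (lambda_mean (chi f) x + RtoC (ln x%:R)) <= B) /\
   (~ vanishing f -> cabs (lambda_mean (chi f) x) <= B)) ->
  complex.Re (lambda_mean (chi f) x) <= B /\
  (vanishing f -> complex.Re (lambda_mean (chi f) x) <= B - ln x%:R).
Proof.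
move=> x0 [h1 h2]; have l0 : 0 <= ln x%:R :> R by rewrite ln_ge0 // ler1n.
have hv : vanishing f -> complex.Re (lambda_mean (chi f) x) <= B - ln x%:R.
  move=> /h1 h; have := le_trans (Re_le_cabs _) h.
  by rewrite raddfD /= => e; rewrite lerBrDr.
split=> //; have [v1|v1] := pselect (vanishing f).
  by apply: le_trans (hv v1) _; rewrite lerBlDr lerDl.
by apply: le_trans (Re_le_cabs _) (h2 v1).
Qed.

Lemma vanishingN f : vanishing f -> vanishing (- f).
Proof.
move=> hv x; rewrite -cabs_conj /ell rmorph_sum; apply: le_trans (hv x).
rewrite le_eqVlt; apply/orP; left; apply/eqP; congr cabs; apply: eq_bigr => n _.
rewrite /chi_over characterNE.
by rewrite -[LHS]/(conjc _) conjcM conjcK; congr (_ * _); rewrite /conjc /= oppr0.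
Qed.

(** The class of one has a non-negative mean, and each vanishing character
    contributes [- ln x] to it, so at most one of them vanishes; it is then its own
    conjugate, hence real. *)
Lemma vanishing_opp f : is_character f -> f != 0 -> vanishing f -> - f = f.
Proof.
move=> cf f0 hv; apply/eqP/negP => /negP fN.
have [B [B0 hB]] := mean_bound_uniform.
have cN : is_character (- f) by exact: characterN.
have fN0 : - f != 0 by rewrite oppr_eq0.
pose D : R := 5 + \sum_(p <- primes v) 2 * ln p%:R + n_chars%:R * B.
have key x : (0 < x)%N -> ln x%:R <= D.
  move=> x0; have l0 : 0 <= ln x%:R :> R by rewrite ln_ge0 // ler1n.
  have M0 : 0 <= n_chars%:R * class_mean 1 x.
    by rewrite mulr_ge0 // sumr_ge0 // => n _; rewrite divr_ge0 ?vonM_ge0.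
  have e := class_meanE x (coprimen1 v).
  have e2 : n_chars%:R * class_mean 1 x = \sum_(g | is_character g) complex.Re (lambda_mean (chi g) x).
    have -> : n_chars%:R * class_mean 1 x = complex.Re (RtoC (n_chars%:R * class_mean 1 x)) by [].
    rewrite e raddf_sum /=; apply: eq_bigr => g cg.
    by rewrite character1 // conjc1 mul1r.
  have h0 : complex.Re (lambda_mean (chi 0) x) <= ln x%:R + (5 + \sum_(p <- primes v) 2 * ln p%:R).
    have := le_trans (Re_le_cabs _) (lambda_mean_principal x0).
    by rewrite raddfB /= lerBlDr [in leRHS]addrC.
  set P : R := ln x%:R + (5 + \sum_(p <- primes v) 2 * ln p%:R) in h0.
  pose at_char (a : chars) (z : R) g : R := if g == a then z else 0.
  have sum_at (a : chars) z : is_character a -> \sum_(g | is_character g) at_char a z g = z.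
    move=> ca; rewrite (bigD1 a) //= {1}/at_char eqxx big1 ?addr0 // => g /andP[_ /negPf ga].
    by rewrite /at_char ga.
  have hb : \sum_(g | is_character g) complex.Re (lambda_mean (chi g) x) <=
     \sum_(g | is_character g) (B + at_char 0 P g - at_char f (ln x%:R) g - at_char (- f) (ln x%:R) g).
    apply: ler_sum => g cg; rewrite /at_char.
    have Nf : (f == - f) = false by rewrite eq_sym (negPf fN).
    have [g0|g0] := eqVneq g 0.
      rewrite g0 eq_sym (negPf f0) eq_sym (negPf fN0) !subr0.
      by apply: le_trans h0 _; rewrite lerDr.
    have [r1 r2] := Re_lambda_mean_le x0 (hB g cg g0 x x0).
    rewrite addr0; have [gf|gf] := eqVneq g f.
      by move: r2; rewrite gf Nf subr0; apply.
    have [gN|gN] := eqVneq g (- f); last by rewrite !subr0.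
    by move: r2; rewrite gN subr0; apply; exact: vanishingN.
  have sb : \sum_(g | is_character g)
      (B + at_char 0 P g - at_char f (ln x%:R) g - at_char (- f) (ln x%:R) g) =
      n_chars%:R * B + P - ln x%:R - ln x%:R.
    rewrite !sumrB big_split /= !sum_at ?character0 //.
    by rewrite sumr_const mulr_natl.
  move: M0; rewrite e2 => M0; have := le_trans M0 hb.
  by rewrite sb /P /D; lra.
pose y := (Num.truncn (expR D)).+1.
have y0 : (0 < y)%N by [].
have := key y y0; apply/negP; rewrite -ltNge -[ltLHS](@expRK R) ltr_ln ?posrE ?expR_gt0 ?ltr0n //.
exact: truncnS_gt.
Qed.

Lemma character_nonvanishing f : is_character f -> f != 0 -> ~ vanishing f.
Proof.
move=> cf f0 hv; have fN := vanishing_opp cf f0 hv.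
pose rho n := complex.Re (chi f n).
have conj n : conjc (chi f n) = chi f n by rewrite -characterNE fN.
have rhoE n : RtoC (rho n) = chi f n.
  have := conj n; rewrite /rho; case: (chi f n) => x y /= [] e; congr (Complex _ _).
  by move: e; lra.
have rho_inj (x y : R) : RtoC x = RtoC y -> x = y by exact: complexI.
apply: (@real_char_nonvanishing R rho c).
- by apply: rho_inj; rewrite rhoE character1.
- by move=> m n; apply: rho_inj; rewrite rhoE rmorphM /= !rhoE characterM.
- move=> n; case cn : (coprime v n); last first.
    have -> : rho n = 0 by rewrite /rho /character cn.
    by rewrite eqxx orbT.
  have : rho n ^+ 2 = 1.
    apply: rho_inj; rewrite rmorphXn /= rhoE expr2 -{2}conj -cabs_sqr.
    by rewrite /character cn cabs_root expr1n.
  by move=> /eqP; rewrite sqrf_eq1 => /orP[] ->; rewrite ?orbT.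
- move=> a b; rewrite -cabs_real rmorph_sum /=.
  under eq_bigr do rewrite rhoE.
  exact: character_sum_bound.
move=> x; rewrite -cabs_real rmorph_sum /=; apply: le_trans (hv x).
rewrite le_eqVlt; apply/orP; left; apply/eqP; congr cabs; apply: eq_bigr => n _.
by rewrite /chi_over rmorphM /= rhoE mulrC.
Qed.

(** Only the principal character contributes [ln x]; all other means are bounded,
    since no L-value vanishes. *)
Lemma class_mean_asymptotic : exists B : R, 0 <= B /\ forall u x, coprime v u -> (0 < x)%N ->
  `|n_chars%:R * class_mean u x - ln x%:R| <= B.
Proof.
have [B [B0 hB]] := mean_bound_uniform.
pose D : R := (5 + \sum_(p <- primes v) 2 * ln p%:R) + n_chars%:R * B.
have P0 : 0 <= \sum_(p <- primes v) 2 * ln p%:R :> R.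
  rewrite big_seq sumr_ge0 // => p; rewrite mem_primes => /and3P[pp _ _].
  by rewrite mulr_ge0 // ln_ge0 // ler1n prime_gt0.
exists D; split; first by rewrite /D !addr_ge0 ?mulr_ge0.
move=> u x cu x0; rewrite -cabs_realB class_meanE // (bigD1 (0 : chars)) ?character0 //=.
have -> : conjc (chi 0 u) = 1 by rewrite /character cu ffunE root0 conjc1.
rewrite mul1r addrAC; apply: le_trans (cabsD _ _) _; apply: lerD.
  exact: lambda_mean_principal.
apply: le_trans (cabs_sum _ _ _) _.
apply: (@le_trans _ _ (\sum_(g : chars | is_character g) B)); last by rewrite sumr_const mulr_natl.
rewrite big_mkcond [leRHS]big_mkcond; apply: ler_sum => g _.
case cg : (is_character g) => //=; case: eqVneq => g0 //=.
rewrite cabsM cabs_conj.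
have [_ h] := hB g cg g0 x x0; have {}h := h (character_nonvanishing cg g0).
apply: le_trans h; rewrite ler_piMl ?cabs_ge0 //; exact: cabs_character.
Qed.

End Modulus.

Section Density.
Context {R : realType}.
Local Notation vonM := (@vonM R).

(** Over the window [x / A < m <= x] the logarithmic mean is at least one, as [ln A]
    exceeds the two error terms; and [1 / m <= A / x] there. *)
Lemma vonM_class_window (B : R) (n A x : nat) (P : pred nat) : (0 < n)%N -> (0 < A)%N ->
  (A <= x)%N ->
  (forall x, (0 < x)%N -> `|n%:R * \sum_(1 <= m < x.+1 | P m) vonM m / m%:R - ln x%:R| <= B) ->
  n%:R + 2 * B <= ln A%:R ->
  (x %/ A)%:R <= \sum_((x %/ A).+1 <= m < x.+1 | P m) vonM m.
Proof.
move=> n0 A0 Ax hB hA; set y := (x %/ A)%N.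
have y0 : (0 < y)%N by rewrite divn_gt0.
have x0 : (0 < x)%N by exact: leq_trans Ax.
have yx : (y <= x)%N by exact: leq_div.
have np : 0 < n%:R :> R by rewrite ltr0n.
have lnA : ln y%:R + ln A%:R <= ln x%:R :> R.
  rewrite -lnM ?posrE ?ltr0n // ler_ln ?posrE ?mulr_gt0 ?ltr0n //.
  by rewrite -natrM ler_nat leq_divM.
set D := \sum_(y.+1 <= m < x.+1 | P m) vonM m / m%:R.
have E : \sum_(1 <= m < x.+1 | P m) vonM m / m%:R = \sum_(1 <= m < y.+1 | P m) vonM m / m%:R + D.
  by rewrite /D -big_cat_nat.
have D1 : 1 <= D.
  have hx := hB x x0; have hy := hB y y0; rewrite E in hx.
  move: hx hy; rewrite !ler_norml mulrDr => /andP[hx _] /andP[_ hy].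
  rewrite -(ler_pM2l np) mulr1; lra.
apply: (@le_trans _ _ (y%:R * D)); first by rewrite ler_peMr.
rewrite /D mulr_sumr big_nat_cond [leRHS]big_nat_cond; apply: ler_sum => m /andP[/andP[ym _] _].
have mp : 0 < m%:R :> R by rewrite ltr0n; apply: leq_trans ym.
rewrite mulrCA ler_piMr ?vonM_ge0 // ler_pdivrMr // mul1r ler_nat; exact: ltnW.
Qed.

(** Proper prime powers contribute [O(sqrt x * ln x ^ 2)], which is eventually
    less than any positive multiple of [x]. *)
Lemma proper_prime_powers_small (A : nat) : (0 < A)%N -> exists N0 : nat, forall x, (N0 <= x)%N ->
  \sum_(1 <= m < x.+1) (vonM m - prime_log m) <= x%:R / (4 * A%:R).
Proof.
move=> A0; have Ap : 0 < A%:R :> R by rewrite ltr0n.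
pose c : R := 2 ^+ 13 * A%:R.
have c0 : 0 < c by rewrite mulr_gt0 // exprn_gt0.
exists (maxn 16 (Num.truncn (c ^+ 4)).+1) => x; rewrite geq_max => /andP[x16 xc].
have xp : 0 < x%:R :> R by rewrite ltr0n (leq_trans _ x16).
have ln1 := ln_ge1 R x16.
have [Y YX] := sqrt_exists x; have /andP[Yx _] := YX.
have l1 : 1 <= 4 * ln x%:R :> R by lra.
have lX : 1 + ln x%:R <= 4 * ln x%:R :> R by lra.
apply: le_trans (prime_powers_le (leq_trans (isT : (1 < 16)%N) x16) l1 lX YX (leqnn x)) _.
pose r : R := x%:R `^ (1 / 8).
have r0 : 0 < r by exact: powR_gt0.
have r8 : r ^+ 8 = x%:R by rewrite -powR_mulrn ?powR_ge0 // -powRrM mul1r mulVf // powRr1.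
have lr : ln x%:R <= 8 * r.
  rewrite -r8 lnXn // -[_ *+ 8]mulr_natl; apply: ler_wpM2l => //.
  by apply: ltW; exact: ln_sublinear.
have Yr : Y%:R <= r ^+ 4.
  rewrite -(@ler_pXn2r _ 2) ?nnegrE ?exprn_ge0 ?(ltW r0) //.
  by rewrite -exprM r8 -natrX ler_nat.
have cr : c <= r ^+ 2.
  rewrite -(@ler_pXn2r _ 4) ?nnegrE ?exprn_ge0 ?(ltW r0) ?(ltW c0) // -exprM r8.
  by apply: ltW; apply: lt_le_trans (truncnS_gt _) _; rewrite ler_nat.
apply: (@le_trans _ _ (2 * r ^+ 4 * (4 * (8 * r)) ^+ 2)).
  apply: ler_pM; [exact: mulr_ge0|exact: sqr_ge0|exact: ler_wpM2l|].
  by apply: lerXn2r; rewrite ?nnegrE ?mulr_ge0 ?(ltW r0) //; [lra|apply: ler_wpM2l].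
rewrite ler_pdivlMr ?mulr_gt0 //.
have -> : 2 * r ^+ 4 * (4 * (8 * r)) ^+ 2 * (4 * A%:R) = r ^+ 6 * c by rewrite /c; ring.
by rewrite -r8 (exprD r 6 2); apply: ler_wpM2l => //; rewrite exprn_ge0 // ltW.
Qed.

(** A Chebyshev type lower bound.  By [vonM_class_window] von Mangoldt's function has
    sum at least [x / (2 * A)] over the class; proper prime powers are negligible,
    and each prime counts for at most [ln x].  The modulus one is reduced to two, as
    characters are only set up for moduli at least two. *)
Theorem primes_in_progression (v : nat) : (0 < v)%N -> exists2 kappa : R, 0 < kappa &
  exists N0 : nat, forall u x, coprime u v -> (N0 <= x)%N ->
  kappa * (x%:R / ln x%:R) <= \sum_(1 <= m < x.+1 | prime m && (m %% v == u %% v)%N) 1.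
Proof.
have big w : exists2 kappa : R, 0 < kappa & exists N0 : nat, forall u x, coprime u w.+2 -> (N0 <= x)%N ->
  kappa * (x%:R / ln x%:R) <= \sum_(1 <= m < x.+1 | prime m && (m %% w.+2 == u %% w.+2)%N) 1.
  have [k hk] := unit_exponent w.
  have [B [B0 hB]] := @class_mean_asymptotic R w k hk.
  set n := n_chars w k in hB; have n0 : (0 < n)%N by exact: n_chars_gt0.
  pose A := (Num.truncn (expR (n%:R + 2 * B))).+1.
  have A0 : (0 < A)%N by [].
  have Ap : 0 < A%:R :> R by rewrite ltr0n.
  have hA : n%:R + 2 * B <= ln A%:R.
    by rewrite -[leLHS](@expRK R) ler_ln ?posrE ?expR_gt0 // ltW // truncnS_gt.
  have [N1 hN1] := proper_prime_powers_small A0.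
  exists (1 / (4 * A%:R)); first by rewrite divr_gt0 // mulr_gt0.
  exists (maxn 16 (maxn A N1)) => u x cu; rewrite !geq_max => /and3P[x16 xA xN].
  rewrite coprime_sym in cu.
  pose P m := (m == u %[mod w.+2])%N.
  have win := @vonM_class_window B n A x P n0 A0 xA (fun x => hB u x cu) hA.
  set y := (x %/ A)%N in win.
  have small := hN1 x xN.
  have xp : 0 < x%:R :> R by rewrite ltr0n (leq_trans _ x16).
  have lx := ln_ge1 R x16; have lx0 : 0 < ln x%:R :> R by exact: lt_le_trans lx.
  have y2 : x%:R / (2 * A%:R) <= y%:R :> R.
    rewrite ler_pdivrMr ?mulr_gt0 // -!natrM ler_nat.
    have y0 : (0 < y)%N by rewrite divn_gt0.
    apply: leq_trans (ltnW (ltn_ceil x A0)) _; rewrite -/y mulnA leq_mul2r; apply/orP; right; lia.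
  have d0 m : 0 <= vonM m - prime_log m by rewrite subr_ge0 prime_log_le.
  have h1 : \sum_(y.+1 <= m < x.+1 | P m) vonM m <=
     \sum_(1 <= m < x.+1) (vonM m - prime_log m) + \sum_(1 <= m < x.+1 | P m) prime_log m.
    have yx : (y.+1 <= x.+1)%N by rewrite ltnS leq_div.
    apply: (@le_trans _ _ (\sum_(1 <= m < x.+1 | P m) vonM m)).
      rewrite [leRHS](@big_cat_nat _ _ _ y.+1) //= lerDr sumr_ge0 // => m _; exact: vonM_ge0.
    rewrite big_mkcond [X in _ <= _ + X]big_mkcond -big_split /=; apply: ler_sum => m _.
    by case: ifP => _; rewrite ?subrK // addr0.
  have h2 : \sum_(1 <= m < x.+1 | P m) prime_log m <=
     ln (x%:R : R) * \sum_(1 <= m < x.+1 | prime m && (m %% w.+2 == u %% w.+2)%N) 1.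
    rewrite mulr_sumr big_mkcond [leRHS]big_mkcond; apply: ler_sum_nat => m /andP[m0 mx].
    rewrite /prime_log /P; case: (prime m) => /=; case: ifP => _ //; rewrite mulr1.
    by rewrite ler_ln ?posrE ?ltr0n ?ler_nat // (leq_trans _ x16).
  rewrite mulrA ler_pdivrMr // [leRHS]mulrC; apply: le_trans h2.
  have e : x%:R / (2 * A%:R) = x%:R / (4 * A%:R) + x%:R / (4 * A%:R) :> R by field; exact: lt0r_neq0.
  have -> : 1 / (4 * A%:R) * x%:R = x%:R / (4 * A%:R) :> R by rewrite mul1r mulrC.
  move: win y2 small h1; rewrite e; lra.
case: v => [//|[|w]] _; last exact: big.
have [kappa k0 [N0 hN]] := big 0%N.
exists kappa => //; exists N0 => u x _ xN; apply: le_trans (hN 1%N x _ xN) _ => //.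
rewrite big_mkcond [leRHS]big_mkcond; apply: ler_sum => m _.
by rewrite !modn1 eqxx andbT; case: (prime m) => //=; case: (_ == _).
Qed.

End Density.

(** * Diophantine approximation *)
Section DirichletApproximation.
Context {R : realType}.

(** The fractional parts of [g * i] for [0 <= i <= Q] fall into [Q] boxes of length
    [1 / Q]. *)
Lemma dirichlet_pigeonhole (g : R) (Q : nat) : (0 < Q)%N ->
  exists q : nat, exists a : int, [/\ (0 < q <= Q)%N & `|g * q%:R - a%:~R| < 1 / Q%:R].
Proof.
move=> Q0; have Qp : 0 < Q%:R :> R by rewrite ltr0n.
pose r (i : nat) : R := g * i%:R - (Num.floor (g * i%:R))%:~R.
have r01 i : 0 <= r i < 1.
  have /andP[h1 h2] := floor_itv (g * i%:R); rewrite /r subr_ge0 h1 /= ltrBlDl.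
  by move: h2; rewrite intrD addrC.
pose box (i : nat) := Num.truncn (Q%:R * r i).
have boxP i : (box i)%:R <= Q%:R * r i < (box i).+1%:R.
  by apply: truncn_itv; case/andP: (r01 i) => h _; rewrite mulr_ge0.
have boxQ i : (box i < Q)%N.
  rewrite -(ltr_nat R); case/andP: (boxP i) => h _; apply: le_lt_trans h _.
  by case/andP: (r01 i) => _ h; rewrite gtr_pMr.
have [i [j [ij e]]] : exists i j : 'I_Q.+1, (i < j)%N /\ box i = box j.
  pose f (i : 'I_Q.+1) : 'I_Q := Ordinal (boxQ i).
  have : ~ injective f by move=> /leq_card; rewrite !card_ord ltnn.
  move=> ninj; have /injectivePn[i [j ij e]] : ~~ injectiveb f by apply/negP => /injectiveP.
  have {}e : box i = box j by have := congr1 val e.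
  have [h|h|h] := ltngtP i j; [by exists i, j | by exists j, i |].
  by move: ij; rewrite (val_inj h) eqxx.
have hd : `|r j - r i| < 1 / Q%:R.
  rewrite ltr_pdivlMr // -[X in _ * X](ger0_norm (ltW Qp)) -normrM ltr_norml.
  have := boxP i; have := boxP j; rewrite e -natr1 => /andP[a1 a2] /andP[b1 b2].
  by apply/andP; split; lra.
exists (j - i)%N, (Num.floor (g * j%:R) - Num.floor (g * i%:R)); split.
  by rewrite subn_gt0 ij /=; have := ltn_ord j; lia.
have -> : g * (j - i)%:R - (Num.floor (g * j%:R) - Num.floor (g * i%:R))%:~R = r j - r i.
  by rewrite natrB ?(ltnW ij) // intrB /r; ring.
by [].
Qed.

Lemma dist_int_gt0 (g : R) (q0 : nat) : (forall q : nat, (0 < q)%N -> 0 < dist_int (g * q%:R)) ->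
  exists2 d : R, 0 < d & forall q, (0 < q <= q0)%N -> d <= dist_int (g * q%:R).
Proof.
move=> h; elim: q0 => [|n [d d0 hd]]; first by exists 1 => // q; rewrite leqn0; case: q.
exists (Num.min d (dist_int (g * n.+1%:R))); first by rewrite lt_min d0 h.
move=> q /andP[q0]; rewrite leq_eqVlt => /orP[/eqP ->|]; first by rewrite ge_min lexx orbT.
by rewrite ltnS => qn; rewrite ge_min hd // q0.
Qed.

Lemma dist_int_irrational (x : R) (v q : nat) : irrational x -> (0 < v)%N -> (0 < q)%N ->
  0 < dist_int (x * v%:R * q%:R).
Proof.
move=> ix v0 q0; rewrite lt_def dist_int_ge0 andbT; apply/eqP => e.
have [m hm _] := dist_int_attained (x * v%:R * q%:R).
move: hm; rewrite e => /esym/normr0_eq0/eqP; rewrite subr_eq0 => /eqP em.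
apply: ix; apply/rationalP; exists m, (v * q)%N.
by rewrite -em natrM -mulrA mulfK // mulf_neq0 // pnatr_eq0 -lt0n.
Qed.

(** The multiples of [x * v] by at most [q0] stay at a positive distance [d] from the
    integers, so an approximation of quality better than [d] has a denominator beyond
    [q0].  Dividing out the common factor of [a] and [q] only improves it. *)
Lemma good_approximation (x : R) (v q0 : nat) : irrational x -> (0 < v)%N ->
  exists q : nat, exists a : int, [/\ (q0 < q)%N, coprimez a q &
    `|x * v%:R - a%:~R / q%:R| <= 1 / q%:R ^+ 2].
Proof.
move=> ix v0; pose g := x * v%:R.
have [d d0 hd] := @dist_int_gt0 g q0 (fun q h => dist_int_irrational ix v0 h).
pose Q := (Num.truncn (1 / d)).+1.
have Qp : 0 < Q%:R :> R by [].
have Qd : 1 / Q%:R < d.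
  rewrite ltr_pdivrMr // mulrC -ltr_pdivrMr //; exact: truncnS_gt.
have [q [a [/andP[q1 qQ] h]]] := @dirichlet_pigeonhole g Q isT.
pose e := gcdn `|a| q; have e0 : (0 < e)%N by rewrite gcdn_gt0 q1 orbT.
pose q' := (q %/ e)%N; pose a' := (a %/ e)%Z.
have qE : q = (q' * e)%N by rewrite divnK // dvdn_gcdr.
have aE : a = a' * e%:Z.
  by rewrite divzK // dvdzE dvdn_gcdl.
have q'0 : (0 < q')%N by rewrite divn_gt0 // dvdn_leq // dvdn_gcdr.
have q'p : 0 < q'%:R :> R by rewrite ltr0n.
have ep : 1 <= e%:R :> R by rewrite ler1n.
have h2 : `|g * q'%:R - a'%:~R| < 1 / Q%:R.
  apply: le_lt_trans h; have -> : g * q%:R - a%:~R = (g * q'%:R - a'%:~R) * e%:R.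
    by rewrite {1}qE {1}aE natrM intrM -pmulrn; ring.
  by rewrite normrM normr_nat ler_peMr.
exists q', a'; split.
- rewrite ltnNge; apply/negP => qq.
  have := hd q'; rewrite q'0 qq => /(_ isT); rewrite leNgt => /negP; apply.
  by apply: le_lt_trans (dist_int_le _ a') (lt_trans h2 Qd).
- rewrite coprimezE /= /coprime -(eqn_pmul2r e0) mul1n muln_gcdl -qE.
  by have -> : (`|a'| * e)%N = `|a|%N by rewrite [in RHS]aE abszM.
have -> : x * v%:R - a'%:~R / q'%:R = (g * q'%:R - a'%:~R) / q'%:R.
  by rewrite mulrBl mulfK // gt_eqF.
rewrite normrM normfV normr_nat ler_pdivrMr // expr2 invfM mul1r mulfVK ?gt_eqF //.
apply: le_trans (ltW h2) _; rewrite div1r lef_pV2 ?posrE // ler_nat.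
by apply: leq_trans qQ; exact: leq_div.
Qed.

End DirichletApproximation.

(** * Primes with small fractional parts *)
Section PartOne.
Context {R : realType}.

Lemma ln_le_powR (N : R) (k : nat) : (0 < k)%N -> 0 < N -> ln N <= k%:R * N `^ (1 / k%:R).
Proof.
move=> k0 N0; have kp : 0 < k%:R :> R by rewrite ltr0n.
have -> : ln N = k%:R * ln (N `^ (1 / k%:R)).
  by rewrite ln_powR mulrA mulrC div1r mulfV ?gt_eqF // mulr1.
by apply: ler_wpM2l => //; apply: ltW; apply: ln_sublinear; exact: powR_gt0.
Qed.

(** With [N = q ^ 2] and a window width [D] not much larger than [N ^ (-1 / 4)], all
    five error terms are at most [N ^ (3 / 4)]. *)
Section Window.
Context (N q D : R).
Hypotheses (N64 : 64 < N) (qE : q = N `^ (1 / 2)).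
Hypotheses (D_ge : N `^ (- (1 / 4)) <= D) (D_le : D <= N `^ (- (1 / 6))).

Let N1 : 1 <= N. Proof. by move: N64; lra. Qed.
Let N0 : 0 < N. Proof. by move: N1; lra. Qed.
Let Nn0 : N != 0. Proof. by rewrite gt_eqF. Qed.
Let q1 : 1 <= q. Proof. by rewrite qE powR_ge1. Qed.

Lemma powR_add (r s t : R) : r + s = t -> N `^ t = N `^ r * N `^ s.
Proof. by move=> <-; rewrite powRD // Nn0 implybT. Qed.

Lemma window_gt0 : 0 < D.
Proof. by apply: lt_le_trans D_ge; exact: powR_gt0. Qed.

Lemma window_lt_half : D < 1 / 2.
Proof.
apply: le_lt_trans D_le _; rewrite powRN [1 / 2]div1r ltf_pV2 ?posrE ?powR_gt0 //.
have -> : 2 = 64 `^ (1 / 6) :> R.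
  have -> : 64 = 2 ^+ 6 :> R by ring.
  by rewrite -powR_mulrn // -powRrM div1r mulfV ?pnatr_eq0 // powRr1.
by apply: gt0_ltr_powR; rewrite ?nnegrE ?divr_gt0 // ltW.
Qed.

Lemma window_log : 0 <= ln (N * q / D) <= 2 * ln N.
Proof.
have D0 := window_gt0; have D2 := window_lt_half.
have q0 : 0 < q by apply: lt_le_trans q1.
apply/andP; split.
  apply: ln_ge0; rewrite ler_pdivlMr // mul1r.
  have h : 1 <= N * q by rewrite -[leLHS]mulr1; apply: ler_pM.
  by move: D2 h; lra.
have -> : 2 * ln N = ln (N ^+ 2) by rewrite lnXn // mulr_natl.
rewrite ler_ln ?posrE ?exprn_gt0 ?divr_gt0 ?mulr_gt0 //.
rewrite expr2 -mulrA; apply: ler_wpM2l; first exact: ltW.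
rewrite ler_pdivrMr //; apply: le_trans (ler_wpM2l (ltW N0) D_ge).
have -> : N * N `^ (- (1 / 4)) = N `^ (3 / 4).
  by rewrite (@powR_add 1 (- (1 / 4)) (3 / 4)) ?powRr1 ?(ltW N0) //; field.
by rewrite qE; apply: ler_powR => //; lra.
Qed.

Lemma window_errors : error_terms N q D (1 / 8) <= 5 * N `^ (3 / 4).
Proof.
have D0 := window_gt0; have D2 := window_lt_half.
have h1 : N * q `^ (- (1 / 2)) <= N `^ (3 / 4).
  rewrite qE -powRrM (@powR_add 1 (1 / 2 * - (1 / 2)) (3 / 4)); last by field.
  by rewrite powRr1 // ltW.
have h3 : N `^ (5 / 6) * D `^ (1 / 2) <= N `^ (3 / 4).
  rewrite (@powR_add (5 / 6) (- (1 / 6) * (1 / 2)) (3 / 4)); last by field.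
  apply: ler_wpM2l; first exact: powR_ge0.
  rewrite [leRHS]powRrM.
  by apply: ge0_ler_powR; rewrite ?nnegrE ?divr_ge0 ?powR_ge0 // ltW.
have h4 : (D * N * q) `^ (1 / 2) <= N `^ (3 / 4).
  apply: (@le_trans _ _ ((N `^ (4 / 3)) `^ (1 / 2))).
    apply: ge0_ler_powR; rewrite ?nnegrE ?divr_ge0 ?powR_ge0 //.
      by rewrite !mulr_ge0 // ltW // (lt_le_trans ltr01).
    rewrite qE (@powR_add (5 / 6) (1 / 2) (4 / 3)); last by field.
    rewrite (@powR_add (- (1 / 6)) 1 (5 / 6)); last by field.
    rewrite (powRr1 (ltW N0)); apply: ler_wpM2r; first exact: powR_ge0.
    by apply: ler_wpM2r; first exact: ltW.
  by rewrite -powRrM; apply: ler_powR => //; lra.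
have h5 : N `^ (1 / 8) * q * D `^ (1 - 1 / 8) <= N `^ (3 / 4).
  apply: (@le_trans _ _ (N `^ (5 / 8))); last by apply: ler_powR => //; lra.
  rewrite qE (@powR_add (1 / 8) (1 / 2) (5 / 8)); last by field.
  apply: ler_piMr; first by apply: mulr_ge0; exact: powR_ge0.
  have p0 : 0 <= 1 - 1 / 8 :> R by lra.
  have e1 : (1 : R) `^ (1 - 1 / 8) = 1 by rewrite powR1.
  rewrite -[leRHS]e1; apply: ge0_ler_powR => //; rewrite ?nnegrE //; lra.
rewrite /error_terms; lra.
Qed.

End Window.

(** The main term [2 * D * mainpi] is at least [2 * c0 * kappa * N ^ (3 / 4) * ln N ^ 7]
    and the error at most [640 * C' * N ^ (3 / 4) * ln N ^ 7]: hence the condition on [c0].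
    Having more than [q = sqrt N] primes in the window ensures a large one.  The
    constant [640] is [5 * 2 ^ 7]: five error terms, and a logarithm that is at most
    [2 * ln N]. *)
Lemma window_count (N q c0 C' kappa cnt mainpi : R) : 64 < N -> q = N `^ (1 / 2) ->
  0 < kappa -> 0 <= C' -> 1 <= c0 -> 640 * C' <= c0 * kappa -> 1 <= ln N ->
  c0 * ln N ^+ 8 <= N `^ (1 / 12) -> 1 < kappa * N `^ (1 / 4) ->
  kappa * (N / ln N) <= mainpi ->
  let D := c0 * N `^ (- (1 / 4)) * ln N ^+ 8 in
  (forall eps, eps = 1 / 8 -> 0 < D -> D < 1 / 2 ->
   `|cnt - 2 * D * mainpi| <= C' * ln (N * q / D) ^+ 7 * error_terms N q D eps) ->
  0 < D /\ q < cnt.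
Proof.
move=> N64 qE k0 C0 c01 ck l1 cl kN hpi D hD.
have N1 : 1 <= N by lra.
have N0 : 0 < N by lra.
have c0p : 0 < c0 by lra.
have l8 : 1 <= ln N ^+ 8 by rewrite exprn_ege1.
have l7 : 1 <= ln N ^+ 7 by rewrite exprn_ege1.
have l0 : 0 < ln N by lra.
have D_ge : N `^ (- (1 / 4)) <= D.
  have h : 1 <= c0 * ln N ^+ 8 by rewrite -[leLHS]mulr1; apply: ler_pM.
  by rewrite /D mulrAC ler_peMl // powR_ge0.
have D_le : D <= N `^ (- (1 / 6)).
  rewrite (@powR_add _ N64 (1 / 12) (- (1 / 4)) (- (1 / 6))); last by field.
  by rewrite /D mulrAC; apply: ler_wpM2r => //; exact: powR_ge0.
have D0 := window_gt0 N64 D_ge; have D2 := window_lt_half N64 D_le.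
split => //.
have he := window_errors N64 qE D_ge D_le.
have /andP[L0 L2] := window_log N64 qE D_ge D_le.
pose S := N `^ (3 / 4) * ln N ^+ 7.
have main : 2 * c0 * kappa * S <= 2 * D * mainpi.
  have -> : 2 * c0 * kappa * S = 2 * D * (kappa * (N / ln N)).
    rewrite /S /D (@powR_add _ N64 1 (- (1 / 4)) (3 / 4)); last by field.
    rewrite powRr1 ?ltW // (exprSr (ln N) 7); field.
    by rewrite gt_eqF.
  by apply: ler_wpM2l => //; apply: mulr_ge0 => //; exact: ltW.
have err : C' * ln (N * q / D) ^+ 7 * error_terms N q D (1 / 8) <= 640 * C' * S.
  have -> : 640 * C' * S = C' * (2 * ln N) ^+ 7 * (5 * N `^ (3 / 4)) by rewrite /S exprMn; ring.
  apply: (@le_trans _ _ (C' * ln (N * q / D) ^+ 7 * (5 * N `^ (3 / 4)))).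
    by apply: ler_wpM2l => //; apply: mulr_ge0 => //; exact: exprn_ge0.
  apply: ler_wpM2r; first by apply: mulr_ge0 => //; exact: powR_ge0.
  by apply: ler_wpM2l => //; rewrite lerXn2r // nnegrE //; apply: le_trans L2.
have S0 : 0 <= S by apply: mulr_ge0; [exact: powR_ge0 | exact: le_trans l7].
have h := hD _ erefl D0 D2.
have cS : c0 * kappa * S <= cnt.
  have a1 : 640 * C' * S <= c0 * kappa * S by apply: ler_wpM2r.
  by move: h; rewrite ler_norml => /andP[h _]; lra.
apply: lt_le_trans cS.
have a2 : kappa * N `^ (3 / 4) <= c0 * kappa * S.
  rewrite /S [leRHS](_ : _ = (kappa * N `^ (3 / 4)) * (c0 * ln N ^+ 7)); last by ring.
  rewrite ler_peMr //; first by apply: mulr_ge0; [exact: ltW | exact: powR_ge0].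
  by rewrite -[leLHS]mulr1; apply: ler_pM.
apply: lt_le_trans a2.
rewrite qE (@powR_add _ N64 (1 / 4) (1 / 2) (3 / 4)); last by field.
by rewrite mulrA ltr_pMl // powR_gt0.
Qed.

(** The exponent [1 / 192] in the bound for the logarithm is [1 / (8 * 24)]: the eighth
    power of the logarithm is then absorbed by [N ^ (1 / 24)], and the constants by
    another such factor. *)
Lemma eventually_large (kappa c0 : R) (N0 n0 : nat) : 0 < kappa -> 1 <= c0 ->
  exists q0 : nat, forall q : nat, (q0 < q)%N -> let N : R := (q ^ 2)%:R in
  [/\ [/\ 64 < N, (N0 <= q ^ 2)%N & (n0 <= q)%N], 1 <= ln N, c0 * ln N ^+ 8 <= N `^ (1 / 12) &
      1 < kappa * N `^ (1 / 4)].
Proof.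
move=> k0 c01; have c0p : 0 < c0 by lra.
pose K : R := 192 ^+ 8; have K0 : 0 <= K by apply: exprn_ge0.
exists (16 + N0 + n0 + Num.truncn ((c0 * K) ^+ 12) + Num.truncn (kappa^-1 ^+ 2))%N => q qq N.
have q16 : (16 < q)%N by lia.
have qN : (q <= q ^ 2)%N by rewrite leq_pmulr //; lia.
have qp : 0 < q%:R :> R by rewrite ltr0n; lia.
have NE : N = q%:R ^+ 2 by rewrite /N natrX.
have N0p : 0 < N by rewrite NE exprn_gt0.
have root (k : nat) (x : R) : 0 <= x -> (0 < k)%N -> x ^+ k < q%:R -> x < N `^ (1 / (2 * k)%:R).
  move=> x0 k1 h; rewrite -(@ltr_pXn2r _ k) ?nnegrE ?powR_ge0 //.
  rewrite -(@powR_mulrn _ (N `^ _)) ?powR_ge0 // -powRrM.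
  have -> : 1 / (2 * k)%:R * k%:R = 1 / 2 :> R.
    by rewrite natrM; field; rewrite pnatr_eq0 -lt0n.
  by rewrite sqrt_powR ?ltW // NE sqrtr_sqr ger0_norm ?ltW.
have tq (x : R) : (Num.truncn x < q)%N -> x < q%:R.
  by move=> h; apply: lt_le_trans (truncnS_gt x) _; rewrite ler_nat.
split.
- split; [|by lia|by lia].
  by rewrite (ltr_nat R 64) ltnNge; apply/negP; nia.
- by apply: ln_ge1; apply: leq_trans qN; lia.
- have h : c0 * K < N `^ (1 / 24).
    by apply: (root 12%N) => //; [apply: mulr_ge0 => //; exact: ltW | apply: tq; lia].
  have hl : ln N ^+ 8 <= K * N `^ (1 / 24).
    have l1 : 0 <= ln N by apply: ln_ge0; rewrite (ler_nat R 1); lia.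
    apply: (@le_trans _ _ ((192 * N `^ (1 / 192)) ^+ 8)).
      rewrite lerXn2r ?nnegrE ?mulr_ge0 ?powR_ge0 //; exact: (@ln_le_powR N 192).
    rewrite exprMn -(@powR_mulrn _ (N `^ _)) ?powR_ge0 // -powRrM.
    by have -> : 1 / 192 * 8 = 1 / 24 :> R by field.
  apply: (@le_trans _ _ (c0 * (K * N `^ (1 / 24)))); first by apply: ler_wpM2l => //; exact: ltW.
  rewrite mulrA; apply: (@le_trans _ _ (N `^ (1 / 24) * N `^ (1 / 24))).
    by apply: ler_wpM2r; [exact: powR_ge0 | exact: ltW].
  rewrite -powRD; last by rewrite gt_eqF // implybT.
  by have -> : 1 / 24 + 1 / 24 = 1 / 12 :> R by field.
have h : kappa^-1 < N `^ (1 / 4).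
  apply: (root 2%N) => //; first by rewrite invr_ge0 ltW.
  by apply: tq; apply: leq_ltn_trans qq; exact: leq_addl.
have : kappa * kappa^-1 < kappa * N `^ (1 / 4) by rewrite ltr_pM2l.
by rewrite divff // gt_eqF.
Qed.

Lemma infinite_setP (A : set nat) : (forall n0 : nat, exists2 l, A l & (n0 < l)%N) -> infinite_set A.
Proof.
move=> h /finite_seqP [s As]; have [l Al] := h (\max_(i <- s) i)%N.
by apply/negP; rewrite -leqNgt; apply: leq_bigmax_seq => //; move: Al; rewrite As.
Qed.

Lemma dominating_multiple (A k : R) : 0 <= A -> 0 < k -> exists2 c, 1 <= c & A <= c * k.
Proof.
move=> A0 k0; exists (1 + A / k); first by rewrite lerDl divr_ge0 // ltW.
by rewrite mulrDl mul1r divfK ?gt_eqF // lerDr ltW.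
Qed.

(** The prime [l] found by [window_count] satisfies [sqrt N < l <= N], so [N ^ (-1 / 4)]
    and [ln N] may be replaced by [l ^ (-1 / 4)] and [2 * ln l]; the constant
    [2 ^ 8] comes from the latter. *)
Lemma primes_near (v : nat) : (0 < v)%N -> exists2 C : R, 0 < C &
  forall u : nat, coprime u v -> forall alpha beta : R, irrational alpha ->
  infinite_set (primes_in_class u v `&`
    [set l | dist_int (alpha * l%:R - beta) <= C * l%:R `^ (- (1 / 4)) * ln l%:R ^+ 8]).
Proof.
move=> v0.
have [kappa k0 [N0 hprimes]] := @primes_in_progression R v v0.
have e8 : 0 < 1 / 8 :> R by rewrite divr_gt0.
have [C' C0 hcount] := count_discrepancy v0 e8.
have A0 : 0 <= 640 * C' by exact: (mulr_ge0 (ler0n R 640) (ltW C0)).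
have [c0 c01 ck] := dominating_multiple A0 k0.
have c0p : 0 < c0 by apply: lt_le_trans c01.
exists (2 ^+ 8 * c0); first by rewrite mulr_gt0 // exprn_gt0.
move=> u cuv al be ial; apply: infinite_setP => n0.
have [q0 hq0] := eventually_large N0 n0 k0 c01.
have [q [a [qq co apx]]] := good_approximation q0 ial v0.
have [[N64 NN0 nq] l1 cl kN] := hq0 q qq.
set N : R := (q ^ 2)%:R in N64 l1 cl kN.
have Np : 0 < N by apply: lt_trans N64.
have tN : Num.truncn N = (q ^ 2)%N by rewrite natrK.
have qE : q%:R = N `^ (1 / 2) :> R.
  by rewrite sqrt_powR ?(ltW Np) // /N natrX sqrtr_sqr ger0_norm.
have qp : 0 < q%:R :> R by rewrite qE powR_gt0.
pose cls n := prime n && (n %% v == u %% v)%N.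
have clsE n : primes_in_class u v n <-> cls n.
  by split; [move=> [pn e]; rewrite /cls pn; apply/eqP | move=> /andP[pn /eqP e]].
pose D := c0 * N `^ (- (1 / 4)) * ln N ^+ 8.
pose near n := cls n && (dist_int (al * n%:R - be) < D).
have nearE n : (primes_in_class u v `&` [set l | dist_int (al * l%:R - be) < D]) n <-> near n.
  by split; [move=> [/clsE ? /= ?]; apply/andP | move=> /andP[/clsE]].
have [D0 qcnt] : 0 < D /\ q%:R < \sum_(1 <= n < (q ^ 2).+1 | near n) 1 :> R.
  apply: (@window_count N q%:R c0 C' kappa _ _ N64 qE k0 (ltW C0) c01 ck l1 cl kN
    (hprimes u (q ^ 2)%N cuv NN0)) => eps -> D0 D2.
  have := hcount u al be N D a q; rewrite (count_uptoE _ nearE) // tN.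
  rewrite /prime_pi (count_uptoE _ clsE) // tN; apply => //.
  - by apply: ltW; apply: lt_trans N64; rewrite (ltr_nat R 1).
  - rewrite -pmulrn qE (@powR_add _ N64 (1 / 4) (1 / 4) (1 / 2)); last by field.
    have e1 : (1 : R) `^ (1 / 4) = 1 by rewrite powR1.
    have N1 : 1 < N by apply: lt_trans N64; rewrite (ltr_nat R 1).
    by rewrite ltr_pMr ?powR_gt0 // -[ltLHS]e1; apply: gt0_ltr_powR => //; rewrite nnegrE ?ler01 // ltW.
have [l [lq lN nl]] : exists l, [/\ (q < l)%N, (l <= q ^ 2)%N & near l].
  apply: contrapT => hn; move: qcnt; apply/negP; rewrite -leNgt.
  have qN : (q.+1 <= (q ^ 2).+1)%N by rewrite ltnS leq_pmulr // -(ltr_nat R).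
  rewrite (@big_cat_nat _ _ _ q.+1) //= [X in _ + X]big_nat_cond [X in _ + X]big_pred0 ?addr0; last first.
    move=> n; apply/negP => /andP[/andP[qn nN] nn]; apply: hn; exists n; split => //.
  apply: le_trans (_ : _ <= \sum_(1 <= n < q.+1) 1) _; last by rewrite sumr_const_nat subn1.
  by rewrite big_mkcond /=; apply: ler_sum_nat => n _; case: ifP.
exists l; last by apply: leq_ltn_trans lq.
move: nl => /andP[/clsE cl_l dl]; split => //=.
have lp : 0 < l%:R :> R by rewrite ltr0n (leq_trans _ lq).
have lN' : l%:R <= N by rewrite ler_nat.
have lnl : ln N <= 2 * ln l%:R.
  have -> : 2 * ln l%:R = ln (l%:R ^+ 2) :> R by rewrite lnXn // mulr_natl.
  by rewrite ler_ln ?posrE ?exprn_gt0 // /N natrX lerXn2r ?nnegrE // ler_nat ltnW.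
apply: le_trans (ltW dl) _; rewrite /D.
have -> : 2 ^+ 8 * c0 * l%:R `^ (- (1 / 4)) * ln l%:R ^+ 8
   = c0 * l%:R `^ (- (1 / 4)) * (2 * ln l%:R) ^+ 8 by rewrite exprMn; ring.
apply: ler_pM.
- by apply: mulr_ge0; [exact: ltW | exact: powR_ge0].
- by apply: exprn_ge0; apply: le_trans l1.
- apply: ler_wpM2l; first exact: ltW.
  rewrite !powRN lef_pV2 ?posrE ?powR_gt0 //.
  by apply: ge0_ler_powR; rewrite ?nnegrE // ltW.
by rewrite lerXn2r ?nnegrE //; [apply: le_trans l1 | apply: le_trans lnl; apply: le_trans l1].
Qed.

End PartOne.

Theorem corollary2 (R : realType) (v : nat) (v_ge1 : (1 <= v)%N) :
  (exists2 C : R, 0 < C &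
    forall u : nat, (1 <= u)%N -> coprime u v ->
    forall alpha beta : R, irrational alpha ->
    infinite_set
      (primes_in_class u v `&`
       [set l | dist_int (alpha * l%:R - beta)
                <= C * l%:R `^ (- (1 / 4)) * ln l%:R ^+ 8]))
  /\
  (forall eps : R, 0 < eps ->
    exists2 C' : R, 0 < C' &
    forall u : nat, (1 <= u)%N -> coprime u v ->
    forall (alpha beta N Delta : R) (a q : int),
    irrational alpha -> 1 <= N -> 0 < Delta -> Delta < 1 / 2 ->
    coprimez a q -> N `^ (1 / 4) < q%:~R ->
    `|alpha * v%:R - a%:~R / q%:~R| <= 1 / q%:~R ^+ 2 ->
    let L := ln (N * q%:~R / Delta) in
    `|(count_upto N
         (primes_in_class u v `&`
          [set l | dist_int (alpha * l%:R - beta) < Delta]))%:R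
      - 2 * Delta * (prime_pi N u v)%:R|
    <= C' * L ^+ 7 *
       (N * q%:~R `^ (- (1 / 2)) + N `^ (3 / 4) + N `^ (5 / 6) * Delta `^ (1 / 2)
        + (Delta * N * q%:~R) `^ (1 / 2)
        + N `^ eps * q%:~R * Delta `^ (1 - eps))).
Proof.
split.
  have [C C0 h] := @primes_near R v v_ge1.
  by exists C => // u _ cuv al be ial; exact: h.
move=> eps e0; have [C' C0 h] := count_discrepancy v_ge1 e0.
exists C' => // u _ _ al be N D a q _ N1 D0 D2 co qN apx.
by have := h u al be N D a q N1 D0 D2 co qN apx; rewrite /error_terms.
Qed.
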